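(* Let $m\in\{1,2,3\}$, $U=L^2((0,\pi)^m)$, $H=U\times U$, and let $\Lambda=(-\Delta)^2$ be the realization of the bi-Laplace operator in $L^2((0,\pi)^m)$ with homogeneous Dirichlet boundary conditions (the square of the Dirichlet Laplacian), with eigenvalues $(\mu_n)_{n\in\mathbb N}$ in nondecreasing order and corresponding eigenvectors $e_n$ forming an orthogonal basis of $U$. Let $\alpha\in(0,1)$, $\gamma,\sigma\ge0$, $\rho>0$ with $\rho^2\ne4\mu_n^{1-2\alpha}$ for every $n$, and $\theta\in(0,1)$. Assume that $C\in C_b^\theta(H;U)$ and that one of the following sets of assumptions is fulfilled: (i) $\alpha\in\left(\frac m8,\frac12\right]$, $\gamma\in\left(\frac m8-\frac\alpha2,\frac\alpha2\right)\cap[0,\infty)$, $\theta\in\left(\frac23\cdot\frac{\gamma+\alpha}{\alpha},1\right)$, $\sigma>\frac12-\alpha$; (ii) $\alpha\in\left[\frac12,1\right)$, $\gamma\in\left(\frac m8-\frac\alpha2,\frac12-\frac\alpha2\right)\cap[0,\infty)$, $\theta\in\left(\frac23\cdot\frac{\gamma+1-\alpha}{1-\alpha},1\right)$ if $\gamma+2\alpha<\frac32$ and $\theta\in\left(\frac{4\gamma+2\alpha-1}{2\gamma+\alpha},1\right)$ if $\gamma+2\alpha\ge\frac32$, and $\sigma>0$. If $m=3$, assume further that $$\sum_{n\in\mathbb N}\mu_n^{-2\sigma-\alpha}\Big\|\Big\langle C(\cdot),\frac{e_n}{\|e_n\|_U}\Big\rangle_U\Big\|_{C_b^\theta(H)}^2<\infty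 .$$ Then, for the damped equation $$\frac{\partial^2y}{\partial t^2}=-\Lambda y-\rho\Lambda^\alpha\Big(\frac{\partial y}{\partial t}\Big)+\Lambda^{-\sigma}C\Big(y,\frac{\partial y}{\partial t}\Big)+\Lambda^{-\gamma}\dot W,$$ written in abstract form in $H$ as explained in the context, the following holds: for every $T>0$ there exists $C_T>0$ such that for every $x_1,x_2\in H$, if $X(\cdot,x_1),X(\cdot,x_2)$ are two mild solutions with initial data $x_1,x_2$ defined on the same filtered probability space with respect to the same cylindrical Wiener process $W$, then $$\sup_{t\in[0,T]}\mathbb E\big[\|X(t,x_1)-X(t,x_2)\|_H^2\big]\le C_T\|x_1-x_2\|_H^2 .$$
   Context: $C_b^\theta(H;U)$ is the space of bounded $\theta$-Hölder continuous functions from $H$ to $U$, with norm sup norm plus Hölder seminorm; $C_b^\theta(H)$ denotes real values. A $U$-cylindrical Wiener process on a normal filtered probability space is $W(t)=\sum_k\beta_k(t)g_k$ with $(g_k)$ an orthonormal basis of $U$ and $(\beta_k)$ independent real Brownian motions. Abstract form: on $H=U\times U$ let $$A=\begin{pmatrix}0&\Lambda^{1/2}\\ -\Lambda^{1/2}&-\rho\Lambda^\alpha\end{pmatrix},\quad D(A)=\Big\{\begin{pmatrix}h_1\\ h_2\end{pmatrix}:h_2\in D(\Lambda^{1/2}),\ h_1+\rho\Lambda^{\alpha-\frac12}h_2\in D(\Lambda^{1/2})\Big\}$$ (the action $-\Lambda^{1/2}h_1-\rho\Lambda^\alpha h_2$ being understood as $-\Lambda^{1/2}(h_1+\rho\Lambda^{\alpha-1/2}h_2)$),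 which generates a strongly continuous semigroup $(e^{tA})_{t\ge0}$, and let $$\widetilde G=\begin{pmatrix}0\\ \mathrm{Id}\end{pmatrix},\quad G=\widetilde G\Lambda^{-\gamma},\quad \widetilde{\mathscr L}=\begin{pmatrix}0&0\\ 0&\Lambda^{-\sigma}\end{pmatrix},\quad B(h)=\widetilde G\,C(\Lambda^{-1/2}h_1,h_2)\quad\text{for } h=\begin{pmatrix}h_1\\ h_2\end{pmatrix}\in H.$$ The equation becomes $dX(t)=AX(t)dt+\widetilde{\mathscr L}B(X(t))dt+G\,dW(t)$, $t\in[0,T]$, $X(0)=x\in H$, with $y=\Lambda^{-1/2}X_1$, $\partial_ty=X_2$. A mild solution is an adapted $H$-valued process $X$ (on a normal filtered probability space carrying a $U$-cylindrical Wiener process $W$) such that for every $t\in[0,T]$, a.s., $$X(t,x)=e^{tA}x+\int_0^te^{(t-s)A}\widetilde{\mathscr L}B(X(s,x))\,ds+\int_0^te^{(t-s)A}G\,dW(s).$$ *)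

(* Defs.v *)
From HB Require Import structures.
From mathcomp Require Import all_boot all_order all_algebra ring_quotient.
From mathcomp Require Import generic_quotient.
From mathcomp Require Import all_classical all_reals all_analysis.

Set Implicit Arguments.
Unset Strict Implicit.
Unset Printing Implicit Defensive.

Import Order.TTheory GRing.Theory Num.Theory.
Import numFieldTopology.Exports numFieldNormedType.Exports.

Local Open Scope classical_set_scope.
Local Open Scope ring_scope.

(** The library has square-integrable functions ([LfunType]) but no normed
    space of classes; [L2] is their quotient by the kernel of the seminorm. *)

Section L2.
Context d (T : measurableType d) (R : realType).
Variable mu : {measure set T -> \bar R}.

Local Notation fun2 := (LfunType mu (lee1n 2)).

Definition seminorm2 (f : fun2) : R := fine ('N[mu]_(2%:R%:E)[EFin \o f]).

Lemma seminorm2D f g : seminorm2 (f + g) <= seminorm2 f + seminorm2 g.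
Proof. exact: ler_LnormD. Qed.

Lemma seminorm2_ge0 f : 0 <= seminorm2 f.
Proof. by rewrite /seminorm2 fine_ge0// Lnorm_ge0. Qed.

Lemma seminorm2Z a f : seminorm2 (a *: f) = `|a| * seminorm2 f.
Proof.
apply: EFin_inj; rewrite /seminorm2 EFinM (@finite_norm_fine _ _ _ _ _ _ f).
by rewrite (@finite_norm_fine _ _ _ _ _ _ (a *: f)) -LnormZ.
Qed.

Definition null2 : {pred fun2} := [pred f : fun2 | seminorm2 f == 0].

Lemma null2_zmod_closed : zmod_closed null2.
Proof.
split=> [|f g]; rewrite !inE.
  by rewrite -(scale0r (0 : fun2)) seminorm2Z normr0 mul0r.
move=> /eqP f0 /eqP g0; rewrite eq_le seminorm2_ge0 andbT.
apply: le_trans (seminorm2D _ _) _.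
by rewrite -scaleN1r seminorm2Z f0 g0 mulr0 addr0.
Qed.
HB.instance Definition _ :=
  GRing.isZmodClosed.Build fun2 null2 null2_zmod_closed.

Definition L2 := Quotient.quot null2.
HB.instance Definition _ := GRing.Zmodule.on L2.

Definition L2_class (f : fun2) : L2 := (\pi_L2 f)%qT.
Definition L2_repr (u : L2) : fun2 := repr u.
Definition L2_fun (u : L2) : T -> R := L2_repr u.

Lemma L2_reprK u : L2_class (L2_repr u) = u.
Proof. exact: reprK. Qed.

Lemma L2_classD f g : L2_class (f + g) = L2_class f + L2_class g.
Proof. exact: (pi_addr (s := Quotient.quot null2) f g). Qed.

Lemma L2_classP f g : L2_class f = L2_class g <-> seminorm2 (f - g) = 0.
Proof.
rewrite /L2_class; split=> [/eqP|/eqP h].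
  by rewrite -Quotient.idealrBE inE => /eqP.
by apply/eqP; rewrite -Quotient.idealrBE inE.
Qed.

Lemma seminorm2_class f : seminorm2 (L2_repr (L2_class f)) = seminorm2 f.
Proof.
have h : forall f g, seminorm2 (f - g) = 0 -> seminorm2 f <= seminorm2 g.
  move=> f' g fg; rewrite -[f'](subrK g).
  by apply: le_trans (seminorm2D _ _) _; rewrite fg add0r.
have := L2_reprK (L2_class f); rewrite L2_classP => fg.
apply/eqP; rewrite eq_le !h//.
by rewrite -opprB -scaleN1r seminorm2Z fg mulr0.
Qed.

Definition L2_scale (a : R) (u : L2) : L2 := L2_class (a *: L2_repr u).

Lemma L2_scale_class a f : L2_scale a (L2_class f) = L2_class (a *: f).
Proof.
apply/L2_classP; rewrite -scalerBr seminorm2Z.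
by have /L2_classP-> := L2_reprK (L2_class f); rewrite mulr0.
Qed.

Lemma L2_scaleA a b u : L2_scale a (L2_scale b u) = L2_scale (a * b) u.
Proof. by rewrite -[u]L2_reprK !L2_scale_class scalerA. Qed.
Lemma L2_scale1 : left_id 1 L2_scale.
Proof. by move=> u; rewrite -[u]L2_reprK L2_scale_class scale1r. Qed.
Lemma L2_scaleDr : right_distributive L2_scale +%R.
Proof.
move=> a u v; rewrite -[u]L2_reprK -[v]L2_reprK -L2_classD !L2_scale_class.
by rewrite scalerDr L2_classD.
Qed.
Lemma L2_scaleDl u : {morph L2_scale^~ u : a b / a + b}.
Proof.
by move=> a b /=; rewrite -[u]L2_reprK !L2_scale_class scalerDl L2_classD.
Qed.
HB.instance Definition _ := GRing.Zmodule_isLmodule.Build R L2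
  L2_scaleA L2_scale1 L2_scaleDr L2_scaleDl.

Definition L2_norm (u : L2) : R := seminorm2 (L2_repr u).

Lemma L2_normD u v : L2_norm (u + v) <= L2_norm u + L2_norm v.
Proof.
rewrite /L2_norm -{1}[u]L2_reprK -{1}[v]L2_reprK -L2_classD seminorm2_class.
exact: seminorm2D.
Qed.
Lemma L2_normZ a (u : L2) : L2_norm (a *: u) = `|a| * L2_norm u.
Proof. by rewrite /L2_norm seminorm2_class seminorm2Z. Qed.
Lemma L2_norm0_eq0 u : L2_norm u = 0 -> u = 0.
Proof.
move=> u0; have h0 : L2_class 0 = 0.
  by apply: (addrI (L2_class 0)); rewrite -L2_classD !addr0.
by rewrite -[u]L2_reprK -h0; apply/L2_classP; rewrite subr0.
Qed.
HB.instance Definition _ := Lmodule_isNormed.Build R L2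
  L2_normD L2_normZ L2_norm0_eq0.

Definition dot (u v : L2) : R := \int[mu]_x (L2_fun u x * L2_fun v x).

Definition unitv (e : nat -> L2) (n : nat) : L2 := `|e n|^-1 *: e n.

Definition orthogonal_basis (e : nat -> L2) : Prop :=
  [/\ forall n, e n != 0,
      forall i j, i != j -> dot (e i) (e j) = 0 &
      forall u, series (fun n => dot u (unitv e n) *: unitv e n) @ \oo --> u].

Definition orthonormal_basis (g : nat -> L2) : Prop :=
  (forall n, `|g n| = 1) /\ orthogonal_basis g.

End L2.
Coercion L2_fun : L2 >-> Funclass.

(** [cube_measure m] is Lebesgue measure on (0,pi)^m, as a measure on tuples:
    the product of m copies of the restriction of Lebesgue measure to (0,pi). *)

Section cube.
Context (R : realType).

Local Notation RT := (measurableTypeR R).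

Definition itv_measure : set RT -> \bar R :=
  mrestr (@lebesgue_measure R) (measurable_itv `]0 : R, pi[).

HB.instance Definition _ := Measure.on itv_measure.

Section step.
Variables (n : nat) (nu : {finite_measure set (n.-tuple RT) -> \bar R}).

Definition cons_pt (z : RT * n.-tuple RT) : n.+1.-tuple RT :=
  [the n.+1.-tuple RT of z.1 :: z.2].

Lemma measurable_cons_pt : measurable_fun [set: _] cons_pt.
Proof. exact: measurable_cons. Qed.

Definition cube_step : set (n.+1.-tuple RT) -> \bar R :=
  pushforward (itv_measure \x nu)%E cons_pt.

Lemma cube_step0 : cube_step set0 = 0%E.
Proof. by rewrite /cube_step /pushforward preimage_set0 measure0. Qed.
Lemma cube_step_ge0 A : (0 <= cube_step A)%E.
Proof. exact: integral_ge0. Qed.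
Lemma cube_step_sigma_additive : semi_sigma_additive cube_step.
Proof.
exact: (@measure_semi_sigma_additive _ _ _
  (measure_function_pushforward__canonical__measure_function_Measure _ measurable_cons_pt)).
Qed.
HB.instance Definition _ := isMeasure.Build _ _ _ cube_step
  cube_step0 cube_step_ge0 cube_step_sigma_additive.

Lemma cube_step_fin : fin_num_fun cube_step.
Proof.
have cubeT : cube_step setT = (itv_measure setT * nu setT)%E.
  by rewrite -product_measure1E// setXTT.
apply: lty_fin_num_fun; rewrite [ltLHS]cubeT /itv_measure /mrestr setTI.
rewrite lebesgue_measure_itv/= lte_fin pi_gt0 oppr0 adde0.
by rewrite lte_mul_pinfty ?lee_fin ?pi_ge0// ltey_eq fin_num_measure.
Qed.
HB.instance Definition _ := Measure_isFinite.Build _ _ _ cube_step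
  cube_step_fin.
End step.

Fixpoint cube_measure (m : nat) : {finite_measure set (m.-tuple RT) -> \bar R} :=
  match m with
  | 0 => [the {finite_measure set _ -> \bar R} of
          @dirac _ (0.-tuple RT) [tuple] R]
  | n.+1 => [the {finite_measure set _ -> \bar R} of
             cube_step (cube_measure n)]
  end.

Definition pt (m : nat) (x : m.-tuple RT) : 'rV[R]_m := \row_i (tnth x i : R).

Definition open_cube (m : nat) : set 'rV[R]_m :=
  [set v | forall i, 0 < v ord0 i < pi].

End cube.

Notation Usp R m := (L2 (cube_measure R m)).
Notation Hsp R m := (Usp R m * Usp R m)%type.

Section laplacian.
Context (R : realType) (m : nat).
Implicit Types (u v f : Usp R m) (phi : 'rV[R]_m -> R).

Definition partial (i : 'I_m) phi : 'rV[R]_m -> R :=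
  fun x => 'D_('e_i) phi x.

Definition smooth phi : Prop := forall (s : seq 'I_m),
  let psi := foldr partial phi s in
  continuous psi /\ forall x i, derivable psi x 'e_i.

(** C_c^oo((0,pi)^m) *)
Definition test_function phi : Prop :=
  smooth phi /\ exists K : set 'rV[R]_m,
    [/\ compact K, K `<=` @open_cube R m & forall x, ~ K x -> phi x = 0].

(** u is in H^1_0, the H^1-closure of the test functions, with gradient g *)
Definition H01 u (g : 'I_m -> Usp R m) : Prop :=
  exists phi : nat -> 'rV[R]_m -> R,
  [/\ forall k, test_function (phi k),
      (\int[cube_measure R m]_x ((u x - phi k (pt x)) ^+ 2)%:E)%E
        @[k --> \oo] --> 0%E &
      forall i, (\int[cube_measure R m]_x
        ((g i x - partial i (phi k) (pt x)) ^+ 2)%:E)%E @[k --> \oo] --> 0%E].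

(** u is in the domain of the Dirichlet Laplacian and - Delta u = f *)
Definition neg_laplacian u f : Prop :=
  exists2 g : 'I_m -> Usp R m, H01 u g &
  forall phi, test_function phi ->
    \sum_(i < m) \int[cube_measure R m]_x (g i x * partial i phi (pt x)) =
    \int[cube_measure R m]_x (f x * phi (pt x)).

(** Lambda u = f, with Lambda the square of the Dirichlet Laplacian *)
Definition bilaplacian u f : Prop :=
  exists2 v, neg_laplacian u v & neg_laplacian v f.

Definition bilaplacian_eigenbasis (mu : nat -> R) (e : nat -> Usp R m) : Prop :=
  [/\ forall n, bilaplacian (e n) (mu n *: e n),
      {homo mu : i j / (i <= j)%N >-> i <= j} &
      orthogonal_basis e].

(** Lambda^s u = sum_n (mu n)^s <u, e n> (e n) for the normalized e n, on the
    domain where the series converges in U. The value of [pow] is meaningless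
    outside [pow_dom]. *)
Section powers.
Variables (mu : nat -> R) (e : nat -> Usp R m).

Definition pow_series (s : R) u : nat -> Usp R m :=
  series (fun n => (mu n `^ s * dot u (unitv e n)) *: unitv e n).

Definition pow_dom (s : R) : set (Usp R m) := [set u | cvgn (pow_series s u)].

Definition pow (s : R) u : Usp R m := limn (pow_series s u).

End powers.
End laplacian.

Section product_space.
Context (R : realType) (m : nat).
Implicit Types (h : Hsp R m) (V : normedModType R).

(** The library's norm on a product is the (equivalent) maximum norm *)
Definition hnorm h : R := Num.sqrt (`|h.1| ^+ 2 + `|h.2| ^+ 2).

Definition cb_norm V (theta : R) (f : Hsp R m -> V) : \bar R :=
  (ereal_sup [set `|f h|%:E | h in setT] +
   ereal_sup [set (`|f z.1 - f z.2| / hnorm (z.1 - z.2) `^ theta)%:E |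
              z in [set z : Hsp R m * Hsp R m | z.1 != z.2]])%E.

Definition C_b V (theta : R) (f : Hsp R m -> V) : Prop :=
  (cb_norm theta f < +oo)%E.

(** S is a strongly continuous semigroup with generator (A, D). Only the
    values S t for t >= 0 matter. *)
Definition generates (D : set (Hsp R m)) (A : Hsp R m -> Hsp R m)
    (S : R -> Hsp R m -> Hsp R m) : Prop :=
  [/\ (forall t, 0 <= t -> linear (S t) /\ continuous (S t)),
      (forall x, S 0 x = x),
      (forall s t x, 0 <= s -> 0 <= t -> S (s + t) x = S s (S t x)),
      (forall x, S t x @[t --> 0^'+] --> x) &
      (forall x, D x <-> cvg (t^-1 *: (S t x - x) @[t --> 0^'+])) /\
      (forall x, D x -> t^-1 *: (S t x - x) @[t --> 0^'+] --> A x)].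

End product_space.

Section operators.
Context (R : realType) (m : nat) (mu : nat -> R) (e : nat -> Usp R m).
Variables (rho alpha gamma sigma : R) (C : Hsp R m -> Usp R m).
Implicit Types h : Hsp R m.

Local Notation Lpow := (pow mu e).
Local Notation Ldom := (pow_dom mu e).

Definition domA : set (Hsp R m) := [set h | Ldom (1 / 2) h.2 /\
  Ldom (1 / 2) (h.1 + rho *: Lpow (alpha - 1 / 2) h.2)].

Definition opA h : Hsp R m :=
  (Lpow (1 / 2) h.2,
   - Lpow (1 / 2) (h.1 + rho *: Lpow (alpha - 1 / 2) h.2)).

Definition opG (u : Usp R m) : Hsp R m := (0, Lpow (- gamma) u).

Definition opL h : Hsp R m := (0, Lpow (- sigma) h.2).

Definition opB h : Hsp R m := (0, C (Lpow (- (1 / 2)) h.1, h.2)).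

End operators.

Section bochner.
Context d (T : measurableType d) (R : realType) (V : normedModType R).
Variable mu : {measure set T -> \bar R}.

(** The simple function sum_i 1_(A i) (c i), as the sequence of the (A i, c i) *)
Definition simple_val (s : seq (set T * V)) (x : T) : V :=
  \sum_(p <- s) \1_(p.1) x *: p.2.

Definition simple_int (s : seq (set T * V)) : V :=
  \sum_(p <- s) fine (mu p.1) *: p.2.

Definition bochner_integral (D : set T) (f : T -> V) (I : V) : Prop :=
  exists s : nat -> seq (set T * V),
  [/\ forall n p, p \in s n ->
        [/\ measurable p.1, p.1 `<=` D & (mu p.1 < +oo)%E],
      {ae mu, forall x, D x -> simple_val (s n) x @[n --> \oo] --> f x},
      (\int[mu]_(x in D) `|f x - simple_val (s n) x|%:E)%E
        @[n --> \oo] --> 0%E &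
      simple_int (s n) @[n --> \oo] --> I].

End bochner.

Section probability.
Context (R : realType) d (Omega : measurableType d) (P : probability Omega R).

Definition normal_filtration (T : R) (F : R -> set (set Omega)) : Prop :=
  [/\ forall t, 0 <= t <= T -> sigma_algebra setT (F t) /\ F t `<=` measurable,
      forall s t, 0 <= s -> s <= t -> t <= T -> F s `<=` F t,
      forall A, measurable A -> P A = 0%E -> F 0 A &
      forall t, 0 <= t < T ->
        \bigcap_(s in [set s | t < s <= T]) F s `<=` F t].

Definition sigma_generated (I : Type) (D : set I) (Y : I -> Omega -> R) :
    set (set Omega) :=
  <<s \bigcup_(i in D) preimage_set_system setT (Y i) measurable >>.

Definition independent2 (F G : set (set Omega)) : Prop :=
  forall A B, F A -> G B -> P (A `&` B) = (P A * P B)%E.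

Definition independent (F : nat -> set (set Omega)) : Prop :=
  forall (J : seq nat) (A : nat -> set Omega), uniq J ->
    (forall k, k \in J -> F k (A k)) ->
    P (\bigcap_(k in [set` J]) A k) = (\prod_(k <- J) P (A k))%E.

Definition brownian_motion (T : R) (b : R -> Omega -> R) : Prop :=
  [/\ forall t, 0 <= t <= T -> measurable_fun setT (b t),
      {ae P, forall w, b 0 w = 0},
      {ae P, forall w, {within `[0, T], continuous (b ^~ w)}},
      forall s t, 0 <= s -> s < t -> t <= T -> forall B, measurable B ->
        P ((fun w => b t w - b s w) @^-1` B) =
        normal_prob 0 (Num.sqrt (t - s)) B &
      forall s t, 0 <= s -> s <= t -> t <= T ->
        independent2 (sigma_generated `[0, s] b)
                     (sigma_generated [set: unit] (fun=> b t \- b s))].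

(** W = sum_k (b k) (g k) is a U-cylindrical Wiener process with respect to
    the filtration F: besides being adapted, its increments after s are
    independent of F s, jointly in k *)
Definition cylindrical_wiener m (T : R) (F : R -> set (set Omega))
    (g : nat -> Usp R m) (b : nat -> R -> Omega -> R) : Prop :=
  [/\ orthonormal_basis g,
      forall k, brownian_motion T (b k),
      independent (fun k => sigma_generated `[0, T] (b k)),
      forall k t, 0 <= t <= T -> sigma_generated [set: unit] (fun=> b k t) `<=` F t &
      forall s, 0 <= s <= T -> independent2 (F s)
        (sigma_generated [set kt : nat * R | s <= kt.2 <= T]
           (fun kt => b kt.1 kt.2 \- b kt.1 s))].

Section H_valued.
Variable m : nat.
Implicit Types (X Y I : Omega -> Hsp R m).

Definition H_measurable (F : set (set Omega)) X : Prop :=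
  forall O : set (Hsp R m), open O -> F (X @^-1` O).

Definition cvg_L2_H (X : nat -> Omega -> Hsp R m) Y : Prop :=
  (\int[P]_w (hnorm (X n w - Y w) ^+ 2)%:E)%E @[n --> \oo] --> 0%E.

(** The step function sum_j 1_(]a_j, b_j]) v_j, as the sequence of the
    (a_j, b_j, v_j), and its integral with respect to b *)
Definition step_val (s : seq (R * R * Hsp R m)) (r : R) : Hsp R m :=
  \sum_(p <- s) \1_(`]p.1.1, p.1.2]%classic) r *: p.2.

Definition step_int (b : R -> Omega -> R) (s : seq (R * R * Hsp R m)) (w : Omega)
    : Hsp R m :=
  \sum_(p <- s) (b p.1.2 w - b p.1.1 w) *: p.2.

(** I = int_0^t f(r) db(r) for a deterministic f in L^2(0, t; H) *)
Definition wiener_integral (b : R -> Omega -> R) (t : R) (f : R -> Hsp R m) I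
    : Prop :=
  H_measurable measurable I /\
  exists s : nat -> seq (R * R * Hsp R m),
  [/\ forall n, all (fun p => (0 <= p.1.1) && (p.1.1 <= p.1.2 <= t)) (s n),
      (\int[@lebesgue_measure R]_(r in `[0%R, t])
        (hnorm (f r - step_val (s n) r) ^+ 2)%:E)%E @[n --> \oo] --> 0%E &
      cvg_L2_H (fun n => step_int b (s n)) I].

(** I = int_0^t Phi(r) dW(r) = sum_k int_0^t Phi(r) (g k) d(b k)(r), for a
    deterministic Phi *)
Definition stochastic_integral (g : nat -> Usp R m) (b : nat -> R -> Omega -> R)
    (t : R) (Phi : R -> Usp R m -> Hsp R m) I : Prop :=
  H_measurable measurable I /\
  exists J : nat -> Omega -> Hsp R m,
    (forall k, wiener_integral (b k) t (fun r => Phi r (g k)) (J k)) /\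
    cvg_L2_H (fun n w => \sum_(k < n) J k w) I.

(** X is a mild solution on [0, T] of dX = A X dt + drift(X) dt + G dW,
    X(0) = x, with S the semigroup generated by A. Joint measurability is
    needed for the Lebesgue integral to make sense; adaptedness alone would
    not exclude changing X on a set with null sections in Omega only. *)
Definition mild_solution (S : R -> Hsp R m -> Hsp R m) (drift : Hsp R m -> Hsp R m)
    (G : Usp R m -> Hsp R m) (T : R) (F : R -> set (set Omega))
    (g : nat -> Usp R m) (b : nat -> R -> Omega -> R) (x : Hsp R m)
    (X : R -> Omega -> Hsp R m) : Prop :=
  [/\ forall t, 0 <= t <= T -> H_measurable (F t) (X t),
      forall O : set (Hsp R m), open O ->
        measurable [set z : measurableTypeR R * Omega |
                    0 <= (z.1 : R) <= T /\ O (X z.1 z.2)] &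
      forall t, 0 <= t <= T -> exists I1 I2 : Omega -> Hsp R m,
      [/\ {ae P, forall w, bochner_integral (@lebesgue_measure R) `[0, t]
             (fun s => S (t - s) (drift (X s w))) (I1 w)},
          stochastic_integral g b t (fun s u => S (t - s) (G u)) I2 &
          {ae P, forall w, X t w = S t x + I1 w + I2 w}]].

End H_valued.
End probability.

(* Main.v *)
(** The Gaussian increment of the stochastic convolution over [[u, r]] satisfies
    a Harnack inequality whose cost is the energy of a control steering the
    linear equation from [h] to [0] in time [r - u]: of order
    [(r - u)^-k1 |h|] in general, and of a smaller order [(r - u)^-k2] when [h]
    is produced by the drift. Conditional expectations of Hoelder functions of
    the solution are therefore Lipschitz in the past, with constant
    [(r - u)^(-k1 (1 - theta))]. Stochastic sewing, with dyadic refinement and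
    martingale orthogonality, turns this into a mean square bound of order
    [(w - u)^(1/2 + ep)] for the difference of the two drift integrals over
    [[u, w]]; the lower bound on [theta] is what makes [ep > 0]. The estimate
    contracts on short intervals, which are then chained. *)
Require Import Defs.
From HB Require Import structures.
From mathcomp Require Import all_boot all_order all_algebra.
From mathcomp Require Import all_classical all_reals all_analysis.
From mathcomp Require Import measurable_realfun unstable ring lra zify.

Import Order.TTheory GRing.Theory Num.Theory.
Import numFieldTopology.Exports numFieldNormedType.Exports.

Set Implicit Arguments.
Unset Strict Implicit.
Unset Printing Implicit Defensive.

Local Open Scope classical_set_scope.
Local Open Scope ring_scope.

(** The noise acts on the velocity only, so steering a position in time t costs t^(-3/2): this is
    the origin of [3 / 2] in [k1] and of [2 / 3] in the thresholds for [theta]. An error of the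
    drift also enters through the velocity; its position part is smaller by a factor frequency times
    elapsed time, which removes that [3 / 2] from its cost. With mode decay of order mu^beta,
    [beta = min alpha (1 - alpha)], the binding condition is
    [k1 (1 - theta) + gamma / beta < 1 / 2]. Stochastic integrals are given only as limits of step
    sums; independence is therefore tested on uniformly continuous functions, and smoothing is
    expressed by Harnack inequalities, both of which survive limits in probability. Paths are
    jointly measurable but not known to be continuous, so Riemann sums of the drift need not
    converge; their mean over a uniform shift of the mesh is the integral exactly. Coordinates are
    estimated together by duality, with constants that do not depend on their number. *)

Lemma le_of_eq (disp : Order.disp_t) (T : porderType disp) (x y : T) : x = y -> (x <= y)%O.
Proof. by move=> ->. Qed.

(** * Expectations of almost surely bounded variables *)

Section expectation.
Context (R : realType) d (Omega : measurableType d) (P : probability Omega R).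
Implicit Types f g h : Omega -> R.

(** Boundedness holds only almost surely because it must cover the squared gap between two
    solutions, which is controlled off a null set once the noise has cancelled. Gaussian quantities
    enter [Ex] only through bounded functions; their own moments are extended-real integrals. *)
Definition abd g := measurable_fun setT g /\
 exists M : R, {ae P, forall w, `|g w| <= M}.

Definition Ex g : R := \int[P]_w g w.

Lemma abd_intble g : abd g -> P.-integrable setT (EFin \o g).
Proof.
move=> [mg [M gM]]; apply/integrableP; split; first exact/measurable_EFinP.
apply: (@le_lt_trans _ _ (\int[P]_w (cst (Num.max M 0)%:E) w)%E); last first.
 by rewrite integral_cst//= probability_setT mule1 ltry.
apply: ae_ge0_le_integral => //.
- by apply: measurableT_comp => //; exact/measurable_EFinP.
- by move=> w _; rewrite lee_fin le_max lexx orbT.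
- apply: filterS gM => w gM _ /=.
 by rewrite lee_fin le_max gM.
Qed.

Lemma abd_cst a : abd (cst a).
Proof. by split=> //; exists `|a|; apply: aeW. Qed.

Lemma abd_bnd g M : measurable_fun setT g -> (forall w, `|g w| <= M) -> abd g.
Proof. by move=> mg gM; split=> //; exists M; apply: aeW => w; exact: gM. Qed.

Lemma abdD f g : abd f -> abd g -> abd (fun w => f w + g w).
Proof.
move=> [mf [M fM]] [mg [N gN]]; split; first exact: measurable_funD.
exists (M + N); apply: filterS2 fM gN => w fM gN.
by rewrite (le_trans (ler_normD _ _))// lerD.
Qed.

Lemma abdM f g : abd f -> abd g -> abd (fun w => f w * g w).
Proof.
move=> [mf [M fM]] [mg [N gN]]; split; first exact: measurable_funM.
exists (M * N); apply: filterS2 fM gN => w fM gN.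
by rewrite normrM ler_pM.
Qed.

Lemma abdZ a g : abd g -> abd (fun w => a * g w).
Proof. exact/abdM/abd_cst. Qed.

Lemma abdN g : abd g -> abd (fun w => - g w).
Proof.
by move=> /(abdZ (-1)); congr abd; apply/funext => w; rewrite mulN1r.
Qed.

Lemma abdB f g : abd f -> abd g -> abd (fun w => f w - g w).
Proof. by move=> hf /abdN; exact: abdD. Qed.

Lemma abd_normr g : abd g -> abd (fun w => `|g w|).
Proof.
move=> [mg [M gM]]; split; first exact: measurableT_comp.
by exists M; apply: filterS gM => w; rewrite normr_id.
Qed.

Lemma abdX g n : abd g -> abd (fun w => g w ^+ n).
Proof.
move=> hg; elim: n => [|n ih]; first exact: abd_cst.
have := abdM hg ih; congr abd; apply/funext => w; by rewrite exprS.
Qed.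

Lemma abd_sum I (r : seq I) (Q : pred I) (F : I -> Omega -> R) :
 (forall i, Q i -> abd (F i)) -> abd (fun w => \sum_(i <- r | Q i) F i w).
Proof.
move=> hF; elim: r => [|i r ih].
 by have := abd_cst 0; congr abd; apply/funext => w; rewrite big_nil.
case: (boolP (Q i)) => Qi.
 have := abdD (hF _ Qi) ih; congr abd; apply/funext => w.
 by rewrite big_cons Qi.
by move: ih; congr abd; apply/funext => w; rewrite big_cons (negbTE Qi).
Qed.

Lemma Ex_cst a : Ex (cst a) = a.
Proof. by rewrite /Ex Rintegral_cst// [X in fine X]probability_setT mulr1. Qed.

Lemma ExD f g : abd f -> abd g -> Ex (fun w => f w + g w) = Ex f + Ex g.
Proof. by move=> hf hg; rewrite /Ex RintegralD//; exact: abd_intble. Qed.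

Lemma ExZ a g : abd g -> Ex (fun w => a * g w) = a * Ex g.
Proof. by move=> hg; rewrite /Ex RintegralZl//; exact: abd_intble. Qed.

Lemma ExB f g : abd f -> abd g -> Ex (fun w => f w - g w) = Ex f - Ex g.
Proof. by move=> hf hg; rewrite /Ex RintegralB//; exact: abd_intble. Qed.

Lemma Ex_sum I (r : seq I) (Q : pred I) (F : I -> Omega -> R) :
 (forall i, Q i -> abd (F i)) ->
 Ex (fun w => \sum_(i <- r | Q i) F i w) = \sum_(i <- r | Q i) Ex (F i).
Proof.
move=> hF; elim: r => [|i r ih].
 rewrite big_nil -[RHS](Ex_cst 0); congr Ex.
 by apply/funext => w; rewrite big_nil.
rewrite big_cons; case: (boolP (Q i)) => Qi.
 rewrite -ih -ExD//; [|exact: hF|exact: abd_sum].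
 by congr Ex; apply/funext => w; rewrite big_cons Qi.
by rewrite -ih; congr Ex; apply/funext => w; rewrite big_cons (negbTE Qi).
Qed.

Lemma Ex_ae_le f g : abd f -> abd g -> {ae P, forall w, f w <= g w} ->
 Ex f <= Ex g.
Proof.
move=> hf hg fg; rewrite -subr_ge0 -ExB//.
have hB := abdB hg hf.
have -> : Ex (fun w => g w - f w) = Ex (fun w => `|g w - f w|).
 congr fine; apply: ae_eq_integral => //.
 - by case: hB => /measurable_EFinP.
 - by case: (abd_normr hB) => /measurable_EFinP.
 - by apply: filterS fg => w fg _; rewrite ger0_norm// subr_ge0.
exact: Rintegral_ge0.
Qed.

Lemma Ex_le f g : abd f -> abd g -> (forall w, f w <= g w) -> Ex f <= Ex g.
Proof. by move=> hf hg fg; apply: Ex_ae_le => //; exact: aeW. Qed.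

Lemma Ex_ge0 g : (forall w, 0 <= g w) -> 0 <= Ex g.
Proof. by move=> g0; exact: Rintegral_ge0. Qed.

Lemma Ex_norm g : abd g -> `|Ex g| <= Ex (fun w => `|g w|).
Proof. by move=> hg; rewrite le_normr_Rintegral//; exact: abd_intble. Qed.

Lemma Ex_bnd g M : abd g -> {ae P, forall w, `|g w| <= M} -> `|Ex g| <= M.
Proof.
move=> hg gM; rewrite (le_trans (Ex_norm hg))// -[leRHS]Ex_cst.
by apply: Ex_ae_le; [exact: abd_normr|exact: abd_cst|].
Qed.

Lemma EFin_Ex g : abd g -> (Ex g)%:E = (\int[P]_w (g w)%:E)%E.
Proof.
move=> hg; rewrite fineK//.
by apply: integrable_fin_num => //; exact: abd_intble.
Qed.

(* The nonnegative quadratic polynomial t |-> Ex ((f - t)^2) at t = Ex f. *)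
Lemma Ex_sqr g : abd g -> Ex g ^+ 2 <= Ex (fun w => g w ^+ 2).
Proof.
move=> hg; have : 0 <= Ex (fun w => (g w - Ex g) ^+ 2).
 by apply: Ex_ge0 => w; exact: sqr_ge0.
have -> : (fun w => (g w - Ex g) ^+ 2) =
  (fun w => g w ^+ 2 - ((2 * Ex g) * g w - Ex g ^+ 2)).
 by apply/funext => w; ring.
rewrite ExB//; [|exact: abdX|by apply: abdB; [exact: abdZ|exact: abd_cst]].
rewrite ExB//; [|exact: abdZ|exact: abd_cst].
rewrite ExZ//.
have -> : Ex (fun=> Ex g ^+ 2) = Ex g ^+ 2 by exact: Ex_cst.
lra.
Qed.

Lemma abd_indic A : measurable A -> abd (\1_A : Omega -> R).
Proof.
move=> mA; apply: (abd_bnd (M := 1)); first exact: measurable_indic.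
by move=> w; rewrite indicE; case: (_ \in _); rewrite /= ?normr1 ?normr0.
Qed.

Lemma Ex_indic A : measurable A -> Ex (\1_A) = fine (P A).
Proof.
by move=> mA; rewrite /Rintegral; congr fine; rewrite integral_indic// setIT.
Qed.
End expectation.
(** With [b = a + 1] it makes [e / (a + 1)] a tolerance that also serves when [a = 0]. *)
Lemma mul_div_le (R : realFieldType) (a b e : R) :
 0 <= a -> a <= b -> 0 < b -> 0 <= e -> a * (e / b) <= e.
Proof. by move=> a0 ab b0 e0; rewrite mulrA ler_pdivrMr// mulrC ler_wpM2l. Qed.

Lemma lip_continuous (R : realType) (V W : normedModType R) (f : V -> W) (K : R) :
 (forall x y, `|f x - f y| <= K * `|x - y|) -> continuous f.
Proof.
move=> hf x; apply/cvgrPdist_le => e e0; apply/nbhs_ballP.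
exists (e / (`|K| + 1)); first exact: divr_gt0.
move=> y; rewrite -ball_normE /ball_/= => xy.
apply: (le_trans (hf x y)).
apply: (@le_trans _ _ (`|K| * (e / (`|K| + 1)))).
 have := ler_norm K; have := normr_ge0 (x - y); have := normr_ge0 K; nra.
by apply: mul_div_le => //; [rewrite lerDl|exact: ltW].
Qed.

(** * Random variables in separable normed spaces, and uniformly continuous test functions *)

Section vector_variables.
Context (R : realType) d (Omega : measurableType d).
Implicit Types V W : normedModType R.

Definition sepa V := exists q : nat -> V, forall x (e : R), 0 < e ->
 exists i, `|x - q i| < e.

Definition vmeas V (Y : Omega -> V) :=
 forall O : set V, open O -> measurable (Y @^-1` O).

Lemma vmeas_comp V W (f : V -> W) (Y : Omega -> V) :
 continuous f -> vmeas Y -> vmeas (f \o Y).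
Proof.
move=> cf mY O oO; rewrite comp_preimage; apply: mY.
by apply: open_comp => // x _; exact: cf.
Qed.

Lemma vmeas_fun (Y : Omega -> R) : vmeas (Y : Omega -> R^o) ->
 measurable_fun setT Y.
Proof.
move=> mY; apply: (measurability _ (RGenOpens.measurableE R)) => _ [_ [a [b ->]] <-].
by rewrite setTI; apply: mY; exact: interval_open.
Qed.

Lemma fun_vmeas (Y : Omega -> R) : measurable_fun setT Y ->
 vmeas (Y : Omega -> R^o).
Proof.
by move=> mY O oO; rewrite -[X in measurable X]setTI; apply: mY => //;
 exact: open_measurable.
Qed.

Lemma vmeas_cst V (y : V) : vmeas (cst y).
Proof.
move=> O oO; rewrite preimage_cst; case: ifP => _ //; exact: measurable0.
Qed.

Lemma open_dist_lt V (q : V) (e : R) : open [set x | `|x - q| < e].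
Proof.
have -> : [set x | `|x - q| < e] = ball q e.
 by apply/funext => x; rewrite -ball_normE /ball_/= distrC.
have [e0|e0] := ltP 0 e; first exact: ball_open.
suff -> : ball q e = set0 by exact: open0.
apply/seteqP; split => // x /=; rewrite -ball_normE => h.
by have := lt_le_trans h e0; rewrite ltNge normr_ge0.
Qed.

Lemma vmeas_balls V (Y : Omega -> V) : sepa V ->
 (forall q (r : R), measurable [set w | `|Y w - q| < r]) -> vmeas Y.
Proof.
move=> [q dq] mB O oO.
pose r k : R := k.+1%:R^-1.
pose Q (i k : nat) := forall a : V, `|a - q i| < r k -> O a.
have -> : Y @^-1` O = \bigcup_i \bigcup_k
  (if `[< Q i k >] then [set w | `|Y w - q i| < r k] else set0).
 apply/seteqP; split => [w /= Ow|w [i _ [k _]]]; last first.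
  by case: asboolP => // Qik; exact: Qik.
 move: oO; rewrite openE => /(_ _ Ow).
 rewrite /interior -nbhs_ballE => -[e /= e0 he].
 have [k hk] : exists k, r k < e / 2.
  by have [k _ hk] := near_infty_natSinv_lt (PosNum (divr_gt0 e0 (ltr0n _ 2)));
   exists k; exact: (hk k (leqnn k)).
 have rk : 0 < r k by rewrite invr_gt0.
 have [i hi] := dq (Y w) _ rk.
 exists i => //; exists k => //.
 rewrite (_ : `[< _ >] = true)//; apply/asboolP => a ha.
 apply: he; rewrite -ball_normE /ball_/=.
 rewrite -(subrKA (q i)) (le_lt_trans (ler_normD _ _))// (distrC (q i)); lra.
apply: bigcupT_measurable => i; apply: bigcupT_measurable => k.
by case: ifP => _ //; exact: mB.
Qed.

(* Separability makes the Borel sets of the product generated by rectangles. *)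
Lemma vmeasD V (Y Z : Omega -> V) : sepa V -> vmeas Y -> vmeas Z ->
 vmeas (fun w => Y w + Z w).
Proof.
move=> [q dq] mY mZ O oO.
pose r k : R := k.+1%:R^-1.
pose Q (i j k : nat) := forall a b : V, `|a - q i| < r k -> `|b - q j| < r k ->
 O (a + b).
pose B i k := [set x : V | `|x - q i| < r k].
have -> : (fun w => Y w + Z w) @^-1` O =
  \bigcup_i \bigcup_j \bigcup_k
  (if `[< Q i j k >] then Y @^-1` B i k `&` Z @^-1` B j k else set0).
 apply/seteqP; split => [w|w [i _ [j _ [k _]]]]; last first.
  by case: asboolP => // Qijk [/= hY hZ]; exact: Qijk.
 move=> /= Ow; move: oO; rewrite openE => /(_ _ Ow).
 rewrite /interior -nbhs_ballE => -[e /= e0 he].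
 have [k hk] : exists k, r k < e / 4%:R.
  by have [k _ hk] := near_infty_natSinv_lt (PosNum (divr_gt0 e0 (ltr0n _ 4)));
   exists k; exact: (hk k (leqnn k)).
 have rk : 0 < r k by rewrite invr_gt0.
 have [i hi] := dq (Y w) _ rk; have [j hj] := dq (Z w) _ rk.
 exists i => //; exists j => //; exists k => //.
 rewrite (_ : `[< _ >] = true)//; apply/asboolP => a b ha hb.
 apply: he; rewrite -ball_normE /ball_/=.
 have -> : Y w + Z w - (a + b) =
  (Y w - q i) - (a - q i) + ((Z w - q j) - (b - q j)).
  have E (u v z : V) : u - z - (v - z) = u - v by rewrite opprB addrA subrK.
  by rewrite !E opprD addrACA.
 rewrite (le_lt_trans (ler_normD _ _))//.
 apply: (@le_lt_trans _ _ ((`|Y w - q i| + `|a - q i|) + (`|Z w - q j| + `|b - q j|))).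
  by apply: lerD; exact: ler_normB.
 lra.
have mB i k (X : Omega -> V) : vmeas X -> measurable (X @^-1` B i k).
 by apply; exact: open_dist_lt.
apply: bigcupT_measurable => i; apply: bigcupT_measurable => j.
apply: bigcupT_measurable => k; case: ifP => _ //.
by apply: measurableI; exact: mB.
Qed.

Lemma vmeasN V (Y : Omega -> V) : vmeas Y -> vmeas (fun w => - Y w).
Proof. by move=> mY; apply: (vmeas_comp (f := fun x : V => - x)) => //; exact: opp_continuous. Qed.

Lemma vmeasB V (Y Z : Omega -> V) : sepa V -> vmeas Y -> vmeas Z ->
 vmeas (fun w => Y w - Z w).
Proof. by move=> sV mY mZ; apply: vmeasD => //; exact: vmeasN. Qed.

Lemma vmeas_sum V I (r : seq I) (F : I -> Omega -> V) : sepa V ->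
 (forall i, vmeas (F i)) -> vmeas (fun w => \sum_(i <- r) F i w).
Proof.
move=> sV mF; elim: r => [|i r ih].
 by have := @vmeas_cst V 0; congr vmeas; apply/funext => w; rewrite big_nil.
have := vmeasD sV (mF i) ih; congr vmeas; apply/funext => w.
by rewrite big_cons.
Qed.

Lemma vmeas_line V (xi : Omega -> R) (v : V) : measurable_fun setT xi ->
 vmeas (fun w => xi w *: v).
Proof.
move=> /fun_vmeas mxi; apply: (@vmeas_comp R^o V (fun x : R^o => x *: v)) => //.
by move=> x; exact: scalel_continuous.
Qed.

Lemma vmeas_norm V (Y : Omega -> V) : vmeas Y ->
 measurable_fun setT (fun w => `|Y w|).
Proof.
move=> mY; apply: vmeas_fun.
by apply: (@vmeas_comp V R^o (fun x : V => `|x|)) => //; exact: norm_continuous.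
Qed.

(** The test functions used throughout: averaging one of them over an independent noise gives
    another one, and their expectations change little when the argument is perturbed by a variable
    that is small in probability. *)
Definition ucb V (f : V -> R) := (exists M : R, forall x, `|f x| <= M) /\
 forall e : R, 0 < e -> exists2 dl : R, 0 < dl &
  forall x y, `|x - y| <= dl -> `|f x - f y| <= e.

Lemma ucb_cont V (f : V -> R) : ucb f -> continuous (f : V -> R^o).
Proof.
move=> [_ hf] x; apply/cvgrPdist_le => e e0.
have [dl dl0 h] := hf e e0; apply/nbhs_ballP; exists dl => //= y.
by rewrite -ball_normE => /ltW; exact: h.
Qed.

Lemma ucb_shift V (f : V -> R) y : ucb f -> ucb (fun x => f (x + y)).
Proof.
move=> [[M fM] hf]; split; first by exists M => x; exact: fM.
move=> e /hf[dl dl0 h]; exists dl => // a b ab; apply: h.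
by rewrite opprD addrACA subrr addr0.
Qed.

Lemma ucbX2 V (f : V -> R) : ucb f -> ucb (fun x => f x ^+ 2).
Proof.
move=> [[M fM] hf]; split.
 exists (M ^+ 2) => x; rewrite normrX lerXn2r//.
 exact: le_trans (fM x).
move=> e e0; have M0 : 0 <= M by apply: le_trans (fM 0).
have [|dl dl0 h] := hf (e / (2 * M + 1)); first by rewrite divr_gt0//; lra.
exists dl => // x y xy; rewrite subr_sqr normrM.
apply: (@le_trans _ _ (e / (2 * M + 1) * (2 * M))).
 rewrite ler_pM ?h//; apply: (le_trans (ler_normD _ _)).
 by have := fM x; have := fM y; lra.
rewrite mulrC mul_div_le//; lra.
Qed.

Lemma ucbD V (f g : V -> R) : ucb f -> ucb g -> ucb (fun x => f x + g x).
Proof.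
move=> [[M fM] hf] [[N gN] hg]; split.
 by exists (M + N) => x; rewrite (le_trans (ler_normD _ _))// lerD.
move=> e e0; have e2 : 0 < e / 2 by lra.
have [d1 d10 h1] := hf _ e2; have [d2 d20 h2] := hg _ e2.
exists (Num.min d1 d2); first by rewrite lt_min d10.
move=> x y; rewrite le_min => /andP[/h1 a /h2 b].
rewrite opprD addrACA (le_trans (ler_normD _ _))//; lra.
Qed.

Lemma ucbZ V a (f : V -> R) : ucb f -> ucb (fun x => a * f x).
Proof.
move=> [[M fM] hf]; split.
 by exists (`|a| * M) => x; rewrite normrM ler_wpM2l.
move=> e e0; have [|dl dl0 h] := hf (e / (`|a| + 1)); first by rewrite divr_gt0// ltr_wpDl.
exists dl => // x y xy; rewrite -mulrBr normrM.
apply: (@le_trans _ _ (`|a| * (e / (`|a| + 1)))); first by rewrite ler_wpM2l// h.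
apply: mul_div_le; have := normr_ge0 a; lra.
Qed.

Lemma ucbB V (f g : V -> R) : ucb f -> ucb g -> ucb (fun x => f x - g x).
Proof.
move=> hf /(ucbZ (-1)) hg; have := ucbD hf hg; congr ucb.
by apply/funext => x; rewrite mulN1r.
Qed.

Lemma ucb_cst V a : @ucb V (cst a).
Proof.
split; first by exists `|a|.
by move=> e e0; exists 1 => // x y _ /=; rewrite subrr normr0 ltW.
Qed.

Lemma ucb_sum V n (f : nat -> V -> R) : (forall i, ucb (f i)) ->
 ucb (fun x => \sum_(i < n) f i x).
Proof.
move=> hf; elim: n => [|n ih].
 have := @ucb_cst V 0; congr ucb; apply/funext => x; by rewrite big_ord0.
have := ucbD ih (hf n); congr ucb; apply/funext => x; by rewrite big_ord_recr.
Qed.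
End vector_variables.

(** * Limits in probability, independence, freezing, and Harnack inequalities *)

Section approximation.
Context (R : realType) d (Omega : measurableType d) (P : probability Omega R).
Implicit Types (V W : normedModType R).

Notation Ex := (Ex P).
Notation abd := (abd P).

Definition pr (A : set Omega) : R := fine (P A).

Lemma pr_ge0 A : 0 <= pr A. Proof. exact: fine_ge0. Qed.

Lemma EFin_pr A : measurable A -> (pr A)%:E = P A.
Proof. by move=> mA; rewrite fineK// fin_num_measure. Qed.

Lemma pr_le A B : measurable A -> measurable B -> A `<=` B -> pr A <= pr B.
Proof.
by move=> mA mB AB; rewrite -lee_fin !EFin_pr// le_measure// inE.
Qed.

Lemma pr_leU A B C : measurable A -> measurable B -> measurable C ->
 A `<=` B `|` C -> pr A <= pr B + pr C.
Proof.
move=> mA mB mC ABC; rewrite -lee_fin EFinD !EFin_pr//.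
apply: (@le_trans _ _ (P (B `|` C))); last exact: measureU2.
by apply: le_measure; rewrite ?inE//; exact: measurableU.
Qed.

Lemma abd_ucb V (f : V -> R) Y : ucb f -> vmeas Y -> abd (fun w => f (Y w)).
Proof.
move=> hf mY; have [[M fM] _] := hf.
apply: (@abd_bnd _ _ _ _ _ M) => [|w]; last exact: fM.
exact/vmeas_fun/(vmeas_comp (ucb_cont hf) mY).
Qed.

Lemma Ex_ucb_bnd V (f : V -> R) M Y : ucb f -> (forall x, `|f x| <= M) ->
 vmeas Y -> `|Ex (fun w => f (Y w))| <= M.
Proof.
move=> hf fM mY; apply: Ex_bnd; first exact: abd_ucb.
by apply: aeW => w; exact: fM.
Qed.

Definition far V (e : R) (Y Z : Omega -> V) := [set w | e < `|Y w - Z w|].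

Lemma measurable_far V e (Y Z : Omega -> V) : sepa V -> vmeas Y -> vmeas Z ->
 measurable (far e Y Z).
Proof.
move=> sV mY mZ; rewrite (_ : far e Y Z = (fun w => `|Y w - Z w|) @^-1` `]e, +oo[%classic).
 rewrite -[X in measurable X]setTI.
 by apply: (vmeas_norm (vmeasB sV mY mZ)) => //; exact: measurable_itv.
by apply/seteqP; split => w /=; rewrite in_itv andbT.
Qed.

Lemma Ex_split f a b A : abd f -> measurable A -> 0 <= b ->
 (forall w, ~ A w -> f w <= a) -> (forall w, A w -> f w <= a + b) ->
 Ex f <= a + b * pr A.
Proof.
move=> hf mA b0 h1 h2.
have -> : a + b * pr A = Ex (fun w => a + b * \1_A w).
 rewrite ExD; [|exact: abd_cst|by apply: abdZ; exact: abd_indic].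
 rewrite ExZ ?Ex_indic//; last exact: abd_indic.
 by congr (_ + _); rewrite Ex_cst.
apply: Ex_le => //.
 by apply: abdD; [exact: abd_cst|apply: abdZ; exact: abd_indic].
move=> w; rewrite indicE; case: (boolP (w \in A)) => [|/negP].
 by rewrite inE mulr1 => /h2.
by rewrite inE mulr0 addr0 => /h1.
Qed.

(** Uniform continuity acts where the two variables are close, the bound [M] on the exceptional
    event. A single [e] measures both the distance and the probability, so that no pair of
    parameters has to be carried along. *)
Lemma ucb_far V (f : V -> R) eta : sepa V -> ucb f -> 0 < eta ->
 exists2 e, 0 < e & forall Y Z, vmeas Y -> vmeas Z -> pr (far e Y Z) <= e ->
  Ex (fun w => `|f (Y w) - f (Z w)|) <= eta.
Proof.
move=> sV hf eta0; have [[M fM] hu] := hf.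
have M0 : 0 <= M by apply: le_trans (fM 0).
have [|dl dl0 h] := hu (eta / 2); first by lra.
pose e' := eta / 2 / (2 * M + 1).
have e'0 : 0 < e' by rewrite divr_gt0//; lra.
exists (Num.min dl e'); first by rewrite lt_min dl0.
move=> Y Z mY mZ hp.
apply: (@le_trans _ _ (eta / 2 + (2 * M) * pr (far (Num.min dl e') Y Z))).
 apply: Ex_split => //.
 - by apply/abd_normr/abdB; exact: abd_ucb.
 - exact: measurable_far.
 - lra.
 - move=> w /negP; rewrite -leNgt => hw; apply: h.
  by rewrite (le_trans hw)// ge_min lexx.
 - move=> w _; rewrite (le_trans (ler_normB _ _))//.
  by have := fM (Y w); have := fM (Z w); lra.
have : (2 * M) * pr (far (Num.min dl e') Y Z) <= (2 * M) * e'.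
 rewrite ler_wpM2l//; first by lra.
 by rewrite (le_trans hp)// ge_min lexx orbT.
have : (2 * M) * e' <= eta / 2 by rewrite mul_div_le//; lra.
lra.
Qed.

Lemma ucb_far_Ex V (f : V -> R) eta : sepa V -> ucb f -> 0 < eta ->
 exists2 e, 0 < e & forall Y Z, vmeas Y -> vmeas Z -> pr (far e Y Z) <= e ->
  `|Ex (fun w => f (Y w)) - Ex (fun w => f (Z w))| <= eta.
Proof.
move=> sV hf /(ucb_far sV hf)[e e0 h]; exists e => // Y Z mY mZ /(h _ _ mY mZ).
apply: le_trans; rewrite -ExB; [|exact: abd_ucb..].
by apply: Ex_norm; apply: abdB; exact: abd_ucb.
Qed.

(** [apx A Y]: Y is a limit in probability of A-simple functions. *)
Section apx.
Variables (Acl : set (set Omega)) (Am : Acl `<=` measurable).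

Definition apx V (Y : Omega -> V) := forall e : R, 0 < e ->
 exists (I : finType) (A : I -> set Omega) (y : I -> V),
 [/\ forall i, Acl (A i), forall i j w, A i w -> A j w -> i = j &
   pr (~` [set w | exists2 i, A i w & `|Y w - y i| <= e]) <= e].

Lemma measurable_bad V (Y : Omega -> V) (I : finType) (A : I -> set Omega)
  (y : I -> V) (e : R) : sepa V -> vmeas Y -> (forall i, Acl (A i)) ->
 measurable (~` [set w | exists2 i, A i w & `|Y w - y i| <= e]).
Proof.
move=> sV mY hA; apply: measurableC.
have -> : [set w | exists2 i, A i w & `|Y w - y i| <= e] =
  \bigcup_(i in [set: I]) (A i `&` ~` far e Y (cst (y i))).
 apply/seteqP; split => [w [i Ai hi]|w [i _ [Ai hi]]]; exists i => //.
  by split => //; rewrite /far; apply/negP; rewrite -leNgt.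
 by move/negP : hi; rewrite -leNgt.
apply: fin_bigcup_measurable; first exact: finite_finset.
move=> i _; apply: measurableI; first exact/Am/hA.
by apply/measurableC/measurable_far => //; exact: vmeas_cst.
Qed.

Hypothesis AI : setI_closed Acl.

(** Both variables are almost constant on the intersections of a cell [A i] with a cell [B j], and
    uniform continuity makes [h] almost constant there. *)
Lemma apx2 V1 V2 V3 (h : V1 -> V2 -> V3) Y Z :
 sepa V1 -> sepa V2 -> sepa V3 ->
 vmeas Y -> vmeas Z -> vmeas (fun w => h (Y w) (Z w)) ->
 (forall e : R, 0 < e -> exists2 dl : R, 0 < dl & forall x x' z z',
   `|x - x'| <= dl -> `|z - z'| <= dl -> `|h x z - h x' z'| <= e) ->
 apx Y -> apx Z -> apx (fun w => h (Y w) (Z w)).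
Proof.
move=> s1 s2 s3 mY mZ mh hh aY aZ e e0.
have [dl dl0 hdl] := hh e e0.
pose e' := Num.min dl (e / 2).
have e'0 : 0 < e' by rewrite lt_min dl0; lra.
have [I [A [y [hA dA pA]]]] := aY _ e'0.
have [J [B [z [hB dB pB]]]] := aZ _ e'0.
exists (I * J)%type, (fun ij => A ij.1 `&` B ij.2), (fun ij => h (y ij.1) (z ij.2)).
split.
- by move=> ij; exact: AI.
- by move=> [i j] [i' j'] w /= [a b] [a' b']; rewrite (dA _ _ _ a a') (dB _ _ _ b b').
- apply: (@le_trans _ _ (e' + e')); last first.
  have : e' <= e / 2 by rewrite ge_min lexx orbT.
 lra.
 apply: (le_trans _ (lerD pA pB)); apply: pr_leU.
 + by apply: measurable_bad => // ij; exact: AI.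
 + exact: measurable_bad.
 + exact: measurable_bad.
 + move=> w hw; apply: contrapT => /not_orP[/contrapT[i Ai hi] /contrapT[j Bj hj]].
  apply: hw; exists (i, j) => //=; apply: hdl.
   by rewrite (le_trans hi)// ge_min lexx.
  by rewrite (le_trans hj)// ge_min lexx.
Qed.

Lemma apxD V Y Z : sepa V -> vmeas Y -> vmeas Z -> @apx V Y -> apx Z ->
 apx (fun w => Y w + Z w).
Proof.
move=> sV mY mZ; apply: apx2 => //; first exact: vmeasD.
move=> e e0; exists (e / 2); first by lra.
move=> x x' z z' h1 h2; rewrite opprD addrACA (le_trans (ler_normD _ _))//; lra.
Qed.

Lemma apx_comp V W (L : V -> W) Y : sepa V -> sepa W -> vmeas Y ->
 continuous L ->
 (forall e : R, 0 < e -> exists2 dl : R, 0 < dl & forall x x',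
   `|x - x'| <= dl -> `|L x - L x'| <= e) ->
 apx Y -> apx (fun w => L (Y w)).
Proof.
move=> sV sW mY cL hL aY.
apply: (apx2 (h := fun a _ => L a)) (aY) (aY) => //; first exact: (vmeas_comp cL mY).
by move=> e /hL[dl dl0 h]; exists dl => // x x' z z' /h.
Qed.

Lemma apx_ucb V (f : V -> R) Y : sepa V -> sepa R^o -> vmeas Y -> ucb f -> apx Y ->
 apx ((fun w => f (Y w)) : Omega -> R^o).
Proof.
move=> sV sR mY hf; apply: (@apx_comp V R^o) => //; first exact: ucb_cont.
by have [_] := hf.
Qed.

Lemma apx_lim V (Y : Omega -> V) : sepa V -> vmeas Y ->
 (forall e : R, 0 < e -> exists Z, [/\ vmeas Z, apx Z & pr (far e Y Z) <= e]) ->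
 apx Y.
Proof.
move=> sV mY h e e0; have e2 : 0 < e / 2 by lra.
have [Z [mZ aZ pZ]] := h _ e2.
have [I [A [y [hA dA pA]]]] := aZ _ e2.
exists I, A, y; split => //.
apply: (@le_trans _ _ (e / 2 + e / 2)); last lra.
apply: (le_trans _ (lerD pZ pA)); apply: pr_leU.
- exact: measurable_bad.
- exact: measurable_far.
- exact: measurable_bad.
- move=> w hw; apply: contrapT => /not_orP[/negP+ /contrapT[i Ai hi]].
 rewrite -leNgt => hd; apply: hw; exists i => //.
 rewrite -(subrKA (Z w)) (le_trans (ler_normD _ _))//; lra.
Qed.

Lemma apx_cst V (y : V) : Acl setT -> apx (fun=> y).
Proof.
move=> AT e e0; exists unit, (fun=> setT), (fun=> y); split => //.
 by move=> [] [].
rewrite (_ : ~` _ = set0) ?/pr ?measure0 ?ltW//.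
apply/seteqP; split => // w /=; apply; exists tt => //; apply: ltW.
by rewrite subrr normr0.
Qed.
End apx.

Definition indep (Acl : set (set Omega)) V (N : Omega -> V) :=
 forall A (g : V -> R), Acl A -> ucb g ->
  Ex (fun w => \1_A w * g (N w)) = pr A * Ex (fun w => g (N w)).

Lemma indep_lim Acl V (N : Omega -> V) : Acl `<=` measurable -> sepa V ->
 vmeas N ->
 (forall e : R, 0 < e -> exists Z, [/\ vmeas Z, indep Acl Z & pr (far e N Z) <= e]) ->
 indep Acl N.
Proof.
move=> Am sV mN h A g AA hg; have mA := Am _ AA.
apply/eqP; rewrite -subr_eq0 -normr_le0; apply/ler_gtP => eta eta0.
have [|e e0 he] := ucb_far sV hg (eta := eta / 2); first by lra.
have [Z [mZ iZ pZ]] := h _ e0.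
have hNZ := he _ _ mN mZ pZ.
have aN := abd_ucb hg mN; have aZ := abd_ucb hg mZ; have a1 := abd_indic P mA.
have -> : Ex (fun w => \1_A w * g (N w)) - pr A * Ex (fun w => g (N w)) =
  Ex (fun w => \1_A w * (g (N w) - g (Z w))) -
  pr A * Ex (fun w => g (N w) - g (Z w)).
 rewrite (_ : (fun w => \1_A w * (g (N w) - g (Z w))) =
  fun w => \1_A w * g (N w) - \1_A w * g (Z w)); last first.
  by apply/funext => w; rewrite mulrBr.
 rewrite (ExB aN aZ).
 rewrite ExB; [|exact: abdM..].
 by rewrite iZ// mulrBr opprB addrA subrK.
have pA1 : pr A <= 1.
 by rewrite -lee_fin EFin_pr// probability_le1.
have b1 : `|Ex (fun w => \1_A w * (g (N w) - g (Z w)))| <= eta / 2.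
 apply: (le_trans _ hNZ); apply: (le_trans (Ex_norm (abdM a1 (abdB aN aZ)))).
 apply: Ex_le; [exact/abd_normr/abdM/abdB|exact/abd_normr/abdB|].
 move=> w; rewrite normrM indicE ler_piMl//.
 by case: (_ \in _); rewrite ?normr1 ?normr0.
have b2 : `|pr A * Ex (fun w => g (N w) - g (Z w))| <= eta / 2.
 rewrite normrM ger0_norm ?pr_ge0//.
 apply: (le_trans _ hNZ); apply: (le_trans (ler_wpM2l (pr_ge0 A) (Ex_norm (abdB aN aZ)))).
 by rewrite ler_piMl//; exact: Ex_ge0.
rewrite (le_trans (ler_normB _ _))//; lra.
Qed.

(* Conditioning on A: the variable Y is frozen and N is integrated out. *)
Lemma freeze Acl V (N Y : Omega -> V) (xi : Omega -> R) (g : V -> R) B :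
 Acl `<=` measurable -> setI_closed Acl -> sepa V -> sepa R^o ->
 vmeas N -> indep Acl N -> vmeas Y -> apx Acl Y ->
 measurable_fun setT xi -> (forall w, `|xi w| <= B) ->
 apx Acl (xi : Omega -> R^o) -> ucb g ->
 Ex (fun w => xi w * g (Y w + N w)) =
 Ex (fun w => xi w * Ex (fun w' => g (Y w + N w'))).
Proof.
move=> Am AI sV sR mN iN mY aY mxi xiB axi hg.
have [[M gM] hu] := hg.
have M0 : 0 <= M by apply: le_trans (gM 0).
have w0 : Omega by exact: point.
have B0 : 0 <= B by apply: le_trans (xiB w0).
have gN y : abd (fun w => g (y + N w)).
 by have := abd_ucb (ucb_shift y hg) mN; congr abd; apply/funext => w; rewrite addrC.
pose gam (y : V) := Ex (fun w' => g (y + N w')).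
have gamM y : `|gam y| <= M.
 by apply: Ex_bnd => //; apply: aeW => w; exact: gM.
have gamu : forall e : R, 0 < e -> exists2 dl : R, 0 < dl &
  forall x y : V, `|x - y| <= dl -> `|gam x - gam y| <= e /\
   forall z, `|g (x + z) - g (y + z)| <= e.
 move=> e e0; have [dl dl0 h] := hu e e0; exists dl => // x y xy.
 have h' z : `|g (x + z) - g (y + z)| <= e.
  by apply: h; rewrite opprD addrACA subrr addr0.
 split => //; rewrite -ExB//; apply: Ex_bnd; first exact: abdB.
 by apply: aeW => w; exact: h'.
have ucbgam : ucb gam.
 split; first by exists M.
 by move=> e /gamu[dl dl0 h]; exists dl => // x y /h[].
have axi' : abd xi by exact: abd_bnd xiB.
have aYN : abd (fun w => g (Y w + N w)) by apply: abd_ucb => //; exact: vmeasD.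
have agY : abd (fun w => gam (Y w)) by exact: abd_ucb.
apply/eqP; rewrite -subr_eq0 -normr_le0; apply/ler_gtP => eta eta0.
(* Three errors: [M] multiplies the error of [xi], [B] the change of [g] when [Y] moves, and
   [4 * B * M] covers the exceptional set, of probability at most [2 * e], where the integrands
   differ by at most [2 * (B * M)]. *)
pose K := M + B + 4 * B * M + 1.
have K0 : 0 < K by rewrite /K; nra.
pose e1 := eta / 2 / K.
have e10 : 0 < e1 by rewrite !divr_gt0.
have [dl dl0 hdl] := gamu _ e10.
pose e := Num.min dl e1.
have e0 : 0 < e by rewrite lt_min dl0.
have [I [A [y [hA dA pA]]]] := aY _ e0.
have [J [C [x [hC dC pC]]]] := axi _ e0.
(* The values [x j] that approximate [xi] may exceed [B]. Clipping keeps the simple approximation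
   bounded and does not move it away from [xi]. *)
pose cl (t : R) := Num.max (- B) (Num.min B t).
have clB t : `|cl t| <= B.
 rewrite ler_norml le_max lexx ge_max ge_min lexx andbT.
 lra.
have clD (t s : R) : `|t| <= B -> `|t - cl s| <= `|t - s|.
 rewrite ler_norml => /andP[t1 t2]; rewrite /cl.
 case: (leP B s) => Bs.
  rewrite max_r; last by lra.
  by rewrite !ler0_norm; lra.
 case: (leP (- B) s) => // sB; rewrite !ger0_norm; lra.
pose D (ij : I * J) := A ij.1 `&` C ij.2.
have DA ij : Acl (D ij) by exact: AI.
have mD ij : measurable (D ij) by exact/Am.
pose bad := ~` [set w | exists2 i, A i w & `|Y w - y i| <= e] `|`
 ~` [set w | exists2 j, C j w & `|(xi w : R^o) - x j| <= e].
have mbad : measurable bad.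
 by apply: measurableU; apply: (measurable_bad Am) => //; exact: fun_vmeas.
have pbad : pr bad <= e + e.
 apply: (le_trans _ (lerD pA pC)); apply: pr_leU => //.
  exact: (measurable_bad Am).
 by apply: (measurable_bad Am) => //; exact: fun_vmeas.
(* Simple-function version of [xi * G(Y)]. It is formed for [g (y + N)] and for its mean [gam y]:
   independence on each cell gives both the same expectation ([SS]), and [key] compares each with
   the true integrand. *)
pose S (G : Omega -> V -> R) w := \sum_ij \1_(D ij) w * (cl (x ij.2) * G w (y ij.1)).
have aS G : (forall y, abd (fun w => G w y)) -> abd (S G).
 by move=> aG; apply: abd_sum => ij _; apply: abdM; [exact: abd_indic|exact: abdZ].
have SE G w ij : D ij w -> S G w = cl (x ij.2) * G w (y ij.1).
 move=> Dw; rewrite /S (bigD1 ij)//= big1 => [|kl kij].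
  by rewrite addr0 indicE mem_set// mul1r.
 rewrite indicE memNset ?mul0r// => Dkl; move/eqP: kij; apply.
 case: kl ij Dkl Dw => k l [i j] [/= a b] [a' b'].
 by rewrite (dA _ _ _ a a') (dC _ _ _ b b').
have S0 G w : ~ (exists ij, D ij w) -> S G w = 0.
 move=> nD; rewrite /S big1// => ij _; rewrite indicE memNset ?mul0r// => Dw.
 by apply: nD; exists ij.
have key (G : Omega -> V -> R) : (forall y, abd (fun w => G w y)) ->
  abd (fun w => G w (Y w)) -> (forall w y, `|G w y| <= M) ->
  (forall w a b, `|a - b| <= dl -> `|G w a - G w b| <= e1) ->
  `|Ex (fun w => xi w * G w (Y w)) - Ex (S G)| <= eta / 2.
 move=> aG aGY GM Gu.
 have aXG : abd (fun w => xi w * G w (Y w)) by exact: abdM.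
 have SB w : `|S G w| <= B * M.
  have [[ij /SE->]|/S0->] := pselect (exists ij, D ij w).
   by rewrite normrM ler_pM.
  by rewrite normr0 mulr_ge0.
 rewrite -ExB//; last exact: aS.
 apply: (le_trans (Ex_norm (abdB aXG (aS _ aG)))).
 apply: (@le_trans _ _ ((e1 * M + B * e1) + (2 * (B * M)) * pr bad)).
  apply: Ex_split => //.
  - by apply/abd_normr/abdB => //; exact: aS.
  - by rewrite mulr_ge0// mulr_ge0.
  - move=> w /not_orP[/contrapT[i Ai hi] /contrapT[j Cj hj]].
   rewrite (SE _ _ (i, j))//=.
   have -> : xi w * G w (Y w) - cl (x j) * G w (y i) =
    (xi w - cl (x j)) * G w (Y w) + cl (x j) * (G w (Y w) - G w (y i)).
    by ring.
   rewrite (le_trans (ler_normD _ _))// !normrM lerD// ler_pM//.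
    by rewrite (le_trans (clD _ _ _))// (le_trans hj)// ge_min lexx orbT.
   by apply: Gu; rewrite (le_trans hi)// ge_min lexx.
  - move=> w _; rewrite (le_trans (ler_normB _ _))//.
   have : `|xi w * G w (Y w)| <= B * M by rewrite normrM ler_pM.
   have := SB w; have := mulr_ge0 (ltW e10) M0; have := mulr_ge0 B0 (ltW e10).
   lra.
 have : (2 * (B * M)) * pr bad <= 2 * (B * M) * (e1 + e1).
  apply: ler_wpM2l; first by rewrite mulr_ge0// mulr_ge0.
  have : e <= e1 by rewrite ge_min lexx orbT.
  lra.
 have : e1 * (M + B + 4 * B * M) <= eta / 2.
  rewrite mulrC; apply: mul_div_le => //; last by lra.
   by rewrite !addr_ge0// mulr_ge0// mulr_ge0.
  by rewrite /K; lra.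
 lra.
have SS : Ex (S (fun w y => g (y + N w))) = Ex (S (fun _ y => gam y)).
 rewrite !Ex_sum => [|ij _|ij _]; last 2 first.
 - by apply: abdM; [exact: abd_indic|apply: abdZ; exact: abd_cst].
 - by apply: abdM; [exact: abd_indic|exact: abdZ].
 apply: eq_bigr => ij _.
 transitivity (cl (x ij.2) * Ex (fun w => \1_(D ij) w * g (y ij.1 + N w))).
  rewrite -ExZ; last by apply: abdM => //; exact: abd_indic.
  by congr Ex; apply/funext => w; rewrite mulrCA.
 transitivity ((cl (x ij.2) * gam (y ij.1)) * Ex (\1_(D ij))); last first.
  rewrite -ExZ; last exact: abd_indic.
  by congr Ex; apply/funext => w; rewrite mulrC.
 rewrite Ex_indic// -mulrA; congr *%R; rewrite mulrC.
 rewrite -(iN _ (fun z => g (y ij.1 + z))) => //.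
 have := ucb_shift (y ij.1) hg; congr ucb; apply/funext => z; by rewrite addrC.
have k1 := key (fun w y => g (y + N w)) gN aYN.
have k2 := key (fun _ y => gam y) (fun y => abd_cst _ _) agY.
have {}k1 : `|Ex (fun w => xi w * g (Y w + N w)) -
  Ex (S (fun w y => g (y + N w)))| <= eta / 2.
 by apply: k1 => [w u|w a b /hdl[_ h]]; [exact: gM|exact: h].
have {}k2 : `|Ex (fun w => xi w * gam (Y w)) - Ex (S (fun _ y => gam y))| <= eta / 2.
 by apply: k2 => // w a b /hdl[].
rewrite SS in k1.
rewrite -(subrKA (Ex (S (fun _ y => gam y)))) (le_trans (ler_normD _ _))//.
move: k2; rewrite distrC => k2; rewrite -/gam; lra.
Qed.

(** Dimension-free Harnack inequality with power 2. For a Gaussian [Y] and a shift in its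
    Cameron-Martin space, the Cauchy-Schwarz inequality yields it with [k] the squared
    Cameron-Martin norm of [h]. Unlike a density of the shifted law, it survives limits in
    probability ([Harn_lim]). *)
Definition Harn V (Y : Omega -> V) (h : V) (k : R) := forall f : V -> R,
 ucb f -> (forall x, 0 <= f x) ->
 Ex (fun w => f (Y w + h)) ^+ 2 <= expR k * Ex (fun w => f (Y w) ^+ 2).

(** Integrating [N] out leaves a function [gam] of [Y] alone, to which the inequality of [Y]
    applies; the inequality of [N] is then used at each frozen value of [Y]. Costs add, as squared
    Cameron-Martin norms of independent components do. *)
Lemma Harn_add Acl V (Y N : Omega -> V) h1 h2 k1 k2 :
 Acl `<=` measurable -> setI_closed Acl -> Acl setT -> sepa V -> sepa R^o ->
 vmeas N -> indep Acl N -> vmeas Y -> apx Acl Y ->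
 Harn Y h1 k1 -> Harn N h2 k2 ->
 Harn (fun w => Y w + N w) (h1 + h2) (k1 + k2).
Proof.
move=> Am AI AT sV sR mN iN mY aY H1 H2 f hf f0.
have fr (g : V -> R) : ucb g -> Ex (fun w => g (Y w + N w)) =
  Ex (fun w => Ex (fun w' => g (Y w + N w'))).
 move=> hg; have := @freeze Acl V N Y (fun=> 1) g 1 Am AI sV sR mN iN mY aY.
 have -> : Ex (fun w => 1 * g (Y w + N w)) = Ex (fun w => g (Y w + N w)).
  by congr Ex; apply/funext => w; rewrite mul1r.
 have -> : Ex (fun w => 1 * Ex (fun w' => g (Y w + N w'))) =
   Ex (fun w => Ex (fun w' => g (Y w + N w'))).
  by congr Ex; apply/funext => w; rewrite mul1r.
 by apply => //; [move=> w; rewrite normr1|exact: apx_cst].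
have ucbE (g : V -> R) c : ucb g -> ucb (fun y => Ex (fun w' => g (y + N w' + c))).
 move=> hg; have [[L gL] hg'] := hg.
 have ag y : abd (fun w => g (y + N w + c)).
  have := abd_ucb (ucb_shift (y + c) hg) mN; congr abd; apply/funext => w.
  by rewrite addrCA addrA.
 split; first by exists L => y; apply: Ex_bnd => //; apply: aeW => w; exact: gL.
 move=> e /hg'[dl dl0 h]; exists dl => // x y xy; rewrite -ExB//.
 apply: Ex_bnd; first exact: abdB.
 apply: aeW => w; apply: h; suff -> : x + N w + c - (y + N w + c) = x - y by [].
 by rewrite opprD addrACA subrr addr0 opprD addrACA subrr addr0.
pose gam y := Ex (fun w' => f (y + N w' + h2)).
have -> : Ex (fun w => f (Y w + N w + (h1 + h2))) = Ex (fun w => gam (Y w + h1)).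
 rewrite (fr _ (ucb_shift (h1 + h2) hf)); congr Ex; apply/funext => w.
 congr Ex; apply/funext => w'; congr f.
 by rewrite -!addrA; congr (_ + _); rewrite addrCA.
have hgam : ucb gam by exact: ucbE.
apply: (le_trans (H1 gam hgam _)); first by move=> y; exact: Ex_ge0.
rewrite expRD -mulrA ler_wpM2l//.
rewrite (fr _ (ucbX2 hf)) -ExZ; last first.
 have := ucbE _ 0 (ucbX2 hf) => hq.
 have := abd_ucb hq mY; congr abd; apply/funext => w.
 by congr Ex; apply/funext => w'; rewrite addr0.
apply: Ex_le.
- by apply: abdX; exact: abd_ucb.
- apply: abdZ; have := abd_ucb (ucbE _ 0 (ucbX2 hf)) mY; congr abd.
 by apply/funext => w; congr Ex; apply/funext => w'; rewrite addr0.
- move=> w; have hs : ucb (fun x => f (Y w + x)).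
  have := ucb_shift (Y w) hf; congr ucb; apply/funext => x; by rewrite addrC.
 have := H2 _ hs (fun x => f0 _); congr (_ ^+ 2 <= _).
 by congr Ex; apply/funext => w'; rewrite addrA.
Qed.

Lemma Harn_lim V (Y : Omega -> V) h k : sepa V -> vmeas Y ->
 (forall e : R, 0 < e -> exists Z h' k', [/\ vmeas Z, Harn Z h' k', k' <= k,
   `|h - h'| <= e & pr (far e Y Z) <= e]) ->
 Harn Y h k.
Proof.
move=> sV mY H f hf f0; apply/ler_addgt0Pr => eta eta0.
have [[M fM] hu] := hf.
have M0 : 0 <= M by apply: le_trans (fM 0).
(* The left side is a square: expectations bounded by [M] that differ by at most [2 * et] have
   squares that differ by at most [2 * et * (2 * M)]. The right side contributes [expR k]. *)
pose C := expR k + 2 * M * 2 + 1.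
have C0 : 0 < C by rewrite /C; have := expR_ge0 k; nra.
pose et := eta / C.
have et0 : 0 < et by rewrite divr_gt0.
have [e1 e10 h1] := ucb_far_Ex sV (ucb_shift h hf) et0.
have [e2 e20 h2] := ucb_far_Ex sV (ucbX2 hf) et0.
have [dl dl0 h3] := hu _ et0.
pose e := Num.min e1 (Num.min e2 dl).
have e0 : 0 < e by rewrite !lt_min e10 e20.
have [Z [h' [k' [mZ HZ k'k hh' pZ]]]] := H _ e0.
have mF c : e <= c -> pr (far c Y Z) <= c.
 move=> ec; apply: (le_trans _ (le_trans pZ ec)); apply: pr_le.
 - exact: measurable_far.
 - exact: measurable_far.
 - by move=> w; rewrite /far; exact: le_lt_trans.
have {}h1 := h1 _ _ mY mZ (mF _ _).
have e1e : e <= e1 by rewrite ge_min lexx.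
have {}h2 := h2 _ _ mY mZ (mF _ _).
have e2e : e <= e2 by rewrite !ge_min lexx orbT.
have {}h2 := h2 e2e.
have edl : e <= dl by rewrite !ge_min lexx !orbT.
have aZ c : abd (fun w => f (Z w + c)) by exact: abd_ucb (ucb_shift c hf) mZ.
have h4 : `|Ex (fun w => f (Z w + h)) - Ex (fun w => f (Z w + h'))| <= et.
 rewrite -ExB//; apply: Ex_bnd; first exact: abdB.
 apply: aeW => w; apply: h3; rewrite opprD addrACA subrr add0r.
 exact: le_trans edl.
have := HZ f hf f0.
set p := Ex (fun w => f (Y w + h)) in h1 *.
set q := Ex (fun w => f (Y w) ^+ 2) in h2 *.
set q' := Ex (fun w => f (Z w) ^+ 2) in h2 *.
set p1 := Ex (fun w => f (Z w + h)) in h1 h4 *.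
set p' := Ex (fun w => f (Z w + h')) in h4 *.
move=> hp'.
have pM : `|p| <= M by exact: Ex_ucb_bnd (ucb_shift h hf) (fun x => fM _) mY.
have p'M : `|p'| <= M by exact: Ex_ucb_bnd (ucb_shift h' hf) (fun x => fM _) mZ.
have q'0 : 0 <= q' by apply: Ex_ge0 => w; exact: sqr_ge0.
have ek : expR k' * q' <= expR k * q' by rewrite ler_wpM2r// ler_expR.
have k0 := expR_gt0 k.
have s1 : p ^+ 2 - p' ^+ 2 <= 2 * et * (2 * M).
 rewrite subr_sqr; apply: (le_trans (ler_norm _)); rewrite normrM.
 apply: ler_pM => //.
  rewrite -(subrKA p1) (le_trans (ler_normD _ _))//; lra.
 rewrite (le_trans (ler_normD _ _))//; lra.
have s2 : expR k * q' <= expR k * q + expR k * et.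
 rewrite -mulrDr ler_wpM2l//.
 by move: h2; rewrite ler_norml => /andP[]; lra.
have s3 : et * (expR k + 2 * M * 2) <= eta.
 by rewrite mulrC; apply: mul_div_le; rewrite /C//; nra.
lra.
Qed.

Lemma expR_le_quad (x : R) : 0 <= x -> x <= 1 / 2 -> expR x <= 1 + 2 * x.
Proof.
move=> x0 x1; have h : 1 - x <= expR (- x) by have := expR_ge1Dx (- x).
have e0 := expR_gt0 x.
rewrite expRN in h.
have : (1 - x) * expR x <= 1.
 by rewrite -ler_pdivlMr// mul1r.
nra.
Qed.

(* Apply Harnack to M + k f, nonnegative since k <= 1, and expand in k. *)
Lemma Harn_tv V (Y : Omega -> V) h (k : R) f (M : R) : vmeas Y -> 0 < k ->
 Harn Y h (k ^+ 2) -> ucb f -> (forall x, `|f x| <= M) ->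
 `|Ex (fun w => f (Y w + h)) - Ex (fun w => f (Y w))| <= 5 * k * M.
Proof.
move=> mY k0 H.
suff main (g : V -> R) : ucb g -> (forall x, `|g x| <= M) ->
  Ex (fun w => g (Y w + h)) - Ex (fun w => g (Y w)) <= 5 * k * M.
 move=> hf fM; rewrite ler_norml main// andbT.
 have := main (fun x => 0 - f x) (ucbB (ucb_cst V 0) hf).
 have a1 := abd_ucb (ucb_shift h hf) mY; have a2 := abd_ucb hf mY.
 have a0 := abd_cst P 0.
 rewrite (ExB a0 a1) (ExB a0 a2) => main'.
 have /main' : forall x, `|0 - f x| <= M by move=> x; rewrite sub0r normrN.
 lra.
move=> hg gM.
have M0 : 0 <= M by apply: le_trans (gM 0).
have b1 := Ex_ucb_bnd (ucb_shift h hg) (fun x => gM _) mY.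
have b2 := Ex_ucb_bnd hg gM mY.
(* A variation of [2 * M] is trivial, which settles [k >= 2 / 5]. Below that value
   [k ^+ 2 <= 1 / 2], so that [expR_le_quad] applies. *)
have [k5|k5] := leP (2 / 5) k.
 move: b1 b2; rewrite !ler_norml => /andP[_ b1] /andP[b2 _].
 nra.
have [M00|M1] := eqVneq M 0.
 move: b1 b2; rewrite M00 !normr_le0 => /eqP-> /eqP->; lra.
have {M1}M1 : 0 < M by rewrite lt_neqAle eq_sym M1.
have hF : ucb (fun x => M + k * g x) by apply: ucbD; [exact: ucb_cst|exact: ucbZ].
have F0 x : 0 <= M + k * g x.
 have := gM x; rewrite ler_norml => /andP[]; nra.
have := H _ hF F0.
set p := Ex (fun w => g (Y w + h)) in b1 *.
set q := Ex (fun w => g (Y w)) in b2 *.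
have ag := abd_ucb hg mY.
have -> : Ex (fun w => M + k * g (Y w + h)) = M + k * p.
 rewrite ExD; [|exact: abd_cst|by apply: abdZ; exact: abd_ucb (ucb_shift h hg) mY].
 by rewrite ExZ ?Ex_cst//; exact: abd_ucb (ucb_shift h hg) mY.
have s1 : Ex (fun w => (M + k * g (Y w)) ^+ 2) <= M ^+ 2 + k ^+ 2 * M ^+ 2 + 2 * M * k * q.
 apply: (@le_trans _ _ (Ex (fun w => (M ^+ 2 + k ^+ 2 * M ^+ 2) + (2 * M * k) * g (Y w)))).
  apply: Ex_le.
  - exact: abd_ucb (ucbX2 hF) mY.
  - by apply: abdD; [exact: abd_cst|exact: abdZ].
  - move=> w; have : g (Y w) ^+ 2 <= M ^+ 2.
    by rewrite -real_normK ?num_real// lerXn2r//.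
   have := sqr_ge0 k; nra.
 rewrite ExD; [|exact: abd_cst|exact: abdZ].
 by rewrite ExZ// Ex_cst.
have k2 : expR (k ^+ 2) <= 1 + 2 * k ^+ 2 by apply: expR_le_quad; nra.
set E2 := Ex (fun w => (M + k * g (Y w)) ^+ 2) in s1 *.
have E20 : 0 <= E2 by apply: Ex_ge0 => w; exact: sqr_ge0.
move: b1 b2; rewrite !ler_norml => /andP[b1 b1'] /andP[b2 b2'].
move=> hh.
have {}hh : (M + k * p) ^+ 2 <= (1 + 2 * k ^+ 2) * (M ^+ 2 + k ^+ 2 * M ^+ 2 + 2 * M * k * q).
 apply: (le_trans hh); apply: (@le_trans _ _ ((1 + 2 * k ^+ 2) * E2)).
  by rewrite ler_wpM2r.
 rewrite ler_wpM2l//; have := sqr_ge0 k; lra.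
have h5 : 2 * M * k * (p - q) <= M ^+ 2 * (k ^+ 2 + 2 * k ^+ 2 * (1 + k ^+ 2 + 2 * k)).
 have : k * q <= k * M by rewrite ler_wpM2l// ltW.
 nra.
have h6 : 2 * (p - q) <= M * (k + 2 * k * (1 + k ^+ 2 + 2 * k)).
 rewrite -(ler_pM2l (mulr_gt0 M1 k0)).
 by move: h5; congr (_ <= _); ring.
nra.
Qed.
End approximation.

(** * One-dimensional Gaussian variables: second moment and Harnack inequality *)

Section density.
Context d (T : measurableType d) (R : realType) (mu nu : {measure set T -> \bar R}) (g : T -> R)
 (mg : measurable_fun setT g) (g0 : forall x, 0 <= g x)
 (nuE : forall A, measurable A -> nu A = (\int[mu]_(x in A) (g x)%:E)%E).

Import HBNNSimple.

Lemma ge0_integral_density (f : T -> \bar R) : measurable_fun setT f ->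
 (forall x, 0 <= f x)%E ->
 (\int[nu]_x f x = \int[mu]_x (f x * (g x)%:E))%E.
Proof.
move=> mf f0; pose h := nnsfun_approx measurableT mf.
have hf x : EFin \o h^~ x @ \oo --> f x by exact: cvg_nnsfun_approx.
have step n : (\int[nu]_x (h n x)%:E = \int[mu]_x ((h n x)%:E * (g x)%:E))%E.
 have hE x : (h n x)%:E = (\sum_(y \in range (h n)) (y * \1_(h n @^-1` [set y]) x)%:E)%E.
  by rewrite fsumEFin// -fimfunE.
 transitivity (\sum_(y \in range (h n)) (y%:E * nu (h n @^-1` [set y])))%E.
  by rewrite integralT_nnsfun sintegralE.
 transitivity (\int[mu]_x (\sum_(y \in range (h n))
   ((y * \1_(h n @^-1` [set y]) x)%:E * (g x)%:E)))%E; last first.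
  apply: eq_integral => x _; rewrite [in RHS]hE ge0_mule_fsuml// => y.
  exact: nnfun_muleindic_ge0.
 rewrite ge0_integral_fsum//; last 2 first.
 - move=> y; rewrite (_ : (fun x => _) =
   EFin \o (fun x => (y * \1_(h n @^-1` [set y]) x) * g x)); last first.
   by [].
  by apply/measurable_EFinP; apply: measurable_funM => //; exact: measurable_funM.
 - by move=> y x _; rewrite EFinM mule_ge0 ?nnfun_muleindic_ge0 ?lee_fin.
 apply: eq_fsbigr => y yh; have y0 : 0 <= y by move: yh; rewrite inE => -[x _ <-].
 rewrite nuE// integral_mkcond -ge0_integralZl//; last 2 first.
 - apply/(measurable_restrictT (fun x => (g x)%:E) (measurable_funPTI (h n) (measurable_set1 y))).
  by apply/measurable_EFinP; exact: measurable_funS mg.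
 - by move=> x _; rewrite erestrict_ge0// => z _; rewrite lee_fin.
 apply: eq_integral => x _; rewrite EFinM -muleA; congr (_ * _)%E.
 rewrite patchE indicE; case: ifPn => _; by rewrite ?mul1e ?mul0e.
have nd x : {homo h^~ x : m n / (m <= n)%N >-> m <= n}.
 by move=> m n mn; exact/lefP/nd_nnsfun_approx.
transitivity (limn (fun n => \int[nu]_x (h n x)%:E))%E.
 rewrite -monotone_convergence//.
 - by apply: eq_integral => x _; apply/esym/cvg_lim => //; exact: hf.
 - by move=> n; apply/measurable_EFinP.
 - by move=> n x _; rewrite lee_fin.
 - by move=> x _ m n mn; rewrite lee_fin nd.
under eq_fun do rewrite step.
rewrite -monotone_convergence//.
- apply: eq_integral => x _; apply/cvg_lim => //.
 by apply: cvgeZr => //; exact: hf.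
- move=> n; under eq_fun do rewrite -EFinM.
 by apply/measurable_EFinP; exact: measurable_funM.
- by move=> n x _; rewrite mule_ge0// lee_fin.
- by move=> x _ m n mn; rewrite -!EFinM lee_fin ler_wpM2r// nd.
Qed.
End density.

Lemma normal_pdf_scale (R : realType) (s x : R) : 0 < s ->
 (s * x) ^+ 2 * normal_pdf 0 s (s * x) * s = s ^+ 2 * (x ^+ 2 * normal_pdf 0 1 x).
Proof.
move=> s0; rewrite /normal_pdf oner_eq0 gt_eqF// /normal_peak /normal_fun !subr0.
rewrite exprMn expr1n.
have -> : s ^+ 2 * pi *+ 2 = s ^+ 2 * (1 * pi *+ 2) by lra.
rewrite sqrtrM ?sqr_ge0// sqrtr_sqr gtr0_norm// invfM.
have -> : - (s ^+ 2 * x ^+ 2) / (s ^+ 2 *+ 2) = - x ^+ 2 / 2.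
 by rewrite -mulrN -[s ^+ 2 *+ 2]mulr_natr -mulf_div divff ?mul1r// sqrf_eq0 gt_eqF.
have : s^-1 * s = 1 by rewrite mulVf// gt_eqF.
set a := (Num.sqrt _)^-1; set e := expR _; set t := s^-1 => ts.
transitivity (s ^+ 2 * x ^+ 2 * a * e * (t * s)); first by ring.
by rewrite ts; ring.
Qed.

(* x^2 exp(-x^2/2) <= 4 exp(-x^2/4) *)
Lemma sqr_normal_pdf_le (R : realType) (r x : R) : 0 < r -> r ^+ 2 = 2 ->
 x ^+ 2 * normal_pdf 0 1 x <=
 4 * (normal_peak 1 / normal_peak r) * normal_pdf 0 r x.
Proof.
move=> r0 r2.
have p0 (t : R) : 0 < t -> 0 < normal_peak t.
 by move=> t0; apply: normal_peak_gt0; rewrite gt_eqF.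
rewrite /normal_pdf oner_eq0 gt_eqF// /normal_fun !subr0 r2 expr1n.
pose y := - x ^+ 2 / 4; have yE : x ^+ 2 = 4 * - y by rewrite /y; field.
have -> : - x ^+ 2 / (1 *+ 2) = y + y by lra.
have -> : - x ^+ 2 / (2 *+ 2) = y by lra.
rewrite expRD yE; set e := expR y; have e0 : 0 <= e by exact: expR_ge0.
have := p0 1 ltr01; have := p0 r r0; move: (normal_peak 1) (normal_peak r) => p q q0 p0'.
have -> : 4 * (p / q) * (q * e) = 4 * p * e * (q^-1 * q) by ring.
rewrite mulVf ?gt_eqF// mulr1.
have h := expR_ge1Dx (- y); have {}h : - y * e <= 1.
 rewrite -ler_pdivlMr ?expR_gt0// mul1r -expRN; lra.
have -> : 4 * - y * (p * (e * e)) = (- y * e) * (4 * p * e) by ring.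
by rewrite ler_piMl// mulr_ge0// mulr_ge0// ltW.
Qed.

Lemma normal_pdf_shift (R : realType) (a s x : R) :
 0 < s -> normal_pdf a s x = normal_pdf 0 s (x - a).
Proof. by move=> s0; rewrite /normal_pdf gt_eqF// /normal_fun subr0. Qed.

(** Completing the square: [2 (x - a)^2 = x^2 + (x - 2a)^2 - 2a^2]. The square of the shifted
    density becomes a product of two densities, one to weigh the squared function and one of total
    mass 1. *)
Lemma normal_pdf_sqr (R : realType) (a s x : R) : 0 < s ->
 normal_pdf a s x ^+ 2 =
 expR (a ^+ 2 / s ^+ 2) * (normal_pdf 0 s x * normal_pdf (2 * a) s x).
Proof.
move=> s0; rewrite /normal_pdf gt_eqF// /normal_fun subr0.
set p := normal_peak s.
transitivity (p ^+ 2 * (expR (- (x - a) ^+ 2 / (s ^+ 2 *+ 2)) * expR (- (x - a) ^+ 2 / (s ^+ 2 *+ 2)))).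
 by ring.
transitivity (p ^+ 2 * (expR (a ^+ 2 / s ^+ 2) *
 (expR (- x ^+ 2 / (s ^+ 2 *+ 2)) * expR (- (x - 2 * a) ^+ 2 / (s ^+ 2 *+ 2))))); last by ring.
congr (_ * _); rewrite -!expRD; congr expR.
lra.
Qed.

(** The choice [l = B / p] recovers the Cauchy-Schwarz inequality from a family of linear bounds,
    and linear bounds can be integrated term by term. *)
Lemma amgm_opt (R : realFieldType) (p A B : R) : 0 <= p -> 0 <= A -> 0 < B ->
 (forall l, 0 < l -> 2 * p <= l * A + l^-1 * B) -> p ^+ 2 <= B * A.
Proof.
move=> p0 A0 B0 h; have [->|pn0] := eqVneq p 0.
 by rewrite expr0n mulr_ge0// ltW.
have {p0}pn0 : 0 < p by lra.
have := h _ (divr_gt0 B0 pn0).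
rewrite invf_div -mulrA [p / B * B]divfK ?gt_eqF// => {}h.
have {h} : p <= B * (p^-1 * A) by lra.
by rewrite mulrCA mulrC ler_pdivlMr// expr2.
Qed.

Lemma amgm_density (R : realFieldType) (l e f p0 p1 p2 : R) : 0 < l -> 0 < e ->
 0 <= f -> 0 <= p2 -> 0 <= p0 -> 0 <= p1 -> p1 ^+ 2 = e * (p0 * p2) ->
 2 * (f * p1) <= l * (f ^+ 2 * p0) + l^-1 * e * p2.
Proof.
move=> l0 e0 f0 p20 p00 p10 h.
have li0 : 0 < l^-1 by rewrite invr_gt0.
have le1 : l * l^-1 = 1 by rewrite divff// gt_eqF.
rewrite -(@ler_pXn2r _ 2)// ?nnegrE; last 2 first.
- by rewrite !mulr_ge0.
- by rewrite addr_ge0// !mulr_ge0//// ltW.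
have -> : (2 * (f * p1)) ^+ 2 = 4 * (l * (f ^+ 2 * p0)) * (l^-1 * e * p2).
 transitivity (4 * f ^+ 2 * p1 ^+ 2); first by ring.
 transitivity (4 * f ^+ 2 * (e * (p0 * p2)) * (l * l^-1)); last by ring.
 by rewrite h le1 mulr1.
move: (l * _) (l^-1 * _ * _) => A B.
have := sqr_ge0 (A - B); nra.
Qed.

Section gaussian.
Context (R : realType) d (Omega : measurableType d) (P : probability Omega R)
 (xi : Omega -> measurableTypeR R) (s : R) (mxi : measurable_fun setT xi) (s0 : 0 < s)
 (lawxi : forall B, measurable B -> P (xi @^-1` B) = normal_prob 0 s B).

Notation leb := (@lebesgue_measure R).

Lemma ge0_integral_gauss (f : R -> R) : measurable_fun setT f ->
 (forall x, 0 <= f x) ->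
 (\int[P]_w (f (xi w))%:E = \int[leb]_x (f x * normal_pdf 0 s x)%:E)%E.
Proof.
move=> mf f0.
have mEf : measurable_fun setT (EFin \o f) by exact/measurable_EFinP.
pose pf := measure_function_pushforward__canonical__measure_function_Measure P mxi.
transitivity (\int[pf]_x (f x)%:E)%E.
 by rewrite ge0_integral_pushforward// => x _; rewrite lee_fin.
transitivity (\int[normal_prob 0 s]_x (f x)%:E)%E.
 exact: (@eq_measure_integral _ (measurableTypeR R) R setT (normal_prob 0 s) pf
  (fun x => (f x)%:E) (fun A mA _ => lawxi mA)).
rewrite (@ge0_integral_density _ _ _ leb (normal_prob 0 s) (normal_pdf 0 s))//.
- exact: measurable_normal_pdf.
- by move=> x; exact: normal_pdf_ge0.
Qed.

Lemma integral_affine (f : R -> R) (a b : R) : 0 < a -> continuous f ->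
 (forall x, 0 <= f x) ->
 (\int[leb]_x (f x)%:E = \int[leb]_x (f (a * x + b) * a)%:E)%E.
Proof.
move=> a0 cf f0; pose F (x : R^o) : R^o := a * x + b.
have dF (x : R^o) : is_derive x 1 F a.
 rewrite /F; apply: is_derive_eq.
 by rewrite addr0 /GRing.scale/= mulr1.
have F'E : F^`()%classic = cst a.
 by apply/funext => x; rewrite derive1E; exact: derive_val.
rewrite (@increasing_ge0_integration_by_substitutionT R F f) ?F'E//.
- by move=> x y xy; rewrite ltrD2r ltr_pM2l.
- by move=> x; exact: cvg_cst.
- exact: is_cvg_cst.
- exact: is_cvg_cst.
- by apply: cvg_comp (cvg_addrr_Ny b); exact: gt0_cvgMrNy.
- by apply: cvg_comp (cvg_addrr b); exact: gt0_cvgMry.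
Qed.

(** The second moment of the standard normal law stays unevaluated: its finiteness suffices, and
    this number becomes the constant [c] of the isometry of the Wiener integral. *)
Lemma gauss_second_moment :
 (\int[P]_w (xi w ^+ 2)%:E =
  (s ^+ 2)%:E * \int[leb]_x (x ^+ 2 * normal_pdf 0 1 x)%:E)%E.
Proof.
have cX2 : continuous (fun x : R => x ^+ 2) by exact: exprn_continuous.
rewrite (@ge0_integral_gauss (fun x => x ^+ 2)); last 2 first.
- exact: continuous_measurable_fun.
- by move=> x; exact: sqr_ge0.
have cf : continuous (fun x : R => x ^+ 2 * normal_pdf 0 s x).
 move=> x; apply: cvgM; first exact: cX2.
 by apply: continuous_normal_pdf; rewrite gt_eqF.
rewrite (integral_affine 0 s0 cf); last first.
 by move=> x; rewrite mulr_ge0 ?sqr_ge0// normal_pdf_ge0.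
rewrite -ge0_integralZl//; last 3 first.
- apply/measurable_EFinP; apply: measurable_funM; last exact: measurable_normal_pdf.
 exact: continuous_measurable_fun.
- by move=> x _; rewrite lee_fin mulr_ge0 ?sqr_ge0// normal_pdf_ge0.
- by rewrite lee_fin sqr_ge0.
apply: eq_integral => x _; rewrite addr0 -EFinM; congr EFin.
exact: normal_pdf_scale.
Qed.

Lemma second_moment_fin :
 (\int[leb]_x (x ^+ 2 * normal_pdf 0 1 x)%:E < +oo)%E.
Proof.
pose r : R := Num.sqrt 2; have r2 : r ^+ 2 = 2 by rewrite sqr_sqrtr.
have r0 : 0 < r by rewrite sqrtr_gt0.
pose K := 4 * (normal_peak 1 / normal_peak r) : R.
have K0 : 0 <= K by rewrite mulr_ge0// divr_ge0// normal_peak_ge0.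
apply: (@le_lt_trans _ _ (\int[leb]_x (K%:E * (normal_pdf 0 r x)%:E))%E).
 apply: ge0_le_integral => //.
 - by move=> x _; rewrite lee_fin mulr_ge0 ?sqr_ge0// normal_pdf_ge0.
 - by apply/measurable_EFinP; apply: measurable_funM => //; exact: measurable_normal_pdf.
 - by apply: emeasurable_funM => //; apply/measurable_EFinP; exact: measurable_normal_pdf.
 - by move=> x _; rewrite -EFinM lee_fin; exact: sqr_normal_pdf_le.
rewrite ge0_integralZl//.
- by rewrite integral_normal_pdf mule1 ltry.
- by apply/measurable_EFinP; exact: measurable_normal_pdf.
- by move=> x _; rewrite lee_fin normal_pdf_ge0.
Qed.

(* AM-GM: 2 f(x + a) p(x) <= l f^2 p + l^-1 e^(a^2/s^2) p(. - 2a), p the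
  density, after the shift x -> x - a. *)
Lemma gauss_Harn (V : normedModType R) (v : V) (a : R) :
 Harn P (fun w => (xi w : R) *: v) (a *: v) (a ^+ 2 / s ^+ 2).
Proof.
move=> f hf f0; have [[M fM] _] := hf.
pose fa (b : R) (x : R) := f ((x + b) *: v).
have cfa (b : R) : continuous (fa b : R^o -> R^o).
 move=> x; apply: (@continuous_comp R^o V R^o (fun x => (x + b) *: v) f).
  by apply: cvgZr_tmp => //; apply: cvgD => //; exact: cvg_cst.
 exact: ucb_cont.
have mfa b : measurable_fun setT (fa b : measurableTypeR R -> R) by exact: continuous_measurable_fun (cfa b).
have ab b : abd P (fun w => fa b (xi w)).
 by apply: (@abd_bnd _ _ _ _ _ M) => [|w]; [exact: (measurableT_comp (mfa b) mxi)|exact: fM].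
have -> : Ex P (fun w => f ((xi w : R) *: v + a *: v)) = Ex P (fun w => fa a (xi w)).
 by congr Ex; apply/funext => w; rewrite /fa scalerDl.
have -> : Ex P (fun w => f ((xi w : R) *: v) ^+ 2) = Ex P (fun w => fa 0 (xi w) ^+ 2).
 by congr Ex; apply/funext => w; rewrite /fa addr0.
apply: amgm_opt; [by apply: Ex_ge0 => w; exact: f0|by apply: Ex_ge0 => w; exact: sqr_ge0|exact: expR_gt0|].
move=> l l0; rewrite -lee_fin EFinD [X in (X <= _)%E]EFinM [X in (_ <= X + _)%E]EFinM.
rewrite EFin_Ex// EFin_Ex; last exact: abdX.
rewrite (ge0_integral_gauss (f := fa a)); [|exact: mfa a|by move=> x; exact: f0].
have mfa2 : measurable_fun setT (fun x : measurableTypeR R => fa 0 x ^+ 2).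
 exact: measurable_funX (mfa 0).
rewrite (@ge0_integral_gauss (fun x => fa 0 x ^+ 2)); last 2 first.
- exact: mfa2.
- by move=> x; exact: sqr_ge0.
have mf0 : measurable_fun setT (fun x : measurableTypeR R => f ((x : R) *: v)).
 by have := mfa 0; congr measurable_fun; apply/funext => x; rewrite /fa addr0.
have cpdf b : continuous (normal_pdf b s : R^o -> R^o).
 by apply: continuous_normal_pdf; rewrite gt_eqF.
have mpdf b : measurable_fun setT (normal_pdf b s : measurableTypeR R -> R).
 exact: measurable_normal_pdf.
rewrite (@integral_affine (fun x => fa a x * normal_pdf 0 s x) 1 (- a)) ?ltr01//; last 2 first.
- by move=> x; apply: (cvgM (cfa a x) (cpdf 0 x)).
- by move=> x; rewrite mulr_ge0// ?normal_pdf_ge0//; exact: f0.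
under eq_integral => x _.
 rewrite mul1r mulr1 /fa subrK -normal_pdf_shift//.
 over.
rewrite -ge0_integralZl//; last 2 first.
- by apply/measurable_EFinP; apply: measurable_funM; [exact: mf0|exact: mpdf].
- by move=> x _; rewrite lee_fin mulr_ge0// normal_pdf_ge0.
rewrite -[X in (_ <= X + _)%E]ge0_integralZl; last 4 first.
- exact: measurableT.
- by apply/measurable_EFinP; apply: measurable_funM; [exact: mfa2|exact: mpdf].
- by move=> x _; rewrite lee_fin mulr_ge0 ?sqr_ge0// normal_pdf_ge0.
- by rewrite lee_fin ltW.
have -> : (l^-1 * expR (a ^+ 2 / s ^+ 2))%:E =
  (\int[leb]_x ((l^-1 * expR (a ^+ 2 / s ^+ 2))%:E * (normal_pdf (2 * a) s x)%:E))%E.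
 rewrite ge0_integralZl//.
 - by rewrite integral_normal_pdf mule1.
 - by apply/measurable_EFinP; exact: mpdf.
 - by move=> x _; rewrite lee_fin normal_pdf_ge0.
 - by rewrite lee_fin mulr_ge0// invr_ge0 ltW.
have A0 (x : R) : 0 <= fa 0 x ^+ 2 * normal_pdf 0 s x.
 by apply: mulr_ge0; [exact: sqr_ge0|exact: normal_pdf_ge0].
have B0 : 0 <= l^-1 * expR (a ^+ 2 / s ^+ 2).
 by apply: mulr_ge0; [rewrite invr_ge0 ltW|exact: expR_ge0].
have mA : measurable_fun setT (fun x : measurableTypeR R =>
  l%:E * (fa 0 x ^+ 2 * normal_pdf 0 s x)%:E)%E.
 apply: emeasurable_funM => //; apply/measurable_EFinP.
 by apply: measurable_funM; [exact: mfa2|exact: mpdf].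
have mB : measurable_fun setT (fun x : measurableTypeR R =>
  (l^-1 * expR (a ^+ 2 / s ^+ 2))%:E * (normal_pdf (2 * a) s x)%:E)%E.
 by apply: emeasurable_funM => //; apply/measurable_EFinP; exact: mpdf.
rewrite -ge0_integralD; last 5 first.
- exact: measurableT.
- by move=> x _; apply: mule_ge0; rewrite lee_fin; [exact: ltW|exact: A0].
- exact: mA.
- by move=> x _; apply: mule_ge0; rewrite lee_fin; [exact: B0|exact: normal_pdf_ge0].
- exact: mB.
apply: ge0_le_integral.
- exact: measurableT.
- move=> x _; apply: mule_ge0; rewrite lee_fin; first exact: ler0n.
 by apply: mulr_ge0; [exact: f0|exact: normal_pdf_ge0].
- apply: emeasurable_funM => //; apply/measurable_EFinP.
 by apply: measurable_funM; [exact: mf0|exact: mpdf].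
- exact: emeasurable_funD.
- move=> x _; rewrite -!EFinM -EFinD lee_fin /fa addr0.
 have := normal_pdf_sqr a x s0; have := normal_pdf_ge0 a s x.
 have := normal_pdf_ge0 0 s x; have := normal_pdf_ge0 (2 * a) s x.
 have := f0 ((x : R) *: v); have := expR_gt0 (a ^+ 2 / s ^+ 2).
 move=> e0 fx0 q2 q0 q1 hq; exact: amgm_density.
Qed.
End gaussian.

(** * Scalar product, orthonormal expansions and separability of L2 *)

Section hilbert.
Context d (T : measurableType d) (R : realType) (mu : {measure set T -> \bar R}).
Notation U := (L2 mu).
Notation fun2 := (LfunType mu (lee1n 2)).
Implicit Types (u v w : U) (f g : fun2).

Lemma intble2 f g : mu.-integrable setT (fun x => (f x * g x)%:E).
Proof.
have := Lfun2_mul_Lfun1 (LfunP f) (LfunP g).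
by move/Lfun1_integrable.
Qed.

Lemma seminorm2_sqr f : seminorm2 f ^+ 2 = \int[mu]_x (f x * f x).
Proof.
apply: EFin_inj; rewrite fineK; last first.
 by apply: integrable_fin_num => //; exact: intble2.
have := poweR_Lnorm mu (EFin \o f) (r := 2) (ltac:(by rewrite pnatr_eq0)).
rewrite -(finite_norm_fine f) -/(seminorm2 f) poweR_EFin powR_mulrn ?seminorm2_ge0// => ->.
apply: eq_integral => x _ /=.
by rewrite powR_mulrn// -normrX ger0_norm ?sqr_ge0.
Qed.

Lemma L2_class_ae f g : L2_class f = L2_class g -> {ae mu, forall x, f x = g x}.
Proof.
move/L2_classP => /(@fine_Lnormr_eq0 _ _ _ mu _ (lee1n 2) (f - g)).
by apply: filterS => x /= /(_ I) /subr0_eq.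
Qed.

Lemma L2_fun_class f : {ae mu, forall x, L2_fun (L2_class f) x = f x}.
Proof. by apply: L2_class_ae; rewrite L2_reprK. Qed.

Lemma L2_funD u v : {ae mu, forall x, L2_fun (u + v) x = u x + v x}.
Proof.
apply: (@L2_class_ae (L2_repr (u + v)) (L2_repr u + L2_repr v)).
by rewrite L2_reprK L2_classD !L2_reprK.
Qed.

Lemma L2_funZ a u : {ae mu, forall x, L2_fun (a *: u) x = a * u x}.
Proof.
apply: (@L2_class_ae (L2_repr (a *: u)) (a *: L2_repr u)).
by rewrite L2_reprK -L2_scale_class L2_reprK.
Qed.

Lemma L2_measurable u : measurable_fun setT (u : T -> R).
Proof. exact: measurable_funP. Qed.

Lemma dot_intble u v : mu.-integrable setT (fun x => (u x * v x)%:E).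
Proof. exact: intble2. Qed.

Lemma dotC u v : dot u v = dot v u.
Proof. by congr fine; apply: eq_integral => x _; rewrite mulrC. Qed.

Lemma dotDl u v w : dot (u + v) w = dot u w + dot v w.
Proof.
rewrite -RintegralD//; [|exact: dot_intble..].
congr fine; apply: ae_eq_integral => //.
- exact: measurable_int (dot_intble _ _).
- apply: (@measurable_int _ _ _ mu); under eq_fun do rewrite EFinD.
 by apply: integrableD => //; exact: dot_intble.
- by apply: filterS (L2_funD u v) => x -> _; rewrite mulrDl.
Qed.

Lemma dotZl a u w : dot (a *: u) w = a * dot u w.
Proof.
rewrite -RintegralZl//; last exact: dot_intble.
congr fine; apply: ae_eq_integral => //.
- exact: measurable_int (dot_intble _ _).
- apply: (@measurable_int _ _ _ mu); under eq_fun do rewrite EFinM.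
 by apply: integrableZl => //; exact: dot_intble.
- by apply: filterS (L2_funZ a u) => x -> _; rewrite mulrA.
Qed.

Lemma dotDr u v w : dot u (v + w) = dot u v + dot u w.
Proof. by rewrite dotC dotDl !(dotC u). Qed.

Lemma dotZr a u w : dot u (a *: w) = a * dot u w.
Proof. by rewrite dotC dotZl dotC. Qed.

Lemma dotNl u w : dot (- u) w = - dot u w.
Proof. by rewrite -scaleN1r dotZl mulN1r. Qed.

Lemma dotNr u w : dot u (- w) = - dot u w.
Proof. by rewrite dotC dotNl dotC. Qed.

Lemma dotBl u v w : dot (u - v) w = dot u w - dot v w.
Proof. by rewrite dotDl dotNl. Qed.

Lemma dotBr u v w : dot w (u - v) = dot w u - dot w v.
Proof. by rewrite dotDr dotNr. Qed.

Lemma dot0l w : dot 0 w = 0.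
Proof. by rewrite -(scale0r 0) dotZl mul0r. Qed.

Lemma dot0r w : dot w 0 = 0.
Proof. by rewrite dotC dot0l. Qed.

Lemma dot_suml I (r : seq I) (Q : pred I) (F : I -> U) w :
 dot (\sum_(i <- r | Q i) F i) w = \sum_(i <- r | Q i) dot (F i) w.
Proof.
by apply: (big_morph (fun u => dot u w)) => [u v|]; [exact: dotDl|exact: dot0l].
Qed.

Lemma dot_sumr I (r : seq I) (Q : pred I) (F : I -> U) w :
 dot w (\sum_(i <- r | Q i) F i) = \sum_(i <- r | Q i) dot w (F i).
Proof. by rewrite dotC dot_suml; apply: eq_bigr => i _; rewrite dotC. Qed.

Lemma dot_norm u : dot u u = `|u| ^+ 2.
Proof. by rewrite -[`|u|]/(L2_norm u) seminorm2_sqr. Qed.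

Lemma L2_normD_sqr u v : `|u + v| ^+ 2 = `|u| ^+ 2 + 2 * dot u v + `|v| ^+ 2.
Proof. by rewrite -!dot_norm dotDl !dotDr (dotC v u); ring. Qed.

Lemma dot_le u v : `|dot u v| <= `|u| * `|v|.
Proof.
have [->|v0] := eqVneq v 0; first by rewrite dot0r !normr0 mulr0.
have nv : 0 < `|v| by rewrite normr_gt0.
rewrite -(@ler_pXn2r _ 2) ?nnegrE//.
rewrite real_normK ?num_real// exprMn.
have := sqr_ge0 `|(`|v| ^+ 2) *: u - dot u v *: v|.
rewrite L2_normD_sqr dotNr dotZl dotZr normrN !normrZ normr_id.
rewrite [(`|dot u v| * _) ^+ 2]exprMn real_normK ?num_real//.
have -> : (`|v| * `|v| * `|u|) ^+ 2 +
 2 * - (`|v| ^+ 2 * (dot u v * dot u v)) + dot u v ^+ 2 * `|v| ^+ 2 =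
 `|v| ^+ 2 * (`|u| ^+ 2 * `|v| ^+ 2 - dot u v ^+ 2) by ring.
by rewrite pmulr_rge0 ?exprn_gt0// subr_ge0.
Qed.

Lemma dot_continuous w : continuous (fun u => dot u w : R^o).
Proof.
apply: (@lip_continuous R U R^o _ `|w|) => u v.
by rewrite -dotBl mulrC dot_le.
Qed.

Section basis.
Variables (e : nat -> U) (he : orthogonal_basis e).
Notation h n := (unitv e n).

Lemma unitv_norm n : `|h n| = 1.
Proof.
have [e0 _ _] := he; rewrite normrZ normfV normr_id mulVf//.
by rewrite normr_eq0.
Qed.

Lemma dot_unitv i j : dot (h i) (h j) = (i == j)%:R.
Proof.
have [e0 eo _] := he; have [->|ij] := eqVneq i j.
 by rewrite dot_norm unitv_norm expr1n.
by rewrite dotZl dotZr eo ?mulr0.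
Qed.

Definition proj n u := \sum_(i < n) dot u (h i) *: h i.

Lemma dot_span n (c : nat -> R) k :
 dot (\sum_(i < n) c i *: h i) (h k) = if (k < n)%N then c k else 0.
Proof.
rewrite dot_suml; case: ltnP => kn.
 rewrite (bigD1 (Ordinal kn))//= dotZl dot_unitv eqxx mulr1 big1 ?addr0//.
 move=> i; rewrite -val_eqE => /negbTE ik.
 by rewrite dotZl dot_unitv ik mulr0.
rewrite big1// => i _; rewrite dotZl dot_unitv.
by rewrite ltn_eqF ?mulr0// (leq_trans (ltn_ord i)).
Qed.

Lemma norm_span n (c : nat -> R) :
 `|\sum_(i < n) c i *: h i| ^+ 2 = \sum_(i < n) c i ^+ 2.
Proof.
rewrite -dot_norm dot_sumr; apply: eq_bigr => i _.
by rewrite dotZr dot_span ltn_ord expr2.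
Qed.

Lemma proj_cvg u : proj n u @[n --> \oo] --> u.
Proof.
have [_ _ /(_ u)] := he.
rewrite (_ : series _ = fun n => proj n u)//.
by apply/funext => n; rewrite /series/= big_mkord.
Qed.

Lemma norm_proj n u : `|proj n u| ^+ 2 = \sum_(i < n) dot u (h i) ^+ 2.
Proof. exact: (norm_span n (fun k => dot u (h k))). Qed.

Lemma Bessel n u : \sum_(i < n) dot u (h i) ^+ 2 <= `|u| ^+ 2.
Proof.
have := sqr_ge0 `|u - proj n u|.
rewrite L2_normD_sqr normrN dotNr norm_proj dot_sumr.
under eq_bigr do rewrite dotZr -expr2.
lra.
Qed.

Lemma Parseval u : (\sum_(i < n) dot u (h i) ^+ 2 : R^o) @[n --> \oo] --> (`|u| ^+ 2 : R^o).
Proof.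
have : (`|proj n u| : R^o) @[n --> \oo] --> (`|u| : R^o).
 exact: cvg_norm (@proj_cvg u).
move=> /[dup] c1 /(cvgM c1); rewrite -expr2.
rewrite (_ : _ \* _ = fun n => \sum_(i < n) dot u (h i) ^+ 2)//.
by apply/funext => n /=; rewrite -expr2 norm_proj.
Qed.

Lemma norm_le_coef u (K : R) : 0 <= K ->
 (forall n, \sum_(i < n) dot u (h i) ^+ 2 <= K) -> `|u| ^+ 2 <= K.
Proof.
move=> K0 uK; have := @Parseval u => /[dup] /cvg_lim <-//.
by move=> /cvgP c; apply: limr_le => //; near=> n; exact: uK.
Unshelve. all: by end_near. Qed.

Lemma coef_inj u v : (forall n, dot u (h n) = dot v (h n)) -> u = v.
Proof.
move=> uv; apply/eqP; rewrite -subr_eq0 -normr_eq0 -sqrf_eq0 eq_le sqr_ge0 andbT.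
apply: norm_le_coef => // n; rewrite big1// => i _.
by rewrite dotBl uv subrr expr0n.
Qed.

(** The dense sequence consists of the finite rational combinations of the basis, enumerated by
    [unpickle]. *)
Lemma sepa_L2 : sepa U.
Proof.
pose q (n : nat) : U := if unpickle n is Some s then
 \sum_(i < size s) ratr (nth 0 s i) *: h i else 0.
exists q => u eps eps0.
have e2 : 0 < eps / 2 by lra.
have /cvgrPdist_lt /(_ _ e2) [N _ /(_ N (leqnn N))/= hN] := @proj_cvg u.
have d0 : 0 < eps / 2 / N.+1%:R by rewrite divr_gt0.
have hr i : exists r : rat, `|dot u (h i) - ratr r| < eps / 2 / N.+1%:R.
 set a := eps / 2 / _ in d0 *.
 have [r] := @rat_in_itvoo R (dot u (h i) - a) (dot u (h i) + a) ltac:(lra).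
 rewrite in_itv/= => /andP[r1 r2]; exists r; rewrite ltr_norml; lra.
have [r rP] := choice hr.
exists (pickle (mkseq r N)); rewrite /q pickleK size_mkseq.
rewrite -(subrKA (proj N u)) (le_lt_trans (ler_normD _ _))//.
suff : `|proj N u - \sum_(i < N) ratr (nth 0 (mkseq r N) i) *: h i| <= eps / 2 by lra.
rewrite -sumrB (le_trans (ler_norm_sum _ _ _))//.
apply: (@le_trans _ _ (\sum_(i < N) (eps / 2 / N.+1%:R))).
 apply: ler_sum => i _; rewrite -scalerBl normrZ unitv_norm mulr1 nth_mkseq//.
 exact/ltW/rP.
rewrite sumr_const card_ord -[leLHS]mulr_natl.
by apply: mul_div_le; [exact: ler0n|rewrite ler_nat|exact: ltr0n|exact: ltW].
Qed.
End basis.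
End hilbert.

Lemma sepa_prod (R : realType) (V W : normedModType R) : sepa V -> sepa W ->
 @sepa R (V * W)%type.
Proof.
move=> [q hq] [r hr].
exists (fun n => if (unpickle n : option (nat * nat)) is Some ij
         then (q ij.1, r ij.2) else (0, 0)) => x e e0.
have [i hi] := hq x.1 e e0; have [j hj] := hr x.2 e e0.
by exists (pickle (i, j)); rewrite pickleK prod_normE gt_max hi.
Qed.

Lemma sepa_R (R : realType) : @sepa R R^o.
Proof.
exists (fun n => if (unpickle n : option rat) is Some q then ratr q else 0) => x e e0.
have [q] := @rat_in_itvoo R (x - e) (x + e) ltac:(lra).
rewrite in_itv/= => /andP[q1 q2]; exists (pickle q); rewrite pickleK.
rewrite ltr_norml; lra.
Qed.

(** * Completeness of L2 *)

Lemma geometric2_le (R : realType) n : \sum_(0 <= k < n) (2^-1 : R) ^+ k <= 2.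
Proof.
have := @geometric_le_lim R n 1 2^-1 ler01 ltac:(lra).
rewrite ger0_norm// => /(_ ltac:(lra)).
have -> : series (geometric 1 2^-1) n = \sum_(0 <= k < n) (2^-1 : R) ^+ k.
 by apply: eq_bigr => k _; rewrite /geometric/= mul1r.
have -> : 1 - 2^-1 = 2^-1 :> R by lra.
lra.
Qed.

Section L2_complete.
Context d (T : measurableType d) (R : realType) (mu : {finite_measure set T -> \bar R}).
Notation U := (L2 mu).
Implicit Types u v : U.

Lemma L2_of (h : T -> R) : measurable_fun setT h ->
 (\int[mu]_x (h x ^+ 2)%:E < +oo)%E -> exists u : U, {ae mu, forall x, u x = h x}.
Proof.
move=> mh fh; have Lh : h \in Lfun mu 2%:E.
 rewrite inE; apply/andP; split; rewrite inE//= /finite_norm unlock poweR_lty//.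
 rewrite (eq_integral (fun x => (h x ^+ 2)%:E))// => x _ /=.
 by rewrite powR_mulrn// -normrX ger0_norm ?sqr_ge0.
exists (L2_class (Lfun_Sub (lee1n 2) Lh)).
by apply: filterS (L2_fun_class (Lfun_Sub (lee1n 2) Lh)) => x ->; rewrite Lfun_valP.
Qed.

Lemma integral_sqr_sub u v :
 (\int[mu]_x ((u x - v x) ^+ 2)%:E = (`|u - v| ^+ 2)%:E)%E.
Proof.
rewrite -dot_norm fineK; last first.
 by apply: integrable_fin_num => //; exact: dot_intble.
apply: ae_eq_integral => //.
- apply/measurable_EFinP; apply: measurable_funX.
 by apply: measurable_funB; exact: L2_measurable.
- exact: measurable_int (dot_intble _ _).
- have := L2_funD u (- v); have := L2_funZ (-1) v; rewrite scaleN1r.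
 by apply: filterS2 => x e1 -> _; rewrite e1 mulN1r expr2.
Qed.

(** Riesz-Fischer: a subsequence with increments below [2^-k] converges absolutely almost
    everywhere, and Fatou's lemma identifies its pointwise limit as the limit in norm. *)
Lemma L2_complete (v : nat -> U) :
 (forall e : R, 0 < e -> exists N, forall m n, (N <= m)%N -> (N <= n)%N ->
   `|v m - v n| <= e) ->
 exists u, v @ \oo --> u.
Proof.
move=> hv.
have /choice[N hN] k : exists N, forall m n, (N <= m)%N -> (N <= n)%N ->
  `|v m - v n| <= (2^-1 : R) ^+ k by apply: hv; rewrite exprn_gt0.
pose M k := (\sum_(j < k.+1) N j)%N.
have NM k l : (k <= l)%N -> (N k <= M l)%N.
 by move=> kl; rewrite /M (bigD1 (inord k))//= inordK ?leq_addr.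
pose w k := v (M k).
have hw k l : (k <= l)%N -> `|w l - w k| <= (2^-1 : R) ^+ k.
 by move=> kl; apply: hN; apply: NM.
have mw k : measurable_fun setT (w k : T -> R) by exact: L2_measurable.
pose g k (x : T) : R := `|w k.+1 x - w k x|.
have mg k : measurable_fun setT (g k).
 by apply: measurableT_comp => //; exact: measurable_funB.
have g0 k x : 0 <= g k x by exact: normr_ge0.
pose K : R := 1 + fine (mu setT).
have muT : (fine (mu setT))%:E = mu setT by rewrite fineK// fin_num_measure.
have mu0 : 0 <= fine (mu setT) by exact: fine_ge0.
have K0 : 0 <= K by rewrite addr_ge0.
(* On a finite measure the L1 bound follows from the L2 bound through the pointwise inequality
   [g <= 2^k g^2 + 2^-k]. *)
have ig k : (\int[mu]_x (g k x)%:E <= (K * 2^-1 ^+ k)%:E)%E.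
 apply: (@le_trans _ _ (\int[mu]_x ((2 ^+ k)%:E * (((w k.+1 x - w k x) ^+ 2)%:E) +
   (2^-1 ^+ k)%:E))%E).
  apply: ge0_le_integral => //.
  - by move=> x _; rewrite lee_fin normr_ge0.
  - exact/measurable_EFinP.
  - apply: emeasurable_funD => //; apply: emeasurable_funM => //.
   by apply/measurable_EFinP; apply: measurable_funX; exact: measurable_funB.
  - move=> x _; rewrite -EFinM -EFinD lee_fin /g; move: (_ - _) => t.
   have p0 : 0 < 2 ^+ k :> R by rewrite exprn_gt0.
   rewrite exprVn -(ler_pM2l p0) mulrDr divff//.
   have := real_normK (num_real t); have := sqr_ge0 (2 ^+ k * `|t| - 1).
   have := normr_ge0 t; move: (2 ^+ k) p0 (`|t|) => a a0 b; nra.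
 rewrite ge0_integralD//; last 2 first.
 - by move=> x _; rewrite -EFinM lee_fin mulr_ge0 ?sqr_ge0.
 - apply: emeasurable_funM => //; apply/measurable_EFinP.
  by apply: measurable_funX; exact: measurable_funB.
 rewrite ge0_integralZl//; last 2 first.
 - by apply/measurable_EFinP; apply: measurable_funX; exact: measurable_funB.
 - by move=> x _; rewrite lee_fin sqr_ge0.
 rewrite integral_sqr_sub integral_cst//= -muT -!EFinM -EFinD lee_fin mulrDl mul1r.
 rewrite mulrC lerD// ; last by rewrite mulrC.
 have := hw k k.+1 (leqnSn k); set t := `|_ - _| => ht.
 have t0 : 0 <= t by exact: normr_ge0.
 rewrite mulrC; apply: (@le_trans _ _ (2 ^+ k * (2^-1 ^+ k) ^+ 2)).
  by rewrite ler_wpM2l// lerXn2r// nnegrE.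
 by rewrite exprVn expr2 mulrA divff ?mul1r// expf_neq0.
have Sg : (\int[mu]_x (\sum_(0 <= k <oo) (g k x)%:E) < +oo)%E.
 rewrite integral_nneseries; last 3 first.
 - exact: measurableT.
 - by move=> k; exact/measurable_EFinP.
 - by move=> k x _; rewrite lee_fin normr_ge0.
 apply: (@le_lt_trans _ _ (K * 2)%:E); last exact: ltry.
 apply: lime_le; first by apply: is_cvg_nneseries => k _ _; apply: integral_ge0 => x _; rewrite lee_fin g0.
 apply: nearW => n; apply: (@le_trans _ _ (\sum_(0 <= k < n) (K * 2^-1 ^+ k)%:E)%E).
  exact: lee_sum.
 by rewrite sumEFin lee_fin -mulr_sumr ler_wpM2l// geometric2_le.
have cvw : {ae mu, forall x, cvgn (fun k => w k x : R^o)}.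
 have := @integrable_ae _ _ _ mu setT measurableT (fun x => \sum_(0 <= k <oo) (g k x)%:E)%E.
 have mS : measurable_fun setT (fun x => \sum_(0 <= k <oo) (g k x)%:E)%E.
  by apply: ge0_emeasurable_sum => [k x _ _|k _]; [rewrite lee_fin g0|exact/measurable_EFinP].
 move=> /(_ _)/wrap[].
  apply/integrableP; split => //.
  rewrite (eq_integral (fun x => \sum_(0 <= k <oo) (g k x)%:E)%E)// => x _.
  by rewrite gee0_abs// nneseries_ge0// => k _ _; rewrite lee_fin g0.
 apply: filterS => x /(_ I) fx.
 have ub n : \sum_(0 <= k < n) g k x <= fine (\sum_(0 <= k <oo) (g k x)%:E)%E.
  by rewrite -lee_fin fineK// -sumEFin; apply: nneseries_lim_ge => k _; rewrite lee_fin g0.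
 have : cvgn (series (telescope (fun k => w k x : R^o))).
  apply: normed_cvg; apply: nondecreasing_is_cvgn.
   apply/nondecreasing_seqP => n.
   change (\sum_(0 <= k < n) g k x <= \sum_(0 <= k < n.+1) g k x).
   by rewrite big_nat_recr//= lerDl.
  by exists (fine (\sum_(0 <= k <oo) (g k x)%:E)%E) => _ [n _ <-]; exact: ub.
 move=> /(is_cvgD (is_cvg_cst (w 0%N x : R^o))).
 rewrite (_ : _ + _ = fun k => w k x)//.
 by apply/funext => k; exact: (esym (eq_sum_telescope (fun k => w k x : R^o) k)).
(* The upper limit is measurable without knowing where the sequence converges; its value on the
   exceptional null set is irrelevant. *)
pose f x := fine (limn_esup (fun k => (w k x)%:E)).
have mf : measurable_fun setT f.
 apply: measurableT_comp; first exact: fine_measurable.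
 by apply: measurable_fun_limn_esup => k; exact/measurable_EFinP.
have cf : {ae mu, forall x, (w k x : R^o) @[k --> \oo] --> (f x : R^o)}.
 apply: filterS cvw => x /cvg_ex[/= l cl]; rewrite /f.
 have : (w k x)%:E @[k --> \oo] --> l%:E by apply: cvg_EFin => //; exact: nearW.
 by move=> /cvg_limn_einf_sup[_ ->].
have fj j : (\int[mu]_x ((f x - w j x) ^+ 2)%:E <= ((2^-1 ^+ j) ^+ 2)%:E)%E.
 pose F k x := (((w (k + j)%N x : R) - w j x) ^+ 2)%:E.
 have mF k : measurable_fun setT (F k).
  by apply/measurable_EFinP; apply: measurable_funX; exact: measurable_funB.
 have F0 k x : (0 <= F k x)%E by rewrite lee_fin sqr_ge0.
 have -> : (\int[mu]_x ((f x - w j x) ^+ 2)%:E = \int[mu]_x (limn_einf (F^~ x)))%E.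
  apply: ae_eq_integral => //.
  - by apply/measurable_EFinP; apply: measurable_funX; exact: measurable_funB.
  - rewrite (_ : (fun x => limn_einf (F^~ x)) = fun x => (- limn_esup (fun k => - F k x))%E).
    apply: measurableT_comp => //; apply: measurable_fun_limn_esup => k.
    exact: measurableT_comp.
   by [].
  - apply: filterS cf => x cx _; apply/esym.
   have : F k x @[k --> \oo] --> ((f x - w j x) ^+ 2)%:E.
    apply: cvg_EFin; first exact: nearW.
    have : ((w (k + j)%N x : R^o) - w j x) @[k --> \oo] --> (f x - w j x : R^o).
     apply: cvgB; last exact: cvg_cst.
     by rewrite (cvg_shiftn j (fun k => w k x : R^o)).
    by move=> /[dup] c /(cvgM c); rewrite -expr2.
   by move=> /cvg_limn_einf_sup[].
 apply: (le_trans (fatou mu measurableT mF (fun k x _ => F0 k x))).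
 rewrite limn_einf_lim; apply: lime_le; first exact: is_cvg_einfs.
 apply: nearW => n; apply: (@le_trans _ _ (\int[mu]_x F n x)%E).
  by apply: ereal_inf_lbound; exists n => /=.
 rewrite integral_sqr_sub lee_fin lerXn2r ?nnegrE//.
 by apply: hw; rewrite leq_addl.
have [||u0 hu0] := @L2_of (fun x => f x - w 0%N x).
- exact: measurable_funB.
- by apply: le_lt_trans (fj 0%N) _; rewrite ltry.
have uf : {ae mu, forall x, L2_fun (u0 + w 0%N) x = f x}.
 by apply: filterS2 hu0 (L2_funD u0 (w 0%N)) => x e1 ->; rewrite e1 subrK.
exists (u0 + w 0%N).
have uw j : `|u0 + w 0%N - w j| <= 2^-1 ^+ j.
 rewrite -(@ler_pXn2r _ 2) ?nnegrE//.
 rewrite -lee_fin -integral_sqr_sub; apply: le_trans (fj j); rewrite le_eqVlt.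
 apply/orP; left; apply/eqP; apply: ae_eq_integral => //.
 - apply/measurable_EFinP; apply: measurable_funX; apply: measurable_funB; last exact: mw.
  exact: (L2_measurable (u0 + w 0%N)).
 - by apply/measurable_EFinP; apply: measurable_funX; exact: measurable_funB.
 - by apply: filterS uf => x -> _.
apply/cvgrPdist_le => eps eps0; have e2 : 0 < eps / 2 by lra.
have [j hj] : exists j, (2^-1 : R) ^+ j <= eps / 2.
 have /cvgrPdist_le /(_ _ e2)[j _ /(_ j (leqnn j))/= hj] := @cvg_expr R 2^-1 ltac:(rewrite ger0_norm//; lra).
 by exists j; move: hj; rewrite sub0r normrN ger0_norm// exprn_ge0// invr_ge0.
exists (N j) => // n /= Nn; rewrite -(subrKA (w j)) (le_trans (ler_normD _ _))//.
have h1 := uw j; have h2 : `|w j - v n| <= 2^-1 ^+ j by apply: hN => //; exact: NM.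
lra.
Qed.
End L2_complete.

(** * Poincare's inequality on the cube and positivity of the eigenvalues *)

Section poincare_line.
Context (R : realType).
Notation leb := (@lebesgue_measure R).

(* |psi(z)| <= int |psi'| <= (l int psi'^2 + pi/l)/2, and optimize over l. *)
Lemma poincare_line (psi dpsi : R -> R) (z : R) : 0 < z < pi ->
 continuous dpsi -> (forall x : R, is_derive x 1 psi (dpsi x)) -> psi 0 = 0 ->
 ((psi z ^+ 2)%:E <= pi%:E * \int[leb]_(t in `]0%R, pi[) (dpsi t ^+ 2)%:E)%E.
Proof.
move=> /andP[z0 zpi] cd dp p0.
have mdp : measurable_fun setT dpsi by exact: continuous_measurable_fun.
set I := (\int[leb]_(t in _) _)%E.
have I0 : (0 <= I)%E by apply: integral_ge0 => t _; rewrite lee_fin sqr_ge0.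
have [fI|] := boolP (I \is a fin_num); last first.
 rewrite ge0_fin_numE// -leNgt leye_eq => /eqP ->.
 by rewrite gt0_muley ?leey// lte_fin pi_gt0.
rewrite -(fineK fI) -EFinM lee_fin -real_normK ?num_real//.
apply: amgm_opt => //; [exact: fine_ge0|exact: pi_gt0|move=> l l0].
have cpsi : continuous psi.
 by move=> x; apply/differentiable_continuous/derivable1_diffP; have [] := dp x.
have ftc : (\int[leb]_(t in `[0%R, z]) (dpsi t)%:E = (psi z)%:E)%E.
 rewrite (@continuous_FTC2 _ dpsi psi)//.
 - by rewrite p0 sube0.
 - exact: continuous_subspaceT.
 - split.
  + by [].
  + by apply: cvg_at_right_filter; exact: cpsi.
  + by apply: cvg_at_left_filter; exact: cpsi.
 - by move=> x _; rewrite derive1E; have [_] := dp x.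
have h1 : (`|psi z|%:E <= \int[leb]_(t in `]0%R, pi[) `|dpsi t|%:E)%E.
 rewrite -abse_EFin -ftc; apply: (le_trans (le_abse_integral _ _ _)) => //.
  by apply/measurable_EFinP; exact: measurable_funTS.
 rewrite integral_itv_bndoo; last first.
  by apply: measurableT_comp => //; apply/measurable_EFinP; exact: measurable_funTS.
 apply: ge0_subset_integral => //.
  by apply/measurable_EFinP; apply: measurableT_comp => //; exact: measurable_funTS.
 by apply: subset_itvl; rewrite bnd_simp ltW.
have leb_pi : leb `]0%R, pi[ = pi%:E.
 by rewrite lebesgue_measure_itv/= lte_fin pi_gt0 oppr0 adde0.
have h2 : (2%:E * `|psi z|%:E <= l%:E * I + (l^-1 * pi)%:E)%E.
 apply: (@le_trans _ _ (2%:E * \int[leb]_(t in `]0%R, pi[) `|dpsi t|%:E)%E).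
  by rewrite lee_wpmul2l// lee_fin.
 rewrite -!ge0_integralZl//; last 4 first.
 - by apply/measurable_EFinP; apply: measurable_funX; exact: measurable_funTS.
 - by move=> t _; rewrite lee_fin sqr_ge0.
 - by rewrite lee_fin ltW.
 - by apply/measurable_EFinP; apply: measurableT_comp => //; exact: measurable_funTS.
 have -> : (l^-1 * pi)%:E = (\int[leb]_(t in `]0%R, pi[) (cst (l^-1)%:E) t)%E.
  by rewrite integral_cst// -[X in (_ * X)%E]/(leb _) leb_pi EFinM.
 rewrite -ge0_integralD//; last 3 first.
 - by move=> t _; rewrite -EFinM lee_fin mulr_ge0 ?sqr_ge0// ltW.
 - apply: emeasurable_funM => //; apply/measurable_EFinP; apply: measurable_funX.
  exact: measurable_funTS.
 - by move=> t _; rewrite lee_fin invr_ge0 ltW.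
 apply: ge0_le_integral => //.
 - apply: emeasurable_funM => //; apply/measurable_EFinP.
  by apply: measurableT_comp => //; exact: measurable_funTS.
 - apply: emeasurable_funD => //; apply: emeasurable_funM => //; apply/measurable_EFinP.
  by apply: measurable_funX; exact: measurable_funTS.
 - move=> t _; rewrite -!EFinM -EFinD lee_fin.
  have ll : l * l^-1 = 1 by rewrite divff// gt_eqF.
  rewrite -(@real_normK _ (dpsi t)) ?num_real//; move: (`|dpsi t|) => y.
  have h := sqr_ge0 (l * y - 1).
  suff : l * (2 * y) <= l * (l * y ^+ 2 + l^-1) by rewrite ler_pM2l.
  rewrite [leRHS]mulrDr ll; nra.
by rewrite -lee_fin EFinD !EFinM fineK// -EFinM.
Qed.
End poincare_line.

Section row_space.
Context (R : realType).

Lemma sepa_rV n : sepa 'rV[R]_n.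
Proof.
exists (fun k => if (unpickle k : option 'rV[rat]_n) is Some A
  then map_mx ratr A else 0) => x e e0.
have hr i : exists r : rat, `|x ord0 i - ratr r| < e.
 have [r] := @rat_in_itvoo R (x ord0 i - e) (x ord0 i + e) ltac:(lra).
 by rewrite in_itv/= => /andP[r1 r2]; exists r; rewrite ltr_norml; lra.
have [r rP] := choice hr.
exists (pickle (\row_i r i)); rewrite pickleK.
rewrite [X in X < _]/Num.norm/= mx_normrE; apply: bigmax_lt => // -[i j] _ /=.
by rewrite !mxE ord1.
Qed.

Lemma vmeas_pt n : @vmeas R _ (n.-tuple (measurableTypeR R)) 'rV[R]_n (@pt R n).
Proof.
apply: vmeas_balls => [|q r]; first exact: sepa_rV.
have [r0|r0] := leP r 0.
 rewrite (_ : [set _ | _] = set0)//; apply/seteqP; split => // w /=.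
 by move=> /lt_le_trans/(_ r0); rewrite ltNge normr_ge0.
have -> : [set w | `|pt w - q| < r] = \bigcap_(i in [set: 'I_n])
  [set w : n.-tuple (measurableTypeR R) | `|(tnth w i : R) - q ord0 i| < r].
 apply/seteqP; split => [w /= h i _ /=|w /= h].
  apply: le_lt_trans h; rewrite [leRHS]/Num.norm/= mx_normrE.
  apply: le_trans (le_bigmax _ _ (ord0, i)) => /=.
  by rewrite !mxE.
 by rewrite [X in X < _]/Num.norm/= mx_normrE; apply: bigmax_lt => // -[j i] _ /=; rewrite !mxE (ord1 j); exact: h.
apply: fin_bigcap_measurable => [|i _]; first exact: finite_finset.
have mt : measurable_fun setT (fun w : n.-tuple (measurableTypeR R) =>
  `|(tnth w i : R) - q ord0 i|).
 apply: measurableT_comp => //; apply: measurable_funB => //.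
 exact: measurable_tnth.
rewrite (_ : [set w | _] = (fun w => `|(tnth w i : R) - q ord0 i|) @^-1` `]-oo, r[%classic).
 by rewrite -[X in measurable X]setTI; apply: mt => //; exact: measurable_itv.
by [].
Qed.
End row_space.

Section eigenvalues.
Context (R : realType).
Notation leb := (@lebesgue_measure R).
Notation RT := (measurableTypeR R).

Lemma ge0_integral_itv_measure (f : RT -> R) : measurable_fun setT f ->
 (forall x, 0 <= f x) ->
 (\int[@itv_measure R]_x (f x)%:E = \int[leb]_(x in `]0%R, pi[) (f x)%:E)%E.
Proof.
move=> mf f0.
rewrite (@ge0_integral_density _ _ _ leb (@itv_measure R) (\1_`]0%R, pi[%classic)).
- rewrite [RHS]integral_mkcond; apply: eq_integral => x _.
 rewrite patchE indicE; case: ifPn => _; by rewrite ?mule1 ?mule0.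
- exact: measurable_indic.
- by [].
- by move=> A mA; rewrite integral_indic// setIC.
- exact/measurable_EFinP.
- by [].
Qed.

Lemma itv_measureT : @itv_measure R setT = pi%:E.
Proof.
rewrite /itv_measure /mrestr setTI lebesgue_measure_itv/= lte_fin pi_gt0.
by rewrite oppr0 adde0.
Qed.

Lemma itv_measure_fin : fin_num_fun (@itv_measure R).
Proof. by apply: lty_fin_num_fun; rewrite [ltLHS]itv_measureT ltry. Qed.

HB.instance Definition _ := Measure_isFinite.Build _ _ _ (@itv_measure R) itv_measure_fin.

Section poincare.
Variables (n : nat) (phi : 'rV[R]_n.+1 -> R) (tphi : test_function phi).
Notation cube := (cube_measure R n.+1).

Lemma test_cont : continuous phi.
Proof. by have [/(_ [::])[]] := tphi. Qed.

Lemma test_partial_cont i : continuous (partial i phi).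
Proof. by have [/(_ [:: i])[]] := tphi. Qed.

Lemma measurable_pt (f : 'rV[R]_n.+1 -> R) : continuous f ->
 measurable_fun setT (fun x : n.+1.-tuple RT => f (pt x)).
Proof.
move=> cf; apply: vmeas_fun; apply: (@vmeas_comp _ _ _ 'rV[R]_n.+1 R^o f) => //.
exact: vmeas_pt.
Qed.

Lemma cube_integral (f : n.+1.-tuple RT -> R) : measurable_fun setT f ->
 (forall x, 0 <= f x) ->
 (\int[cube]_x (f x)%:E =
  \int[cube_measure R n]_y \int[@itv_measure R]_t (f (cons_pt (t, y)))%:E)%E.
Proof.
move=> mf f0.
have mEf : measurable_fun setT (EFin \o f) by exact/measurable_EFinP.
have mc := @measurable_cons_pt R n.
transitivity (\int[(@itv_measure R \x cube_measure R n)%E]_z (f (cons_pt z))%:E)%E.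
 exact: (@ge0_integral_pushforward _ _ _ _ _ _ mc _ setT (EFin \o f)
  measurableT mEf (fun x _ => f0 x)).
rewrite (@fubini_tonelli2 _ _ _ _ _ (@itv_measure R) (cube_measure R n)
 (fun z => (f (cons_pt z))%:E))//.
- by apply: (measurableT_comp mEf mc).
- by move=> z; rewrite lee_fin.
Qed.

Lemma pt_cons (t h : R) y : pt (cons_pt (h + t, y) : n.+1.-tuple RT) =
 h *: 'e_ord0 + pt (cons_pt (t, y)) :> 'rV[R]_n.+1.
Proof.
apply/rowP => i; rewrite !mxE; case: (unliftP ord0 i) => [j ->|->] /=.
 by rewrite mulr0 add0r !(tnth_nth 0).
by rewrite mulr1.
Qed.

(** Fubini along the first axis: every line parallel to it starts on the boundary of the cube, where
    a test function vanishes. One factor [pi] comes from [poincare_line], the other from the length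
    of the line. *)
Lemma Poincare :
 (\int[cube]_x (phi (pt x) ^+ 2)%:E <=
  (pi ^+ 2)%:E * \int[cube]_x (partial ord0 phi (pt x) ^+ 2)%:E)%E.
Proof.
have mp : measurable_fun setT (fun x : n.+1.-tuple RT => phi (pt x) ^+ 2).
 by apply: measurable_funX; apply: measurable_pt; exact: test_cont.
have md : measurable_fun setT (fun x : n.+1.-tuple RT => partial ord0 phi (pt x) ^+ 2).
 by apply: measurable_funX; apply: measurable_pt; exact: test_partial_cont.
rewrite !cube_integral//; try by move=> x; exact: sqr_ge0.
have mf (f : n.+1.-tuple RT -> R) : measurable_fun setT f -> (forall x, 0 <= f x) ->
  measurable_fun setT (fun y => \int[@itv_measure R]_t (f (cons_pt (t, y)))%:E)%E.
 move=> mf f0; apply: (@measurable_fun_fubini_tonelli_G _ _ _ _ _ (@itv_measure R)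
  (fun z => (f (cons_pt z))%:E)).
 - by apply/measurable_EFinP; exact: measurableT_comp mf (@measurable_cons_pt R n).
 - by move=> z; rewrite lee_fin.
have i0 (f : n.+1.-tuple RT -> R) y : (forall x, 0 <= f x) ->
  (0 <= \int[@itv_measure R]_t (f (cons_pt (t, y)))%:E)%E.
 by move=> f0; apply: integral_ge0 => t _; rewrite lee_fin.
have mfp := mf _ mp (fun x => sqr_ge0 _); have mfd := mf _ md (fun x => sqr_ge0 _).
have i0p y := i0 (fun x => phi (pt x) ^+ 2) y (fun x => sqr_ge0 _).
have i0d y := i0 (fun x => partial ord0 phi (pt x) ^+ 2) y (fun x => sqr_ge0 _).
rewrite -ge0_integralZl; [|exact: measurableT|exact: mfd|by move=> y _; exact: i0d|by rewrite lee_fin sqr_ge0].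
apply: ge0_le_integral; [exact: measurableT|by move=> y _; exact: i0p|exact: mfp|exact: emeasurable_funM|].
move=> y _.
pose psi (t : R) := phi (pt (cons_pt (t, y))).
pose dpsi (t : R) := partial ord0 phi (pt (cons_pt (t, y))).
have E (f : 'rV[R]_n.+1 -> R) (t h : R) :
  f (pt (cons_pt (h *: (1 : R^o) + t, y))) = f (h *: 'e_ord0 + pt (cons_pt (t, y))).
 by rewrite -pt_cons /GRing.scale/= mulr1.
have dp (t : R) : is_derive t 1 psi (dpsi t).
 have [/(_ [::])[_ /(_ (pt (cons_pt (t, y))) ord0)/= dph] _] := tphi.
 have e1 : (fun h : R => h^-1 *: (psi (h *: (1 : R^o) + t) - psi t)) =
   (fun h : R => h^-1 *: (phi (h *: 'e_ord0 + pt (cons_pt (t, y))) - phi (pt (cons_pt (t, y))))).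
  by apply/funext => h; rewrite /psi E.
 split; first by rewrite /derivable; move: dph; rewrite /derivable -e1.
 by rewrite /dpsi /partial /derive -e1.
have cl (f : 'rV[R]_n.+1 -> R) : continuous f ->
  continuous (fun t : R => f (pt (cons_pt (t, y)))).
 move=> cf t; apply: (@continuous_comp R^o 'rV[R]_n.+1 R^o (fun t : R => pt (cons_pt (t, y))) f);
  last exact: cf.
 have -> : (fun t : R => pt (cons_pt (t, y))) =
   (fun t : R^o => t *: 'e_ord0 + pt (cons_pt (0, y)) : 'rV[R]_n.+1).
  by apply/funext => s; rewrite -pt_cons addr0.
 by apply: cvgD; [apply: cvgZr_tmp => //; exact: cvg_id|exact: cvg_cst].
have p0 : psi 0 = 0.
 have [_ [K [_ KO]]] := tphi; apply => /KO /(_ ord0).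
 by rewrite !mxE ltxx.
have cd : continuous dpsi by apply: cl; exact: test_partial_cont.
have cp : continuous psi by apply: cl; exact: test_cont.
have mline (f : R -> R) : continuous f -> measurable_fun setT (fun t : RT => f t ^+ 2).
 by move=> cf; apply: measurable_funX; exact: continuous_measurable_fun.
rewrite (@ge0_integral_itv_measure (fun t => psi t ^+ 2)); [|exact: mline|by move=> t; exact: sqr_ge0].
rewrite (@ge0_integral_itv_measure (fun t => dpsi t ^+ 2)); [|exact: mline|by move=> t; exact: sqr_ge0].
set I := (\int[leb]_(t in _) (dpsi t ^+ 2)%:E)%E.
apply: (@le_trans _ _ (\int[leb]_(t in `]0%R, pi[) (cst (pi%:E * I)%E t))%E).
 apply: ge0_le_integral => //.
 - by move=> t _; rewrite lee_fin sqr_ge0.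
 - by apply/measurable_EFinP; apply: measurable_funTS; exact: mline.
 - move=> t /=; rewrite in_itv => tpi.
  exact: (@poincare_line R psi dpsi t tpi cd dp p0).
rewrite integral_cst//= lebesgue_measure_itv/= lte_fin pi_gt0 oppr0 adde0.
by rewrite -muleA (muleC I) muleA -EFinM expr2.
Qed.
End poincare.

Section test_approx.
Variable m : nat.
Notation cube := (cube_measure R m).
Notation U := (Usp R m).

Lemma cvge0_le (f : nat -> \bar R) (eps : R) : f @ \oo --> 0%E ->
 (forall n, 0 <= f n)%E -> 0 < eps -> \forall n \near \oo, (f n <= eps%:E)%E.
Proof.
move=> /fine_cvgP[ff cf] f0 e0.
have := cf => /cvgrPdist_le /(_ _ e0) he.
near=> n; have fn : f n \is a fin_num by near: n.
rewrite -(fineK fn) lee_fin.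
have : `|0 - fine (f n)| <= eps by near: n.
by rewrite sub0r normrN; exact: le_trans (ler_norm _).
Unshelve. all: by end_near. Qed.

Lemma measurable_ptm (f : 'rV[R]_m -> R) : continuous f ->
 measurable_fun setT (fun x : m.-tuple RT => f (pt x)).
Proof.
move=> cf; apply: vmeas_fun; apply: (@vmeas_comp _ _ _ 'rV[R]_m R^o f) => //.
exact: vmeas_pt.
Qed.

Lemma L2_near (u : U) (f : 'rV[R]_m -> R) (eps : R) : continuous f -> 0 <= eps ->
 (\int[cube]_x ((u x - f (pt x)) ^+ 2)%:E <= (eps ^+ 2)%:E)%E ->
 exists2 F : U, {ae cube, forall x, F x = f (pt x)} & `|u - F| <= eps.
Proof.
move=> cf e0 hf; have mf := measurable_ptm cf.
have [||h hh] := @L2_of _ _ _ cube (fun x => u x - f (pt x)).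
- by apply: measurable_funB => //; exact: (L2_measurable u).
- by apply: le_lt_trans hf _; rewrite ltry.
have hF : {ae cube, forall x, L2_fun (u - h) x = f (pt x)}.
 have := L2_funD u (- h); have := L2_funZ (-1) h; rewrite scaleN1r.
 by apply: filterS3 hh => x e3 e1 ->; rewrite e1 e3; ring.
exists (u - h) => //.
rewrite -(@ler_pXn2r _ 2) ?nnegrE//.
rewrite -lee_fin -integral_sqr_sub; apply: le_trans hf; rewrite le_eqVlt.
apply/orP; left; apply/eqP; apply: ae_eq_integral => //.
- apply/measurable_EFinP; apply: measurable_funX; apply: measurable_funB.
  exact: (L2_measurable u).
 exact: (L2_measurable (u - h)).
- by apply/measurable_EFinP; apply: measurable_funX; apply: measurable_funB => //; exact: (L2_measurable u).
- by apply: filterS hF => x -> _.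
Qed.

Lemma H01_approx (u : U) g (eps : R) : H01 u g -> 0 < eps ->
 exists phi (F : U) (G : 'I_m -> U),
 [/\ test_function phi, {ae cube, forall x, F x = phi (pt x)},
   forall i, {ae cube, forall x, G i x = partial i phi (pt x)},
   `|u - F| <= eps & forall i, `|g i - G i| <= eps].
Proof.
move=> [phi [tphi cu cg]] eps0.
have e20 : 0 < eps ^+ 2 by rewrite exprn_gt0.
have i0 (v : U) (f : 'rV[R]_m -> R) : (0 <= \int[cube]_x ((v x - f (pt x)) ^+ 2)%:E)%E.
 by apply: integral_ge0 => x _; rewrite lee_fin sqr_ge0.
have nu := cvge0_le cu (fun k => i0 u (phi k)) e20.
have ng i := cvge0_le (cg i) (fun k => i0 (g i) (partial i (phi k))) e20.
have [k [hk1 hk2]] : exists k, (\int[cube]_x ((u x - phi k (pt x)) ^+ 2)%:E <= (eps ^+ 2)%:E)%E /\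
  forall i, (\int[cube]_x ((g i x - partial i (phi k) (pt x)) ^+ 2)%:E <= (eps ^+ 2)%:E)%E.
 have [N1 _ h1] := nu; have /choice[N2 h2] i : exists N, forall k, (N <= k)%N ->
   (\int[cube]_x ((g i x - partial i (phi k) (pt x)) ^+ 2)%:E <= (eps ^+ 2)%:E)%E.
  by have [N _ h] := ng i; exists N => k; exact: h.
 exists (maxn N1 (\max_i N2 i)); split; first by apply: h1 => /=; exact: leq_maxl.
 by move=> i; apply: h2; apply: leq_trans (leq_maxr _ _); exact: leq_bigmax.
have [F FE uF] := L2_near (let: conj c _ := (tphi k).1 [::] in c) (ltW eps0) hk1.
have /choice[G hG] i : exists G : U, {ae cube, forall x, G x = partial i (phi k) (pt x)} /\
  `|g i - G| <= eps.
 have [G GE uG] := L2_near (let: conj c _ := (tphi k).1 [:: i] in c) (ltW eps0) (hk2 i).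
 by exists G.
by exists (phi k), F, G; split => // i; have [] := hG i.
Qed.

Lemma dot_pt (u F : U) f : {ae cube, forall x, F x = f (pt x)} -> continuous f ->
 dot u F = \int[cube]_x (u x * f (pt x)).
Proof.
move=> FE cf; congr fine; apply: ae_eq_integral => //.
- exact: measurable_int (dot_intble _ _).
- by apply/measurable_EFinP; apply: measurable_funM; [exact: (L2_measurable u)|exact: measurable_ptm].
- by apply: filterS FE => x -> _.
Qed.

(** Test functions approximate function and gradient together, and both sides are continuous in
    these. The extension allows testing with an eigenvector and with its Laplacian, which need not
    be test functions. *)
Lemma neg_laplacian_H01 (u f : U) : neg_laplacian u f ->
 exists2 g, H01 u g & forall w k, H01 w k ->
  \sum_(i < m) dot (g i) (k i) = dot f w.
Proof.
move=> [g ug hg]; exists g => // w k wk.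
apply/eqP; rewrite -subr_eq0 -normr_le0; apply/ler_gtP => eta eta0.
pose K := \sum_(i < m) `|g i| + `|f| + 1.
have K0 : 0 < K by rewrite ltr_wpDl// addr_ge0// sumr_ge0.
have ep0 : 0 < eta / K by rewrite divr_gt0.
have [phi [F [G [tphi FE GE wF kG]]]] := H01_approx wk ep0.
have hphi : \sum_(i < m) dot (g i) (G i) = dot f F.
 rewrite (dot_pt f FE); last by have [/(_ [::])[]] := tphi.
 rewrite -(hg _ tphi); apply: eq_bigr => i _; apply: dot_pt => //.
 by have [/(_ [:: i])[]] := tphi.
have -> : \sum_(i < m) dot (g i) (k i) - dot f w =
  \sum_(i < m) dot (g i) (k i - G i) - dot f (w - F).
 under [in RHS]eq_bigr do rewrite dotBr.
 by rewrite sumrB hphi dotBr; ring.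
apply: (@le_trans _ _ (\sum_(i < m) `|g i| * (eta / K) + `|f| * (eta / K))).
 rewrite (le_trans (ler_normB _ _))// lerD//.
  rewrite (le_trans (ler_norm_sum _ _ _))//; apply: ler_sum => i _.
  by rewrite (le_trans (dot_le _ _))// ler_wpM2l.
 by rewrite (le_trans (dot_le _ _))// ler_wpM2l.
rewrite -mulr_suml -mulrDl; apply: mul_div_le => //; last exact: ltW.
- by rewrite addr_ge0// sumr_ge0.
- by rewrite lerDl.
Qed.
End test_approx.

Lemma H01_grad0 n (u : Usp R n.+1) g : H01 u g -> g ord0 = 0 -> u = 0.
Proof.
move=> ug g0; apply/eqP; rewrite -normr_le0; apply/ler_gtP => eta eta0.
have K0 : 0 < 1 + pi :> R by rewrite addr_gt0// pi_gt0.
have ep0 : 0 < eta / (1 + pi) by rewrite divr_gt0.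
have [phi [F [G [tphi FE GE wF kG]]]] := H01_approx ug ep0.
have FG : `|F| <= pi * `|G ord0|.
 rewrite -(@ler_pXn2r _ 2) ?nnegrE ?mulr_ge0 ?pi_ge0// exprMn.
 have sq (A : Usp R n.+1) f : {ae cube_measure R n.+1, forall x, A x = f (pt x)} -> continuous f ->
   ((`|A| ^+ 2)%:E = \int[cube_measure R n.+1]_x (f (pt x) ^+ 2)%:E)%E.
  move=> AE cf; rewrite -(subr0 A) -integral_sqr_sub; apply: ae_eq_integral => //.
  - apply/measurable_EFinP; apply: measurable_funX; apply: measurable_funB.
    exact: (L2_measurable A).
   exact: (L2_measurable 0).
  - by apply/measurable_EFinP; apply: measurable_funX; exact: measurable_ptm.
  - have := L2_funZ 0 A; rewrite scale0r => z0.
   by apply: filterS2 AE z0 => x -> -> _; rewrite mul0r subr0.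
 rewrite -lee_fin [X in (_ <= X)%E]EFinM (sq F phi)//; last exact: test_cont.
 rewrite (sq (G ord0) (partial ord0 phi))//; last exact: test_partial_cont.
 exact: Poincare.
have := kG ord0; rewrite g0 sub0r normrN => hG.
rewrite -(subrK F u) (le_trans (ler_normD _ _))//.
apply: (@le_trans _ _ ((1 + pi) * (eta / (1 + pi)))).
 rewrite mulrDl mul1r lerD// (le_trans FG)// ler_wpM2l ?pi_ge0//.
by rewrite mulrC divfK// gt_eqF.
Qed.

(** With [v] the negative Laplacian of [u], testing each of the two equations with the solution of
    the other or with itself gives [a |u|^2 = |v|^2]. If [a = 0] then [v = 0], so the gradient of
    [u] vanishes and Poincare's inequality forces [u = 0]. *)
Lemma eigenvalue_gt0 n (u : Usp R n.+1) (a : R) : bilaplacian u (a *: u) ->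
 u != 0 -> 0 < a.
Proof.
move=> [v /neg_laplacian_H01[g ug hg] /neg_laplacian_H01[k vk hk]] u0.
have nu : 0 < `|u| ^+ 2 by rewrite exprn_gt0// normr_gt0.
have e1 := hg _ _ vk; have e2 := hk _ _ ug; have e3 := hg _ _ ug.
have e4 : a * `|u| ^+ 2 = `|v| ^+ 2.
 rewrite -!dot_norm -dotZl -e2 -e1; apply: eq_bigr => i _; exact: dotC.
have a0 : 0 <= a by rewrite -(pmulr_lge0 _ nu) e4 sqr_ge0.
rewrite lt_neqAle a0 andbT eq_sym; apply/eqP => a00.
have v0 : v = 0 by apply/eqP; rewrite -normr_eq0 -sqrf_eq0 -e4 a00 mul0r.
move: e3; rewrite v0 dot0l => /eqP; rewrite psumr_eq0 => [|i _]; last by rewrite dot_norm sqr_ge0.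
move=> /allP /(_ ord0 (mem_index_enum _))/= /eqP; rewrite dot_norm => /eqP.
rewrite sqrf_eq0 normr_eq0 => /eqP g0.
by move/eqP: u0; apply; exact: H01_grad0 ug g0.
Qed.
End eigenvalues.

(** * Powers of the operator through their coefficients *)

Section modes.
Context (R : realType) (m : nat) (mu : nat -> R) (e : nat -> Usp R m)
 (he : orthogonal_basis e) (mu0 : forall n, 0 < mu n).
Notation V := (Usp R m).
Notation h n := (unitv e n).
Implicit Types u v : V.

Lemma span_cvg u (c : nat -> R) K : (forall i, `|c i| <= K * `|dot u (h i)|) ->
 exists2 v, (fun n => \sum_(i < n) c i *: h i) @ \oo --> v &
  forall k, dot v (h k) = c k.
Proof.
move=> cK.
have K0 : 0 <= `|K| + 1 by rewrite addr_ge0.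
have cK2 i : c i ^+ 2 <= (`|K| + 1) ^+ 2 * dot u (h i) ^+ 2.
 rewrite -exprMn -[leLHS]real_normK ?num_real// -[leRHS]real_normK ?num_real//.
 rewrite lerXn2r// normrM (ger0_norm K0).
 apply: le_trans (cK i) _; apply: ler_wpM2r => //.
 by apply: le_trans (ler_norm K) _; rewrite lerDl.
pose s n := \sum_(i < n) c i *: h i.
have dif (d : nat -> R) p n : (p <= n)%N ->
  \sum_(i < n) d i *: h i - \sum_(i < p) d i *: h i =
  \sum_(i < n) (if (i < p)%N then 0 else d i) *: h i.
 move=> pn; rewrite (big_ord_widen n (fun i => d i *: h i) pn) [X in _ - X]big_mkcond/= -sumrB.
 by apply: eq_bigr => i _; case: ifP => _; rewrite ?subrr ?scale0r ?subr0.
have sp p n : (p <= n)%N -> `|s n - s p| <= (`|K| + 1) * `|proj e n u - proj e p u|.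
 move=> pn; rewrite -ler_sqr ?nnegrE// exprMn.
 rewrite (dif c p n pn) (dif (fun i => dot u (h i)) p n pn).
 rewrite (norm_span he n (fun i => if (i < p)%N then 0 else c i)).
 rewrite (norm_span he n (fun i => if (i < p)%N then 0 else dot u (h i))).
 rewrite mulr_sumr; apply: ler_sum => i _; case: ifP => _ //.
 lra.
have [v sv] : exists v, s @ \oo --> v.
 apply: L2_complete => eps eps0.
 have : cvgn (proj e ^~ u) by apply/cvg_ex; exists u; exact: (@proj_cvg _ _ _ _ _ he u).
 have pu := @proj_cvg _ _ _ _ _ he u.
 have e1 : 0 < eps / (`|K| + 1) / 2 by rewrite !divr_gt0.
 move=> _; move/cvgrPdist_le/(_ _ e1) : pu => [N _ NP].
 have sym p n : (N <= p)%N -> (p <= n)%N -> `|s n - s p| <= eps.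
  move=> Np pn; apply: le_trans (sp _ _ pn) _; rewrite mulrC -ler_pdivlMr//.
  have := NP p Np; have := NP n (leq_trans Np pn) => /= h1 h2.
  have -> : proj e n u - proj e p u = (u - proj e p u) - (u - proj e n u).
   by rewrite opprB [RHS]addrC subrKA.
  apply: le_trans (ler_normB _ _) _; rewrite (splitr (eps / _)); exact: lerD.
 exists N => p n Np Nn; case: (leqP n p) => np; first exact: sym.
 by rewrite distrC; apply: sym => //; exact: ltnW.
exists v => // k.
have c1 : (dot (s n) (h k) : R^o) @[n --> \oo] --> (dot v (h k) : R^o).
 exact: (cvg_comp _ _ sv (@dot_continuous _ _ _ _ (h k) v)).
have c2 : (dot (s n) (h k) : R^o) @[n --> \oo] --> (c k : R^o).
 apply/cvgrPdist_le => eps eps0; exists k.+1 => // n /= kn.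
 by rewrite (dot_span he) kn subrr normr0 ltW.
exact: (cvg_unique _ c1 c2).
Qed.

Lemma pow_seriesE s u n :
 pow_series mu e s u n = \sum_(i < n) (mu i `^ s * dot u (h i)) *: h i.
Proof. by rewrite /pow_series seriesEord. Qed.

(** A multiplier bound yields membership in the domain and the coefficients at once. It is applied
    to single modes for every power, and to general vectors for nonpositive powers; positive powers
    of general vectors are never computed. *)
Lemma pow_coef s u K : (forall i, `|mu i `^ s * dot u (h i)| <= K * `|dot u (h i)|) ->
 pow_dom mu e s u /\ forall k, dot (pow mu e s u) (h k) = mu k `^ s * dot u (h k).
Proof.
move=> /span_cvg[v cv vk].
have cv' : pow_series mu e s u @ \oo --> v.
 rewrite (_ : pow_series mu e s u = fun n => \sum_(i < n) (mu i `^ s * dot u (h i)) *: h i) //.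
 by apply/funext => n; rewrite pow_seriesE.
split; first by apply/cvg_ex; exists v.
by move=> k; rewrite /pow (cvg_lim _ cv').
Qed.

Lemma pow_mode s (a : R) n :
 pow_dom mu e s (a *: h n) /\ pow mu e s (a *: h n) = (mu n `^ s * a) *: h n.
Proof.
have [] := @pow_coef s (a *: h n) (mu n `^ s).
 move=> i; rewrite dotZl (dot_unitv he).
 by case: eqP => [->|_]; rewrite ?mulr0 ?normr0// normrM ger0_norm ?powR_ge0.
move=> hd hk; split => //; apply: (coef_inj he) => k.
have dZ b : dot (b *: h n) (h k) = b * (n == k)%:R by rewrite dotZl (dot_unitv he).
by rewrite hk !dZ; case: eqP => [->|_]; rewrite ?mulr0 ?mulrA.
Qed.

Local Opaque pow.

Hypothesis muS : {homo mu : i j / (i <= j)%N >-> i <= j}.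

Lemma powN_le s n : 0 <= s -> mu n `^ (- s) <= mu 0%N `^ (- s).
Proof.
move=> s0; rewrite !powRN lef_pV2 ?posrE ?powR_gt0//.
by apply: ge0_ler_powR; rewrite // ?nnegrE ?(ltW (mu0 _))//; exact: (muS (leq0n n)).
Qed.

Lemma powN_dot s u k : 0 <= s ->
 dot (pow mu e (- s) u) (h k) = mu k `^ (- s) * dot u (h k).
Proof.
move=> s0; have [|_ ->//] := @pow_coef (- s) u (mu 0%N `^ (- s)).
by move=> i; rewrite normrM (ger0_norm (powR_ge0 _ _)) ler_wpM2r// powN_le.
Qed.

Lemma powND s u v : 0 <= s ->
 pow mu e (- s) (u + v) = pow mu e (- s) u + pow mu e (- s) v.
Proof.
move=> s0; apply: (coef_inj he) => k; apply: (etrans (powN_dot _ _ s0)).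
by rewrite !dotDl mulrDr; congr (_ + _); apply/esym/powN_dot.
Qed.

Lemma powNZ s a u : 0 <= s -> pow mu e (- s) (a *: u) = a *: pow mu e (- s) u.
Proof.
move=> s0; apply: (coef_inj he) => k; apply: (etrans (powN_dot _ _ s0)).
by rewrite !dotZl mulrCA; congr (_ * _); apply/esym/powN_dot.
Qed.

Lemma powN_norm s u : 0 <= s -> `|pow mu e (- s) u| <= mu 0%N `^ (- s) * `|u|.
Proof.
move=> s0; have K0 : 0 <= mu 0%N `^ (- s) * `|u| by rewrite mulr_ge0 ?powR_ge0.
rewrite -ler_sqr ?nnegrE//.
apply: (norm_le_coef he); first by rewrite exprn_ge0// mulr_ge0.
move=> n; rewrite exprMn; apply: le_trans (ler_wpM2l _ (Bessel he n u)).
 rewrite mulr_sumr; apply: ler_sum => i _; rewrite powN_dot// exprMn.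
 rewrite ler_wpM2r ?sqr_ge0// lerXn2r ?nnegrE ?powR_ge0//; exact: powN_le.
by rewrite exprn_ge0// powR_ge0.
Qed.

Lemma powN_B s u v : 0 <= s ->
 pow mu e (- s) u - pow mu e (- s) v = pow mu e (- s) (u - v).
Proof. by move=> s0; rewrite (powND _ _ s0) -(scaleN1r v) (powNZ _ _ s0) scaleN1r. Qed.
End modes.

(** * Functions with continuous right derivative *)

Section one_sided.
Context (R : realType).
Implicit Types f g : R -> R.

(** Let [s] be the last time at which [f] lies below the line of slope [K + eps] through its value
    at [a]. If [s < b], the local bound at [s] produces a later such time. *)
Lemma slope_le f (a b K : R) : a <= b -> continuous f ->
 (forall t eps : R, a <= t < b -> 0 < eps -> exists2 dl : R, 0 < dl &
   forall x : R, 0 < x < dl -> f (t + x) - f t <= (K + eps) * x) ->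
 f b - f a <= K * (b - a).
Proof.
move=> ab cf H.
suff G eps : 0 < eps -> f b - f a <= (K + eps) * (b - a).
 apply/ler_addgt0Pr => eps eps0.
 have d0 : 0 < b - a + 1 by rewrite ltr_wpDl// subr_ge0.
 apply: le_trans (G (eps / (b - a + 1)) _) _; first exact: divr_gt0.
 rewrite mulrDl lerD2l [leLHS]mulrC; apply: mul_div_le => //; last exact: ltW.
  by rewrite subr_ge0.
 by rewrite lerDl.
move=> eps0; pose phi t := f t - f a - (K + eps) * (t - a).
have cphi : continuous phi.
 move=> t; apply: cvgB; first by apply: cvgB; [exact: cf|exact: cvg_cst].
 by apply: cvgM; [exact: cvg_cst|apply: cvgB; [exact: cvg_id|exact: cvg_cst]].
suff : phi b <= 0 by rewrite subr_le0.
rewrite leNgt; apply/negP => pb.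
pose A := [set t | a <= t <= b /\ phi t <= 0].
have Aa : A a by rewrite /A/= lexx ab /phi !subrr mulr0 subr0.
have hA : has_sup A by split; [exists a|exists b => t [/andP[_]]].
pose s := sup A.
have sa : a <= s by exact: (sup_upper_bound hA).
have sb : s <= b by apply: ge_sup; [exists a|move=> t [/andP[_]]].
have ps : phi s <= 0.
 rewrite leNgt; apply/negP => ps.
 have /nbhs_ballP[r /= r0 rP] : \forall t \near s, 0 < phi t.
  exact: (cvgr_gt _ (cphi s) _ ps).
 have [t At st] := sup_adherent r0 hA.
 have ts : t <= s by exact: (sup_upper_bound hA).
 have : 0 < phi t.
  apply: rP; rewrite /ball/= ger0_norm ?subr_ge0//; rewrite ltrBlDl -ltrBlDr.
  exact: st.
 by rewrite ltNge; case: At => _ ->.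
have slb : s < b by rewrite lt_neqAle sb andbT; apply/eqP => sbe; move: ps; rewrite sbe leNgt pb.
have sab : a <= s < b by rewrite sa.
have [dl dl0 dlP] := H s eps sab eps0.
pose x := Num.min (dl / 2) (b - s).
have x0 : 0 < x by rewrite lt_min divr_gt0//= subr_gt0.
have xd : x < dl by apply: (@le_lt_trans _ _ (dl / 2)); [by rewrite ge_min lexx|rewrite ltr_pdivrMr// ltr_pMr// ltr1n].
have xb : s + x <= b by rewrite -lerBrDl ge_min lexx orbT.
have fx : f (s + x) - f s <= (K + eps) * x by apply: dlP; rewrite x0.
have : A (s + x).
 split; first by rewrite xb (le_trans sa)// lerDl ltW.
 move: ps fx; rewrite /phi; lra.
by move=> /(sup_upper_bound hA); rewrite gerDl leNgt x0.
Qed.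

(** Generators provide right derivatives only. [slope_le] for [f] and for [- f], on either side of
    [t], bounds difference quotients by values of [g] near [t]; continuity of [g] then gives a
    two-sided derivative. *)
Lemma right_derive f g : continuous f -> continuous g ->
 (forall t : R, 0 <= t -> x^-1 * (f (t + x) - f t) @[x --> 0^'+] --> g t) ->
 forall t : R, 0 < t -> is_derive t 1 f (g t).
Proof.
move=> cf cg H t t0.
have up F G (a b K : R) : 0 <= a -> a <= b -> continuous F ->
  (forall t : R, 0 <= t -> x^-1 * (F (t + x) - F t) @[x --> 0^'+] --> (G t : R)) ->
  (forall t, a <= t < b -> G t <= K) -> F b - F a <= K * (b - a).
 move=> a0 ab cF HF GK; apply: slope_le => // u eps uab eps0.
 have u0 : 0 <= u by move/andP : uab => [au _]; exact: le_trans au.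
 have /cvgrPdist_le/(_ _ eps0)/nbhs_ballP[dl /= dl0 dlP] := HF u u0.
 exists dl => // x /andP[x0 xdl].
 have := dlP x; rewrite /ball/= sub0r normrN (gtr0_norm x0) => /(_ xdl x0).
 rewrite ler_norml => /andP[h1 _].
 have : x^-1 * (F (u + x) - F u) <= K + eps by have := GK u uab; lra.
 by rewrite ler_pdivrMl// mulrC.
have key eps : 0 < eps -> exists2 dl : R, 0 < dl & forall x : R, `|x| < dl ->
  `|f (t + x) - f t - g t * x| <= eps * `|x|.
 move=> eps0; have /cvgrPdist_le/(_ _ eps0)/nbhs_ballP[r /= r0 rP] := cg t.
 exists (Num.min r t); first by rewrite lt_min r0.
 move=> x; rewrite lt_min => /andP[xr xt].
 have gb s : `|s - t| < r -> g t - eps <= g s <= g t + eps.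
  by rewrite distrC => /rP /=; rewrite ler_norml; lra.
 have HN u : 0 <= u -> x^-1 * (- f (u + x) - - f u) @[x --> 0^'+] --> - g u.
  move=> u0; have -> : (fun x => x^-1 * (- f (u + x) - - f u)) =
    - (fun x => x^-1 * (f (u + x) - f u)).
   by apply/funext => y; rewrite -opprD mulrN.
  exact: (cvgN (H u u0)).
 have cN : continuous (fun u => - f u) by move=> u; apply: cvgN; exact: cf.
 case: (leP 0 x) => x0.
  have a1 : f (t + x) - f t <= (g t + eps) * (t + x - t).
   apply: (up f g) => //; [exact: ltW|by rewrite lerDl|].
   move=> s /andP[h1 h2]; have /gb/andP[g1 g2] : `|s - t| < r by rewrite ger0_norm ?subr_ge0//; move: xr; rewrite ger0_norm//; lra.
   lra.
  have a2 : - f (t + x) - - f t <= (- g t + eps) * (t + x - t).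
   apply: (up (fun u => - f u) (fun u => - g u)) => //; [exact: ltW|by rewrite lerDl|].
   move=> s /andP[h1 h2]; have /gb/andP[g1 g2] : `|s - t| < r by rewrite ger0_norm ?subr_ge0//; move: xr; rewrite ger0_norm//; lra.
   lra.
  by rewrite ler_norml (ger0_norm x0); move: a1 a2; rewrite !(addrC t) addrK; lra.
 have tx : 0 <= t + x by move: xt; rewrite ltr0_norm//; lra.
 have a1 : f t - f (t + x) <= (g t + eps) * (t - (t + x)).
  apply: (up f g) => //; first by rewrite gerDl ltW.
   move=> s /andP[h1 h2]; have /gb/andP[g1 g2] : `|s - t| < r by rewrite ltr0_norm ?subr_lt0//; move: xr; rewrite ltr0_norm//; lra.
   lra.
 have a2 : - f t - - f (t + x) <= (- g t + eps) * (t - (t + x)).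
  apply: (up (fun u => - f u) (fun u => - g u)) => //; first by rewrite gerDl ltW.
   move=> s /andP[h1 h2]; have /gb/andP[g1 g2] : `|s - t| < r by rewrite ltr0_norm ?subr_lt0//; move: xr; rewrite ltr0_norm//; lra.
   lra.
 by rewrite ler_norml (ltr0_norm x0); move: a1 a2; lra.
have lim : x^-1 *: (f (x *: 1 + t) - f t) @[x --> 0^'] --> g t.
 apply/cvgrPdist_le => eps eps0; have [dl dl0 dlP] := key eps eps0.
 near=> x.
 have x0 : x != 0 by near: x; exact: nbhs_dnbhs_neq.
 have xd : `|x| < dl.
  by near: x; apply: dnbhs0_lt.
 have -> : g t - x^-1 *: (f (x *: 1 + t) - f t) =
   - (x^-1 * (f (t + x) - f t - g t * x)).
  rewrite (_ : x%:A = x); last exact: mulr1.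
  by rewrite (addrC x) -[_ *: _]/(_ * _) [in RHS]mulrBr (mulrC (g t)) mulKf// [RHS]opprB.
 rewrite normrN normrM normfV ler_pdivrMl ?normr_gt0// [leRHS]mulrC; exact: dlP.
apply: DeriveDef; first by apply/cvg_ex; exists (g t).
exact: cvg_lim lim.
Unshelve. all: by end_near. Qed.

Lemma noninc_of_derive f g : continuous f ->
 (forall t : R, 0 < t -> is_derive t 1 f (g t)) -> (forall t : R, 0 < t -> g t <= 0) ->
 forall s t : R, 0 <= s -> s <= t -> f t <= f s.
Proof.
move=> cf df g0 s t s0; rewrite le_eqVlt => /predU1P[->//|st].
have pos x : x \in `]s, t[ -> 0 < x.
 by rewrite in_itv => /andP[sx _]; exact: le_lt_trans sx.
apply: (@ler0_derive1_nincr _ f s t).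
- by move=> x /pos x0; have [] := df x x0.
- by move=> x /pos x0; rewrite derive1E; have [_ ->] := df x x0; exact: g0.
- exact: continuous_subspaceT.
- exact: lexx.
- exact: ltW.
- exact: lexx.
Qed.
End one_sided.

(** * Strongly continuous semigroups: local boundedness and continuity of orbits *)

Section semigroup.
Context (R : realType) (m : nat).
Notation V := (Usp R m).
Notation H := (Hsp R m).

(** Convergence of Cauchy filters is the form of completeness that the Banach-Steinhaus theorem asks
    for. Centres of balls of radius [2^-n] that belong to the filter form a Cauchy sequence, and the
    filter converges to its limit. *)
Lemma Usp_complete (F : set_system V) : ProperFilter F -> cauchy F -> cvg F.
Proof.
move=> FF cF.
have sel (n : nat) : exists x : V, F (ball x (2^-1 ^+ n)).
 have [] := (cauchy_ballP F).2 cF (2^-1 ^+ n); first by rewrite exprn_gt0// invr_gt0.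
 move=> [A B] /= [FA FB] AB.
 have [x [Ax Bx]] := filter_ex (filterI FA FB).
 exists x; apply: filterS FB => y By; exact: (AB (x, y)).
pose x n := projT1 (cid (sel n)).
have xP n : F (ball (x n) (2^-1 ^+ n)) by rewrite /x; case: cid.
have small (eps : R) : 0 < eps -> exists N, 2 * (2^-1 ^+ N) <= eps.
 move=> e0.
 have h : (2^-1 ^+ n : R) @[n --> \oo] --> (0 : R).
  by apply: cvg_expr; rewrite ger0_norm// invf_lt1// ltr1n.
 have e1 : 0 < eps / 2 by rewrite divr_gt0.
 move/cvgrPdist_le/(_ _ e1) : h => [N _ /(_ N (leqnn N))] /=.
 rewrite sub0r normrN ger0_norm// => h.
 by exists N; rewrite mulrC -ler_pdivlMr.
have mono n N : (N <= n)%N -> (2^-1 : R) ^+ n <= 2^-1 ^+ N.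
 by move=> Nn; apply: ler_wiXn2l; rewrite// invf_le1// ler1n.
have [u xu] : exists u : V, x @ \oo --> u.
 apply: L2_complete => eps eps0; have [N NP] := small eps eps0.
 exists N => i j Ni Nj.
 have [y [iy jy]] := filter_ex (filterI (xP i) (xP j)).
 have -> : x i - x j = (x i - y) - (x j - y) by rewrite opprB addrA subrK.
 apply: le_trans (ler_normB _ _) _; apply: (le_trans _ NP).
 rewrite mulr_natl mulr2n; apply: lerD.
  by move: iy; rewrite -ball_normE => /ltW/le_trans; apply; exact: mono.
 by move: jy; rewrite -ball_normE => /ltW/le_trans; apply; exact: mono.
apply/cvg_ex; exists u; apply/cvg_ballP => eps eps0.
have e2 : 0 < eps / 4 by rewrite divr_gt0.
have [N NP] := small _ e2.
move/cvgrPdist_le/(_ _ e2) : xu => [N' _ N'P].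
pose n := maxn N N'.
apply: filterS (xP n) => y; rewrite -!ball_normE => xy.
have := N'P n (leq_maxr _ _) => /= un.
have -> : u - y = (u - x n) + (x n - y) by rewrite addrA subrK.
apply: le_lt_trans (ler_normD _ _) _.
have : `|x n - y| <= 2^-1 ^+ N by apply: le_trans (ltW xy) _; apply: mono; exact: leq_maxl.
lra.
Qed.
HB.instance Definition _ := Uniform_isComplete.Build V Usp_complete.

Variables (D : set H) (A : H -> H) (S : R -> H -> H) (hS : generates D A S).

Lemma S_linear t : 0 <= t -> linear (S t).
Proof. by move=> t0; have [/(_ t t0)[]] := hS. Qed.

Lemma SD t x y : 0 <= t -> S t (x + y) = S t x + S t y.
Proof. by move=> t0; have := S_linear t0 1 x y; rewrite !scale1r. Qed.

Lemma S0 t : 0 <= t -> S t 0 = 0.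
Proof. by move=> t0; apply: (@addrI _ (S t 0)); rewrite -SD// !addr0. Qed.

Lemma SZ t a x : 0 <= t -> S t (a *: x) = a *: S t x.
Proof. by move=> t0; have := S_linear t0 a x 0; rewrite S0// !addr0. Qed.

Lemma SB t x y : 0 <= t -> S t (x - y) = S t x - S t y.
Proof. by move=> t0; rewrite SD// -scaleN1r SZ// scaleN1r. Qed.

Lemma S_sum t I (r : seq I) (Q : pred I) (F : I -> H) : 0 <= t ->
 S t (\sum_(i <- r | Q i) F i) = \sum_(i <- r | Q i) S t (F i).
Proof.
by move=> t0; apply: (big_morph (S t)) => [x y|]; [exact: SD|exact: S0].
Qed.

Lemma S_cont t : 0 <= t -> continuous (S t).
Proof. by move=> t0; have [/(_ t t0)[]] := hS. Qed.

Lemma S_add s t x : 0 <= s -> 0 <= t -> S (s + t) x = S s (S t x).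
Proof. by move=> s0 t0; have [_ _ h _ _] := hS; exact: h. Qed.

Lemma S_id x : S 0 x = x. Proof. by have [] := hS. Qed.

Lemma linear_bounded (W : normedModType R) (f : V -> W) : linear f -> continuous f ->
 bounded_fun_norm f.
Proof.
move=> lf cf r.
have f0 : f 0 = 0 by apply: (@addrI _ (f 0)); have := lf 1 0 0; rewrite !scale1r !addr0 => <-.
have /cvgrPdist_le/(_ _ ltr01)/nbhs_ballP[dl /= dl0 dlP] := cf 0.
have fZ a x : f (a *: x) = a *: f x by have := lf a x 0; rewrite f0 !addr0.
pose k := dl / (2 * (`|r| + 1)).
have k0 : 0 < k by rewrite divr_gt0.
exists k^-1 => x xr.
have : `|f (k *: x)| <= 1.
 have := dlP (k *: x); rewrite -ball_normE/= sub0r normrN f0 sub0r normrN; apply.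
 rewrite normrZ gtr0_norm// mulrAC ltr_pdivrMr// ltr_pM2l//.
 have := ler_norm r; have := normr_ge0 x; lra.
by rewrite fZ normrZ gtr0_norm// mulrC -ler_pdivlMr// mul1r.
Qed.

(** Otherwise there are times [t n <= 1 / (n + 1)] at which the operator norm exceeds [n]. Strong
    continuity at 0 bounds every orbit along these times, which contradicts the uniform boundedness
    principle. *)
Lemma S_bounded_near0 : exists dl M : R, [/\ 0 < dl, 0 <= M &
 forall t x, 0 <= t -> t <= dl -> `|S t x| <= M * `|x|].
Proof.
(* The principle is applied on the complete space [V]; the two coordinate embeddings of [V] into [H]
   cover the product. *)
suff G (i : V -> H) : linear i -> continuous i -> exists dl M : R, [/\ 0 < dl, 0 <= M &
  forall t u, 0 <= t -> t <= dl -> `|S t (i u)| <= M * `|u|].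
 have [||d1 [M1 [d10 M10 H1]]] := G (fun u => (u, 0)).
  by move=> a u v; congr pair; rewrite /= scaler0 addr0.
  apply: (@lip_continuous _ _ _ _ 1) => u v.
  by rewrite mul1r prod_normE /= subrr normr0 ge_max lexx normr_ge0.
 have [||d2 [M2 [d20 M20 H2]]] := G (fun u => (0, u)).
  by move=> a u v; congr pair; rewrite /= scaler0 addr0.
  apply: (@lip_continuous _ _ _ _ 1) => u v.
  by rewrite mul1r prod_normE /= subrr normr0 ge_max lexx normr_ge0.
 exists (Num.min d1 d2), (M1 + M2); split; [by rewrite lt_min d10|exact: addr_ge0|].
 move=> t x t0; rewrite le_min => /andP[t1 t2].
 have -> : x = (x.1, 0) + (0, x.2) by case: x => a b; congr pair; rewrite /= ?addr0 ?add0r.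
 rewrite SD// mulrDl; apply: le_trans (ler_normD _ _) _.
 have -> : (x.1, 0) + (0, x.2) = x :> H by case: x => a b; congr pair; rewrite /= ?addr0 ?add0r.
 apply: lerD.
  by apply: le_trans (H1 _ _ t0 t1) _; apply: ler_wpM2l => //; rewrite [leRHS]prod_normE le_max lexx.
 by apply: le_trans (H2 _ _ t0 t2) _; apply: ler_wpM2l => //; rewrite [leRHS]prod_normE le_max lexx orbT.
move=> li ci; apply: contrapT => bad.
have sel (n : nat) : exists t : R, exists u : V,
  [/\ 0 <= t, t <= n.+1%:R^-1 & n%:R * `|u| < `|S t (i u)|].
 apply: contrapT => h; apply: bad; exists n.+1%:R^-1, n%:R; split => //.
 move=> t u t0 tn; rewrite leNgt; apply/negP => hu; apply: h.
 by exists t, u.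
pose t n := projT1 (cid (sel n)).
have tP n : exists u : V, [/\ 0 <= t n, t n <= n.+1%:R^-1 & n%:R * `|u| < `|S (t n) (i u)|].
 by rewrite /t; case: cid.
have t0 n : 0 <= t n by have [u []] := tP n.
have cS n : continuous (S (t n) \o i).
 by move=> u; apply: continuous_comp; [exact: ci|exact: S_cont].
have lS n : linear (S (t n) \o i).
 by move=> a u v; rewrite /= li S_linear.
have [||M MP] := @Banach_Steinhauss R V H [set S (t n) \o i | n in [set: nat]] _ _ 1.
- move=> _ [n _ <-]; split; [exact: linear_bounded (lS n) (cS n)|exact: lS].
- move=> u.
 have [_ _ _ sc _] := hS.
 have /cvgrPdist_le/(_ _ ltr01)/nbhs_ballP[dl /= dl0 dlP] := sc (i u).
 have [N NP] : exists N : nat, forall n, (N <= n)%N -> n.+1%:R^-1 < dl.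
  exists (Num.truncn dl^-1) => n Nn.
  rewrite invf_plt ?posrE//; apply: lt_le_trans (truncnS_gt _) _.
  by rewrite ler_nat ltnS.
 have big n : (N <= n)%N -> `|S (t n) (i u)| <= 1 + `|i u|.
  move=> Nn; have : `|i u - S (t n) (i u)| <= 1.
   have := t0 n; rewrite le_eqVlt => /predU1P[<-|tn0].
    by rewrite S_id subrr normr0.
   apply: dlP => //; rewrite -ball_normE/= sub0r normrN gtr0_norm//.
   by have [w [_ h _]] := tP n; apply: le_lt_trans h (NP _ Nn).
  move=> h; rewrite -[S _ _](subrK (i u)).
  apply: le_trans (ler_normD _ _) _; rewrite lerD2r distrC//.
 exists (1 + `|i u| + \sum_(k < N) `|S (t k) (i u)|) => _ [n _ <-] /=.
 case: (ltnP n N) => nN.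
  rewrite (bigD1 (Ordinal nN))//= addrCA lerDl addr_ge0////.
  exact: sumr_ge0.
 by apply: le_trans (big n nN) _; rewrite lerDl sumr_ge0.
pose n := (Num.truncn `|M|).+1.
have [u [_ _ hu]] := tP n.
have u0 : 0 < `|u|.
 rewrite lt_neqAle normr_ge0 andbT eq_sym normr_eq0; apply/eqP => u0.
 move: hu; have -> : S (t n) (i u) = (S (t n) \o i) 0 by rewrite u0.
 have -> : (S (t n) \o i) 0 = 0.
  by apply: (@addrI _ ((S (t n) \o i) 0)); have := lS n 1 0 0; rewrite !scale1r !addr0 => <-.
 by rewrite u0 !normr0 mulr0 ltxx.
have := MP (S (t n) \o i) (ex_intro2 _ _ n I erefl) (`|u|^-1 *: u).
rewrite normrZ normfV normr_id mulVf ?gt_eqF// => /(_ (lexx _)).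
have -> : (S (t n) \o i) (`|u|^-1 *: u) = `|u|^-1 *: S (t n) (i u).
 have := lS n `|u|^-1 u 0; rewrite addr0 => ->; rewrite /=.
 have -> : S (t n) (i 0) = 0.
  by apply: (@addrI _ (S (t n) (i 0))); have := lS n 1 0 0; rewrite /= !scale1r !addr0 => <-.
 by rewrite addr0.
rewrite normrZ normfV normr_id ler_pdivrMl// mulrC => h.
have := lt_le_trans hu h; rewrite ltr_pM2r// ltNge => /negP; apply.
by apply: le_trans (ler_norm M) _; exact: ltW (truncnS_gt _).
Qed.

(** Orbits are extended evenly to negative times, so that continuity and derivatives can be treated
    on the whole line. Right continuity follows from the semigroup law; left continuity needs the
    bound near 0. *)
Lemma S_strong x : continuous (fun t : R => S `|t| x).
Proof.
have [_ _ _ sc _] := hS.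
have [dl [M [dl0 M0 SM]]] := S_bounded_near0.
have rc y (eps : R) : 0 < eps -> exists2 r : R, 0 < r & forall s, 0 <= s -> s < r -> `|S s y - y| <= eps.
 move=> e0; have /cvgrPdist_le/(_ _ e0)/nbhs_ballP[r /= r0 rP] := sc y.
 exists r => // s; rewrite le_eqVlt => /predU1P[<-|s0] sr.
  by rewrite S_id subrr normr0 ltW.
 by rewrite distrC; apply: rP => //; rewrite -ball_normE/= sub0r normrN gtr0_norm.
(* S_t x - S_(t-k) x = S_(t-s) S_(s-k) (S_k x - x) with s = min t dl *)
have key t (eps : R) : 0 <= t -> 0 < eps -> exists2 r : R, 0 < r & forall s, 0 <= s -> `|s - t| < r ->
  `|S s x - S t x| <= eps.
 move=> t0 e0.
 have [r1 r10 R1] := rc (S t x) eps e0.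
 pose s0 := Num.min t dl.
 have ts0 : 0 <= t - s0 by rewrite subr_ge0 ge_min lexx.
 have ct0 : continuous (S (t - s0)) by exact: S_cont.
 have /cvgrPdist_le/(_ _ e0)/nbhs_ballP[r2 /= r20 R2] := ct0 0.
 have e1 : 0 < r2 / (M + 1) / 2 by rewrite !divr_gt0// ltr_wpDl.
 have [r3 r30 R3] := rc x _ e1.
 have [t1|tp] := eqVneq t 0.
  exists r1 => // s s1; rewrite t1 subr0 ger0_norm// S_id => sr.
  by have := R1 s s1 sr; rewrite t1 S_id.
 have tgt : 0 < t by rewrite lt_neqAle eq_sym tp.
 exists (Num.min (Num.min r1 r3) s0); first by rewrite !lt_min r10 r30 tgt dl0.
 move=> s s1; rewrite !lt_min => /andP[/andP[sr1 sr3] /andP[st sd]].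
 case: (leP t s) => ts.
  have ks : 0 <= s - t by rewrite subr_ge0.
  by rewrite -{1}(subrK t s) S_add//; apply: R1 => //; move: sr1; rewrite ger0_norm.
 have k0 : 0 <= t - s by rewrite subr_ge0 ltW.
 have kE : `|s - t| = t - s by rewrite ltr0_norm ?subr_lt0// opprB.
 have ks0 : 0 <= s0 - (t - s).
  by rewrite subr_ge0 le_min; rewrite kE in st sd; rewrite (ltW st) (ltW sd).
 have e2 : s = (t - s0) + (s0 - (t - s)) by lra.
 have e3 : t = (t - s0) + ((s0 - (t - s)) + (t - s)) by lra.
 have -> : S t x = S (t - s0) (S (s0 - (t - s)) (S (t - s) x)).
  by rewrite {1}e3 (S_add x ts0 (addr_ge0 ks0 k0)) (S_add x ks0 k0).
 have -> : S s x = S (t - s0) (S (s0 - (t - s)) x) by rewrite {1}e2 (S_add x ts0 ks0).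
 rewrite -SB// -SB//.
 have := R2 (S (s0 - (t - s)) (x - S (t - s) x)).
 rewrite S0// sub0r normrN; apply; rewrite -ball_normE/= sub0r normrN.
 apply: le_lt_trans (SM _ _ ks0 _) _; first by rewrite lerBlDl ler_wpDl// ge_min lexx orbT.
 have : `|x - S (t - s) x| <= r2 / (M + 1) / 2.
  by rewrite distrC; apply: R3 => //; rewrite -kE.
 move=> h; apply: (@le_lt_trans _ _ (r2 / 2)); last by rewrite ltr_pdivrMr// ltr_pMr// ltr1n.
 apply: le_trans (ler_wpM2l M0 h) _; rewrite [r2 / _ / _]mulrAC.
 apply: mul_div_le => //; first by rewrite lerDl.
  by rewrite ltr_wpDl.
 by rewrite divr_ge0// ltW.
move=> t; apply/cvgrPdist_le => eps e0.
have [r r0 rP] := key `|t| eps (normr_ge0 t) e0.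
apply/nbhs_ballP; exists r => //= s ts; rewrite distrC; apply: rP => //.
apply: le_lt_trans ts.
by rewrite distrC; exact: ler_dist_dist.
Qed.
End semigroup.

(** * The damped oscillator: energy, decay, and smallness of the off-diagonal entry *)

Section oscillator.
Context (R : realType).
Implicit Types w d r : R.

(** With [y1] a position and [y2] minus a velocity this is the oscillator of frequency [w] and
    damping [d]. The same system is satisfied by every row of the matrix of the semigroup on a mode
    ([row_osc]) and by the coordinates of an orbit ([osc_S]). Derivatives are asked for [t > 0]
    only, since orbits are extended evenly. *)
Definition osc w d (y1 y2 : R -> R) := [/\ continuous y1, continuous y2,
 forall t : R, 0 < t -> is_derive t (1 : R) y1 (- w * y2 t) &
 forall t : R, 0 < t -> is_derive t (1 : R) y2 (w * y1 t - d * y2 t)].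

Lemma osc_lin w d y1 y2 z1 z2 a b : osc w d y1 y2 -> osc w d z1 z2 ->
 osc w d (fun t => a * y1 t + b * z1 t) (fun t => a * y2 t + b * z2 t).
Proof.
move=> [c1 c2 d1 d2] [c3 c4 d3 d4]; split.
- by move=> t; apply: cvgD; apply: cvgM; [exact: cvg_cst|exact: c1|exact: cvg_cst|exact: c3].
- by move=> t; apply: cvgD; apply: cvgM; [exact: cvg_cst|exact: c2|exact: cvg_cst|exact: c4].
- move=> t t0; have h1 := d1 t t0; have h3 := d3 t t0.
 apply: is_derive_eq; rewrite /= /GRing.scale /=; ring.
- move=> t t0; have h1 := d2 t t0; have h3 := d4 t t0.
 apply: is_derive_eq; rewrite /= /GRing.scale /=; ring.
Qed.

Lemma osc_energy w d y1 y2 : 0 <= d -> osc w d y1 y2 ->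
 forall s t : R, 0 <= s -> s <= t ->
 y1 t ^+ 2 + y2 t ^+ 2 <= y1 s ^+ 2 + y2 s ^+ 2.
Proof.
move=> d0 [c1 c2 d1 d2].
apply: (@noninc_of_derive _ (fun t => y1 t ^+ 2 + y2 t ^+ 2)
 (fun t => - (2 * d * y2 t ^+ 2))).
- by move=> t; apply: cvgD; rewrite expr2; apply: cvgM; [exact: c1|exact: c1|exact: c2|exact: c2].
- move=> t t0; have h1 := d1 t t0; have h2 := d2 t t0.
 apply: is_derive_eq; rewrite /= /GRing.scale /=; ring.
- by move=> t t0; rewrite oppr_le0; apply: mulr_ge0; [exact: mulr_ge0|exact: sqr_ge0].
Qed.

Lemma osc_unique w d y1 y2 : 0 <= d -> osc w d y1 y2 -> y1 0 = 0 -> y2 0 = 0 ->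
 forall t : R, 0 <= t -> y1 t = 0 /\ y2 t = 0.
Proof.
move=> d0 o y10 y20 t t0.
have := osc_energy d0 o (lexx 0) t0; rewrite y10 y20 expr0n/= addr0 => h.
have h1 := sqr_ge0 (y1 t); have h2 := sqr_ge0 (y2 t).
by split; apply/eqP; rewrite -sqrf_eq0 eq_le ?h1 ?h2 andbT; lra.
Qed.

Lemma amgm_form (A B c a b : R) : 0 <= A -> 0 <= B -> c ^+ 2 <= A * B ->
 2 * c * (a * b) <= A * a ^+ 2 + B * b ^+ 2.
Proof.
move=> A0 B0 cAB; have h0 : 0 <= A * a ^+ 2 + B * b ^+ 2.
 by rewrite addr_ge0// mulr_ge0// sqr_ge0.
apply: le_trans (ler_norm _) _; rewrite -ler_sqr// real_normK ?num_real//.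
have h1 : 0 <= (A * a ^+ 2 - B * b ^+ 2) ^+ 2 by exact: sqr_ge0.
have h2 : c ^+ 2 * (a * b) ^+ 2 <= A * B * (a * b) ^+ 2 by rewrite ler_wpM2r// sqr_ge0.
move: h1 h2; rewrite !exprMn !expr2; lra.
Qed.

(* Lyapunov function y1^2 + y2^2 - 2 eta y1 y2, with eta = r / w. *)
Lemma osc_decay w d r y1 y2 : 0 < w -> 0 < d -> 0 <= r ->
 r <= w / 2 -> r <= d / 4 -> 2 * r * d <= w ^+ 2 ->
 osc w d y1 y2 -> forall t : R, 0 <= t ->
 y1 t ^+ 2 + y2 t ^+ 2 <= 4 * expR (- (r / 2 * t)) * (y1 0 ^+ 2 + y2 0 ^+ 2).
Proof.
move=> w0 d0 r0 rw rd rwd [c1 c2 d1 d2] t t0.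
pose eta := r / w; have eta0 : 0 <= eta by rewrite divr_ge0// ltW.
have etaw : eta * w = r by rewrite mulfVK ?gt_eqF.
have eta2 : eta <= 2^-1 by rewrite /eta ler_pdivrMr// mulrC.
pose L t := y1 t ^+ 2 + y2 t ^+ 2 - 2 * eta * (y1 t * y2 t).
have cross a b : 2 * eta * (a * b) <= (a ^+ 2 + b ^+ 2) / 2 /\
  - ((a ^+ 2 + b ^+ 2) / 2) <= 2 * eta * (a * b).
 have h1 : 0 <= (a - b) ^+ 2 by exact: sqr_ge0.
 have h2 : 0 <= (a + b) ^+ 2 by exact: sqr_ge0.
 have h3 : `|2 * (a * b)| <= a ^+ 2 + b ^+ 2.
  by rewrite ler_norml; move: h1 h2; rewrite !expr2; lra.
 have : `|2 * eta * (a * b)| <= (a ^+ 2 + b ^+ 2) / 2.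
  have -> : 2 * eta * (a * b) = eta * (2 * (a * b)) by ring.
  rewrite normrM (ger0_norm eta0) [leRHS]mulrC; exact: ler_pM.
 by rewrite ler_norml => /andP[? ?].
pose G t := expR (r / 2 * t) * L t.
pose dL t := - (2 * (d - r)) * y2 t ^+ 2 - 2 * r * y1 t ^+ 2 + 2 * eta * d * (y1 t * y2 t).
have dLP (s : R) : 0 < s -> is_derive s (1 : R) L (dL s).
 move=> s0; have h1 := d1 s s0; have h2 := d2 s s0.
 apply: is_derive_eq; rewrite /= /GRing.scale /= /dL -etaw; ring.
have eta_d : (eta * d) ^+ 2 <= r * d / 2.
 have -> : (eta * d) ^+ 2 = r * d * (r * d / w ^+ 2) by rewrite /eta; field; rewrite gt_eqF.
 apply: ler_wpM2l; first by rewrite mulr_ge0// ltW.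
 by rewrite ler_pdivrMr ?exprn_gt0// mulrC; move: rwd; lra.
have dLle (s : R) : dL s + r / 2 * L s <= 0.
 have [c3 c4] := cross (y1 s) (y2 s).
 have am : 2 * eta * d * (y1 s * y2 s) <= r * y1 s ^+ 2 + d / 2 * y2 s ^+ 2.
  rewrite -[2 * eta * d]mulrA; apply: amgm_form => //; first by rewrite divr_ge0// ltW.
  lra.
 have p1 : 0 <= r * y1 s ^+ 2 by rewrite mulr_ge0// sqr_ge0.
 have p2 : r * y2 s ^+ 2 <= d / 4 * y2 s ^+ 2 by rewrite ler_wpM2r// sqr_ge0.
 have p3 : r / 2 * L s <= r / 2 * (3 / 2 * (y1 s ^+ 2 + y2 s ^+ 2)).
  by apply: ler_wpM2l; [rewrite divr_ge0|rewrite /L; lra].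
 have p4 : 0 <= d * y2 s ^+ 2 by rewrite mulr_ge0 ?sqr_ge0// ltW.
 rewrite /dL; lra.
have GP (s : R) : 0 < s -> is_derive s (1 : R) G (expR (r / 2 * s) * (dL s + r / 2 * L s)).
 move=> s0; have h := dLP s s0.
 apply: is_derive_eq; rewrite /= /GRing.scale /=; ring.
have cG : continuous G.
 move=> s; apply: cvgM.
  by apply: continuous_comp; [apply: cvgM; [exact: cvg_cst|exact: cvg_id]|exact: continuous_expR].
 apply: cvgB; last by apply: cvgM; [exact: cvg_cst|apply: cvgM; [exact: c1|exact: c2]].
 by apply: cvgD; rewrite expr2; apply: cvgM; [exact: c1|exact: c1|exact: c2|exact: c2].
have := noninc_of_derive cG GP _ (lexx 0) t0.
have neg (s : R) : 0 < s -> expR (r / 2 * s) * (dL s + r / 2 * L s) <= 0.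
 by move=> _; rewrite pmulr_rle0 ?expR_gt0.
move=> /(_ neg); rewrite /G mulr0 expR0 mul1r.
have [_ c4] := cross (y1 0) (y2 0); have [c3 _] := cross (y1 t) (y2 t).
have E0 : 0 < expR (r / 2 * t) by exact: expR_gt0.
move=> h; rewrite expRN mulrAC ler_pdivlMr// mulrC.
apply: (@le_trans _ _ (expR (r / 2 * t) * (2 * L t))).
 by apply: ler_wpM2l; [exact: ltW|rewrite /L; lra].
have l0 : L 0 <= 3 / 2 * (y1 0 ^+ 2 + y2 0 ^+ 2) by rewrite /L; lra.
have s1 := sqr_ge0 (y1 0); have s2 := sqr_ge0 (y2 0).
lra.
Qed.

Lemma osc_decay_each w d r y1 y2 : 0 < w -> 0 < d -> 0 <= r ->
 r <= w / 2 -> r <= d / 4 -> 2 * r * d <= w ^+ 2 ->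
 osc w d y1 y2 -> y1 0 ^+ 2 + y2 0 ^+ 2 <= 1 -> forall t : R, 0 <= t ->
 `|y1 t| <= 2 * expR (- (r / 4 * t)) /\ `|y2 t| <= 2 * expR (- (r / 4 * t)).
Proof.
move=> w0 d0 r0 rw rd rwd o y0 t t0.
have := osc_decay w0 d0 r0 rw rd rwd o t0.
have e0 : 0 < expR (- (r / 2 * t)) by exact: expR_gt0.
have e1 : 4 * expR (- (r / 2 * t)) * (y1 0 ^+ 2 + y2 0 ^+ 2) <= 4 * expR (- (r / 2 * t)).
 by rewrite ger_pMr// mulr_gt0.
have e2 : 4 * expR (- (r / 2 * t)) = (2 * expR (- (r / 4 * t))) ^+ 2.
 rewrite exprMn -expRM_natl; congr (_ * expR _); first by rewrite expr2; lra.
 lra.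
have s1 := sqr_ge0 (y1 t); have s2 := sqr_ge0 (y2 t).
have e3 : 0 <= 2 * expR (- (r / 4 * t)) by rewrite mulr_ge0// expR_ge0.
move=> h; split; rewrite -ler_sqr// real_normK ?num_real// -e2; lra.
Qed.

(* (y2 e^(d t))' = w y1 e^(d t) with |y1| <= 2 e^(- r t / 4). *)
Lemma osc_small w d r y1 y2 : 0 < w -> 0 < d -> 0 <= r ->
 r <= w / 2 -> r <= d / 4 -> 2 * r * d <= w ^+ 2 ->
 osc w d y1 y2 -> y1 0 ^+ 2 <= 1 -> y2 0 = 0 -> forall t : R, 0 <= t ->
 `|y2 t| <= 2 * w * t * expR (- (r / 4 * t)) /\ `|y2 t| <= 4 * (w / d) * expR (- (r / 4 * t)).
Proof.
move=> w0 d0 r0 rw rd rwd o y10 y20 t t0.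
have y1e (s : R) : 0 <= s -> `|y1 s| <= 2 * expR (- (r / 4 * s)).
 move=> s0; have [|//] := osc_decay_each w0 d0 r0 rw rd rwd o _ s0.
 by rewrite y20 expr0n addr0.
case: o => [c1 c2 d1 d2].
pose k := d - r / 4.
have k0 : 0 < k by rewrite /k; lra.
have kd : d / 2 <= k by rewrite /k; lra.
have ekE s : expR (- (r / 4 * s)) * expR (d * s) = expR (k * s).
 by rewrite -expRD /k; congr expR; ring.
have cont_exp a : continuous (fun s : R => expR (a * s)).
 by move=> s; apply: continuous_comp; [apply: cvgM; [exact: cvg_cst|exact: cvg_id]|exact: continuous_expR].
have gen (g dg : R -> R) : continuous g -> (forall s : R, 0 < s -> is_derive s (1 : R) g (dg s)) ->
  (forall s, 0 < s -> 2 * w * expR (k * s) <= dg s) -> 0 <= g 0 ->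
  `|y2 t| * expR (d * t) <= g t.
 move=> cg dgP dgl g0.
 have one (sg : R) : `|sg| = 1 -> sg * y2 t * expR (d * t) <= g t.
  move=> s1; rewrite -subr_le0.
  pose f s := sg * y2 s * expR (d * s) - g s.
  pose df s := sg * (w * y1 s) * expR (d * s) - dg s.
  have dfP (s : R) : 0 < s -> is_derive s (1 : R) f (df s).
   move=> s0; have h2 := d2 s s0; have h3 := dgP s s0.
   apply: is_derive_eq; rewrite /= /GRing.scale /= /df; ring.
  have cf : continuous f.
   move=> s; apply: cvgB; last exact: cg.
   by apply: cvgM; [apply: cvgM; [exact: cvg_cst|exact: c2]|exact: cont_exp].
  have df0 (s : R) : 0 < s -> df s <= 0.
   move=> s0; rewrite subr_le0; apply: le_trans (dgl s s0).
   rewrite -ekE [leRHS]mulrA ler_pM2r ?expR_gt0//; apply: le_trans (ler_norm _) _.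
   rewrite normrM s1 mul1r normrM (gtr0_norm w0) [2 * w]mulrC -[leRHS]mulrA.
   apply: ler_wpM2l; first exact: ltW.
   exact: (y1e s (ltW s0)).
  have := noninc_of_derive cf dfP df0 (lexx 0) t0.
  by move/le_trans; apply; rewrite /f y20 mulr0 mul0r sub0r oppr_le0.
 case: (leP 0 (y2 t)) => h.
  by rewrite ger0_norm// -[y2 t]mul1r; apply: one; exact: normr1.
 by rewrite ltr0_norm// -mulN1r; apply: one; rewrite normrN1.
have fin a : `|y2 t| * expR (d * t) <= a * expR (k * t) -> `|y2 t| <= a * expR (- (r / 4 * t)).
 by rewrite -ekE mulrA ler_pM2r ?expR_gt0.
split; apply: fin.
 apply: (gen (fun s => 2 * w * s * expR (k * s))
  (fun s => 2 * w * expR (k * s) + 2 * w * s * (k * expR (k * s)))).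
 - move=> s; apply: cvgM; last exact: cont_exp.
  by apply: cvgM; [exact: cvg_cst|exact: cvg_id].
 - move=> s s0; apply: is_derive_eq; rewrite /= /GRing.scale /=; ring.
 - by move=> s s0; rewrite lerDl !mulr_ge0// ltW.
 - lra.
apply: (@le_trans _ _ (2 * w / k * expR (k * t))); last first.
 rewrite ler_pM2r ?expR_gt0// ler_pdivrMr//.
 have -> : 2 * w = 4 * (w / d) * (d / 2) by field; rewrite gt_eqF.
 by apply: ler_wpM2l => //; rewrite mulr_ge0// divr_ge0// ltW.
apply: (gen (fun s => 2 * w / k * expR (k * s)) (fun s => 2 * w / k * (k * expR (k * s)))).
- by move=> s; apply: cvgM; [exact: cvg_cst|exact: cont_exp].
- move=> s s0; apply: is_derive_eq; rewrite /= /GRing.scale /=; ring.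
- by move=> s s0; rewrite mulrA mulfVK ?gt_eqF.
- by rewrite mulr_ge0// divr_ge0 ?mulr_ge0// ltW.
Qed.
End oscillator.

(** * The semigroup on the modes, its contractivity and its decay *)

Section mode_semigroup.
Context (R : realType) (m : nat) (mu : nat -> R) (e : nat -> Usp R m)
 (he : orthogonal_basis e) (mu0 : forall n, 0 < mu n) (muS : {homo mu : i j / (i <= j)%N >-> i <= j}) (rho alpha : R)
 (rho0 : 0 < rho) (alpha01 : 0 < alpha < 1).
Notation V := (Usp R m).
Notation H := (Hsp R m).
Notation h n := (unitv e n).
Variables (S : R -> H -> H) (hS : generates (domA mu e rho alpha) (opA mu e rho alpha) S).

Definition frq n := mu n `^ (1 / 2).
Definition damp n := rho * mu n `^ alpha.
Definition cx n (z : H) := dot z.1 (h n).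
Definition cv n (z : H) := dot z.2 (h n).
Definition em n a b : H := (a *: h n, b *: h n).
Notation w := frq.
Notation d := damp.

Lemma frq_gt0 n : 0 < w n. Proof. exact: powR_gt0. Qed.
Lemma damp_gt0 n : 0 < d n. Proof. by rewrite mulr_gt0// powR_gt0. Qed.

Lemma frq_sqr n : w n ^+ 2 = mu n.
Proof.
rewrite expr2 -powRD; last by rewrite (gt_eqF (mu0 n)) implybT.
by rewrite -splitr powRr1// ltW.
Qed.

Lemma scaler_comb (u : V) a b c : a *: u + b *: (c *: u) = (a + b * c) *: u.
Proof. by rewrite scalerA scalerDl. Qed.

Lemma domA_em n a b : domA mu e rho alpha (em n a b).
Proof.
split; first by have [] := pow_mode mu he (1 / 2) b n.
rewrite /=; have [_ ->] := pow_mode mu he (alpha - 1 / 2) b n.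
by rewrite scaler_comb; have [] := pow_mode mu he (1 / 2) (a + rho * (mu n `^ (alpha - 1 / 2) * b)) n.
Qed.

Lemma opA_em n a b :
 opA mu e rho alpha (em n a b) = em n (w n * b) (- (w n * a + d n * b)).
Proof.
rewrite /opA /=; have [_ ->] := pow_mode mu he (1 / 2) b n.
have [_ ->] := pow_mode mu he (alpha - 1 / 2) b n.
rewrite scaler_comb; have [_ ->] := pow_mode mu he (1 / 2) (a + rho * (mu n `^ (alpha - 1 / 2) * b)) n.
rewrite -scaleNr; congr (_, - _ *: _); rewrite mulrDr; congr (_ + _).
have -> : d n = w n * (rho * mu n `^ (alpha - 1 / 2)).
 rewrite mulrCA -powRD ?(gt_eqF (mu0 n)) ?implybT//; congr (_ * _ `^ _); ring.
by rewrite !mulrA.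
Qed.

Lemma emD n a b a' b' : em n a b + em n a' b' = em n (a + a') (b + b').
Proof. by rewrite /em; congr pair; rewrite /= -scalerDl. Qed.

Lemma emZ n c a b : c *: em n a b = em n (c * a) (c * b).
Proof. by rewrite /em; congr pair; rewrite /= scalerA. Qed.

Definition functional (l : H -> R) := [/\ forall x y, l (x + y) = l x + l y,
 forall a x, l (a *: x) = a * l x & continuous (l : H -> R^o)].

Lemma functional_cx n : functional (cx n).
Proof.
split=> [x y|a x|]; [exact: dotDl|exact: dotZl|].
move=> x; apply: (@continuous_comp _ _ _ (fun z : H => z.1) (fun u => dot u (h n) : R^o)).
 exact: cvg_fst.
exact: dot_continuous.
Qed.

Lemma functional_cv n : functional (cv n).
Proof.
split=> [x y|a x|]; [exact: dotDl|exact: dotZl|].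
move=> x; apply: (@continuous_comp _ _ _ (fun z : H => z.2) (fun u => dot u (h n) : R^o)).
 exact: cvg_snd.
exact: dot_continuous.
Qed.

Lemma functional_S l t : 0 <= t -> functional l -> functional (l \o S t).
Proof.
move=> t0 [l1 l2 l3]; split=> [x y|a x|].
- by rewrite /= (SD hS)// l1.
- by rewrite /= (SZ hS)// l2.
- by move=> x; apply: continuous_comp; [exact: (S_cont hS)|exact: l3].
Qed.

Lemma orbit_cont l z : functional l -> continuous (fun t : R => l (S `|t| z)).
Proof.
move=> [_ _ cl] t.
apply: (@continuous_comp _ _ _ (fun t : R => S `|t| z) (l : H -> R^o)).
 exact: (S_strong hS).
exact: cl.
Qed.

Lemma orbit_derive l z : functional l -> domA mu e rho alpha z ->
 forall t : R, 0 < t ->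
 is_derive t (1 : R) (fun t : R => l (S `|t| z)) (l (S `|t| (opA mu e rho alpha z))).
Proof.
move=> fl Dz; apply: right_derive.
- exact: orbit_cont.
- exact: orbit_cont.
move=> t t0; rewrite (ger0_norm t0).
have [_ _ _ _ [_ gen]] := hS.
have [l1 l2 cl] := functional_S t0 fl.
have lim : l (S t (x^-1 *: (S x z - z))) @[x --> (0 : R)^'+] --> l (S t (opA mu e rho alpha z)).
 exact: (cvg_comp _ _ (gen z Dz) (cl _)).
apply: cvg_trans lim; apply: near_eq_cvg; near=> x.
rewrite ger0_norm ?addr_ge0////.
have -> : S (t + x) z = S t (S x z) by apply: (S_add hS) => //; exact: ltW.
have := l2 x^-1 (S x z - z); rewrite /= => ->; congr (_ * _).
have := l1 (S x z) (- z); rewrite /= => ->; congr (_ + _).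
by have := l2 (-1) z; rewrite scaleN1r mulN1r.
Unshelve. all: by end_near. Qed.

(** The derivative of the orbit of [z] is the orbit of [A z]: the generator acts on the initial mode
    vector, where it is explicit, and never on the orbit. For a fixed functional the two initial
    vectors therefore form a closed system. *)
Lemma row_osc n l : functional l -> osc (w n) (d n)
 (fun t => l (S `|t| (em n 1 0))) (fun t => l (S `|t| (em n 0 1))).
Proof.
move=> fl; split; [exact: orbit_cont|exact: orbit_cont|..] => t t0.
 have := orbit_derive fl (domA_em n 1 0) t0; rewrite opA_em !mulr0 mulr1 addr0.
 have -> : em n 0 (- w n) = (- w n) *: em n 0 1 by rewrite emZ mulr0 mulr1.
 by have [_ l2 _] := functional_S (normr_ge0 t) fl; have := l2 (- w n) (em n 0 1) => /= ->.
have := orbit_derive fl (domA_em n 0 1) t0; rewrite opA_em !mulr0 !mulr1 add0r.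
have -> : em n (w n) (- d n) = w n *: em n 1 0 + (- d n) *: em n 0 1.
 by rewrite !emZ emD !mulr0 !mulr1 addr0 add0r.
have [l1 l2 _] := functional_S (normr_ge0 t) fl.
have := l1 (w n *: em n 1 0) (- d n *: em n 0 1) => /= ->.
have := l2 (w n) (em n 1 0) => /= ->; have := l2 (- d n) (em n 0 1) => /= ->.
by rewrite mulNr.
Qed.

Lemma cx_em k n a b : cx k (em n a b) = a * (n == k)%:R.
Proof. by rewrite /cx /= dotZl (dot_unitv he). Qed.
Lemma cv_em k n a b : cv k (em n a b) = b * (n == k)%:R.
Proof. by rewrite /cv /= dotZl (dot_unitv he). Qed.

(** On mode [n] the semigroup is the matrix with rows ([Px], [px]) and ([- px], [qv]). The lower row
    is determined by the upper one through uniqueness for [osc] ([cv_S_em]). *)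
Definition Px n (t : R) := cx n (S `|t| (em n 1 0)).
Definition px n (t : R) := cx n (S `|t| (em n 0 1)).
Definition qv n (t : R) := Px n t - d n / w n * px n t.

Lemma S_id0 z : S `|0 : R| z = z.
Proof. by rewrite normr0 (S_id hS). Qed.

Lemma osc_Px n : osc (w n) (d n) (Px n) (px n).
Proof. exact: row_osc (functional_cx n). Qed.

Lemma Px0 n : Px n 0 = 1.
Proof. by rewrite /Px S_id0 cx_em eqxx mulr1. Qed.
Lemma px0 n : px n 0 = 0.
Proof. by rewrite /px S_id0 cx_em mul0r. Qed.

Lemma osc_qv n : osc (w n) (d n) (fun t => - px n t) (qv n).
Proof.
have [c1 c2 d1 d2] := osc_Px n; have w0 := frq_gt0 n.
split.
- by move=> t; apply: cvgN; exact: c2.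
- by move=> t; apply: cvgB; [exact: c1|apply: cvgM; [exact: cvg_cst|exact: c2]].
- move=> t t0; have h2 := d2 t t0; apply: is_derive_eq; rewrite /qv /=.
 by field; rewrite gt_eqF.
- move=> t t0; have h1 := d1 t t0; have h2 := d2 t t0; apply: is_derive_eq.
 by rewrite /qv /GRing.scale /=; field; rewrite gt_eqF.
Qed.

Lemma cv_S_em n t : cv n (S `|t| (em n 1 0)) = - px n t /\ cv n (S `|t| (em n 0 1)) = qv n t.
Proof.
have o := osc_lin 1 (-1) (row_osc n (functional_cv n)) (osc_qv n).
have [||] := osc_unique (ltW (damp_gt0 n)) o _ _ (normr_ge0 t).
- by rewrite /px !S_id0 cv_em cx_em !mul0r mulr0 oppr0 mulr0 addr0.
- by rewrite /qv Px0 px0 !S_id0 cv_em eqxx !mulr1 mulr0 subr0 mulN1r subrr.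
rewrite !mul1r !mulN1r /qv /Px /px !normr_id => h1 h2.
lra.
Qed.

(** A functional that vanishes on the vectors of mode [n] sees their orbits as an oscillator with
    zero initial values, so uniqueness decouples the modes; invariance of the mode subspaces is a
    consequence, not a premise. *)
Lemma S_em_other k n (t : R) : k != n -> forall a b, cx k (S `|t| (em n a b)) = 0 /\ cv k (S `|t| (em n a b)) = 0.
Proof.
move=> kn a b; have nk : (n == k) = false by rewrite eq_sym; exact/negbTE.
suff z l : functional l -> (forall a b, l (em n a b) = 0) -> l (S `|t| (em n a b)) = 0.
 split; apply: z; [exact: functional_cx|by move=> *; rewrite cx_em nk mulr0|exact: functional_cv|].
 by move=> *; rewrite cv_em nk mulr0.
move=> fl l0.
have [||h1 h2] := osc_unique (ltW (damp_gt0 n)) (row_osc n fl) _ _ (normr_ge0 t).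
- by rewrite S_id0.
- by rewrite S_id0.
have -> : em n a b = a *: em n 1 0 + b *: em n 0 1.
 by rewrite !emZ emD !mulr0 !mulr1 addr0 add0r.
have [l1 l2 _] := functional_S (normr_ge0 t) fl.
have := l1 (a *: em n 1 0) (b *: em n 0 1) => /= ->.
have := l2 a (em n 1 0) => /= ->; have := l2 b (em n 0 1) => /= ->.
by move: h1 h2; rewrite normr_id => -> ->; rewrite !mulr0 addr0.
Qed.

Definition zproj N (z : H) : H := (proj e N z.1, proj e N z.2).

Lemma zproj_sum N z : zproj N z = \sum_(k < N) (cx k z *: em k 1 0 + cv k z *: em k 0 1).
Proof.
rewrite (eq_bigr (fun k : 'I_N => em k (cx k z) (cv k z))); last first.
 by move=> k _; rewrite !emZ emD !mulr0 !mulr1 addr0 add0r.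
rewrite /zproj /proj /em; elim/big_rec3 : _ => [//|k a b c _].
by move=> <-.
Qed.

Lemma zproj_cvg z : zproj N z @[N --> \oo] --> z.
Proof.
have c1 := @proj_cvg _ _ _ _ _ he z.1; have c2 := @proj_cvg _ _ _ _ _ he z.2.
by rewrite [z in _ --> z](_ : z = (z.1, z.2)); [exact: cvg_pair c1 c2|case: z {c1 c2}].
Qed.

Lemma functional_modes l z : functional l ->
 (\sum_(k < N) (cx k z * l (em k 1 0) + cv k z * l (em k 0 1)) : R^o) @[N --> \oo] --> (l z : R^o).
Proof.
move=> [l1 l2 cl].
have -> : (fun N => \sum_(k < N) (cx k z * l (em k 1 0) + cv k z * l (em k 0 1)) : R^o) =
  (fun N => l (zproj N z)).
 apply/funext => N; rewrite zproj_sum (big_morph l l1 (_ : l 0 = 0)).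
  by apply: eq_bigr => k _; rewrite l1 !l2.
 by rewrite -(scale0r (0 : H)) l2 mul0r.
exact: (cvg_comp _ _ (@zproj_cvg z) (cl z)).
Qed.

Lemma functional_one_mode l n z : functional l ->
 (forall k, k != n -> l (em k 1 0) = 0 /\ l (em k 0 1) = 0) ->
 l z = cx n z * l (em n 1 0) + cv n z * l (em n 0 1).
Proof.
move=> fl ln; have c1 := @functional_modes l z fl.
suff c2 : (\sum_(k < N) (cx k z * l (em k 1 0) + cv k z * l (em k 0 1)) : R^o) @[N --> \oo] -->
  (cx n z * l (em n 1 0) + cv n z * l (em n 0 1) : R^o) by exact: (cvg_unique _ c1 c2).
apply/cvgrPdist_le => eps eps0; exists n.+1 => // N /= nN.
rewrite (bigD1 (Ordinal nN))//= big1 ?addr0 ?subrr ?normr0 ?(ltW eps0)// => k kn.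
have [|-> ->] := ln k; last by rewrite !mulr0 addr0.
by [].
Qed.

Lemma cx_S n t z : 0 <= t -> cx n (S t z) = Px n t * cx n z + px n t * cv n z.
Proof.
move=> t0.
have := @functional_one_mode (cx n \o S t) n z (functional_S t0 (functional_cx n)) _.
rewrite /= => -> //; last first.
 move=> k kn; rewrite -(ger0_norm t0); have nk : n != k by rewrite eq_sym.
 by have [h1 h2] := S_em_other t nk 1 0; have [h3 h4] := S_em_other t nk 0 1.
by rewrite /Px /px (ger0_norm t0) mulrC [X in _ + X]mulrC.
Qed.

Lemma cv_S n t z : 0 <= t -> cv n (S t z) = - px n t * cx n z + qv n t * cv n z.
Proof.
move=> t0.
have := @functional_one_mode (cv n \o S t) n z (functional_S t0 (functional_cv n)) _.
rewrite /= => -> //; last first.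
 move=> k kn; rewrite -(ger0_norm t0); have nk : n != k by rewrite eq_sym.
 by have [h1 h2] := S_em_other t nk 1 0; have [h3 h4] := S_em_other t nk 0 1.
have [] := cv_S_em n t; rewrite (ger0_norm t0) => -> ->.
lra.
Qed.

Lemma osc_S n z : osc (w n) (d n) (fun t => cx n (S `|t| z)) (fun t => - cv n (S `|t| z)).
Proof.
have o := osc_lin (cx n z) (- cv n z) (osc_Px n) (osc_qv n).
have Pn t : Px n `|t| = Px n t by rewrite /Px normr_id.
have pn t : px n `|t| = px n t by rewrite /px normr_id.
have qn t : qv n `|t| = qv n t by rewrite /qv Pn pn.
congr (osc _ _ _ _) : o; apply/funext => t.
 by rewrite cx_S// Pn pn; ring.
by rewrite cv_S// pn qn; ring.
Qed.

Lemma coef_energy n t z : 0 <= t ->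
 cx n (S t z) ^+ 2 + cv n (S t z) ^+ 2 <= cx n z ^+ 2 + cv n z ^+ 2.
Proof.
move=> t0; have := osc_energy (ltW (damp_gt0 n)) (osc_S n z) (lexx 0) t0.
by rewrite !sqrrN (ger0_norm t0) S_id0.
Qed.

Lemma hnorm_sqr (z : H) : hnorm z ^+ 2 = `|z.1| ^+ 2 + `|z.2| ^+ 2.
Proof. by rewrite sqr_sqrtr// addr_ge0// sqr_ge0. Qed.

Lemma hnorm_coef (z : H) :
 (\sum_(i < N) (cx i z ^+ 2 + cv i z ^+ 2) : R^o) @[N --> \oo] --> (hnorm z ^+ 2 : R^o).
Proof.
rewrite hnorm_sqr; under eq_fun do rewrite big_split.
exact: cvgD (@Parseval _ _ _ _ _ he z.1) (@Parseval _ _ _ _ _ he z.2).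
Qed.

Lemma hnorm_coef_le N (z : H) : \sum_(i < N) (cx i z ^+ 2 + cv i z ^+ 2) <= hnorm z ^+ 2.
Proof. by rewrite hnorm_sqr big_split; apply: lerD; exact: Bessel. Qed.

Lemma hnorm_le_coef (z : H) K : 0 <= K ->
 (forall N, \sum_(i < N) (cx i z ^+ 2 + cv i z ^+ 2) <= K ^+ 2) -> hnorm z <= K.
Proof.
move=> K0 zK; rewrite -ler_sqr ?nnegrE// ?sqrtr_ge0//.
have := @hnorm_coef z => /[dup] /cvg_lim <-//.
by move=> /cvgP c; apply: limr_le => //; near=> n; exact: zK.
Unshelve. all: by end_near. Qed.

Lemma S_contraction t z : 0 <= t -> hnorm (S t z) <= hnorm z.
Proof.
move=> t0; apply: hnorm_le_coef => [|N]; first exact: sqrtr_ge0.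
apply: le_trans (hnorm_coef_le N z); apply: ler_sum => i _; exact: coef_energy.
Qed.

(** Underdamped modes relax at a rate of order [d], that is mu^alpha, overdamped ones at a rate of
    order [w^2 / d], that is mu^(1 - alpha). Up to constants, mu^beta is a lower bound for both. *)
Definition beta := Num.min alpha (1 - alpha).

Lemma powR_mu_ge n s : 0 <= s -> mu 0%N `^ s <= mu n `^ s.
Proof.
by move=> s0; apply: ge0_ler_powR; rewrite // ?nnegrE ?(ltW (mu0 _))//; exact: (muS (leq0n n)).
Qed.

Lemma beta_gt0 : 0 < beta.
Proof. by case/andP : alpha01 => a0 a1; rewrite lt_min a0 subr_gt0. Qed.

Definition rate (c : R) n t := expR (- (c * mu n `^ beta * t)).

Lemma mode_decay : exists2 c : R, 0 < c & forall n t, 0 <= t ->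
 [/\ `|Px n t| <= 2 * rate c n t, `|px n t| <= 2 * rate c n t,
   `|qv n t| <= 2 * rate c n t, `|px n t| <= 2 * w n * t * rate c n t &
   `|px n t| <= 4 * (w n / d n) * rate c n t].
Proof.
case/andP : alpha01 => a0 a1.
have ba : beta <= alpha by rewrite ge_min lexx.
have b1 : beta <= 1 - alpha by rewrite ge_min lexx orbT.
(* For [r] equal to [c] times mu_n^beta, the three entries of the minimum give the conditions
   [r <= w / 2], [r <= d / 4] and [2 * r * d <= w ^+ 2] of [osc_decay]. The exponents
   [1 / 2 - beta], [alpha - beta] and [1 - alpha - beta] are nonnegative, so the smallest eigenvalue
   is the worst case. *)
pose c := Num.min (Num.min (mu 0%N `^ (1 / 2 - beta) / 2) (rho / 4 * mu 0%N `^ (alpha - beta)))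
 (mu 0%N `^ (1 - alpha - beta) / (2 * rho)).
have c0 : 0 < c.
 have A0 s : 0 < mu 0%N `^ s by exact: powR_gt0.
 rewrite !lt_min (divr_gt0 (A0 _))//= (mulr_gt0 _ (A0 _)) ?divr_gt0//=.
 by rewrite mulr_gt0.
have cle : [/\ c <= mu 0%N `^ (1 / 2 - beta) / 2, c <= rho / 4 * mu 0%N `^ (alpha - beta) &
  c <= mu 0%N `^ (1 - alpha - beta) / (2 * rho)].
 by rewrite !ge_min !lexx /= !orbT.
have split_pow n s : mu n `^ s = mu n `^ (s - beta) * mu n `^ beta.
 by rewrite -powRD ?subrK// (gt_eqF (mu0 n)) implybT.
exists (c / 4) => [|n t t0]; first by rewrite divr_gt0.
pose r := c * mu n `^ beta.
have rE : rate (c / 4) n t = expR (- (r / 4 * t)).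
 by rewrite /rate [c / 4 * _]mulrAC.
have B0 : 0 < mu n `^ beta by exact: powR_gt0.
have r0 : 0 <= r by rewrite mulr_ge0// ltW.
case: cle => cl1 cl2 cl3.
have r1 : r <= w n / 2.
 rewrite /frq (split_pow n (1 / 2)) mulrAC ler_pM2r//; apply: le_trans cl1 _.
 by rewrite ler_pM2r//; apply: powR_mu_ge; lra.
have r2 : r <= d n / 4.
 rewrite /damp (split_pow n alpha) mulrA mulrAC ler_pM2r//; apply: le_trans cl2 _.
 rewrite [leRHS]mulrAC ler_pM2l ?divr_gt0//; apply: powR_mu_ge; lra.
have r3 : 2 * r * d n <= w n ^+ 2.
 rewrite frq_sqr -[leRHS]powRr1 ?(ltW (mu0 n))// (split_pow n 1).
 have -> : mu n `^ (1 - beta) = mu n `^ (1 - alpha - beta) * mu n `^ alpha.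
  by rewrite -powRD ?(gt_eqF (mu0 n)) ?implybT//; congr (_ `^ _); ring.
 have -> : 2 * r * d n = 2 * rho * c * mu n `^ alpha * mu n `^ beta by rewrite /r /damp; ring.
 rewrite ler_pM2r// ler_pM2r ?powR_gt0// mulrC -ler_pdivlMr ?mulr_gt0//.
 apply: le_trans cl3 _; rewrite ler_pM2r ?invr_gt0 ?mulr_gt0//; apply: powR_mu_ge; lra.
have w0 := frq_gt0 n; have d0 := damp_gt0 n.
have [|h1 h2] := osc_decay_each w0 d0 r0 r1 r2 r3 (osc_Px n) _ t0.
 by rewrite Px0 px0 expr1n expr0n addr0.
have [|_ h3] := osc_decay_each w0 d0 r0 r1 r2 r3 (osc_qv n) _ t0.
 by rewrite /qv Px0 px0 oppr0 mulr0 subr0 expr1n expr0n add0r.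
have [||h4 h5] := osc_small w0 d0 r0 r1 r2 r3 (osc_Px n) _ _ t0.
- by rewrite Px0 expr1n.
- exact: px0.
by rewrite rE.
Qed.
End mode_semigroup.

(** * Riemann sums and the control that steers one oscillator to rest *)

Section riemann.
Context (R : realType).

Lemma heine (V : normedModType R) (f : R -> V) (a b eps : R) : continuous f -> 0 < eps ->
 exists2 dl : R, 0 < dl &
  forall x y : R, a <= x <= b -> `|x - y| <= dl -> `|f x - f y| <= eps.
Proof.
move=> cf e0.
have := (compact_near_coveringP `[a, b]).1 (@segment_compact R a b).
move=> /(_ R (0 : R)^'+ (fun dl x => forall y, `|x - y| <= dl -> `|f x - f y| <= eps)).
case.
 move=> x _; have e2 : 0 < eps / 2 by rewrite divr_gt0.
 have /cvgrPdist_le/(_ _ e2)/nbhs_ballP[r /= r0 rP] := cf x.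
 have r2 : 0 < r / 2 by lra.
 exists (ball x (r / 2), [set dl | dl <= r / 2]); first split => /=.
 - exact: nbhsx_ballx.
 - exact: nbhs_right_le.
 - move=> [x' dl] /= [xx' dlr] y yx.
  have f1 : `|f x - f x'| <= eps / 2 by apply: rP; apply: le_ball xx'; lra.
  have f2 : `|f x - f y| <= eps / 2.
   apply: rP; rewrite /ball /= -(subrKA x'); apply: le_lt_trans (ler_normD _ _) _.
   have {}xx' : `|x - x'| < r / 2 by [].
   have {}dlr : dl <= r / 2 by []; lra.
  rewrite (_ : f x' - f y = - (f x - f x') + (f x - f y)); last by rewrite opprB subrKA.
  apply: le_trans (ler_normD _ _) _; rewrite normrN; lra.
move=> r /= r0 rP; exists (r / 2); first by rewrite divr_gt0.
move=> x y xab; apply: (rP (r / 2)); last by rewrite /= in_itv.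
 by rewrite /= sub0r normrN gtr0_norm ?divr_gt0// ltr_pdivrMr// ltr_pMr// ltr1n.
lra.
Qed.

(** Left-endpoint sums are the form in which a control acts on Brownian increments over a mesh. The
    mean value theorem on each cell compares them with the increment of [z] without introducing an
    integral. *)
Lemma riemann_deriv (z g : R -> R) (tau : R) : 0 < tau -> continuous z -> continuous g ->
 (forall s : R, 0 < s < tau -> is_derive s (1 : R) z (g s)) -> forall eps : R, 0 < eps ->
 exists K0, forall K, (K0 <= K)%N ->
  `|\sum_(j < K.+1) tau / K.+1%:R * g (j%:R * (tau / K.+1%:R)) - (z tau - z 0)| <= eps.
Proof.
move=> t0 cz cg dz eps e0.
have e1 : 0 < eps / tau by rewrite divr_gt0.
have [dl dl0 dlP] := @heine R^o g 0 tau _ cg e1.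
exists (Num.truncn (tau / dl)) => K hK.
pose dt := tau / K.+1%:R.
have dt0 : 0 < dt by rewrite divr_gt0.
have dtl : dt <= dl.
 rewrite ler_pdivrMr// -ler_pdivrMl// mulrC; apply: le_trans (ltW (truncnS_gt _)) _.
 by rewrite ler_nat ltnS.
have Kdt : K.+1%:R * dt = tau by rewrite mulrC divfK// gt_eqF.
have -> : z tau - z 0 = \sum_(j < K.+1) (z (j.+1%:R * dt) - z (j%:R * dt)).
 by rewrite -(big_mkord xpredT (fun j => z (j.+1%:R * dt) - z (j%:R * dt))) telescope_sumr// Kdt mul0r.
rewrite -sumrB; apply: le_trans (ler_norm_sum _ _ _) _.
apply: (@le_trans _ _ (\sum_(j < K.+1) dt * (eps / tau))); last first.
 by rewrite sumr_const card_ord -mulr_natl mulrA Kdt mulrCA divff ?mulr1// gt_eqF.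
apply: ler_sum => j _.
have lt1 : j%:R * dt < j.+1%:R * dt by lra.
have jlo : 0 <= j%:R * dt by rewrite mulr_ge0// ltW.
have jhi : j.+1%:R * dt <= tau by rewrite -Kdt ler_pM2r// ler_nat.
have dd : j.+1%:R * dt - j%:R * dt = dt by lra.
have [|c] := @MVT R z g _ _ lt1 _ (@continuous_subspaceT _ _ _ _ cz).
 by move=> x; rewrite in_itv => /andP[h1 h2]; apply: dz; rewrite (le_lt_trans jlo)//= (lt_le_trans h2).
rewrite in_itv => /andP[h1 h2] ->; rewrite dd [g c * dt]mulrC -mulrBr normrM gtr0_norm//.
rewrite ler_pM2l//; apply: dlP; first by rewrite jlo (le_trans (ltW lt1)).
by apply: le_trans dtl; rewrite ler0_norm ?subr_le0 ?(ltW h1)// opprB -dd lerB// ltW.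
Qed.

(* The cut-off chi has chi = 1, chi' = 0 at 0 and chi = chi' = 0 at tau. If
  (x, v) solves the unforced oscillator, then (chi x, chi v + chi' x / w)
  solves it with the forcing [ctl] in the velocity, and vanishes at tau. *)
Definition chi (tau s : R) := (1 - s / tau) ^+ 2 * (1 + 2 * (s / tau)).
Definition chi1 (tau s : R) := - 6 * (s / tau) * (1 - s / tau) / tau.
Definition chi2 (tau s : R) := - 6 * (1 - 2 * (s / tau)) / tau ^+ 2.
Definition ctl (w d tau : R) (x v : R -> R) (s : R) :=
 2 * chi1 tau s * v s + (chi2 tau s + d * chi1 tau s) * x s / w.

Variables (w d tau : R) (w0 : 0 < w) (d0 : 0 < d) (t0 : 0 < tau).

Lemma is_derive_chi s : is_derive s (1 : R) (chi tau) (chi1 tau s).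
Proof.
rewrite /chi; apply: is_derive_eq; rewrite /chi1 /GRing.scale /=.
by field; rewrite gt_eqF.
Qed.

Lemma is_derive_chi1 s : is_derive s (1 : R) (chi1 tau) (chi2 tau s).
Proof.
rewrite /chi1; apply: is_derive_eq; rewrite /chi2 /GRing.scale /=.
by field; rewrite gt_eqF.
Qed.

Lemma ctl_le x v s : 0 <= s <= tau ->
 `|ctl w d tau x v s| <= 6 * (`|v s| / tau + (1 / tau ^+ 2 + d / tau) * (`|x s| / w)).
Proof.
move=> /andP[s0 st].
have p0 : 0 <= s / tau by rewrite divr_ge0// ltW.
have p1 : s / tau <= 1 by rewrite ler_pdivrMr// mul1r.
have ti : 0 <= tau^-1 by rewrite invr_ge0 ltW.
have q1 : `|chi1 tau s| <= 2 / tau.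
 rewrite normrM [`|tau^-1|]ger0_norm//; apply: ler_wpM2r => //.
 have h : 0 <= (1 - 2 * (s / tau)) ^+ 2 by exact: sqr_ge0.
 rewrite ler_norml; apply/andP; split; last first.
  have : 0 <= (s / tau) * (1 - s / tau) by rewrite mulr_ge0// subr_ge0.
  lra.
 lra.
have q2 : `|chi2 tau s| <= 6 * (1 / tau ^+ 2).
 rewrite normrM [X in _ * X]ger0_norm ?invr_ge0 ?sqr_ge0// mul1r.
 apply: ler_wpM2r; first by rewrite invr_ge0 sqr_ge0.
 by rewrite ler_norml; lra.
rewrite /ctl; apply: le_trans (ler_normD _ _) _; rewrite mulrDr; apply: lerD.
 have -> : `|2 * chi1 tau s * v s| = `|chi1 tau s| * (2 * `|v s|).
  by rewrite !normrM normr_nat mulrAC [RHS]mulrC mulrAC.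
 apply: le_trans (ler_wpM2r _ q1) _; first by rewrite mulr_ge0.
 have : 0 <= `|v s| / tau by rewrite divr_ge0// ltW.
 lra.
rewrite [leRHS]mulrA -[_ * x s / w]mulrA normrM; apply: ler_pM => //.
 have h : `|d * chi1 tau s| <= d * (2 / tau) by rewrite normrM (gtr0_norm d0) ler_pM2l.
 apply: le_trans (ler_normD _ _) _.
 have : 0 <= d / tau by rewrite divr_ge0// ltW.
 lra.
by rewrite normrM normfV (gtr0_norm w0).
Qed.

Variables (y1 y2 x v : R -> R) (oy : osc w d y1 y2) (ox : osc w d x (fun s => - v s)).

Lemma ctl_cont_v : continuous v.
Proof.
have -> : v = (fun s => - (- v s)) by apply/funext => s; rewrite opprK.
by have [_ cv _ _] := ox; move=> s; apply: cvgN; exact: cv.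
Qed.

Lemma ctl_cont : continuous (ctl w d tau x v).
Proof.
have [cx cv _ _] := ox.
have c1 : continuous (chi1 tau).
 by move=> s; apply/differentiable_continuous/derivable1_diffP; have [] := is_derive_chi1 s.
have c2 : continuous (chi2 tau).
 move=> s; apply: cvgM; last exact: cvg_cst.
 apply: cvgM; first exact: cvg_cst.
 apply: cvgB; first exact: cvg_cst.
 by apply: cvgM; [exact: cvg_cst|apply: cvgM; [exact: cvg_id|exact: cvg_cst]].
move=> s; apply: cvgD.
 apply: cvgM; first by apply: cvgM; [exact: cvg_cst|exact: c1].
 exact: ctl_cont_v.
apply: cvgM; last exact: cvg_cst.
apply: cvgM; last exact: cx.
by apply: cvgD; [exact: c2|apply: cvgM; [exact: cvg_cst|exact: c1]].
Qed.

Lemma steer_riemann (eps : R) : 0 < eps ->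
 exists K0, forall K, (K0 <= K)%N ->
  `|\sum_(j < K.+1) tau / K.+1%:R * (y2 (tau - j%:R * (tau / K.+1%:R)) *
     ctl w d tau x v (j%:R * (tau / K.+1%:R))) +
   (y1 tau * x 0 + y2 tau * v 0)| <= eps.
Proof.
move=> e0; have [c1 c2 d1 d2] := oy; have [cx cv dx dv] := ox.
have cvv := ctl_cont_v.
have cchi s : continuous_at s (chi tau) by apply/differentiable_continuous/derivable1_diffP; have [] := is_derive_chi s.
have cchi1 s : continuous_at s (chi1 tau) by apply/differentiable_continuous/derivable1_diffP; have [] := is_derive_chi1 s.
have cb (y : R -> R) : continuous y -> continuous (fun s => y (tau - s)).
 move=> cy s; apply: (@continuous_comp _ _ _ (fun s => tau - s) y); last exact: cy.
 by apply: cvgB; [exact: cvg_cst|exact: cvg_id].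
(* Pairing of the backward row with the steered curve. Only the forcing contributes to its
   derivative, which is [y2 (tau - s)] times [ctl]; the pairing vanishes at [tau], and at 0 it is
   [y1 tau * x 0 + y2 tau * v 0]. *)
pose z s := y1 (tau - s) * (chi tau s * x s) +
 y2 (tau - s) * (chi tau s * v s + chi1 tau s * x s / w).
pose g s := y2 (tau - s) * ctl w d tau x v s.
have cz : continuous z.
 move=> s; apply: cvgD; apply: cvgM; [exact: (cb _ c1)| |exact: (cb _ c2)|].
  by apply: cvgM; [exact: cchi|exact: cx].
 apply: cvgD; first by apply: cvgM; [exact: cchi|exact: cvv].
 by apply: cvgM; [apply: cvgM; [exact: cchi1|exact: cx]|exact: cvg_cst].
have cg : continuous g by move=> s; apply: cvgM; [exact: (cb _ c2)|exact: ctl_cont].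
have dz s : 0 < s < tau -> is_derive s (1 : R) z (g s).
 move=> /andP[s0 st].
 have ts0 : 0 < tau - s by lra.
 have h1 := d1 _ ts0; have h2 := d2 _ ts0; have h3 := dx _ s0; have h4 := dv _ s0.
 have h5 : is_derive s (1 : R) (fun s => - (- v s)) (- (w * x s - d * - v s)).
  exact: is_deriveN h4.
 rewrite (_ : (fun s => - (- v s)) = v) in h5; last by apply/funext => t; rewrite opprK.
 have k1 := is_derive_chi s; have k2 := is_derive_chi1 s.
 have b0 : is_derive s (1 : R) (fun s => tau - s) (- 1).
  by have := is_deriveB (is_derive_cst tau s (1 : R)) (is_derive_id s (1 : R)); rewrite sub0r.
 have b1 : is_derive s (1 : R) (fun s => y1 (tau - s)) (- w * y2 (tau - s) * - 1).
  exact: (@is_derive1_comp _ y1 (fun s => tau - s) s _ _ h1 b0).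
 have b2 : is_derive s (1 : R) (fun s => y2 (tau - s)) ((w * y1 (tau - s) - d * y2 (tau - s)) * - 1).
  exact: (@is_derive1_comp _ y2 (fun s => tau - s) s _ _ h2 b0).
 apply: is_derive_eq; rewrite /g /ctl /GRing.scale /=.
 by field; rewrite gt_eqF.
have [K0 HK] := riemann_deriv t0 cz cg dz e0.
exists K0 => K /HK; rewrite /z.
have -> : chi tau tau = 0 by rewrite /chi divff ?gt_eqF// subrr expr0n mul0r.
have -> : chi1 tau tau = 0 by rewrite /chi1 divff ?gt_eqF// subrr mulr0 mul0r.
have -> : chi tau 0 = 1 by rewrite /chi mul0r subr0 expr1n mulr0 addr0 mulr1.
have -> : chi1 tau 0 = 0 by rewrite /chi1 mul0r mulr0 !mul0r.
rewrite subr0 [X in _ - X](_ : _ = - (y1 tau * x 0 + y2 tau * v 0)) ?opprK //; ring.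
Qed.
End riemann.

(** * The Hilbert norm of the product, mean squares, and quadratic forms of step integrals *)

Section square_mean.
Context (R : realType) (m : nat).
Notation H := (Hsp R m).

Definition hdot (x y : H) := dot x.1 y.1 + dot x.2 y.2.

Lemma hdot_hnorm x : hdot x x = hnorm x ^+ 2.
Proof. by rewrite /hdot !dot_norm hnorm_sqr. Qed.

Lemma hdotDl x y z : hdot (x + y) z = hdot x z + hdot y z.
Proof. by rewrite /hdot !dotDl addrACA. Qed.
Lemma hdotC x y : hdot x y = hdot y x.
Proof. by rewrite /hdot dotC [dot x.2 _]dotC. Qed.
Lemma hdotZl a x z : hdot (a *: x) z = a * hdot x z.
Proof. by rewrite /hdot !dotZl mulrDr. Qed.
Lemma hdot0l z : hdot 0 z = 0.
Proof. by rewrite /hdot !dot0l addr0. Qed.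

Lemma hnorm_ge0 (x : H) : 0 <= hnorm x. Proof. exact: sqrtr_ge0. Qed.

Lemma norm_le_hnorm (x : H) : `|x| <= hnorm x.
Proof.
have h1 : `|x.1| <= hnorm x by rewrite -ler_sqr ?nnegrE ?hnorm_ge0// hnorm_sqr lerDl sqr_ge0.
have h2 : `|x.2| <= hnorm x by rewrite -ler_sqr ?nnegrE ?hnorm_ge0// hnorm_sqr lerDr sqr_ge0.
by rewrite prod_normE ge_max h1.
Qed.

Lemma hnorm_le_norm (x : H) : hnorm x <= 2 * `|x|.
Proof.
rewrite -ler_sqr ?nnegrE ?hnorm_ge0// hnorm_sqr exprMn prod_normE.
have h1 : `|x.1| ^+ 2 <= Num.max `|x.1| `|x.2| ^+ 2 by rewrite ler_sqr ?nnegrE ?le_max ?normr_ge0 ?lexx.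
have h2 : `|x.2| ^+ 2 <= Num.max `|x.1| `|x.2| ^+ 2 by rewrite ler_sqr ?nnegrE ?le_max ?normr_ge0 ?lexx ?orbT.
have h3 : 0 <= Num.max `|x.1| `|x.2| ^+ 2 by exact: sqr_ge0.
rewrite (_ : (2 : R) ^+ 2 = 4); last by rewrite expr2 -natrM.
lra.
Qed.

Lemma hnormN (x : H) : hnorm (- x) = hnorm x.
Proof. by rewrite /hnorm /= !normrN. Qed.

Lemma hnormZ a (x : H) : hnorm (a *: x) = `|a| * hnorm x.
Proof.
apply/eqP; rewrite -(@eqrXn2 _ 2)// ?mulr_ge0 ?hnorm_ge0// exprMn.
by rewrite -!hdot_hnorm hdotZl hdotC hdotZl mulrA -expr2 real_normK ?num_real.
Qed.

Lemma hnorm_sum_sqr I (s : seq I) (F : I -> H) :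
 hnorm (\sum_(i <- s) F i) ^+ 2 = \sum_(i <- s) \sum_(j <- s) hdot (F i) (F j).
Proof.
have suml y : hdot (\sum_(i <- s) F i) y = \sum_(i <- s) hdot (F i) y.
 by apply: (big_morph (hdot^~ y)) => [a b|]; [exact: hdotDl|exact: hdot0l].
rewrite -hdot_hnorm suml; apply: eq_bigr => i _.
by rewrite hdotC suml; apply: eq_bigr => j _; rewrite hdotC.
Qed.

Lemma hnormD_sqr (x y : H) : hnorm (x + y) ^+ 2 <= 2 * (hnorm x ^+ 2) + 2 * (hnorm y ^+ 2).
Proof.
have : 0 <= hnorm (x - y) ^+ 2 by exact: sqr_ge0.
rewrite -!hdot_hnorm !hdotDl ![hdot _ (_ + _)]hdotC !hdotDl.
have N z : hdot (- y) z = - hdot y z by rewrite -scaleN1r hdotZl mulN1r.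
rewrite !N ![hdot _ (- y)]hdotC !N (hdotC y x); lra.
Qed.

Lemma sepa_Hsp (e : nat -> Usp R m) : orthogonal_basis e -> @sepa R H.
Proof. by move=> he; apply: sepa_prod; exact: (sepa_L2 he). Qed.

Section measure.
Context d (T : measurableType d) (nu : {measure set T -> \bar R}) (D : set T) (mD : measurable D).
Implicit Types Y Z : T -> H.

Lemma measurable_hnorm2 (Y : T -> H) : vmeas Y -> measurable_fun setT (fun w => hnorm (Y w) ^+ 2).
Proof.
move=> mY.
have -> : (fun w => hnorm (Y w) ^+ 2) = (fun w => `|(Y w).1| ^+ 2 + `|(Y w).2| ^+ 2).
 by apply/funext => w; rewrite hnorm_sqr.
apply: measurable_funD; apply: measurable_funX; apply: vmeas_norm.
 by apply: (@vmeas_comp _ _ _ _ _ (fun z : H => z.1)) mY => z; exact: cvg_fst.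
by apply: (@vmeas_comp _ _ _ _ _ (fun z : H => z.2)) mY => z; exact: cvg_snd.
Qed.

Definition E2 (Y : T -> H) : \bar R := (\int[nu]_(w in D) (hnorm (Y w) ^+ 2)%:E)%E.

Lemma E2_ge0 Y : (0 <= E2 Y)%E.
Proof. by apply: integral_ge0 => w _; rewrite lee_fin sqr_ge0. Qed.

Let mE2 Y : vmeas Y -> measurable_fun D (fun w => (hnorm (Y w) ^+ 2)%:E).
Proof.
move=> mY; apply: measurable_funTS; apply/measurable_EFinP; exact: measurable_hnorm2.
Qed.

Lemma E2_le Y Z (k : R) : 0 <= k -> vmeas Y -> vmeas Z ->
 (forall w, D w -> hnorm (Y w) ^+ 2 <= k * hnorm (Z w) ^+ 2) -> (E2 Y <= k%:E * E2 Z)%E.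
Proof.
move=> k0 mY mZ YZ; rewrite -ge0_integralZl//=; first last.
- by move=> w _; rewrite lee_fin sqr_ge0.
- exact: mE2.
apply: ge0_le_integral => //=; first by move=> w _; rewrite lee_fin sqr_ge0.
- exact: mE2.
- apply: measurable_funeM; exact: mE2.
Qed.

Lemma E2_ext Y Z : (forall w, D w -> hnorm (Y w) = hnorm (Z w)) -> E2 Y = E2 Z.
Proof. by move=> YZ; apply: eq_integral => w /set_mem Dw; rewrite YZ. Qed.

Lemma E2_add Y Z : vmeas Y -> vmeas Z -> vmeas (fun w => Y w + Z w) ->
 (E2 (fun w => (Y w + Z w)%R) <= 2%:E * (E2 Y + E2 Z))%E.
Proof.
move=> mY mZ mYZ.
have -> : (E2 Y + E2 Z = \int[nu]_(w in D) (hnorm (Y w) ^+ 2 + hnorm (Z w) ^+ 2)%:E)%E.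
 rewrite /E2; under [in RHS]eq_integral do rewrite EFinD.
 rewrite ge0_integralD//; [|exact: mE2| |exact: mE2];
  by move=> w _; rewrite lee_fin sqr_ge0.
have mS : measurable_fun D (fun w => (hnorm (Y w) ^+ 2 + hnorm (Z w) ^+ 2)%:E).
 under eq_fun do rewrite EFinD; apply: emeasurable_funD; exact: mE2.
rewrite -ge0_integralZl//; last first.
 by move=> w _; rewrite lee_fin addr_ge0// sqr_ge0.
apply: ge0_le_integral => //.
- by move=> w _; rewrite lee_fin sqr_ge0.
- exact: mE2.
- exact: measurable_funeM.
- by move=> w _; rewrite -EFinM lee_fin mulrDr; exact: hnormD_sqr.
Qed.

Definition ival (f : T -> R) (I : R) :=
 nu.-integrable D (EFin \o f) /\ (\int[nu]_(w in D) (f w)%:E)%E = I%:E.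

Lemma ivalZ a f I : ival f I -> ival (fun w => a * f w) (a * I).
Proof.
move=> [fi fI]; split; first exact: (integrableZl _ a fi).
rewrite EFinM -fI; exact: (integralZl _ fi).
Qed.

Lemma ivalD f I g J : ival f I -> ival g J -> ival (fun w => f w + g w) (I + J).
Proof.
move=> [fi fI] [gi gJ]; split; first exact: (integrableD _ fi gi).
rewrite EFinD -fI -gJ; exact: (integralD _ fi gi).
Qed.

Lemma ival0 : ival (fun=> 0) 0.
Proof. by split; [exact: integrable0|rewrite integral0]. Qed.

Lemma ival_sum A (s : seq A) (f : A -> T -> R) (I : A -> R) : (forall i, ival (f i) (I i)) ->
 ival (fun w => \sum_(i <- s) f i w) (\sum_(i <- s) I i).
Proof.
move=> h; elim: s => [|i s IH].
 by rewrite big_nil; under eq_fun do rewrite big_nil; exact: ival0.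
by rewrite big_cons; under eq_fun do rewrite big_cons; exact: ivalD.
Qed.

(* Polarization: only the variances of the increments of [b] are used. *)
Lemma quadratic_form (b : R -> T -> R) (c t : R) (s : seq (R * R * H)) :
 (forall x y, 0 <= x <= t -> 0 <= y <= t -> ival (fun w => (b y w - b x w) ^+ 2) (c * `|y - x|)) ->
 all (fun p => (0 <= p.1.1) && (p.1.1 <= p.1.2 <= t)) s ->
 ival (fun w => hnorm (step_int b s w) ^+ 2) (c * \sum_(p <- s) \sum_(q <- s)
  ((`|p.1.2 - q.1.1| + `|p.1.1 - q.1.2| - `|p.1.2 - q.1.2| - `|p.1.1 - q.1.1|) / 2 * hdot p.2 q.2)).
Proof.
move=> var st.
have mem p : p \in s -> (0 <= p.1.1 <= t) /\ (0 <= p.1.2 <= t).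
 move=> /(allP st)/andP[h1 /andP[h2 h3]].
 lra.
have -> : (fun w => hnorm (step_int b s w) ^+ 2) = (fun w => \sum_(p <- s) \sum_(q <- s)
  if (p \in s) && (q \in s) then
   (hdot p.2 q.2 / 2) * ((b p.1.2 w - b q.1.1 w) ^+ 2 + (b p.1.1 w - b q.1.2 w) ^+ 2 +
   (-1) * (b p.1.2 w - b q.1.2 w) ^+ 2 + (-1) * (b p.1.1 w - b q.1.1 w) ^+ 2) else 0).
 apply/funext => w; rewrite hnorm_sum_sqr big_seq [RHS]big_seq.
 apply: eq_bigr => p ps; rewrite big_seq [RHS]big_seq; apply: eq_bigr => q qs.
 rewrite ps qs /= hdotZl hdotC hdotZl hdotC; by field.
have -> : c * (\sum_(p <- s) \sum_(q <- s)
  ((`|p.1.2 - q.1.1| + `|p.1.1 - q.1.2| - `|p.1.2 - q.1.2| - `|p.1.1 - q.1.1|) / 2 * hdot p.2 q.2)) =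
 \sum_(p <- s) \sum_(q <- s) if (p \in s) && (q \in s) then
   (hdot p.2 q.2 / 2) * (c * `|p.1.2 - q.1.1| + c * `|p.1.1 - q.1.2| +
   (-1) * (c * `|p.1.2 - q.1.2|) + (-1) * (c * `|p.1.1 - q.1.1|)) else 0.
 rewrite big_seq [RHS]big_seq mulr_sumr; apply: eq_bigr => p ps.
 rewrite big_seq [RHS]big_seq mulr_sumr; apply: eq_bigr => q qs.
 rewrite ps qs /=; by field.
apply: ival_sum => p; apply: ival_sum => q; case: ifPn => [/andP[/mem[p1 p2] /mem[q1 q2]]|_].
 apply: ivalZ; apply: ivalD; last by apply: ivalZ; exact: var.
 apply: ivalD; last by apply: ivalZ; exact: var.
 by apply: ivalD; exact: var.
exact: ival0.
Qed.
End measure.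

(** In L2 of Lebesgue measure the curve of indicators of []0, t]] has increments of squared norm
    [|y - x|], as Brownian motion has up to a constant. [quadratic_form] applied to both gives the
    Ito isometry for step functions ([step_isometry]). *)
Lemma itv_ival (t x y : R) : 0 <= x <= t -> 0 <= y <= t ->
 ival (@lebesgue_measure R) `[0, t]%classic
  (fun r => (\1_(`]0, y]%classic) r - \1_(`]0, x]%classic) r) ^+ 2) (1 * `|y - x|).
Proof.
wlog xy : x y / x <= y => [W hx hy|].
 case: (leP x y) => [/W|/ltW/W h]; first by apply.
 have [h1 h2] := h hy hx; rewrite distrC.
 have E : (fun r => (\1_(`]0, y]%classic) r - \1_(`]0, x]%classic) r) ^+ 2) =
  (fun r => (\1_(`]0, x]%classic) r - \1_(`]0, y]%classic) r) ^+ 2 : R).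
  by apply/funext => r; rewrite -sqrrN opprB.
 by rewrite E; split.
move=> /andP[x0 xt] /andP[y0 yt].
have E : (fun r => (\1_(`]0, y]%classic) r - \1_(`]0, x]%classic) r) ^+ 2 : R) =
  \1_(`]x, y]%classic).
 apply/funext => r; rewrite !indicE !mem_setE !in_itv/= (ltNge x r).
 case: (leP r x) => rx; case: (leP r y) => ry; case: (ltP 0 r) => r0 //=;
  rewrite//; lra.
rewrite E mul1r ger0_norm ?subr_ge0//.
have D0 : `]x, y] `<=` `[0, t].
 move=> r /=; rewrite !in_itv/= => /andP[h1 h2].
 lra.
have I0 : (\int[@lebesgue_measure R]_(r in `[0%R, t]) (\1_(`]x, y]%classic) r)%:E = (y - x)%:E)%E.
 rewrite integral_indic// setIidl//.
 apply: (etrans (lebesgue_measure_itv `]x, y])).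
 rewrite /= lte_fin; move: xy; rewrite le_eqVlt => /predU1P[->|->].
  by rewrite ltxx subrr.
 by [].
split => //; apply/integrableP; split.
 by apply/measurable_EFinP; exact: measurable_indic.
have -> : (\int[@lebesgue_measure R]_(r in `[0%R, t]) `|(EFin \o \1_(`]x, y]%classic)) r| =
  \int[@lebesgue_measure R]_(r in `[0%R, t]) (\1_(`]x, y]%classic) r)%:E)%E.
 by apply: eq_integral => r _; rewrite /= ger0_norm.
by rewrite I0 ltry.
Qed.
End square_mean.

(** * Measurable variables as limits of simple ones; independence and Chebyshev's inequality *)

Section sigma_algebras.
Context (T : Type) (G : set (set T)) (sG : sigma_algebra setT G).

Lemma sa_setC A : G A -> G (~` A).
Proof. by move=> GA; rewrite -setTD; have [_ h _] := sG; exact: h. Qed.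

Lemma sa_setT : G setT.
Proof. by rewrite -setC0; apply: sa_setC; have [] := sG. Qed.

Lemma sa_bigcup (A : nat -> set T) (Q : nat -> bool) : (forall n, Q n -> G (A n)) ->
 G (\bigcup_(n in [set n | Q n]) A n).
Proof.
move=> GA; have [G0 _ h] := sG.
rewrite (_ : \bigcup_(n in _) _ = \bigcup_n (if Q n then A n else set0)).
 by apply: h => n; case: ifP => // /GA.
apply/seteqP; split => [w [n /= Qn An]|w [n _]]; first by exists n => //; rewrite Qn.
by case: ifP => // Qn An; exists n.
Qed.

Lemma sa_setU A B : G A -> G B -> G (A `|` B).
Proof.
move=> GA GB; have [_ _ h] := sG.
rewrite (_ : A `|` B = \bigcup_n (if n is 0%N then A else B)).
 by apply: h => -[|n].
apply/seteqP; split => [w [Aw|Bw]|w [[|n] _ h']]; [by exists 0%N|by exists 1%N|by left|by right].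
Qed.

Lemma sa_setI A B : G A -> G B -> G (A `&` B).
Proof.
by move=> GA GB; rewrite -[A `&` B]setCK setCI; apply/sa_setC/sa_setU; exact: sa_setC.
Qed.
End sigma_algebras.

Section approximable.
Context (R : realType) d (Omega : measurableType d) (P : probability Omega R).
Implicit Types V : normedModType R.
Notation pr := (pr P).
Notation Ex := (Ex P).

Lemma apx_sub V (A B : set (set Omega)) (Y : Omega -> V) : A `<=` B -> apx P A Y -> apx P B Y.
Proof.
move=> AB aY e e0; have [I [D [y [h1 h2 h3]]]] := aY e e0.
by exists I, D, y; split => // i; exact: AB.
Qed.

(** The preimages of the balls of radius [e] around a dense sequence, made disjoint, exhaust the
    space. By continuity of the probability, finitely many of them leave out an event of probability
    at most [e]. *)
Lemma apx_meas (A : set (set Omega)) V (Y : Omega -> V) : sigma_algebra setT A ->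
 A `<=` measurable -> sepa V -> (forall O : set V, open O -> A (Y @^-1` O)) -> apx P A Y.
Proof.
move=> sA Am [q qP] mY e e0.
pose B i := Y @^-1` [set x | `|x - q i| < e].
have AB i : A (B i) by apply: mY; exact: open_dist_lt.
pose C n := ~` \bigcup_(i in [set i | (i < n)%N]) B i.
have AC n : A (C n) by apply: sa_setC => //; exact: sa_bigcup.
have C0 : \bigcap_n C n = set0.
 rewrite -subset0 => w wC; have [i hi] := qP (Y w) e e0.
 by have := wC i.+1 I; apply; exists i => /=.
have cC : (P \o C) @ \oo --> P (\bigcap_n C n).
 apply: nonincreasing_cvg_mu.
 - by rewrite (le_lt_trans (probability_le1 _ _)) ?ltry//; apply: Am.
 - by move=> n; apply: Am.
 - by rewrite C0.
 - apply/nonincreasing_seqP => n; apply/subsetPset/subsetC => w [i /= ni Bi].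
  by exists i => //=; exact: leqW.
have [N hN] : exists N, pr (C N) <= e.
 move: cC; rewrite C0 measure0 => cC.
 have [N _ /(_ N (leqnn N))] := cvge0_le cC (fun n => measure_ge0 P (C n)) e0.
 rewrite /= -EFin_pr; last exact: Am.
 by exists N.
exists 'I_N, (fun i : 'I_N => B i `&` C i), (fun i : 'I_N => q i); split.
- by move=> i; exact: sa_setI.
- have lt (i j : 'I_N) w : (i < j)%N -> B i w -> C j w -> False by move=> ij Bi; apply; exists i.
 move=> i j w [Bi Ci] [Bj Cj]; apply/val_inj => /=; case: (ltngtP i j) => // ij.
  by case: (lt _ _ _ ij Bi Cj).
 by case: (lt _ _ _ ij Bj Ci).
apply: le_trans hN; apply: pr_le.
- apply: measurableC; rewrite (_ : [set w | _] = \bigcup_(i in [set i | (i < N)%N]) (B i `&` C i)).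
  by apply: Am; apply: sa_bigcup => // i _; exact: sa_setI.
 apply/seteqP; split => [w [i [Bi Ci] _]|w [i /= iN [Bi Ci]]]; first by exists i => /=.
 by exists (Ordinal iN) => //; exact: ltW.
- exact: Am.
move=> w nw [i /= iN Bi]; apply: nw => /=.
have ex : exists i, `[< (i < N)%N /\ B i w >] by exists i; apply/asboolP.
case: (ex_minnP ex) => j /asboolP[jN' Bj'] jmin.
exists (Ordinal jN') => /=; last exact: ltW.
split => // -[k /= kj Bk].
have kj' : (k < j)%N := kj.
have /jmin : `[< (k < N)%N /\ B k w >] by apply/asboolP; split => //; exact: ltn_trans kj' jN'.
by rewrite leqNgt kj'.
Qed.

(** For the simple variables [Z] with cells in [B], factorization of the expectation is a finite
    combination of the product rule for events; [indep_lim] passes to [N]. *)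
Lemma indep_apx (A B : set (set Omega)) V (N : Omega -> V) : independent2 P A B ->
 A `<=` measurable -> B `<=` measurable -> sepa V -> vmeas N -> apx P B N -> indep P A N.
Proof.
move=> AB Am Bm sV mN aN; apply: indep_lim => // e e0.
have [I [D [y [BD disj bad]]]] := aN e e0.
have mD i : measurable (D i) by exact: Bm.
pose Z w := \sum_i (\1_(D i) w : R) *: y i.
have ZD i w : D i w -> Z w = y i.
 move=> Di; rewrite /Z (bigD1 i)//= big1 ?addr0.
  by rewrite indicE mem_set// scale1r.
 move=> j ji; rewrite indicE memNset ?scale0r// => Dj.
 by move/eqP : ji; apply; exact: disj Dj Di.
have Z0 w : (forall i, ~ D i w) -> Z w = 0.
 by move=> h; rewrite /Z big1// => i _; rewrite indicE memNset ?scale0r.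
have mZ : vmeas Z.
 apply: vmeas_sum => // i; apply: vmeas_line; exact: measurable_indic.
exists Z; split => //; last first.
 apply: le_trans bad; apply: pr_le; [exact: measurable_far|exact: (measurable_bad Bm)|].
 move=> w; rewrite /far => h [i Di]; rewrite leNgt => /negP; apply.
 by rewrite -(ZD i w Di).
move=> E f AE hf; have mE := Am _ AE.
have fZ w : f (Z w) = f 0 + \sum_i (f (y i) - f 0) * \1_(D i) w.
 have [[i Di]|h] := pselect (exists i, D i w).
  rewrite (ZD i w Di) (bigD1 i)//= big1 ?addr0.
   by rewrite indicE mem_set// mulr1 addrC subrK.
  move=> j ji; rewrite indicE memNset ?mulr0// => Dj.
  by move/eqP : ji; apply; exact: disj Dj Di.
 rewrite Z0; last by move=> i Di; apply: h; exists i.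
 by rewrite big1 ?addr0// => i _; rewrite indicE memNset ?mulr0// => Di; apply: h; exists i.
have aD i : abd P (\1_(D i) : Omega -> R) by exact: abd_indic.
have aE := abd_indic P mE.
have -> : (fun w => \1_E w * f (Z w)) = (fun w => f 0 * \1_E w +
  \sum_i (f (y i) - f 0) * \1_(E `&` D i) w).
 apply/funext => w; rewrite fZ mulrDr mulrC; congr (_ + _).
 rewrite mulr_sumr; apply: eq_bigr => i _; rewrite mulrCA indicI.
 by [].
have -> : (fun w => f (Z w)) = (fun w => f 0 + \sum_i (f (y i) - f 0) * \1_(D i) w).
 by apply/funext => w; exact: fZ.
have aED i : abd P (\1_(E `&` D i) : Omega -> R) by apply: abd_indic; exact: measurableI.
have s1 : abd P (fun w => \sum_i (f (y i) - f 0) * \1_(E `&` D i) w).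
 by apply: abd_sum => i _; exact: (abdZ _ (aED i)).
have s2 : abd P (fun w => \sum_i (f (y i) - f 0) * \1_(D i) w).
 by apply: abd_sum => i _; exact: (abdZ _ (aD i)).
rewrite (ExD (abdZ (f 0) aE) s1) (ExD (abd_cst P (f 0)) s2).
rewrite ExZ// Ex_indic// Ex_cst mulrDr mulrC; congr (_ + _).
rewrite (Ex_sum _ (fun i _ => abdZ _ (aED i))) (Ex_sum _ (fun i _ => abdZ _ (aD i))).
rewrite mulr_sumr; apply: eq_bigr => i _; rewrite !ExZ// !Ex_indic//; last exact: measurableI.
by rewrite AB// fineM ?fin_num_measure// mulrCA.
Qed.

(** Chebyshev's inequality. The cube lets the same [e] bound the distance and the probability. *)
Lemma E2_far m (Y Z : Omega -> Hsp R m) (e : R) : @sepa R (Hsp R m) -> vmeas Y -> vmeas Z -> 0 < e ->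
 (E2 P setT (fun w => (Y w - Z w)%R) <= (e ^+ 3)%:E)%E -> pr (far e Y Z) <= e.
Proof.
move=> sH mY mZ e0 h; have mf := measurable_far e sH mY mZ.
have e2 : 0 < e ^+ 2 by rewrite exprn_gt0.
rewrite -(ler_pM2l e2) -exprSr -lee_fin; apply: le_trans h.
rewrite EFinM EFin_pr// -(setIT (far e Y Z)) -integral_indic// -ge0_integralZl//=; first last.
- by rewrite lee_fin ltW.
- by apply/measurable_EFinP; exact: measurable_indic.
have mD := measurable_hnorm2 (vmeasB sH mY mZ).
apply: ge0_le_integral => //=.
- by move=> w _; rewrite -EFinM lee_fin mulr_ge0// ltW.
- by apply: measurable_funeM; apply/measurable_EFinP; exact: measurable_indic.
- exact/measurable_EFinP.
move=> w _; rewrite -EFinM lee_fin indicE; case: (boolP (w \in _)) => /= [/set_mem|_].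
 rewrite mulr1 => hw; rewrite ler_sqr ?nnegrE ?hnorm_ge0 ?(ltW e0)//.
 exact: le_trans (ltW hw) (norm_le_hnorm _).
by rewrite mulr0 sqr_ge0.
Qed.
End approximable.

(** * Wiener integrals over one Brownian motion and their grid approximation *)

Lemma budget_steps (R : realFieldType) (c eps : R) : c + 1 != 0 ->
 c * (2 * (2 * (eps / (32 * (c + 1)) + eps / (32 * (c + 1))) + eps / (32 * (c + 1)))) =
 10 * (eps / 32) * (c / (c + 1)).
Proof. lra. Qed.

Lemma budget_total (R : realFieldType) (eps : R) : 0 < eps ->
 2 * (2 * (eps / 32 + eps / 32) + 10 * (eps / 32)) <= eps.
Proof. lra. Qed.

Section wiener_steps.
Context (R : realType) (m : nat) d (Omega : measurableType d) (P : probability Omega R).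
Notation H := (Hsp R m).
Notation leb := (@lebesgue_measure R).
Variables (T : R) (b : nat -> R -> Omega -> R) (bB : forall k, brownian_motion P T (b k)) (sH : @sepa R H).

Lemma ival_ge0 (f : Omega -> R) (I : R) : measurable_fun setT f -> (forall w, 0 <= f w) ->
 (\int[P]_w (f w)%:E = I%:E)%E -> ival P setT f I.
Proof.
move=> mf f0 fI; split => //; apply/integrableP; split; first exact/measurable_EFinP.
under eq_integral do rewrite /= ger0_norm//.
by rewrite fI ltry.
Qed.

Lemma measurable_b k t : 0 <= t <= T -> measurable_fun setT (b k t).
Proof. by move=> tT; have [h _ _ _ _] := bB k; exact: h. Qed.

Lemma increment_variance : exists2 c : R, 0 <= c & forall k x y, 0 <= x <= T -> 0 <= y <= T ->
 ival P setT (fun w => (b k y w - b k x w) ^+ 2) (c * `|y - x|).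
Proof.
pose I2 := (\int[leb]_x (x ^+ 2 * normal_pdf 0 1 x)%:E)%E.
have I20 : (0 <= I2)%E.
 by apply: integral_ge0 => x _; rewrite lee_fin mulr_ge0 ?sqr_ge0// normal_pdf_ge0.
exists (fine I2); first exact: fine_ge0.
have lt k x y : 0 <= x <= T -> 0 <= y <= T -> x < y ->
  ival P setT (fun w => (b k y w - b k x w) ^+ 2) (fine I2 * `|y - x|).
 move=> hx hy xy; have [_ _ _ law _] := bB k.
 have mxi : measurable_fun setT (fun w => b k y w - b k x w).
  by apply: measurable_funB; exact: measurable_b.
 have s0 : 0 < Num.sqrt (y - x) by rewrite sqrtr_gt0 subr_gt0.
 apply: ival_ge0; [exact: measurable_funX|by move=> w; exact: sqr_ge0|].
 have lawx B : measurable B -> P ((fun w => b k y w - b k x w) @^-1` B) = normal_prob 0 (Num.sqrt (y - x)) B.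
  by move=> mB; apply: law => //; [case/andP : hx|case/andP : hy].
 rewrite (@gauss_second_moment _ _ _ P (fun w => b k y w - b k x w) _ mxi s0 lawx).
 rewrite sqr_sqrtr ?subr_ge0 ?ltW// mulrC gtr0_norm ?subr_gt0// EFinM.
 by rewrite fineK// ge0_fin_numE//; exact: second_moment_fin.
move=> k x y hx hy; case: (ltgtP x y) => xy; first exact: lt.
 rewrite distrC (_ : (fun w => _) = (fun w => (b k x w - b k y w) ^+ 2)); first exact: lt.
 by apply/funext => w; rewrite -sqrrN opprB.
rewrite xy subrr normr0 mulr0 (_ : (fun w => _) = (fun=> 0)); first exact: ival0.
by apply/funext => w; rewrite subrr expr0n.
Qed.

Definition valid (t : R) (s : seq (R * R * H)) :=
 all (fun p => (0 <= p.1.1) && (p.1.1 <= p.1.2 <= t)) s.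

Lemma indic_oc (x y r : R) : 0 <= x -> x <= y ->
 \1_(`]x, y]%classic) r = \1_(`]0, y]%classic) r - \1_(`]0, x]%classic) r :> R.
Proof.
move=> x0 xy; rewrite !indicE !mem_setE !in_itv/= (ltNge x r).
case: (leP r x) => rx; case: (leP r y) => ry; case: (ltP 0 r) => r0 //=;
 rewrite//; lra.
Qed.

Lemma step_valE t s r : valid t s ->
 step_val s r = step_int (fun t r => \1_(`]0, t]%classic) r) s r.
Proof.
move=> /allP vs; rewrite /step_val big_seq [RHS]big_seq.
by apply: eq_bigr => p /vs/andP[h1 /andP[h2 _]]; rewrite indic_oc.
Qed.

Lemma vmeas_step_int k t s : t <= T -> valid t s -> vmeas (step_int (b k) s).
Proof.
move=> tT; elim: s => [|p s IH] /=.
 by move=> _ O oO; rewrite /step_int; under eq_fun do rewrite big_nil; exact: vmeas_cst.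
move=> /andP[/andP[p0 /andP[p1 p2]] vs].
have -> : step_int (b k) (p :: s) = (fun w => (b k p.1.2 w - b k p.1.1 w) *: p.2 + step_int (b k) s w).
 by apply/funext => w; rewrite /step_int big_cons.
apply: vmeasD => //; last exact: IH.
apply: vmeas_line; apply: measurable_funB; apply: measurable_b.
 by rewrite (le_trans p0 p1) (le_trans p2 tT).
by rewrite p0 (le_trans p1 (le_trans p2 tT)).
Qed.

Lemma vmeas_step_val s : @vmeas R _ (measurableTypeR R) H (step_val s).
Proof. by apply: vmeas_sum => // p; apply: vmeas_line; exact: measurable_indic. Qed.

Lemma vmeas_indic d' (T' : measurableType d') (D : set T') (Y : T' -> H) :
 measurable D -> vmeas Y -> vmeas (fun w => (\1_D w : R) *: Y w).
Proof.
move=> mD mY O oO.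
have -> : (fun w => (\1_D w : R) *: Y w) @^-1` O =
  (D `&` Y @^-1` O) `|` (~` D `&` (cst (0 : H)) @^-1` O).
 apply/seteqP; split => w /=; rewrite indicE.
  case: (boolP (w \in D)) => /= [/set_mem Dw|/negP nD]; first by rewrite scale1r; left.
  by rewrite scale0r => O0; right; split => // Dw; apply: nD; exact: mem_set.
 by move=> [[Dw OY]|[nD O0]]; [rewrite mem_set// scale1r|rewrite memNset// scale0r].
apply: measurableU; apply: measurableI => //; [exact: mY|exact: measurableC|exact: vmeas_cst].
Qed.

Lemma E2_add_le d' (T' : measurableType d') (nu : {measure set T' -> \bar R}) (D : set T')
  (Y Z : T' -> H) (x y : R) : measurable D -> vmeas Y -> vmeas Z ->
 (E2 nu D Y <= x%:E)%E -> (E2 nu D Z <= y%:E)%E ->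
 (E2 nu D (fun w => (Y w + Z w)%R) <= (2 * (x + y))%:E)%E.
Proof.
move=> mD mY mZ hx hy; apply: le_trans (E2_add _ mD mY mZ (vmeasD sH mY mZ)) _.
have -> : (2 * (x + y))%:E = (2%:E * (x%:E + y%:E))%E by rewrite EFinM EFinD.
by apply: lee_wpmul2l; [rewrite lee_fin|exact: leeD].
Qed.

Lemma vmeas_continuous (f : R -> H) : continuous f -> @vmeas R _ (measurableTypeR R) H f.
Proof. by move=> /continuousP cf O oO; apply: open_measurable; exact: cf. Qed.

Lemma step_isometry c : (forall k x y, 0 <= x <= T -> 0 <= y <= T ->
  ival P setT (fun w => (b k y w - b k x w) ^+ 2) (c * `|y - x|)) ->
 forall k (t : R) s, 0 <= t <= T -> valid t s ->
 E2 P setT (step_int (b k) s) = (c%:E * E2 leb `[0%R, t]%classic (step_val s))%E.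
Proof.
move=> hc k t s /andP[t0 tT] vs.
have [|_ e1] := @quadratic_form R m _ _ P setT measurableT (b k) c t s _ vs.
 by move=> x y /andP[x0 xt] /andP[y0 yt]; apply: hc; rewrite ?x0 ?y0 (le_trans _ tT).
have [|_ e2] := @quadratic_form R m _ _ leb `[0, t]%classic (measurable_itv _) (fun t r => \1_(`]0, t]%classic) r) 1 t s _ vs.
 by move=> x y hx hy; exact: itv_ival.
rewrite mul1r in e2.
have e3 : E2 leb `[0%R, t]%classic (step_val s) =
  (\sum_(p <- s) \sum_(q <- s)
  ((`|p.1.2 - q.1.1| + `|p.1.1 - q.1.2| - `|p.1.2 - q.1.2| - `|p.1.1 - q.1.1|) / 2 * hdot p.2 q.2))%:E.
 by rewrite -e2; apply: E2_ext => r _; rewrite (step_valE _ vs).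
by rewrite [LHS]e1 e3 EFinM.
Qed.

Lemma E2_support (u r : R) (Y : R -> H) : u <= r ->
 (forall x, ~ `[0, u]%classic x -> Y x = 0) ->
 E2 leb `[0, r]%classic Y = E2 leb `[0, u]%classic Y.
Proof.
move=> ur Y0; rewrite /E2 -(@setIidr _ `[0, r]%classic `[0, u]%classic); last first.
 by move=> x /=; rewrite !in_itv => /andP[-> h]; exact: le_trans ur.
rewrite integral_mkcondr; apply: eq_integral => x _; rewrite patchE.
case: ifPn => // /negP; rewrite inE => /Y0 ->.
by rewrite -(scale0r 0) hnormZ normr0 mul0r expr0n.
Qed.

Variables (S : R -> H -> H) (SDh : forall t x y, 0 <= t -> S t (x + y) = S t x + S t y)
 (SZh : forall t a x, 0 <= t -> S t (a *: x) = a *: S t x) (Scon : forall t x, 0 <= t -> hnorm (S t x) <= hnorm x)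
 (Sadd : forall s t x, 0 <= s -> 0 <= t -> S (s + t) x = S s (S t x))
 (Sst : forall x, continuous (fun t : R => S `|t| x)).

Definition step_map (f : H -> H) (s : seq (R * R * H)) := [seq (p.1, f p.2) | p <- s].

Lemma step_int_map d' (A : measurableType d') (be : R -> A -> R) (f : H -> H) s w :
 (forall x y, f (x + y) = f x + f y) -> (forall a x, f (a *: x) = a *: f x) ->
 step_int be (step_map f s) w = f (step_int be s w).
Proof.
move=> fD fZ; have f0 : f 0 = 0 by rewrite -(scale0r 0) fZ !scale0r.
by rewrite /step_int big_map (big_morph f fD f0); apply: eq_bigr => p _; rewrite fZ.
Qed.

Lemma step_val_map (f : H -> H) s x :
 (forall x y, f (x + y) = f x + f y) -> (forall a x, f (a *: x) = a *: f x) ->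
 step_val (step_map f s) x = f (step_val s x).
Proof.
move=> fD fZ; have f0 : f 0 = 0 by rewrite -(scale0r 0) fZ !scale0r.
by rewrite /step_val big_map (big_morph f fD f0); apply: eq_bigr => p _; rewrite fZ.
Qed.

Lemma step_val_cat (s s' : seq (R * R * H)) x : step_val (s ++ s') x = step_val s x + step_val s' x.
Proof. exact: big_cat. Qed.

Lemma step_int_cat d' (A : measurableType d') (be : R -> A -> R) (s s' : seq (R * R * H)) w :
 step_int be (s ++ s') w = step_int be s w + step_int be s' w.
Proof. exact: big_cat. Qed.

Definition grid (u r : R) K (z : H) : seq (R * R * H) :=
 [seq (u + j%:R * ((r - u) / K.+1%:R), u + j.+1%:R * ((r - u) / K.+1%:R),
    S (r - (u + j%:R * ((r - u) / K.+1%:R))) z) | j <- iota 0 K.+1].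

Section one_mode.
Variables (u r : R) (u0 : 0 <= u) (ur : u < r) (rT : r <= T).

Lemma grid_point K j : (j <= K.+1)%N -> [/\ 0 <= (r - u) / K.+1%:R,
 u <= u + j%:R * ((r - u) / K.+1%:R) & u + j%:R * ((r - u) / K.+1%:R) <= r].
Proof.
move=> jK; have K0 : (0 : R) < K.+1%:R by rewrite ltr0n.
have d0 : 0 <= (r - u) / K.+1%:R by rewrite divr_ge0 ?subr_ge0 ?ltW.
split => //; first by rewrite lerDl mulr_ge0.
rewrite -lerBrDl mulrCA ger_pMr ?subr_gt0// ler_pdivrMr// mul1r ler_nat//.
Qed.

Lemma valid_grid K z : valid r (grid u r K z).
Proof.
apply/allP => _ /mapP[j + ->] /=; rewrite mem_iota add0n => /andP[_ jK].
have [d0 h1 _] := grid_point (ltnW jK); have [_ _ h2] := grid_point jK.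
by rewrite (le_trans u0 h1) h2 andbT lerD2l ler_wpM2r// ler_nat.
Qed.

Lemma grid_error z (eps : R) : 0 < eps -> exists K0, forall K, (K0 <= K)%N -> forall x, 0 <= x <= r ->
 hnorm (step_val (grid u r K z) x - \1_(`]u, r]%classic) x *: S `|r - x| z) <= eps.
Proof.
move=> e0; have cf : continuous (fun x : R => S `|r - x| z).
 move=> x; apply: (@continuous_comp _ _ _ (fun x : R => r - x) (fun x : R => S `|x| z)).
  by apply: cvgB; [exact: cvg_cst|exact: cvg_id].
 exact: Sst.
have e2 : 0 < eps / 2 by lra.
have [dl dl0 dlP] := @heine R H _ 0 r _ cf e2.
exists (Num.truncn ((r - u) / dl)) => K hK x /andP[x0 xr].
pose dt := (r - u) / K.+1%:R; pose t j := u + j%:R * dt.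
have dt0 : 0 < dt by rewrite divr_gt0 ?subr_gt0.
have dtl : dt <= dl.
 rewrite ler_pdivrMr// -ler_pdivrMl// mulrC; apply: le_trans (ltW (truncnS_gt _)) _.
 by rewrite ler_nat ltnS.
have tle j : t j <= t j.+1 by rewrite lerD2l ler_pM2r// ler_nat.
have t0 j : 0 <= t j by rewrite addr_ge0// mulr_ge0// ltW.
have tK : t K.+1 = r by rewrite /t mulrC divfK// addrC subrK.
have t00 : t 0%N = u by rewrite /t mul0r addr0.
have ind : \1_(`]u, r]%classic) x = \sum_(0 <= j < K.+1) \1_(`]t j, t j.+1]%classic) x :> R.
 rewrite (indic_oc _ u0 (ltW ur)) -{1}tK -t00.
 rewrite -(telescope_sumr (fun j => \1_(`]0, t j]%classic) x : R))//.
 by apply: eq_bigr => j _; rewrite (indic_oc _ (t0 j)).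
rewrite ind /step_val big_map -/(index_iota 0 K.+1) scaler_suml -sumrB.
apply: le_trans (hnorm_le_norm _) _; rewrite -[eps](divfK (_ : 2 != 0 :> R))// mulrC.
rewrite ler_pM2r//; apply: le_trans (ler_norm_sum _ _ _) _.
apply: (@le_trans _ _ (\sum_(0 <= j < K.+1) \1_(`]t j, t j.+1]%classic) x * (eps / 2))).
 rewrite big_seq [leRHS]big_seq; apply: ler_sum => j; rewrite mem_index_iota => /andP[_ jK].
 rewrite -scalerBr normrZ ger0_norm//.
 rewrite /= -/(t j) -/(t j.+1).
 rewrite indicE mem_setE in_itv; case: (boolP (t j < x <= t j.+1)) => [/andP[h1 h2]|_]; last by rewrite !mul0r.
 rewrite !mul1r.
 have tr : t j <= r by lra.
 have -> : S (r - t j) z = S `|r - t j| z by rewrite ger0_norm// subr_ge0.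
 apply: dlP; first by rewrite t0.
 rewrite ltr0_norm ?subr_lt0// opprB; apply: le_trans dtl.
 by move: h2; rewrite /t -addn1 natrD mulrDl mul1r; lra.
by rewrite -mulr_suml -ind ger_pMl// divr_gt0.
Qed.

(** [Jr - S (r - u) Ju] is the integral of [S (r - s) z] over []u, r]], because
    [S (r - u) S (u - s) = S (r - s)]. Wiener integrals are given as limits of step integrals, so
    the step functions of [Jr], of [Ju] and of the grid are concatenated into [s3] and the isometry
    is applied once, to the combination. *)
Lemma one_mode_approx c k z (Jr Ju : Omega -> H) : 0 <= c ->
 (forall k x y, 0 <= x <= T -> 0 <= y <= T ->
  ival P setT (fun w => (b k y w - b k x w) ^+ 2) (c * `|y - x|)) ->
 wiener_integral P (b k) r (fun s => S (r - s) z) Jr ->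
 wiener_integral P (b k) u (fun s => S (u - s) z) Ju ->
 forall eps : R, 0 < eps -> exists K0, forall K, (K0 <= K)%N ->
  (E2 P setT (fun w => (Jr w - S (r - u) (Ju w) - step_int (b k) (grid u r K z) w)%R) <= eps%:E)%E.
Proof.
move=> c0 hc [mJr [sr [vr er cr]]] [mJu [su [vu eu cu]]] eps e0.
have ru0 : 0 <= r - u by rewrite subr_ge0 ltW.
have r0 : 0 <= r by exact: le_trans (ltW ur).
have c1 : 0 < c + 1 by rewrite ltr_wpDl.
have e10 : 0 < eps / (32 * (c + 1)) by rewrite divr_gt0// mulr_gt0.
have e2 : 0 < eps / 32 by rewrite divr_gt0.
have [N1 _ h1] := cvge0_le er (fun n => E2_ge0 _ _ _) e10.
have [N2 _ h2] := cvge0_le eu (fun n => E2_ge0 _ _ _) e10.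
have [N3 _ h3] := cvge0_le cr (fun n => E2_ge0 _ _ _) e2.
have [N4 _ h4] := cvge0_le cu (fun n => E2_ge0 _ _ _) e2.
pose n := maxn (maxn N1 N2) (maxn N3 N4).
have {}h1 := h1 n (_ : (N1 <= n)%N); have {}h2 := h2 n (_ : (N2 <= n)%N).
have {}h3 := h3 n (_ : (N3 <= n)%N); have {}h4 := h4 n (_ : (N4 <= n)%N).
rewrite !leq_max !leqnn !orbT /= in h1 h2 h3 h4.
have {}h1 := h1 isT; have {}h2 := h2 isT; have {}h3 := h3 isT; have {}h4 := h4 isT.
pose e1 := eps / (32 * (c + 1)).
have eg0 : 0 < Num.sqrt (e1 / (r + 1)) by rewrite sqrtr_gt0 divr_gt0// ltr_wpDl.
have [K0 HK] := grid_error z eg0.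
exists K0 => K /HK{HK} hK.
set gr := grid u r K z; set s1 := sr n in h1 h3; set s2 := su n in h2 h4.
pose f v := - S (r - u) v.
have fD x y : f (x + y) = f x + f y by rewrite /f SDh// opprD.
have fZ a x : f (a *: x) = a *: f x by rewrite /f SZh// scalerN.
have fB x y : f (x - y) = f x - f y by rewrite fD -(scaleN1r y) fZ scaleN1r.
have fh x : hnorm (f x) <= hnorm x by rewrite /f hnormN; exact: Scon.
have f0 : f 0 = 0 by rewrite -(scale0r 0) fZ !scale0r.
pose s3 := s1 ++ (step_map f s2 ++ step_map -%R gr).
have v2 : valid r (step_map f s2).
 rewrite /valid all_map; apply/allP => p /(allP (vu n))/= /andP[-> /andP[-> h]] /=.
 exact: le_trans h (ltW ur).
have vg : valid r (step_map -%R gr) by rewrite /valid all_map; exact: (valid_grid K z).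
have v3 : valid r s3 by rewrite /valid !all_cat (vr n) [all _ (step_map f s2)]v2 [all _ (step_map _ gr)]vg.
pose Phi x := S `|r - x| z.
have mPhi' v : @vmeas R _ (measurableTypeR R) H (fun x => S `|v - x| z).
 apply: vmeas_continuous => x; apply: (@continuous_comp _ _ _ (fun x : R => v - x) (fun x : R => S `|x| z)).
  by apply: cvgB; [exact: cvg_cst|exact: cvg_id].
 exact: Sst.
have mPhi : @vmeas R _ (measurableTypeR R) H Phi := mPhi' r.
have mfc d' (T' : measurableType d') (Y : T' -> H) : vmeas Y -> vmeas (fun x => f (Y x)).
 move=> mY; apply: (vmeas_comp _ mY).
 apply: (@lip_continuous _ _ _ _ 2) => x y.
 rewrite -fB.
 exact: le_trans (norm_le_hnorm _) (le_trans (fh _) (hnorm_le_norm _)).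
(* [A] is the error of the steps of [Jr] on [[0, r]], [B] the error on [[0, u]] of the steps of [Ju]
   carried along by [S (r - u)], and [C] the error of the grid on []u, r]]. The terms with [Phi]
   cancel in [A + B + C], which leaves the steps [s3]. *)
pose A x := step_val s1 x - Phi x.
pose B x := f (step_val s2 x) + (\1_(`[0, u]%classic) x : R) *: Phi x.
pose C x := - (step_val gr x - (\1_(`]u, r]%classic) x : R) *: Phi x).
have mA : @vmeas R _ (measurableTypeR R) H A by apply: vmeasB => //; exact: vmeas_step_val.
have m1 (D : set R) : measurable D -> @vmeas R _ (measurableTypeR R) H (fun x => (\1_D x : R) *: Phi x).
 by move=> mD; apply: vmeas_indic.
have mB : @vmeas R _ (measurableTypeR R) H B.
 by apply: vmeasD => //; [apply: mfc; exact: vmeas_step_val|exact: m1].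
have mC : @vmeas R _ (measurableTypeR R) H C.
 by apply: vmeasN; apply: vmeasB => //; [exact: vmeas_step_val|exact: m1].
have EA : (E2 leb `[0%R, r]%classic A <= e1%:E)%E.
 apply: le_trans h1; apply: le_of_eq; apply: E2_ext => x /=; rewrite in_itv/= => /andP[x0 xr].
 by rewrite -hnormN opprB /Phi ger0_norm ?subr_ge0.
have EB : (E2 leb `[0%R, r]%classic B <= e1%:E)%E.
 rewrite (E2_support (ltW ur)).
  have h2' : (E2 leb `[0%R, u]%classic (fun x => (S `|u - x| z - step_val s2 x)%R) <= e1%:E)%E.
   apply: le_trans h2; apply: le_of_eq; apply: E2_ext => x /=; rewrite in_itv/= => /andP[x0 xu].
   by rewrite ger0_norm ?subr_ge0.
  apply: le_trans h2'; rewrite -[leRHS]mul1e; apply: E2_le => //.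
  - by apply: vmeasB => //; exact: vmeas_step_val.
  - move=> x /=; rewrite in_itv/= => /andP[x0 xu]; rewrite mul1r ler_sqr ?nnegrE ?hnorm_ge0//.
   rewrite /B indicE mem_setE in_itv/= x0 xu scale1r /Phi !ger0_norm ?subr_ge0 ?(le_trans xu (ltW ur))//.
   have -> : r - x = (r - u) + (u - x) by rewrite addrA subrK.
   rewrite Sadd// ?subr_ge0// addrC; rewrite -[X in X + _]opprK -/(f _).
   have -> : - f (S (u - x) z) + f (step_val s2 x) = - f (S (u - x) z - step_val s2 x).
    by rewrite fB opprB addrC.
   by rewrite hnormN; exact: fh.
 move=> x nx; rewrite /B indicE memNset// scale0r addr0.
 rewrite /step_val big_seq big1 ?f0// => p /(allP (vu n)) /andP[p0 /andP[p1 p2]].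
 rewrite indicE memNset ?scale0r// => /=; rewrite in_itv/= => /andP[q1 q2].
 by apply: nx => /=; rewrite in_itv/= (ltW (le_lt_trans p0 q1)) (le_trans q2 p2).
have EC : (E2 leb `[0%R, r]%classic C <= e1%:E)%E.
 apply: (@le_trans _ _ (\int[leb]_(x in `[0%R, r]) (cst (e1 / (r + 1))%:E x))%E).
  apply: ge0_le_integral => //=.
  - by move=> x _; rewrite lee_fin sqr_ge0.
  - by apply: measurable_funTS; apply/measurable_EFinP; exact: measurable_hnorm2.
  - move=> x; rewrite in_itv/= => hx; rewrite lee_fin hnormN.
   by rewrite -[leRHS]sqr_sqrtr ?ler_sqr ?nnegrE ?hnorm_ge0 ?(ltW eg0) ?hK// divr_ge0 ?ltW// ltr_wpDl.
 rewrite integral_cst//= (lebesgue_measure_itv `[0, r])/= lte_fin.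
 have r1 : 0 < r by exact: le_lt_trans ur.
 rewrite r1 sube0 -EFinM lee_fin mulrAC ler_pdivrMr ?ltr_wpDl// ler_pM2l//.
 by rewrite lerDl.
have v3E x : `[0, r]%classic x -> step_val s3 x = A x + B x + C x.
 rewrite /= in_itv/= => /andP[x0 xr].
 have -> : step_val s3 x = step_val s1 x + (f (step_val s2 x) - step_val gr x).
  rewrite /s3 !step_val_cat (@step_val_map f s2 x fD fZ).
  by rewrite (@step_val_map -%R gr x (@opprD _) (fun a v => esym (scalerN a v))).
 have e3 (a b' p q g : H) : a + (b' - g) = a - (p + q) + (b' + p) - (g - q).
  by rewrite addrACA opprD [_ + p]addrAC addNr add0r opprB -[RHS]addrA addKr addrA.
 have PhiE : Phi x = (\1_(`[0, u]%classic) x : R) *: Phi x + (\1_(`]u, r]%classic) x : R) *: Phi x.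
  rewrite -scalerDl !indicE !mem_setE !in_itv/= x0 xr andbT/=.
  by case: (leP x u) => _; rewrite ?addr0 ?add0r scale1r.
 by rewrite /A /B /C {1}PhiE; exact: e3.
have E3 : (E2 leb `[0%R, r]%classic (step_val s3) <= (2 * (2 * (e1 + e1) + e1))%:E)%E.
 have E4 : (E2 leb `[0%R, r]%classic (fun x => (A x + B x + C x)%R) <= (2 * (2 * (e1 + e1) + e1))%:E)%E.
  apply: E2_add_le => //; first exact: vmeasD.
  exact: E2_add_le.
 by apply: le_trans E4; apply: le_of_eq; apply: E2_ext => x hx; rewrite v3E.
have I3 : (E2 P setT (step_int (b k) s3) <= (10 * (eps / 32))%:E)%E.
 rewrite (step_isometry hc _ _ v3) ?r0//.
 apply: le_trans (lee_wpmul2l _ E3) _; first by rewrite lee_fin.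
 rewrite -EFinM lee_fin.
 have -> : c * (2 * (2 * (e1 + e1) + e1)) = 10 * (eps / 32) * (c / (c + 1)).
  by apply: budget_steps; rewrite gt_eqF.
 rewrite ger_pMr; last by rewrite mulr_gt0.
 by rewrite ler_pdivrMr// mul1r lerDl.
have mI s t : t <= T -> valid t s -> vmeas (step_int (b k) s) by exact: vmeas_step_int.
have uT : u <= T by exact: le_trans (ltW ur) rT.
have m3 := mI _ _ rT v3; have ms1 := mI _ _ rT (vr n); have ms2 := mI _ _ uT (vu n).
have mg := mI _ _ rT (valid_grid K z).
have I1 : (E2 P setT (fun w => (Jr w - step_int (b k) s1 w)%R) <= (eps / 32)%:E)%E.
 apply: le_trans h3; rewrite /cvg_L2_H -/(E2 P setT _); apply: le_of_eq.
 by apply: E2_ext => w _; rewrite -hnormN opprB.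
have I2 : (E2 P setT (fun w => f (Ju w - step_int (b k) s2 w)%R) <= (eps / 32)%:E)%E.
 apply: le_trans h4; rewrite -[leRHS]mul1e; apply: E2_le => //.
 - by apply: mfc; exact: vmeasB.
 - exact: vmeasB.
 - move=> w _; rewrite mul1r ler_sqr ?nnegrE ?hnorm_ge0//.
  by apply: le_trans (fh _) _; rewrite -hnormN opprB.
have := E2_add_le measurableT (vmeasD sH (vmeasB sH mJr ms1) (mfc _ _ _ (vmeasB sH mJu ms2))) m3
 (E2_add_le measurableT (vmeasB sH mJr ms1) (mfc _ _ _ (vmeasB sH mJu ms2)) I1 I2) I3.
have -> : (fun w => (Jr w - step_int (b k) s1 w + f (Ju w - step_int (b k) s2 w) + step_int (b k) s3 w)%R) =
  (fun w => (Jr w - S (r - u) (Ju w) - step_int (b k) gr w)%R).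
 apply/funext => w.
 have -> : step_int (b k) s3 w = step_int (b k) s1 w + (f (step_int (b k) s2 w) - step_int (b k) gr w).
  rewrite /s3 !step_int_cat (@step_int_map _ _ (b k) f s2 w fD fZ).
  by rewrite (@step_int_map _ _ (b k) -%R gr w (@opprD _) (fun a v => esym (scalerN a v))).
 have -> : f (Ju w - step_int (b k) s2 w) = f (Ju w) - f (step_int (b k) s2 w).
  exact: fB.
 have e4 (a a' c' d' g : H) : a - a' + (c' - d') + (a' + (d' - g)) = a + c' - g.
  by rewrite [a - a' + (c' - d')]addrACA -opprD (addrA a' d') -[LHS]addrA addKr.
 exact: e4.
move=> h; apply: le_trans h _; rewrite lee_fin; exact: budget_total.
Qed.
End one_mode.
End wiener_steps.

(** * Block sums of Brownian increments: adaptedness, independence, Harnack inequality *)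

Section noise.
Context (R : realType) (m : nat) d (Omega : measurableType d) (P : probability Omega R).
Notation V := (Usp R m).
Notation H := (Hsp R m).
Variables (T : R) (F : R -> set (set Omega)) (g : nat -> V) (b : nat -> R -> Omega -> R)
 (hF : normal_filtration P T F) (hW : cylindrical_wiener P T F g b).

Lemma filtration_sub s t : 0 <= s -> s <= t -> t <= T -> F s `<=` F t.
Proof. by have [_ h _ _] := hF; exact: h. Qed.

Lemma filtration_sa t : 0 <= t <= T -> sigma_algebra setT (F t).
Proof. by have [h _ _ _] := hF => /h[]. Qed.

Lemma filtration_meas t : 0 <= t <= T -> F t `<=` measurable.
Proof. by have [h _ _ _] := hF => /h[]. Qed.

Lemma wiener_basis : orthogonal_basis g.
Proof. by have [[_ h] _ _ _ _] := hW. Qed.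

Let sH : @sepa R H := sepa_Hsp wiener_basis.
Let sR := sepa_R R.

Lemma wiener_bm k : brownian_motion P T (b k).
Proof. by have [_ h _ _ _] := hW. Qed.

Let mb k t : 0 <= t <= T -> measurable_fun setT (b k t).
Proof. exact: measurable_b wiener_bm k t. Qed.

Lemma sigma_generated_sa I (D : set I) (Y : I -> Omega -> R) :
 sigma_algebra setT (sigma_generated D Y).
Proof. exact: smallest_sigma_algebra. Qed.

Lemma sigma_generated_mem I (D : set I) (Y : I -> Omega -> R) i (O : set R) :
 D i -> open O -> sigma_generated D Y (Y i @^-1` O).
Proof.
move=> Di oO; apply: sub_gen_smallest; exists i => //.
by exists O; [exact: open_measurable|rewrite setTI].
Qed.

Lemma sigma_generated_sub I (D : set I) (Y : I -> Omega -> R) :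
 (forall i, D i -> measurable_fun setT (Y i)) -> sigma_generated D Y `<=` measurable.
Proof.
move=> mY; apply: smallest_sub; first exact: sigma_algebra_measurable.
by move=> _ [i Di [B mB <-]]; exact: (mY i Di).
Qed.

Lemma apx_gen (A : set (set Omega)) I (D : set I) (Y : I -> Omega -> R) i :
 (forall i, D i -> measurable_fun setT (Y i)) -> sigma_generated D Y `<=` A -> D i ->
 apx P A (Y i : Omega -> R^o).
Proof.
move=> mY DA Di; apply: (apx_sub DA); apply: apx_meas => //.
- exact: sigma_generated_sa.
- exact: sigma_generated_sub.
- by move=> O oO; exact: sigma_generated_mem.
Qed.

Section combinations.
Variables (A : set (set Omega)) (Am : A `<=` measurable) (AI : setI_closed A) (AT : A setT).

Lemma apx_sub_real (x y : Omega -> R) : measurable_fun setT x -> measurable_fun setT y ->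
 apx P A (x : Omega -> R^o) -> apx P A (y : Omega -> R^o) ->
 apx P A ((fun w => x w - y w) : Omega -> R^o).
Proof.
move=> mx my ax ay; apply: (@apx2 _ _ _ P A Am AI R^o R^o R^o (fun a b => a - b)) => //.
- exact: fun_vmeas.
- exact: fun_vmeas.
- by apply: fun_vmeas; exact: measurable_funB.
move=> e e0; exists (e / 2); first by rewrite divr_gt0.
move=> a a' c c' h1 h2; rewrite (_ : a - c - (a' - c') = (a - a') - (c - c')); last by ring.
by apply: le_trans (ler_normB _ _) _; rewrite (splitr e) lerD.
Qed.

Lemma apx_line (x : Omega -> R) (v : H) : measurable_fun setT x ->
 apx P A (x : Omega -> R^o) -> apx P A (fun w => x w *: v).
Proof.
move=> mx ax; have L (a c : R^o) : `|a *: v - c *: v| <= (`|v| + 1) * `|a - c|.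
 by rewrite -scalerBl normrZ mulrC ler_wpM2r// lerDl.
apply: (@apx_comp _ _ _ P A Am AI R^o H (fun a : R^o => (a : R) *: v)) => //.
- exact: fun_vmeas.
- exact: lip_continuous L.
move=> e e0; have v1 : 0 < `|v| + 1 by rewrite ltr_wpDl.
exists (e / (`|v| + 1)); first by rewrite divr_gt0.
by move=> a c h; apply: le_trans (L a c) _; rewrite mulrC -ler_pdivlMr.
Qed.

Lemma apx_sumH I (s : seq I) (Y : I -> Omega -> H) : (forall i, vmeas (Y i)) ->
 (forall i, apx P A (Y i)) -> apx P A (fun w => \sum_(i <- s) Y i w).
Proof.
move=> mY aY; elim: s => [|i s IH].
 by under eq_fun do rewrite big_nil; exact: apx_cst.
rewrite (_ : (fun w => _) = (fun w => Y i w + \sum_(j <- s) Y j w)); last first.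
 by apply/funext => w; rewrite big_cons.
exact: (apxD Am AI sH (mY i) (vmeas_sum _ sH mY) (aY i) IH).
Qed.
End combinations.

Let sigI (A : set (set Omega)) : sigma_algebra setT A -> setI_closed A.
Proof. by move=> sA B C; exact: sa_setI. Qed.

Lemma measurable_incr k s t : 0 <= s <= T -> 0 <= t <= T ->
 measurable_fun setT (fun w => b k t w - b k s w).
Proof. by move=> hs ht; apply: measurable_funB; exact: mb. Qed.

Lemma apx_incr_past k s t u : 0 <= s <= u -> 0 <= t <= u -> u <= T ->
 apx P (F u) ((fun w => b k t w - b k s w) : Omega -> R^o).
Proof.
move=> /andP[s0 su] /andP[t0 tu] uT.
have u0 : 0 <= u <= T by rewrite (le_trans s0 su).
have sT : 0 <= s <= T by rewrite s0 (le_trans su).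
have tT : 0 <= t <= T by rewrite t0 (le_trans tu).
have one v : 0 <= v -> v <= u -> apx P (F u) (b k v : Omega -> R^o).
 move=> v0 vu; have vT : 0 <= v <= T by rewrite v0 (le_trans vu).
 apply: (@apx_gen (F u) unit setT (fun=> b k v) tt) => // [_ _|]; first exact: mb.
 apply: (@subset_trans _ (F v)); last exact: filtration_sub.
 by have [_ _ _ h _] := hW; exact: h.
apply: apx_sub_real; [exact: filtration_meas|by apply: sigI; exact: filtration_sa|exact: mb|exact: mb|exact: one|exact: one].
Qed.

Definition future s := sigma_generated [set kt : nat * R | s <= kt.2 <= T]
 (fun kt => b kt.1 kt.2 \- b kt.1 s).

Lemma future_measurable s : 0 <= s <= T -> future s `<=` measurable.
Proof.
move=> /andP[s0 sT]; apply: sigma_generated_sub => -[k t] /= /andP[st tT].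
by apply: measurable_incr; rewrite ?s0 ?(le_trans s0 st).
Qed.

Lemma apx_incr_future k s t u : 0 <= u -> u <= s <= T -> u <= t <= T ->
 apx P (future u) ((fun w => b k t w - b k s w) : Omega -> R^o).
Proof.
move=> u0 /andP[us sT] /andP[ut tT].
have uT : 0 <= u <= T by rewrite u0 (le_trans us sT).
have one v : u <= v <= T -> apx P (future u) ((fun w => b k v w - b k u w) : Omega -> R^o).
 move=> /andP[uv vT].
 apply: (@apx_gen (future u) (nat * R)%type [set kt : nat * R | u <= kt.2 <= T]
  (fun kt => b kt.1 kt.2 \- b kt.1 u) (k, v)) => /=; last by rewrite uv.
  move=> [k' t'] /= /andP[h1 h2]; apply: measurable_incr => //.
  by rewrite (le_trans u0 h1).
 by [].
have mi v : u <= v <= T -> measurable_fun setT (fun w => b k v w - b k u w).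
 by move=> /andP[uv vT]; apply: measurable_incr; rewrite ?(le_trans u0 uv).
have -> : (fun w => b k t w - b k s w) = (fun w => (b k t w - b k u w) - (b k s w - b k u w)).
 by apply/funext => w; rewrite opprB [RHS]addrA subrK.
apply: apx_sub_real; [exact: future_measurable|by apply: sigI; exact: sigma_generated_sa|..].
- by apply: mi; rewrite ut.
- by apply: mi; rewrite us.
- by apply: one; rewrite ut.
- by apply: one; rewrite us.
Qed.

Definition bsum L n (t : nat -> R) (v : nat -> nat -> H) w : H :=
 \sum_(j <- iota 0 n) \sum_(k <- iota 0 L) (b k (t j.+1) w - b k (t j) w) *: v j k.

Section blocks.
Variables (t : nat -> R) (L : nat) (v : nat -> nat -> H) (t0 : 0 <= t 0%N) (tS : forall j, t j < t j.+1).

Lemma tmono i j : (i <= j)%N -> t i <= t j.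
Proof.
move=> /subnK <-; elim: (j - i)%N => [|n IH]; first by rewrite add0n.
by rewrite addSn (le_trans IH)// ltW.
Qed.

Let tpos i : 0 <= t i. Proof. by rewrite (le_trans t0)// tmono. Qed.

Lemma vmeas_bsum n : t n <= T -> vmeas (bsum L n t v).
Proof.
move=> tT; rewrite /bsum.
have -> : (fun w => \sum_(j <- iota 0 n) \sum_(k <- iota 0 L) (b k (t j.+1) w - b k (t j) w) *: v j k) =
 (fun w => \sum_(j <- iota 0 n) if (j < n)%N then \sum_(k <- iota 0 L) (b k (t j.+1) w - b k (t j) w) *: v j k else 0).
 apply/funext => w; rewrite big_seq [RHS]big_seq; apply: eq_bigr => j.
 by rewrite mem_iota add0n => /andP[_ ->].
apply: vmeas_sum => //= j; case: (ltnP j n) => jn; last exact: vmeas_cst.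
apply: vmeas_sum => // k; apply: vmeas_line; apply: measurable_incr; rewrite tpos.
 exact: le_trans (tmono (ltnW jn)) tT.
exact: le_trans (tmono jn) tT.
Qed.

Lemma apx_bsum A n : A `<=` measurable -> setI_closed A -> A setT -> t n <= T ->
 (forall j k, (j < n)%N -> apx P A ((fun w => b k (t j.+1) w - b k (t j) w) : Omega -> R^o)) ->
 apx P A (bsum L n t v).
Proof.
move=> Am AI AT tT h; rewrite /bsum.
have -> : (fun w => \sum_(j <- iota 0 n) \sum_(k <- iota 0 L) (b k (t j.+1) w - b k (t j) w) *: v j k) =
 (fun w => \sum_(j <- iota 0 n) if (j < n)%N then \sum_(k <- iota 0 L) (b k (t j.+1) w - b k (t j) w) *: v j k else 0).
 apply/funext => w; rewrite big_seq [RHS]big_seq; apply: eq_bigr => j.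
 by rewrite mem_iota add0n => /andP[_ ->].
have mi j k : (j < n)%N -> measurable_fun setT (fun w => b k (t j.+1) w - b k (t j) w).
 move=> jn; apply: measurable_incr; rewrite tpos.
  exact: le_trans (tmono (ltnW jn)) tT.
 exact: le_trans (tmono jn) tT.
apply: apx_sumH => //= j; case: (ltnP j n) => jn; [|exact: vmeas_cst| |exact: apx_cst].
 by apply: vmeas_sum => // k; apply: vmeas_line; exact: mi.
apply: apx_sumH => // k; first by apply: vmeas_line; exact: mi.
by apply: apx_line => //; [exact: mi|exact: h].
Qed.

Lemma bsum_adapted n : t n <= T -> apx P (F (t n)) (bsum L n t v).
Proof.
move=> tT; have sT : 0 <= t n <= T by rewrite tpos.
apply: apx_bsum => //; [exact: filtration_meas|by apply: sigI; exact: filtration_sa|exact: (sa_setT (filtration_sa sT))|].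
by move=> j k jn; apply: apx_incr_past => //; rewrite tpos tmono// ltnW.
Qed.

Lemma bsum_indep n : t n <= T -> indep P (F (t 0%N)) (bsum L n t v).
Proof.
move=> tT; have sT : 0 <= t 0%N <= T by rewrite t0 (le_trans (tmono (leq0n n))).
have [_ _ _ _ ind] := hW.
apply: (indep_apx (ind _ sT)) => //; [exact: filtration_meas|exact: future_measurable|exact: vmeas_bsum|].
apply: apx_bsum => //; [exact: future_measurable|by apply: sigI; exact: sigma_generated_sa|exact: (sa_setT (sigma_generated_sa _ _))|].
move=> j k jn; apply: apx_incr_future => //; rewrite tmono//=.
 exact: le_trans (tmono (ltnW jn)) tT.
exact: le_trans (tmono jn) tT.
Qed.
End blocks.

Lemma Harn_modes x y L (v : nat -> H) (a : nat -> R) : 0 <= x -> x < y -> y <= T ->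
 Harn P (fun w => \sum_(k <- iota 0 L) (b k y w - b k x w) *: v k)
  (\sum_(k <- iota 0 L) a k *: v k) (\sum_(k <- iota 0 L) a k ^+ 2 / (y - x)).
Proof.
move=> x0 xy yT.
have xT : 0 <= x <= T by rewrite x0 (le_trans (ltW xy)).
have yT' : 0 <= y <= T by rewrite yT andbT (le_trans x0 (ltW xy)).
pose Gk k := sigma_generated `[0, T]%classic (b k).
have Gm k : Gk k `<=` measurable.
 by apply: sigma_generated_sub => t; rewrite /= in_itv; exact: mb.
(* Rectangles of events of the first [l] Brownian motions. Stability under intersection and the
   presence of the whole space are all that [Harn_add] asks of such a class of events, so the
   generated sigma-algebra is not formed. *)
pose Pi l := [set A | exists2 B : nat -> set Omega, forall k, Gk k (B k) &
 A = \bigcap_(k in [set` iota 0 l]) B k].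
have Pim l : Pi l `<=` measurable.
 move=> _ [B GB ->]; apply: fin_bigcap_measurable; first exact: finite_seq.
 by move=> k _; exact: Gm (GB k).
have GT k : Gk k setT by exact: (sa_setT (sigma_generated_sa _ _)).
have PiT l : Pi l setT.
 by exists (fun=> setT) => //; apply/seteqP; split.
have PiI l : setI_closed (Pi l).
 move=> _ _ [B GB ->] [C GC ->]; exists (fun k => B k `&` C k).
  by move=> k; exact: (sa_setI (sigma_generated_sa _ _) (GB k) (GC k)).
 by rewrite bigcapI.
have GPi k l : (k < l)%N -> Gk k `<=` Pi l.
 move=> kl A GA; exists (fun k' => if k' == k then A else setT).
  by move=> k'; case: eqP => // ->.
 apply/seteqP; split => [w Aw k' _|w h]; first by case: eqP.
 by have := h k; rewrite /= mem_iota add0n kl eqxx; apply.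
have aG k : apx P (Gk k) ((fun w => b k y w - b k x w) : Omega -> R^o).
 have one t : 0 <= t <= T -> apx P (Gk k) (b k t : Omega -> R^o).
  move=> tT; apply: (@apx_gen (Gk k) R `[0, T]%classic (b k) t); last by rewrite /= in_itv.
   by move=> s; rewrite /= in_itv; exact: mb.
  by [].
 by apply: apx_sub_real => //; [by apply: sigI; exact: sigma_generated_sa|exact: mb|exact: mb|exact: one|exact: one].
have indPi l : independent2 P (Pi l) (Gk l).
 move=> _ C [B GB ->] GC; have [_ _ ind _ _] := hW.
 pose B' k := if k == l then C else B k.
 have B'E : \bigcap_(k in [set` iota 0 l]) B k = \bigcap_(k in [set` iota 0 l]) B' k.
  apply: eq_bigcapr => k; rewrite /= mem_iota add0n => /andP[_ kl].
  by rewrite /B' (ltn_eqF kl).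
 have GB' k : Gk k (B' k) by rewrite /B'; case: eqP => // ->.
 have e1 := ind (iota 0 l.+1) B' (iota_uniq _ _) (fun k _ => GB' k).
 have e2 := ind (iota 0 l) B' (iota_uniq _ _) (fun k _ => GB' k).
 have CE : C = B' l by rewrite /B' eqxx.
 rewrite B'E e2 CE; move: e1; rewrite -addn1 iotaD add0n big_cat big_seq1 => <-.
 congr (P _); apply/seteqP; split => w.
  move=> [h Cw] k /=; rewrite mem_cat mem_seq1 => /orP[kl|/eqP -> //].
  exact: h.
 move=> h; split=> [k kl|]; first by apply: h; rewrite /= mem_cat; apply/orP; left.
 by apply: h; rewrite /= mem_cat mem_seq1 eqxx orbT.
have mi k : measurable_fun setT (fun w => b k y w - b k x w) by exact: measurable_incr.
elim: L => [|l IH].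
 rewrite (_ : (fun w => _) = (fun=> 0)); last by apply/funext => w; rewrite big_nil.
 rewrite !big_nil => f hf f0; rewrite expR0 mul1r addr0 (Ex_cst P (f 0)) expr2.
 by rewrite (Ex_cst P (f 0 ^+ 2)).
rewrite -addn1 iotaD add0n !big_cat !big_seq1.
rewrite (_ : (fun w => _) = (fun w => (\sum_(k <- iota 0 l) (b k y w - b k x w) *: v k) + (b l y w - b l x w) *: v l)); last first.
 by apply/funext => w; rewrite big_cat big_seq1.
have ml k : vmeas (fun w => (b k y w - b k x w) *: v k) by exact: vmeas_line.
apply: (@Harn_add _ _ _ P (Pi l)) => //.
- apply: (indep_apx (indPi l)) => //; apply: apx_line => //; by apply: sigI; exact: sigma_generated_sa.
- exact: vmeas_sum.
- have -> : (fun w => \sum_(k <- iota 0 l) (b k y w - b k x w) *: v k) =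
  (fun w => \sum_(k <- iota 0 l) if (k < l)%N then (b k y w - b k x w) *: v k else 0).
  apply/funext => w; rewrite big_seq [RHS]big_seq; apply: eq_bigr => k.
  by rewrite mem_iota add0n => /andP[_ ->].
 apply: apx_sumH => //= k; case: (ltnP k l) => kl; [exact: ml|exact: vmeas_cst| |exact: apx_cst].
 by apply: apx_line => //; exact: apx_sub (GPi k l kl) (aG k).
- have s0 : 0 < Num.sqrt (y - x) by rewrite sqrtr_gt0 subr_gt0.
 have [_ _ _ law _] := wiener_bm l.
 have := @gauss_Harn R _ _ P (fun w => b l y w - b l x w) _ (mi l) s0 _ H (v l) (a l).
 rewrite sqr_sqrtr ?subr_ge0 ?ltW//; apply => B mB; exact: law.
Qed.

(** Blocks are added one at a time, the new one being independent of [F (t n)]. When [a j k] is the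
    mesh size times the value of a control, the shift is a discretized controlled state and the cost
    a Riemann sum of the energy. *)
Lemma Harn_bsum (t : nat -> R) L v a n : 0 <= t 0%N -> (forall j, t j < t j.+1) -> t n <= T ->
 Harn P (bsum L n t v) (\sum_(j <- iota 0 n) \sum_(k <- iota 0 L) a j k *: v j k)
  (\sum_(j <- iota 0 n) \sum_(k <- iota 0 L) a j k ^+ 2 / (t j.+1 - t j)).
Proof.
move=> t0 tS; elim: n => [|n IH] tT.
 rewrite (_ : bsum _ _ _ _ = (fun=> 0)); last by apply/funext => w; rewrite /bsum big_nil.
 rewrite !big_nil => f hf f0; rewrite expR0 mul1r addr0 (Ex_cst P (f 0)) expr2.
 by rewrite (Ex_cst P (f 0 ^+ 2)).
have tn : t n <= T by exact: le_trans (ltW (tS n)) tT.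
have tn0 : 0 <= t n by rewrite (le_trans t0)// tmono.
have sT : 0 <= t n <= T by rewrite tn0.
rewrite -addn1 iotaD add0n !big_cat !big_seq1.
pose N w := \sum_(k <- iota 0 L) (b k (t n.+1) w - b k (t n) w) *: v n k.
rewrite (_ : bsum L (n + 1) t v = (fun w => bsum L n t v w + N w)); last first.
 by apply/funext => w; rewrite /bsum iotaD add0n big_cat big_seq1.
pose t' j := t (n + j)%N.
have NE : N = bsum L 1 t' (fun j => v (n + j)%N).
 by apply/funext => w; rewrite /bsum /t' /= big_seq1 addn0 addn1.
have t'0 : 0 <= t' 0%N by rewrite /t' addn0.
have t'S j : t' j < t' j.+1 by rewrite /t' addnS.
have t'1 : t' 1%N <= T by rewrite /t' addn1.
apply: (@Harn_add _ _ _ P (F (t n))) => //.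
- exact: filtration_meas.
- by apply: sigI; exact: filtration_sa.
- exact: (sa_setT (filtration_sa sT)).
- by rewrite NE; exact: vmeas_bsum.
- by rewrite NE; have := @bsum_indep t' L (fun j => v (n + j)%N) t'0 t'S 1 t'1; rewrite /t' addn0.
- exact: vmeas_bsum.
- exact: bsum_adapted.
- exact: IH.
- exact: Harn_modes.
Qed.
End noise.

(** * Increments of the stochastic convolution *)

Lemma sqr_mul_div (R : realFieldType) (a x : R) : a != 0 -> (a * x) ^+ 2 / a = a * x ^+ 2.
Proof. by move=> a0; field. Qed.

Lemma budget_tail (R : realFieldType) (a k b ep : R) : a != 0 -> k != 0 -> b != 0 ->
 a * (2 * (k * (b * (ep / 2 / (a * (2 * k) * b))))) = ep / 2.
Proof. by move=> a0 k0 b0; field; rewrite a0 k0 b0. Qed.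

Lemma difference_cancel (V : zmodType) (a a' s s' q : V) :
 a - a' + - (s - s') + (a' - s' - q) = a - s - q.
Proof.
have -> : a - a' + - (s - s') = (a - s) - (a' - s').
 by rewrite !opprB [s' - s]addrC addrACA [- a' + s']addrC.
by rewrite -(addrA (a - s)) addKr.
Qed.

Section noise_increment.
Context (R : realType) (m : nat) d (Omega : measurableType d) (P : probability Omega R).
Notation V := (Usp R m).
Notation H := (Hsp R m).
Variables (T : R) (F : R -> set (set Omega)) (g : nat -> V) (b : nat -> R -> Omega -> R)
 (hF : normal_filtration P T F) (hW : cylindrical_wiener P T F g b) (S : R -> H -> H)
 (SDh : forall t x y, 0 <= t -> S t (x + y) = S t x + S t y) (SZh : forall t a x, 0 <= t -> S t (a *: x) = a *: S t x)
 (Scon : forall t x, 0 <= t -> hnorm (S t x) <= hnorm x)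
 (Sadd : forall s t x, 0 <= s -> 0 <= t -> S (s + t) x = S s (S t x))
 (Sst : forall x, continuous (fun t : R => S `|t| x)) (G : V -> H) (KG : R) (GD : forall x y, G (x + y) = G x + G y)
 (GZ : forall a x, G (a *: x) = a *: G x) (GK : forall x, hnorm (G x) <= KG * `|x|).

Let sH : @sepa R H := sepa_Hsp (wiener_basis hW).
Let bB k := wiener_bm hW k.

Lemma S_lip t x y : 0 <= t -> `|S t x - S t y| <= 2 * `|x - y|.
Proof.
move=> t0; have -> : S t x - S t y = S t (x - y).
 by rewrite SDh// -(scaleN1r y) SZh// scaleN1r.
exact: le_trans (norm_le_hnorm _) (le_trans (Scon _ t0) (hnorm_le_norm _)).
Qed.

Lemma S_continuous t : 0 <= t -> continuous (S t).
Proof. by move=> t0; apply: (@lip_continuous _ _ _ _ 2) => x y; exact: S_lip. Qed.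

Lemma vmeas_S d' (T' : measurableType d') t (Y : T' -> H) : 0 <= t -> vmeas Y ->
 vmeas (fun w => S t (Y w)).
Proof. by move=> t0 mY; exact: vmeas_comp (S_continuous t0) mY. Qed.

Variables (u r : R) (Zu Zr : Omega -> H) (u0 : 0 <= u) (ur : u < r) (rT : r <= T)
 (Iu : stochastic_integral P g b u (fun s v => S (u - s) (G v)) Zu)
 (Ir : stochastic_integral P g b r (fun s v => S (r - s) (G v)) Zr).

Let uT : 0 <= u <= T. Proof. by rewrite u0 (le_trans (ltW ur)). Qed.
Let rT' : 0 <= r <= T. Proof. by rewrite rT andbT (le_trans u0 (ltW ur)). Qed.
Let ru0 : 0 <= r - u. Proof. by rewrite subr_ge0 ltW. Qed.

(** Stands for the integral of [S (r - s) G dW(s)] over [[u, r]], expressed through the two given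
    convolutions so that no further integral has to be constructed. *)
Definition increment w := Zr w - S (r - u) (Zu w).

Lemma vmeas_increment : vmeas increment.
Proof.
have [mZu _] := Iu; have [mZr _] := Ir.
by apply: vmeasB => //; exact: vmeas_S.
Qed.

Definition mesh K j := u + j%:R * ((r - u) / K.+1%:R).
Definition gvec K j k := S (r - mesh K j) (G (g k)).
Definition gsum L K := bsum b L K.+1 (mesh K) (gvec K).

Lemma mesh0 K : mesh K 0 = u. Proof. by rewrite /mesh mul0r addr0. Qed.
Lemma meshK K : mesh K K.+1 = r.
Proof. by rewrite /mesh mulrC divfK// addrC subrK. Qed.
Lemma meshS K j : mesh K j < mesh K j.+1.
Proof. by rewrite ltrD2l ltr_pM2r ?ltr_nat// divr_gt0 ?subr_gt0. Qed.
Lemma mesh_step K j : mesh K j.+1 - mesh K j = (r - u) / K.+1%:R.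
Proof. by rewrite opprD addrACA subrr add0r -mulrBl -natrB// subSnn mul1r. Qed.

Lemma mesh_sum K (x : R) : \sum_(j <- iota 0 K.+1) (r - u) / K.+1%:R * x = (r - u) * x.
Proof.
rewrite -mulr_suml; congr (_ * _).
by rewrite big_const_seq count_predT size_iota iter_addr_0 -[LHS]mulr_natl mulrC divfK.
Qed.

Lemma mesh_ge0 K : 0 <= mesh K 0. Proof. by rewrite mesh0. Qed.
Lemma mesh_le K : mesh K K.+1 <= T. Proof. by rewrite meshK. Qed.

Lemma vmeas_gsum L K : vmeas (gsum L K).
Proof. exact: (vmeas_bsum hW L (gvec K) (mesh_ge0 K) (meshS K) (mesh_le K)). Qed.

Lemma gsumE L K w : gsum L K w = \sum_(k <- iota 0 L) step_int (b k) (grid S u r K (G (g k))) w.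
Proof.
rewrite /gsum /bsum exchange_big; apply: eq_bigr => k _.
by rewrite /step_int big_map.
Qed.

(** The number [L] of Brownian motions is fixed before the mesh: the tails beyond [L] do not involve
    the mesh, whereas the mesh errors accumulate over the [L] terms. *)
Lemma noise_approx (eps : R) : 0 < eps -> exists L0, forall L, (L0 <= L)%N ->
 exists K0, forall K, (K0 <= K)%N -> (E2 P setT (fun w => (increment w - gsum L K w)%R) <= eps%:E)%E.
Proof.
move=> e0; have [mZu [Ju [wJu cJu]]] := Iu; have [mZr [Jr [wJr cJr]]] := Ir.
have [c c0 hc] := increment_variance bB.
have e1 : 0 < eps / 16 by rewrite divr_gt0.
have [N1 _ h1] := cvge0_le cJu (fun n => E2_ge0 _ _ _) e1.
have [N2 _ h2] := cvge0_le cJr (fun n => E2_ge0 _ _ _) e1.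
exists (maxn N1 N2) => L; rewrite geq_max => /andP[L1 L2].
have {}h1 := h1 L L1; have {}h2 := h2 L L2.
have mJu k : vmeas (Ju k) by have [] := wJu k.
have mJr k : vmeas (Jr k) by have [] := wJr k.
have mst k K : vmeas (step_int (b k) (grid S u r K (G (g k)))).
 by apply: (vmeas_step_int bB sH _ rT); exact: valid_grid.
pose D K k w := Jr k w - S (r - u) (Ju k w) - step_int (b k) (grid S u r K (G (g k))) w.
have mD K k : vmeas (D K k) by apply: vmeasB => //; apply: vmeasB => //; exact: vmeas_S.
have sum n (del : R) : 0 < del -> exists K0, forall K, (K0 <= K)%N ->
  (E2 P setT (fun w => (\sum_(k < n) D K k w)%R) <= del%:E)%E.
 elim: n del => [|n IH] del del0.
  exists 0%N => K _; rewrite /E2 integral0_eq ?ltW// => w _.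
  by rewrite big_ord0 -(scale0r 0) hnormZ normr0 mul0r expr0n.
 have d4 : 0 < del / 4 by rewrite divr_gt0.
 have [K1 HK1] := IH _ d4.
 have [K2 HK2] := one_mode_approx bB sH SDh SZh Scon Sadd Sst u0 ur rT c0 hc (wJr n) (wJu n) d4.
 exists (maxn K1 K2) => K; rewrite geq_max => /andP[k1 k2].
 rewrite (_ : (fun w => _) = (fun w => (\sum_(k < n) D K k w + D K n w)%R)); last first.
  by apply/funext => w; rewrite big_ord_recr.
 have mS : vmeas (fun w => \sum_(k < n) D K k w).
  exact: (vmeas_sum (index_enum _) sH (fun k : 'I_n => mD K k)).
 apply: le_trans (E2_add_le sH measurableT mS (mD K n) (HK1 K k1) (HK2 K k2)) _.
 by rewrite lee_fin; lra.
have e4 : 0 < eps / 8 by rewrite divr_gt0.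
have [K0 HK] := sum L _ e4; exists K0 => K /HK{HK} hK.
pose A w := Zr w - \sum_(k < L) Jr k w.
pose B w := - S (r - u) (Zu w - \sum_(k < L) Ju k w).
have mA : vmeas A by apply: vmeasB => //; exact: vmeas_sum.
have mB : vmeas B by apply: vmeasN; apply: vmeas_S => //; apply: vmeasB => //; exact: vmeas_sum.
have EA : (E2 P setT A <= (eps / 16)%:E)%E.
 by apply: le_trans h2; apply: le_of_eq; apply: E2_ext => w _; rewrite -hnormN opprB.
have EB : (E2 P setT B <= (eps / 16)%:E)%E.
 apply: le_trans h1; rewrite -[leRHS]mul1e; apply: E2_le => //.
  by apply: vmeasB => //; exact: vmeas_sum.
 move=> w _; rewrite mul1r ler_sqr ?nnegrE ?hnorm_ge0// hnormN.
 by apply: le_trans (Scon _ ru0) _; rewrite -hnormN opprB.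
have mS : vmeas (fun w => \sum_(k < L) D K k w).
 exact: (vmeas_sum (index_enum _) sH (fun k : 'I_L => mD K k)).
have := E2_add_le sH measurableT (vmeasD sH mA mB) mS
 (E2_add_le sH measurableT mA mB EA EB) hK.
rewrite (_ : (fun w => _) = (fun w => (increment w - gsum L K w)%R)).
 by move=> h; apply: le_trans h _; rewrite lee_fin; lra.
apply/funext => w; rewrite gsumE /A /B !sumrB -(big_mkord xpredT (fun k => Jr k w)).
rewrite -(big_mkord xpredT (fun k => S (r - u) (Ju k w))) -(big_mkord xpredT (fun k => Ju k w)).
rewrite -(big_mkord xpredT (fun k => step_int (b k) (grid S u r K (G (g k))) w)) /index_iota subn0.
have -> : S (r - u) (Zu w - \sum_(k <- iota 0 L) Ju k w) =
  S (r - u) (Zu w) - \sum_(k <- iota 0 L) S (r - u) (Ju k w).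
 rewrite SDh// -(scaleN1r (\sum_(_ <- _) _)) SZh// scaleN1r; congr (_ - _).
 apply: (big_morph (S (r - u))) => [x y|]; first exact: SDh.
 by rewrite -(scale0r 0) SZh// !scale0r.
exact: difference_cancel.
Qed.

Lemma gsum_near (e : R) : 0 < e -> exists L0, forall L, (L0 <= L)%N ->
 exists K0, forall K, (K0 <= K)%N -> pr P (far e increment (gsum L K)) <= e.
Proof.
move=> e0; have [L0 h] := noise_approx (exprn_gt0 3 e0).
exists L0 => L /h[K0 hK]; exists K0 => K /hK hh.
by apply: E2_far => //; [exact: vmeas_increment|exact: vmeas_gsum].
Qed.

Lemma increment_adapted : apx P (F r) increment.
Proof.
apply: apx_lim => //; [exact: (filtration_meas hF rT')|exact: vmeas_increment|] => e e0.
have [L0 /(_ L0 (leqnn _))[K0 /(_ K0 (leqnn _)) h]] := gsum_near e0.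
exists (gsum L0 K0); split => //; first exact: vmeas_gsum.
by have := bsum_adapted hF hW L0 (gvec K0) (mesh_ge0 K0) (meshS K0) (mesh_le K0); rewrite ?meshK.
Qed.

Lemma increment_indep : indep P (F u) increment.
Proof.
apply: indep_lim => //; [exact: (filtration_meas hF uT)|exact: vmeas_increment|] => e e0.
have [L0 /(_ L0 (leqnn _))[K0 /(_ K0 (leqnn _)) h]] := gsum_near e0.
exists (gsum L0 K0); split => //; first exact: vmeas_gsum.
by have := bsum_indep hF hW L0 (gvec K0) (mesh_ge0 K0) (meshS K0) (mesh_le K0); rewrite ?mesh0.
Qed.

(* [c] is a control, in finitely many modes, steering 0 to h in time r - u. *)
Lemma increment_Harn (e : nat -> V) M (c : nat -> R -> R) (h : H) (B kap : R) :
 orthogonal_basis e -> 0 <= B ->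
 (forall n s, 0 <= s <= r - u -> `|c n s| <= B) ->
 (forall s, 0 <= s <= r - u -> \sum_(n < M) c n s ^+ 2 <= kap) ->
 (forall eps : R, 0 < eps -> exists K0, forall K, (K0 <= K)%N ->
  `|\sum_(j <- iota 0 K.+1) ((r - u) / K.+1%:R) *:
    S (r - mesh K j) (G (\sum_(n < M) c n (mesh K j - u) *: unitv e n)) - h| <= eps) ->
 Harn P increment h ((r - u) * kap).
Proof.
move=> he B0 cB ck cR; apply: Harn_lim => //; first exact: vmeas_increment.
move=> ep ep0; have [L0 HL] := gsum_near ep0.
(* Tolerance for expanding the vectors [e n], [n < M], in the basis [g] of the Wiener process. The
   other factors bound the length of the interval, [S] together with [G], and the control, so that
   the total error is [ep / 2]. *)
pose eta := ep / 2 / ((r - u) * (2 * (`|KG| + 1)) * (B + 1)).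
have ru : 0 < r - u by rewrite subr_gt0.
have B1 : 0 < B + 1 by rewrite ltr_wpDl.
have den : 0 < (r - u) * (2 * (`|KG| + 1)) * (B + 1) by rewrite !mulr_gt0.
have eta0 : 0 < eta by rewrite !divr_gt0.
have hg := wiener_basis hW.
have tail n (del : R) : 0 < del -> exists L1, forall L, (L1 <= L)%N ->
  \sum_(i < n) `|unitv e i - proj g L (unitv e i)| <= del.
 elim: n del => [|n IH] del del0; first by exists 0%N => L _; rewrite big_ord0 ltW.
 have d2 : 0 < del / 2 by rewrite divr_gt0.
 have [L1 h1] := IH _ d2.
 have := @proj_cvg _ _ _ _ _ hg (unitv e n); move/cvgrPdist_le/(_ _ d2) => [L2 _ h2].
 exists (maxn L1 L2) => L; rewrite geq_max => /andP[l1 l2].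
 by rewrite big_ord_recr (splitr del) lerD// ?h1//; exact: h2.
have [L1 HL1] := tail M eta eta0.
pose L := maxn L0 L1.
have [K0 HK] := HL L (leq_maxl _ _); have {}HL1 := HL1 L (leq_maxr _ _).
have ep2 : 0 < ep / 2 by rewrite divr_gt0.
have [K1 HK1] := cR _ ep2.
pose K := maxn K0 K1; have {}HK := HK K (leq_maxl _ _); have {}HK1 := HK1 K (leq_maxr _ _).
pose dt := (r - u) / K.+1%:R.
have dt0 : 0 < dt by rewrite divr_gt0.
pose cv j := \sum_(n < M) c n (mesh K j - u) *: unitv e n.
pose a j k := dt * dot (cv j) (g k).
have Gun k : unitv g k = g k by rewrite /unitv; have [[n1 _] _ _ _ _] := hW; rewrite n1 invr1 scale1r.
have jin j : j \in iota 0 K.+1 -> 0 <= mesh K j - u <= r - u /\ 0 <= r - mesh K j.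
 rewrite mem_iota add0n => /andP[_ jK].
 have [_ h1 h2] := grid_point ur (ltnW jK).
 by rewrite !subr_ge0 lerD2r h1 h2.
exists (gsum L K), (\sum_(j <- iota 0 K.+1) \sum_(k <- iota 0 L) a j k *: gvec K j k),
 (\sum_(j <- iota 0 K.+1) \sum_(k <- iota 0 L) a j k ^+ 2 / (mesh K j.+1 - mesh K j)).
split.
- exact: vmeas_gsum.
- exact: (Harn_bsum hF hW _ _ _ (mesh_ge0 K) (meshS K) (mesh_le K)).
- apply: (@le_trans _ _ (\sum_(j <- iota 0 K.+1) dt * kap)); last first.
  by rewrite mesh_sum.
 rewrite big_seq [leRHS]big_seq; apply: ler_sum => j /jin[js _].
 rewrite (eq_bigr (fun k => dt * dot (cv j) (g k) ^+ 2)); last first.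
  by move=> k _; rewrite mesh_step -/dt; apply: sqr_mul_div; rewrite gt_eqF.
 rewrite -mulr_sumr ler_pM2l//; apply: le_trans (ck _ js).
 rewrite -(norm_span he M (fun n => c n (mesh K j - u))) -/(cv j).
 have := Bessel hg L (cv j); rewrite -(big_mkord xpredT (fun i => dot (cv j) (unitv g i) ^+ 2)).
 by rewrite /index_iota subn0; under eq_bigr do rewrite Gun.
- have -> : \sum_(j <- iota 0 K.+1) \sum_(k <- iota 0 L) a j k *: gvec K j k =
   \sum_(j <- iota 0 K.+1) dt *: (if (j < K.+1)%N then S (r - mesh K j) (G (proj g L (cv j))) else 0).
  rewrite big_seq [RHS]big_seq; apply: eq_bigr => j jK; have [_ rj] := jin j jK.
  move: jK; rewrite mem_iota add0n => /andP[_ ->].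
  rewrite (big_morph G GD (_ : G 0 = 0)); last by rewrite -(scale0r 0) GZ !scale0r.
  rewrite (big_morph (S (r - mesh K j)) (fun x y => SDh x y rj) (_ : _ 0 = 0)); last first.
   by rewrite -(scale0r 0) SZh// !scale0r.
  rewrite scaler_sumr -(big_mkord xpredT (fun i => dt *: S (r - mesh K j) (G (dot (cv j) (unitv g i) *: unitv g i)))).
  rewrite /index_iota subn0; apply: eq_bigr => k _.
  by rewrite Gun GZ SZh// scalerA.
 set hR := \sum_(j <- iota 0 K.+1) _ in HK1.
 set hL := \sum_(j <- iota 0 K.+1) _.
 have -> : h - hL = - (hR - h) + (hR - hL) by rewrite opprB subrKA.
 apply: le_trans (ler_normD _ _) _; rewrite normrN (splitr ep) lerD//.
 rewrite -sumrB; apply: le_trans (ler_norm_sum _ _ _) _.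
 apply: (@le_trans _ _ (\sum_(j <- iota 0 K.+1) dt * (2 * (`|KG| + 1) * ((B + 1) * eta)))); last first.
  by rewrite mesh_sum -[2 * _ * _]mulrA budget_tail// gt_eqF.
 rewrite big_seq [leRHS]big_seq; apply: ler_sum => j jK; have [js rj] := jin j jK.
 move: jK; rewrite mem_iota add0n => /andP[_ ->].
 rewrite -scalerBr normrZ gtr0_norm// ler_pM2l//.
 apply: le_trans (S_lip _ _ rj) _; rewrite -mulrA ler_pM2l//.
 have -> : G (cv j) - G (proj g L (cv j)) = G (cv j - proj g L (cv j)).
  by rewrite GD -(scaleN1r (proj _ _ _)) GZ scaleN1r.
 apply: le_trans (norm_le_hnorm _) _; apply: le_trans (GK _) _.
 apply: (@le_trans _ _ ((`|KG| + 1) * `|cv j - proj g L (cv j)|)).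
  by apply: ler_wpM2r => //; apply: le_trans (ler_norm _) _; rewrite lerDl.
 rewrite ler_pM2l//.
 have -> : cv j - proj g L (cv j) = \sum_(n < M) c n (mesh K j - u) *: (unitv e n - proj g L (unitv e n)).
  have pD x y : proj g L (x + y) = proj g L x + proj g L y.
   by rewrite -big_split; apply: eq_bigr => i _; rewrite /= dotDl scalerDl.
  have pZ a' x : proj g L (a' *: x) = a' *: proj g L x.
   by rewrite scaler_sumr; apply: eq_bigr => i _; rewrite [RHS]scalerA; congr (_ *: _); exact: dotZl.
  rewrite (big_morph (proj g L) pD (_ : _ 0 = 0)); last by rewrite -(scale0r 0) pZ !scale0r.
  by rewrite -sumrB; apply: eq_bigr => n _; rewrite pZ scalerBr.
 apply: le_trans (ler_norm_sum _ _ _) _.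
 apply: (@le_trans _ _ ((B + 1) * \sum_(n < M) `|unitv e n - proj g L (unitv e n)|)).
  rewrite mulr_sumr; apply: ler_sum => n _; rewrite normrZ; apply: ler_wpM2r => //.
  by apply: le_trans (cB _ _ js) _; rewrite lerDl.
 by rewrite ler_pM2l.
- exact: HK.
Qed.
End noise_increment.

(** * Steering the modes through the noise *)

Section control.
Context (R : realType) (m : nat) (mu : nat -> R) (e : nat -> Usp R m)
 (he : orthogonal_basis e) (mu0 : forall n, 0 < mu n) (muS : {homo mu : i j / (i <= j)%N >-> i <= j})
 (rho alpha gamma : R) (rho0 : 0 < rho) (alpha01 : 0 < alpha < 1) (gamma0 : 0 <= gamma).
Notation V := (Usp R m).
Notation H := (Hsp R m).
Variables (S : R -> H -> H) (hS : generates (domA mu e rho alpha) (opA mu e rho alpha) S).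
Notation G := (opG mu e gamma).
Notation fr := (frq mu).
Notation da := (damp mu rho alpha).
Notation px := (px e S).
Notation Px := (Px e S).
Notation qv := (qv mu e rho alpha S).

Lemma hnorm_snd (v : V) : hnorm ((0, v) : H) = `|v|.
Proof. by rewrite /hnorm normr0 expr0n add0r sqrtr_sqr normr_id. Qed.

Lemma opGD x y : G (x + y) = G x + G y.
Proof. by rewrite /opG (powND he mu0 muS x y gamma0); congr (_, _); rewrite addr0. Qed.

Lemma opGZ a x : G (a *: x) = a *: G x.
Proof. by rewrite /opG (powNZ he mu0 muS a x gamma0); congr (_, _); rewrite scaler0. Qed.

Lemma opGK x : hnorm (G x) <= mu 0%N `^ (- gamma) * `|x|.
Proof. by rewrite hnorm_snd; exact: powN_norm. Qed.

Lemma S_em n t : 0 <= t -> S t (em e n 0 1) = em e n (px n t) (qv n t).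
Proof.
move=> t0; have pe (z z' : H) : z.1 = z'.1 -> z.2 = z'.2 -> z = z'.
 by case: z z' => [? ?] [? ?]/= -> ->.
apply: pe.
 apply/(coef_inj he) => k; rewrite -/(cx e k _).
 case: (eqVneq k n) => [->|kn].
  have := cx_S he mu0 rho0 hS n (em e n 0 1) t0.
  by rewrite (cx_em he) (cv_em he) eqxx mul0r mulr0 add0r !mulr1 => ->; rewrite -/(cx e n (em e n (px n t) 0)) (cx_em he) eqxx mulr1.
 have [] := S_em_other he mu0 rho0 hS t kn 0 1; rewrite ger0_norm// => -> _.
 by rewrite -/(cx e k (em e n (px n t) 0)) (cx_em he) eq_sym (negbTE kn) mulr0.
apply/(coef_inj he) => k; rewrite -/(cv e k _).
case: (eqVneq k n) => [->|kn].
 have := cv_S he mu0 rho0 hS n (em e n 0 1) t0.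
 by rewrite (cx_em he) (cv_em he) eqxx mul0r mulr0 add0r !mulr1 => ->; rewrite -/(cv e n (em e n 0 (qv n t))) (cv_em he) eqxx mulr1.
have [] := S_em_other he mu0 rho0 hS t kn 0 1; rewrite ger0_norm// => _ ->.
by rewrite -/(cv e k (em e n 0 (qv n t))) (cv_em he) eq_sym (negbTE kn) mulr0.
Qed.

(** The factor mu_n^gamma in the control undoes the regularization of the noise, so that the
    oscillators are forced exactly by [c]. *)
Lemma G_span M (c : nat -> R) :
 G (\sum_(n < M) (mu n `^ gamma * c n) *: unitv e n) = \sum_(n < M) c n *: em e n 0 1.
Proof.
rewrite (big_morph G opGD (_ : G 0 = 0)); last by rewrite -(scale0r 0) opGZ !scale0r.
apply: eq_bigr => n _; rewrite /opG /em; have [_ ->] := pow_mode mu he (- gamma) (mu n `^ gamma * c n) n.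
rewrite mulrA -powRD; last by rewrite (gt_eqF (mu0 n)) implybT.
rewrite addNr powRr0 mul1r emZ mulr0 mulr1 /em; congr (_, _).
by rewrite (scale0r (unitv e n)).
Qed.

Lemma norm_em n a b : `|em e n a b| <= `|a| + `|b|.
Proof.
have u1 c : `|c *: unitv e n| = `|c|.
 by apply: (etrans (normrZ c (unitv e n))); rewrite (unitv_norm he) mulr1.
have -> : `|em e n a b| = Num.max `|a *: unitv e n| `|b *: unitv e n| by [].
by rewrite !u1 ge_max lerDl lerDr !normr_ge0.
Qed.

Section steering.
Context d (Omega : measurableType d) (P : probability Omega R)
 (T : R) (F : R -> set (set Omega)) (g : nat -> V) (b : nat -> R -> Omega -> R)
 (hF : normal_filtration P T F) (hW : cylindrical_wiener P T F g b) (u r : R) (Zu Zr : Omega -> H)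
 (u0 : 0 <= u) (ur : u < r) (rT : r <= T) (Iu : stochastic_integral P g b u (fun s v => S (u - s) (G v)) Zu)
 (Ir : stochastic_integral P g b r (fun s v => S (r - s) (G v)) Zr).
Notation N := (increment S u r Zu Zr).
Notation mesh := (mesh u r).

Let sH : @sepa R H := sepa_Hsp he.
Let ru : 0 < r - u. Proof. by rewrite subr_gt0. Qed.
Let Scon t x : 0 <= t -> hnorm (S t x) <= hnorm x.
Proof. exact: (S_contraction he mu0 rho0 hS). Qed.

Variable h0 : H.
Definition steer n := ctl (fr n) (da n) (r - u) (fun s => cx e n (S `|s| h0)) (fun s => cv e n (S `|s| h0)).

Lemma steer_mode M (eps : R) : 0 < eps -> exists K0, forall K, (K0 <= K)%N ->
 `|\sum_(j <- iota 0 K.+1) ((r - u) / K.+1%:R) *: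
   (\sum_(n < M) steer n (mesh K j - u) *: S (r - mesh K j) (em e n 0 1)) +
  zproj e M (S (r - u) h0)| <= eps.
Proof.
elim: M eps => [|M IH] eps eps0.
 exists 0%N => K _; rewrite big1 ?add0r; last by move=> j _; rewrite big_ord0 scaler0.
 by rewrite zproj_sum big_ord0 normr0 ltW.
have e2 : 0 < eps / 2 by lra.
have e4 : 0 < eps / 4 by lra.
have [K1 h1] := IH _ e2.
have [K2 h2] := steer_riemann (frq_gt0 mu0 M) ru (osc_Px he mu0 hS M) (osc_S he mu0 rho0 hS M h0) e4.
have [K3 h3] := steer_riemann (frq_gt0 mu0 M) ru (osc_qv he mu0 hS M) (osc_S he mu0 rho0 hS M h0) e4.
exists (maxn K1 (maxn K2 K3)) => K; rewrite !geq_max => /and3P[/h1{}h1 /h2{}h2 /h3{}h3].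
pose X n := \sum_(j <- iota 0 K.+1) ((r - u) / K.+1%:R) * (px n (r - mesh K j) * steer n (mesh K j - u)).
pose Y n := \sum_(j <- iota 0 K.+1) ((r - u) / K.+1%:R) * (qv n (r - mesh K j) * steer n (mesh K j - u)).
have em_sum n (p q : nat -> R) : \sum_(j <- iota 0 K.+1) em e n (p j) (q j) =
  em e n (\sum_(j <- iota 0 K.+1) p j) (\sum_(j <- iota 0 K.+1) q j).
 elim: (iota _ _) => [|j s IHs]; first by rewrite !big_nil /em !scale0r.
 by rewrite !big_cons IHs emD.
have -> : \sum_(j <- iota 0 K.+1) ((r - u) / K.+1%:R) *:
   (\sum_(n < M.+1) steer n (mesh K j - u) *: S (r - mesh K j) (em e n 0 1)) =
  \sum_(j <- iota 0 K.+1) ((r - u) / K.+1%:R) *: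
   (\sum_(n < M) steer n (mesh K j - u) *: S (r - mesh K j) (em e n 0 1)) + em e M (X M) (Y M).
 rewrite -em_sum -big_split big_seq [RHS]big_seq; apply: eq_bigr => j.
 rewrite mem_iota add0n => /andP[_ jK]; have [_ _ jr] := grid_point ur (ltnW jK).
 rewrite /= big_ord_recr scalerDr; congr (_ + _).
 by rewrite S_em ?subr_ge0// !emZ; congr (em e M _ _); congr (_ * _); rewrite mulrC.
have -> : zproj e M.+1 (S (r - u) h0) = zproj e M (S (r - u) h0) +
  em e M (cx e M (S (r - u) h0)) (cv e M (S (r - u) h0)).
 by rewrite !zproj_sum big_ord_recr !emZ emD !mulr0 !mulr1 addr0 add0r.
rewrite addrACA emD (splitr eps); apply: le_trans (ler_normD _ _) _; apply: lerD => //.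
apply: le_trans (norm_em _ _ _) _; rewrite (_ : eps / 2 = eps / 4 + eps / 4); last by field.
rewrite (cx_S he mu0 rho0 hS M h0 (ltW ru)) (cv_S he mu0 rho0 hS M h0 (ltW ru)).
have mesh_u j : mesh K j - u = j%:R * ((r - u) / K.+1%:R) by rewrite addrC addKr.
have mesh_r j : r - mesh K j = r - u - j%:R * ((r - u) / K.+1%:R) by rewrite opprD addrA.
rewrite !normr0 !(S_id hS) in h2 h3.
have ho (f : nat -> R) : \sum_(j <- iota 0 K.+1) f j = \sum_(j < K.+1) f j.
 by rewrite -(big_mkord xpredT f) /index_iota subn0.
apply: lerD; [apply: le_trans h2|apply: le_trans h3].
 by rewrite /X ho; under eq_bigr do rewrite mesh_u mesh_r.
by rewrite /Y ho; under eq_bigr do rewrite mesh_u mesh_r.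
Qed.

(** Finitely many modes are steered first, at a cost bounded uniformly in [M]; the full shift is
    reached by [Harn_lim], the noise being left unchanged. The factor [r - u] is the time over which
    the squared control is integrated. *)
Lemma control_Harn (k : nat -> R) (kap : R) :
 (forall n s, 0 <= s <= r - u -> `|mu n `^ gamma * steer n s| <= k n) ->
 (forall M, \sum_(n < M) k n ^+ 2 <= kap) -> Harn P N (- S (r - u) h0) ((r - u) * kap).
Proof.
move=> ck hk; have rr : 0 <= (0 : R) <= r - u by rewrite lexx ltW.
have k0 n : 0 <= k n by apply: le_trans (ck n 0 rr).
have kap0 : 0 <= kap by have := hk 0%N; rewrite big_ord0.
have mN : vmeas N by exact: (vmeas_increment hW (SD hS) (SZ hS) Scon ur Iu Ir).
have fin M : Harn P N (- zproj e M (S (r - u) h0)) ((r - u) * kap).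
 apply: (increment_Harn hF hW (SD hS) (SZ hS) Scon (S_add hS) (S_strong hS) opGD opGZ opGK u0 ur rT Iu Ir he (M := M)
  (c := fun n s => mu n `^ gamma * steer n s) (B := kap + 1)).
 - lra.
 - move=> n s hs; apply: le_trans (ck n s hs) _.
  have : k n ^+ 2 <= kap.
   by apply: le_trans (hk n.+1); rewrite big_ord_recr lerDr sumr_ge0// => i _; exact: sqr_ge0.
  have := sqr_ge0 (k n - 1); nra.
 - move=> s hs; apply: le_trans (hk M); apply: ler_sum => n _.
  by rewrite -real_normK ?num_real// ler_sqr ?nnegrE// ck.
 - move=> eps eps0; have [K0 HK] := steer_mode M eps0; exists K0 => K /HK{}HK.
  rewrite opprK; apply: le_trans HK; apply: le_of_eq; congr `|_ + _|.
  rewrite big_seq [RHS]big_seq; apply: eq_bigr => j.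
  rewrite mem_iota add0n => /andP[_ jK]; have [_ _ jr] := grid_point ur (ltnW jK).
  rewrite (G_span M (fun n => steer n (mesh K j - u))) (S_sum hS) ?subr_ge0//; congr (_ *: _); apply: eq_bigr => n _.
  by rewrite (SZ hS) ?subr_ge0.
apply: Harn_lim => // ep ep0.
have /cvgrPdist_le/(_ _ ep0)[M _ /(_ M (leqnn M)) hM] := @zproj_cvg _ _ _ he (S (r - u) h0).
exists N, (- zproj e M (S (r - u) h0)), ((r - u) * kap); split => //.
 by rewrite opprK addrC -normrN opprB.
rewrite /pr (_ : far _ _ _ = set0) ?measure0 ?ltW//.
by apply/seteqP; split => w //=; rewrite /far/= subrr normr0 => /lt_trans/(_ ep0); rewrite ltxx.
Qed.
End steering.
End control.

(** * The cost of steering as a function of time *)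

Lemma powR_expR_bound (R : realType) (p c : R) : 0 <= p -> 0 < c ->
 exists2 K : R, 0 < K & forall y : R, 0 <= y -> y `^ p * expR (- (c * y)) <= K.
Proof.
rewrite le_eqVlt => /predU1P[<- c0|p0 c0].
 by exists 1 => // y y0; rewrite powRr0 mul1r -expR0 ler_expR oppr_le0 mulr_ge0// ltW.
exists ((p / c) `^ p) => [|y y0]; first by rewrite powR_gt0// divr_gt0.
have pc0 : 0 < p / c by rewrite divr_gt0.
(* This is [1 + z <= exp z] at [z = c * y / p]; raised to the power [p], it produces exactly the
   exponential that the decay cancels. *)
have h : y <= p / c * expR (c * y / p).
 have -> : y = p / c * (c * y / p) by field; rewrite !gt_eqF.
 rewrite ler_pM2l//; have := expR_ge1Dx (c * (p / c * (c * y / p)) / p).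
 have -> : c * (p / c * (c * y / p)) / p = c * y / p by field; rewrite !gt_eqF.
 lra.
have h2 : y `^ p <= (p / c * expR (c * y / p)) `^ p.
 by apply: ge0_ler_powR => //; rewrite ?nnegrE ?(ltW p0)// mulr_ge0// ltW.
apply: le_trans (ler_wpM2r (expR_ge0 _) h2) _.
rewrite powRM ?(ltW pc0)//.
have -> : expR (c * y / p) `^ p = expR (c * y).
 by rewrite /powR (gt_eqF (expR_gt0 _)) expRK; congr expR; field; rewrite gt_eqF.
by rewrite -mulrA -expRD subrr expR0 mulr1.
Qed.

Section cost.
Context (R : realType) (m : nat) (mu : nat -> R) (e : nat -> Usp R m)
 (he : orthogonal_basis e) (mu0 : forall n, 0 < mu n) (muS : {homo mu : i j / (i <= j)%N >-> i <= j})
 (rho alpha gamma : R) (rho0 : 0 < rho) (alpha01 : 0 < alpha < 1) (gamma0 : 0 <= gamma < 1 / 2).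
Notation V := (Usp R m).
Notation H := (Hsp R m).
Variables (S : R -> H -> H) (hS : generates (domA mu e rho alpha) (opA mu e rho alpha) S).
Notation fr := (frq mu).
Notation da := (damp mu rho alpha).
Notation bt := (beta alpha).

(** Smoothing: [powR_expR_bound] at [y = mu^beta * t], with exponent [p / beta]. *)
Lemma rate_powR c p : 0 < c -> 0 <= p -> exists2 K : R, 0 < K & forall n (t : R), 0 < t ->
 mu n `^ p * rate mu alpha c n t <= K * t `^ (- (p / bt)).
Proof.
move=> c0 p0; have b0 : 0 < bt by exact: beta_gt0.
have [K K0 hK] := powR_expR_bound (divr_ge0 p0 (ltW b0)) c0.
exists K => // n t t0; have mt : 0 <= mu n `^ bt * t by rewrite mulr_ge0 ?powR_ge0// ltW.
rewrite powRN ler_pdivlMr ?powR_gt0//; apply: le_trans (hK _ mt).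
rewrite powRM ?powR_ge0 ?(ltW t0)// -powRrM mulrC -!mulrA.
have -> : bt * (p / bt) = p by field; rewrite gt_eqF.
by rewrite mulrCA [c * (_ * t)]mulrA.
Qed.

Lemma rate_le1 c n (t : R) : 0 < c -> 0 <= t -> rate mu alpha c n t <= 1.
Proof. by move=> c0 t0; rewrite -expR0 ler_expR oppr_le0 !mulr_ge0 ?powR_ge0// ltW. Qed.

Lemma rate_mono c n (s t : R) : 0 < c -> s <= t -> rate mu alpha c n t <= rate mu alpha c n s.
Proof.
by move=> c0 st; rewrite ler_expR lerN2; apply: ler_wpM2l => //; rewrite mulr_ge0 ?powR_ge0// ltW.
Qed.

Lemma powR_small (t p q : R) : 0 < t -> t <= 1 -> q <= p -> t `^ p <= t `^ q.
Proof.
move=> t0 t1 qp; rewrite -(subrK q p) powRD; last by rewrite (gt_eqF t0) implybT.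
rewrite ler_piMl ?powR_ge0//; have q0 : 0 <= p - q by rewrite subr_ge0.
by have := ge0_ler_powR q0 _ _ t1; rewrite !nnegrE (ltW t0) ler01 powR1; apply.
Qed.

Lemma mu_powR_le n p : p <= 0 -> mu n `^ p <= mu 0%N `^ p.
Proof. by move=> p0; rewrite -(opprK p); apply: powN_le => //; rewrite oppr_ge0. Qed.

Variable k1 : R.
Hypotheses (k1a : 3 / 2 <= k1) (k1b : 1 / 2 + gamma / bt <= k1)
 (k1c : 1 / 2 + (gamma + alpha - 1 / 2) / bt <= k1).

(** The three terms are those of [ctl_le]: the velocity term has order [t^-(1 + gamma/beta)], the
    position term with [1 / t ^+ 2] has order [t^-2] because [gamma < 1 / 2], and the damping term
    has order [t^-(1 + (gamma + alpha - 1/2)/beta)] when that power of mu is nonnegative. The lower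
    bounds on [k1] keep all exponents below [k1 + 1 / 2]; the extra [1 / 2] is regained by
    integrating over time. *)
Lemma free_cost c : 0 < c -> exists2 C : R, 0 < C & forall n (t : R), 0 < t -> t <= 1 ->
 mu n `^ gamma * rate mu alpha c n t * (1 / t + (1 / t ^+ 2 + da n / t) / fr n) <=
 C * t `^ (- (k1 + 1 / 2)).
Proof.
have k2a : - (k1 + 1 / 2) <= - 1 by have := k1a; lra.
move=> c0; have [g0 g2] := andP gamma0; have b0 : 0 < bt by exact: beta_gt0.
have [K1 K10 h1] := rate_powR c0 g0.
have [K3 K30 h3] : exists2 K : R, 0 < K & forall n (t : R), 0 < t -> t <= 1 ->
  mu n `^ (gamma + alpha - 1 / 2) * rate mu alpha c n t / t <= K * t `^ (- (k1 + 1 / 2)).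
 have [p0|p0] := leP 0 (gamma + alpha - 1 / 2).
  have [K K0 h] := rate_powR c0 p0; exists K => // n t t0 t1.
  apply: (@le_trans _ _ (K * t `^ (- ((gamma + alpha - 1 / 2) / bt)) / t)).
   by rewrite ler_pM2r ?invr_gt0// h.
  rewrite -mulrA ler_pM2l// -(powR_inv1 (ltW t0)) -powRD ?(gt_eqF t0) ?implybT//.
  apply: powR_small => //; move: k1c; set x := _ / bt => hx; lra.
 exists (mu 0%N `^ (gamma + alpha - 1 / 2)); first by rewrite powR_gt0.
 move=> n t t0 t1; apply: ler_pM; rewrite ?invr_ge0 ?mulr_ge0 ?powR_ge0 ?expR_ge0 ?(ltW t0)//.
  rewrite -[leRHS]mulr1; apply: ler_pM; rewrite ?powR_ge0 ?expR_ge0 ?mu_powR_le ?rate_le1// ltW//.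
 by rewrite -(powR_inv1 (ltW t0)); apply: powR_small.
exists (K1 + mu 0%N `^ (gamma - 1 / 2) + rho * K3).
 by rewrite !addr_gt0// ?powR_gt0// mulr_gt0.
move=> n t t0 t1; have r0 : 0 <= rate mu alpha c n t by exact: expR_ge0.
have mun p q : mu n `^ p * mu n `^ q = mu n `^ (p + q) by rewrite powRD// (gt_eqF (mu0 n)) implybT.
have -> : mu n `^ gamma * rate mu alpha c n t * (1 / t + (1 / t ^+ 2 + da n / t) / fr n) =
  mu n `^ gamma * rate mu alpha c n t / t + mu n `^ (gamma - 1 / 2) * rate mu alpha c n t / t ^+ 2 +
  rho * (mu n `^ (gamma + alpha - 1 / 2) * rate mu alpha c n t / t).
 rewrite -!mun powRN /damp /frq; field.
 by rewrite !gt_eqF// powR_gt0.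
rewrite !mulrDl -(mulrA rho) !lerD//.
- apply: (@le_trans _ _ (K1 * t `^ (- (gamma / bt)) / t)).
  by rewrite ler_pM2r ?invr_gt0// h1.
 rewrite -mulrA ler_pM2l// -(powR_inv1 (ltW t0)) -powRD ?(gt_eqF t0) ?implybT//.
 by apply: powR_small => //; have := k1b; lra.
- apply: ler_pM; rewrite ?invr_ge0 ?mulr_ge0 ?powR_ge0 ?(ltW t0)//.
  rewrite -[leRHS]mulr1; apply: ler_pM; rewrite ?powR_ge0 ?rate_le1 ?(ltW t0)//.
  by apply: mu_powR_le; lra.
 rewrite -powR_mulrn ?(ltW t0)// -powRN; apply: powR_small => //; have := k1a; lra.
- by rewrite ler_pM2l// h3.
Qed.

Definition entry_rate c := forall n (t : R), 0 <= t ->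
 [/\ `|Px e S n t| <= 2 * rate mu alpha c n t, `|px e S n t| <= 2 * rate mu alpha c n t,
   `|qv mu e rho alpha S n t| <= 2 * rate mu alpha c n t,
   `|px e S n t| <= 2 * fr n * t * rate mu alpha c n t &
   `|px e S n t| <= 4 * (fr n / da n) * rate mu alpha c n t].

Definition coef_rate c := forall n (s t : R) h, 0 <= s -> 0 <= t ->
 `|cx e n (S `|s| (S t h))| <= 2 * rate mu alpha c n t * (`|cx e n h| + `|cv e n h|) /\
 `|cv e n (S `|s| (S t h))| <= 2 * rate mu alpha c n t * (`|cx e n h| + `|cv e n h|).

Definition free_rate c C := forall n (t : R), 0 < t -> t <= 1 ->
 mu n `^ gamma * rate mu alpha c n t * (1 / t + (1 / t ^+ 2 + da n / t) / fr n) <=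
 C * t `^ (- (k1 + 1 / 2)).

Lemma coef_decay c : 0 < c -> entry_rate c -> coef_rate c.
Proof.
move=> c0 hc n s t h s0 t0.
have st : 0 <= s + t by rewrite addr_ge0.
have [h1 h2 h3 _ _] := hc n (s + t) st; have rt : rate mu alpha c n (s + t) <= rate mu alpha c n t.
 by apply: rate_mono => //; rewrite lerDr.
have up (x : R) : x <= 2 * rate mu alpha c n (s + t) -> x <= 2 * rate mu alpha c n t.
 by move=> hx; apply: le_trans hx _; rewrite ler_pM2l.
rewrite (ger0_norm s0) -(S_add hS _ s0 t0) (cx_S he mu0 rho0 hS n h st) (cv_S he mu0 rho0 hS n h st).
rewrite mulrDr; split; apply: le_trans (ler_normD _ _) _; rewrite !normrM ?normrN.
 by apply: lerD; apply: ler_wpM2r => //; exact: up.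
by apply: lerD; apply: ler_wpM2r => //; exact: up.
Qed.

(* The increments over a time l of the drift convolution: [fb n] is an integral
  of the n-th coordinate of the drift. *)
Definition drift_class (l M : R) (h : H) := exists2 fb : nat -> R,
 (forall N, \sum_(n < N) fb n ^+ 2 <= (M * l) ^+ 2) &
 forall n, [/\ 0 <= fb n, `|cv e n h| <= fb n, `|cx e n h| <= fb n,
  `|cx e n h| <= fr n * l * fb n & `|cx e n h| <= fr n / da n * fb n].

Section steered.
Context d (Omega : measurableType d) (P : probability Omega R)
 (T : R) (F : R -> set (set Omega)) (g : nat -> V) (b : nat -> R -> Omega -> R)
 (hF : normal_filtration P T F) (hW : cylindrical_wiener P T F g b) (Z : R -> Omega -> H).
Hypothesis IZ : forall t, 0 <= t <= T ->
 stochastic_integral P g b t (fun s v => S (t - s) (opG mu e gamma v)) (Z t).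

Definition noise (u r : R) := increment S u r (Z u) (Z r).

Let sH : @sepa R H := sepa_Hsp he.
Let Scon t x : 0 <= t -> hnorm (S t x) <= hnorm x.
Proof. exact: (S_contraction he mu0 rho0 hS). Qed.

Lemma time_in (u r : R) : 0 <= u -> u < r -> r <= T -> (0 <= u <= T) /\ (0 <= r <= T).
Proof. by move=> u0 ur rT; rewrite u0 rT (le_trans u0 (ltW ur)) (le_trans (ltW ur) rT). Qed.

Lemma vmeas_noise u r : 0 <= u -> u < r -> r <= T -> vmeas (noise u r).
Proof.
move=> u0 ur rT; have [uT rT'] := time_in u0 ur rT.
exact: (vmeas_increment hW (SD hS) (SZ hS) Scon ur (IZ uT) (IZ rT')).
Qed.

Lemma noise_adapted u r : 0 <= u -> u < r -> r <= T -> apx P (F r) (noise u r).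
Proof.
move=> u0 ur rT; have [uT rT'] := time_in u0 ur rT.
exact: (increment_adapted hF hW (SD hS) (SZ hS) Scon (S_add hS) (S_strong hS) u0 ur rT (IZ uT) (IZ rT')).
Qed.

Lemma noise_indep u r : 0 <= u -> u < r -> r <= T -> indep P (F u) (noise u r).
Proof.
move=> u0 ur rT; have [uT rT'] := time_in u0 ur rT.
exact: (increment_indep hF hW (SD hS) (SZ hS) Scon (S_add hS) (S_strong hS) u0 ur rT (IZ uT) (IZ rT')).
Qed.

Lemma noise_cocycle u w r omega : u <= w -> w <= r ->
 noise u r omega = S (r - w) (noise u w omega) + noise w r omega.
Proof.
move=> uw wr; rewrite (SB hS) ?subr_ge0// -(S_add hS) ?subr_ge0//.
by rewrite subrKA [RHS]addrC subrKA.
Qed.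

(** On [[u, w]] nothing is steered: the noise there only adds an independent variable, at cost 0 by
    [Ex_sqr], while [h] is smoothed to [S (w - u) h]. *)
Lemma noise_shift u w r h k : 0 <= u -> u < w -> w < r -> r <= T ->
 Harn P (noise w r) (- S (r - w) (S (w - u) h)) k -> Harn P (noise u r) (- S (r - u) h) k.
Proof.
move=> u0 uw wr rT hN; have wT : w <= T by exact: le_trans (ltW wr) rT.
have w0 : 0 <= w by exact: le_trans (ltW uw).
have [wI _] := time_in w0 wr rT.
have rw0 : 0 <= r - w by rewrite subr_ge0 ltW.
have wu0 : 0 <= w - u by rewrite subr_ge0 ltW.
have mN := vmeas_noise u0 uw wT.
have mS : vmeas (fun o => S (r - w) (noise u w o)) by exact: vmeas_comp (S_cont hS rw0) mN.
have -> : noise u r = fun o => S (r - w) (noise u w o) + noise w r o.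
 by apply/funext => o; rewrite -noise_cocycle// ltW.
have -> : S (r - u) h = S (r - w) (S (w - u) h) by rewrite -(S_add hS)// subrKA.
rewrite -(add0r (- S (r - w) (S (w - u) h))) -(add0r k).
have sF := filtration_sa hF wI.
apply: (@Harn_add _ _ _ _ (F w)) => //.
- exact: (filtration_meas hF wI).
- exact: (sa_setI sF).
- exact: (sa_setT sF).
- exact: sepa_R.
- exact: vmeas_noise.
- exact: noise_indep.
- apply: apx_comp => //.
 + exact: (filtration_meas hF wI).
 + exact: (sa_setI sF).
 + exact: (S_cont hS rw0).
 + move=> eps eps0; exists (eps / 2); first by rewrite divr_gt0.
  move=> x x' hx; apply: le_trans (S_lip (SD hS) (SZ hS) Scon _ _ rw0) _.
  by rewrite mulrC -ler_pdivlMr.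
 + exact: noise_adapted.
- move=> f hf f0; rewrite expR0 mul1r.
 have -> : (fun o => f (S (r - w) (noise u w o) + 0)) = (fun o => f (S (r - w) (noise u w o))).
  by apply/funext => o; rewrite addr0.
 by apply: Ex_sqr; exact: abd_ucb.
Qed.

Lemma Harn_le (Y : Omega -> H) h k k' : k <= k' -> Harn P Y h k -> Harn P Y h k'.
Proof.
move=> kk hY f hf f0; apply: le_trans (hY f hf f0) _; apply: ler_wpM2r; last by rewrite ler_expR.
by apply: Ex_ge0 => w; exact: sqr_ge0.
Qed.

(** The first half of the interval smooths [h], the second half steers [S t h]. Integrating the
    squared control over a time [t] turns the exponent [E0 + 1 / 2] into [E0], and the factor 2^E0
    comes from [t = (r - u) / 2]. *)
Lemma half_noise (B E0 t u r : R) h z : 0 <= u -> u < r -> r <= T -> t = (r - u) / 2 -> 0 <= B ->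
 (forall n s, 0 <= s <= t -> `|mu n `^ gamma * steer mu e rho alpha S 0 t (S t h) n s| <= B * t `^ (- (E0 + 1 / 2)) * z n) ->
 (forall M, \sum_(n < M) z n ^+ 2 <= 1) ->
 Harn P (noise u r) (- S (r - u) h) ((B * 2 `^ E0 * (r - u) `^ (- E0)) ^+ 2).
Proof.
move=> u0 ur rT tE B0 hs hz; have ru : 0 < r - u by rewrite subr_gt0.
have t0 : 0 < t by rewrite tE divr_gt0.
pose w := u + t; have uw : w - u = t by rewrite addrC addKr.
have wr : r - w = t by rewrite /w tE; field.
have lt1 : u < w by rewrite -subr_gt0 uw.
have lt2 : w < r by rewrite -subr_gt0 wr.
have w0 : 0 <= w by exact: le_trans (ltW lt1).
have [wI rI] := time_in w0 lt2 rT; have [g0 _] := andP gamma0.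
have stE n s : steer mu e rho alpha S w r (S t h) n s = steer mu e rho alpha S 0 t (S t h) n s.
 by rewrite /steer subr0 wr.
apply: (noise_shift u0 lt1 lt2 rT); rewrite uw.
have := control_Harn he mu0 muS rho0 g0 hS hF hW w0 lt2 rT (IZ wI) (IZ rI) (h0 := S t h)
  (k := fun n => B * t `^ (- (E0 + 1 / 2)) * z n) (kap := (B * t `^ (- (E0 + 1 / 2))) ^+ 2).
rewrite wr => hc; apply: Harn_le (hc _ _).
- have -> : t `^ (- (E0 + 1 / 2)) = t `^ (- E0) * t `^ (- (1 / 2)).
  by rewrite -powRD ?opprD// (gt_eqF t0) implybT.
 have -> : t * (B * (t `^ (- E0) * t `^ (- (1 / 2)))) ^+ 2 =
   (B * t `^ (- E0)) ^+ 2 * (t * t `^ (- (1 / 2)) ^+ 2) by ring.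
 have -> : t * t `^ (- (1 / 2)) ^+ 2 = 1.
  rewrite -powR_mulrn ?powR_ge0// -powRrM -{1}(powRr1 (ltW t0)) -powRD ?(gt_eqF t0) ?implybT//.
  by rewrite (_ : 1 + - (1 / 2) * 2 = 0) ?powRr0//; field.
 have -> : t `^ (- E0) = 2 `^ E0 * (r - u) `^ (- E0).
  by rewrite tE powRM ?(ltW ru)// -(powR_inv1 (ler0n R 2)) -powRrM mulN1r opprK mulrC.
 by rewrite mulr1 mulrA.
- by move=> n s /hs; rewrite stE.
- move=> M; under eq_bigr do rewrite exprMn.
 by rewrite -mulr_sumr ler_piMr ?sqr_ge0.
Qed.

Lemma steer_le n (t s : R) h : 0 < t -> 0 <= s <= t ->
 `|mu n `^ gamma * steer mu e rho alpha S 0 t h n s| <=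
 mu n `^ gamma * (6 * (`|cv e n (S `|s| h)| / t + (1 / t ^+ 2 + da n / t) * (`|cx e n (S `|s| h)| / fr n))).
Proof.
move=> t0 hs; rewrite normrM ger0_norm ?powR_ge0// ler_pM2l ?powR_gt0//.
rewrite /steer subr0; exact: (ctl_le (frq_gt0 mu0 n) (damp_gt0 mu0 alpha rho0 n) t0).
Qed.

Lemma free_steer_with c C u r h : 0 < C -> coef_rate c -> free_rate c C ->
 0 <= u -> u < r -> r <= T -> r - u <= 1 ->
 Harn P (noise u r) (- S (r - u) h) ((24 * C * 2 `^ k1 * (r - u) `^ (- k1) * hnorm h) ^+ 2).
Proof.
move=> C0 hd hC u0 ur rT ru1; have ru : 0 < r - u by rewrite subr_gt0.
have [t tE] : exists t : R, t = (r - u) / 2 by exists ((r - u) / 2).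
have t0 : 0 < t by rewrite tE divr_gt0.
have t1 : t <= 1 by rewrite tE; lra.
have [h0|h0] := eqVneq (hnorm h) 0.
 have -> : h = 0 by apply/eqP; rewrite -normr_le0 -h0; exact: norm_le_hnorm.
 have -> : - S (r - u) 0 = 0 by rewrite (S0 hS) ?oppr0 ?ltW.
 move=> f hf f0; have hn : hnorm (0 : H) = 0.
  by apply/eqP; rewrite eq_le hnorm_ge0 andbT (le_trans (hnorm_le_norm _))// normr0 mulr0.
 rewrite hn mulr0 expr0n expR0 mul1r.
 have -> : (fun o => f (noise u r o + 0)) = (fun o => f (noise u r o)).
  by apply/funext => o; rewrite addr0.
 by apply: Ex_sqr; apply: abd_ucb => //; exact: vmeas_noise.
have hh : 0 < hnorm h by rewrite lt_def h0 hnorm_ge0.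
(* Normalized so that the squares sum to at most [1 / 2]. The constant is [24 = 6 * 2 * 2], from
   [ctl_le], from the decay of the coordinates and from this normalization. *)
pose z n := (`|cx e n h| + `|cv e n h|) / (2 * hnorm h).
have -> : (24 * C * 2 `^ k1 * (r - u) `^ (- k1) * hnorm h) = (24 * C * hnorm h) * 2 `^ k1 * (r - u) `^ (- k1).
 by ring.
apply: (half_noise (z := z) u0 ur rT tE); first by rewrite !mulr_ge0 ?(ltW C0) ?hnorm_ge0.
- move=> n s hs; apply: le_trans (steer_le n (S t h) t0 hs) _.
 have [s0 _] := andP hs; have [hx hv] := hd n s t h s0 (ltW t0).
 have w1 := frq_gt0 mu0 n; have d1 := damp_gt0 mu0 alpha rho0 n.
 pose y := `|cx e n h| + `|cv e n h|; have y0 : 0 <= y by rewrite addr_ge0.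
 apply: (@le_trans _ _ (12 * y * (mu n `^ gamma * rate mu alpha c n t * (1 / t + (1 / t ^+ 2 + da n / t) / fr n)))).
  have -> : 12 * y * (mu n `^ gamma * rate mu alpha c n t * (1 / t + (1 / t ^+ 2 + da n / t) / fr n)) =
    mu n `^ gamma * (6 * (2 * rate mu alpha c n t * y / t + (1 / t ^+ 2 + da n / t) * (2 * rate mu alpha c n t * y / fr n))).
   by field; rewrite !gt_eqF.
  rewrite ler_pM2l ?powR_gt0// ler_pM2l//; apply: lerD; first by rewrite ler_pM2r ?invr_gt0.
  apply: ler_wpM2l; last by rewrite ler_pM2r ?invr_gt0.
  by rewrite addr_ge0 ?divr_ge0 ?exprn_ge0// ltW.
 have := hC n t t0 t1 => hCn; apply: le_trans (ler_wpM2l _ hCn) _; first by rewrite mulr_ge0.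
 by apply: le_of_eq; rewrite /z -/y; field.
- move=> M; under eq_bigr do rewrite expr_div_n.
 rewrite -mulr_suml ler_pdivrMr ?mulr_gt0//.
 apply: (@le_trans _ _ (\sum_(n < M) 2 * (cx e n h ^+ 2 + cv e n h ^+ 2))).
  apply: ler_sum => n _; rewrite -[X in _ <= 2 * (X + _)]real_normK ?num_real// -[X in _ <= 2 * (_ + X)]real_normK ?num_real//.
  by move: (`|cx e n h|) (`|cv e n h|) => p q; have := sqr_ge0 (p - q); rewrite -subr_ge0; lra.
 rewrite -mulr_sumr exprMn; have := hnorm_coef_le he M h; have := sqr_ge0 (hnorm h); lra.
Qed.

(** The position coordinate of [h] is at most [w l] and at most [w / d] times [fb n], and the entry
    [px] obeys similar bounds. With [l <= 8 t] the two position terms of the control are then of the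
    order [fb n / t] of the velocity term, so that neither the exponent [3 / 2] nor the one that
    involves [alpha] appears. *)
Lemma drift_steer_with c K u r l M h : 0 < c -> 0 < K -> entry_rate c ->
 (forall n (t : R), 0 < t -> mu n `^ gamma * rate mu alpha c n t <= K * t `^ (- (gamma / bt))) ->
 0 <= u -> u < r -> r <= T -> r - u <= 1 ->
 0 < l -> l <= 4 * (r - u) -> 0 < M -> drift_class l M h ->
 Harn P (noise u r) (- S (r - u) h) ((180 * K * 2 `^ (1 / 2 + gamma / bt) * (r - u) `^ (- (1 / 2 + gamma / bt)) * (M * l)) ^+ 2).
Proof.
move=> c0 K0 hc hK u0 ur rT ru1 l0 lr M0 [fb hfb fbn]; have ru : 0 < r - u by rewrite subr_gt0.
have [t tE] : exists t : R, t = (r - u) / 2 by exists ((r - u) / 2).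
have t0 : 0 < t by rewrite tE divr_gt0.
have Ml : 0 < M * l by rewrite mulr_gt0.
set E0 := 1 / 2 + gamma / bt.
have -> : 180 * K * 2 `^ E0 * (r - u) `^ (- E0) * (M * l) = (180 * K * (M * l)) * 2 `^ E0 * (r - u) `^ (- E0).
 by ring.
apply: (half_noise (z := fun n => fb n / (M * l)) u0 ur rT tE); first by rewrite !mulr_ge0 ?(ltW K0) ?(ltW M0) ?(ltW l0).
- move=> n s hs; apply: le_trans (steer_le n (S t h) t0 hs) _.
 have [s0 st] := andP hs; have w1 := frq_gt0 mu0 n; have d1 := damp_gt0 mu0 alpha rho0 n.
 have [f0 v1 x1 x2 x3] := fbn n; have st0 : 0 <= s + t by rewrite addr_ge0// ltW.
 have [h1 h2 h3 h4 h5] := hc n (s + t) st0.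
 have rt : rate mu alpha c n (s + t) <= rate mu alpha c n t by apply: rate_mono => //; rewrite lerDr.
 have r0 : 0 <= rate mu alpha c n t by exact: expR_ge0.
 have up a (x : R) : 0 <= a -> x <= a * rate mu alpha c n (s + t) -> x <= a * rate mu alpha c n t.
  by move=> a0 hx; apply: le_trans hx _; exact: ler_wpM2l.
 have {}h1 := up _ _ (ler0n R 2) h1; have {}h2 := up _ _ (ler0n R 2) h2; have {}h3 := up _ _ (ler0n R 2) h3.
 have {}h5 : `|px e S n (s + t)| <= 4 * (fr n / da n) * rate mu alpha c n t.
  by apply: up h5; rewrite mulr_ge0// divr_ge0// ltW.
 have {}h4 : `|px e S n (s + t)| <= 2 * fr n * (2 * t) * rate mu alpha c n t.
  apply: le_trans h4 _; apply: ler_pM; rewrite ?expR_ge0// ?mulr_ge0// ?(ltW w1)//.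
  by rewrite ler_pM2l ?mulr_gt0// mulr2n mulrDl mul1r lerD2r.
 have l4 : l <= 8 * t by rewrite tE; lra.
 rewrite (ger0_norm s0) -(S_add hS _ s0 (ltW t0)) (cx_S he mu0 rho0 hS n h st0) (cv_S he mu0 rho0 hS n h st0).
 set rr := rate mu alpha c n t in rt r0 h1 h2 h3 h4 h5 *; set f := fb n in f0 v1 x1 x2 x3 *.
 have V : `|- px e S n (s + t) * cx e n h + qv mu e rho alpha S n (s + t) * cv e n h| <= 4 * rr * f.
  apply: le_trans (ler_normD _ _) _; rewrite !normrM normrN.
  have a1 := ler_pM (normr_ge0 _) (normr_ge0 _) h2 x1; have a2 := ler_pM (normr_ge0 _) (normr_ge0 _) h3 v1.
  by apply: le_trans (lerD a1 a2) _; rewrite -mulrDl -mulrDl -natrD.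
 have X1 : `|Px e S n (s + t) * cx e n h + px e S n (s + t) * cv e n h| / fr n <= 20 * rr * f * t.
  rewrite ler_pdivrMr//; apply: le_trans (ler_normD _ _) _; rewrite !normrM.
  have a1 := ler_pM (normr_ge0 _) (normr_ge0 _) h1 x2; have a2 := ler_pM (normr_ge0 _) (normr_ge0 _) h4 v1.
  apply: le_trans (lerD a1 a2) _.
  have : 2 * rr * (fr n * l * f) <= 2 * rr * (fr n * (8 * t) * f).
   apply: ler_wpM2l; first by rewrite mulr_ge0.
   by apply: ler_wpM2r => //; rewrite ler_pM2l.
  move=> hq; apply: le_trans (lerD hq (lexx _)) _; apply: le_of_eq; ring.
 have X2 : da n * (`|Px e S n (s + t) * cx e n h + px e S n (s + t) * cv e n h| / fr n) <= 6 * rr * f.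
  rewrite mulrA ler_pdivrMr// mulrC -ler_pdivlMr//; apply: le_trans (ler_normD _ _) _; rewrite !normrM.
  have a1 := ler_pM (normr_ge0 _) (normr_ge0 _) h1 x3; have a2 := ler_pM (normr_ge0 _) (normr_ge0 _) h5 v1.
  apply: le_trans (lerD a1 a2) _; apply: le_of_eq; field.
  by rewrite gt_eqF.
 move: V X1 X2; set vv := `|_|; set xx := `|_| / _ => V X1 X2.
 (* [180 = 6 * (4 + 20 + 6)]: the constants of [V], [X1] and [X2] times that of [ctl_le]. *)
 apply: (@le_trans _ _ (180 * (mu n `^ gamma * rr) * f / t)).
  have -> : 180 * (mu n `^ gamma * rr) * f / t = mu n `^ gamma * (6 * (4 * rr * f / t + (20 * rr * f * t / t ^+ 2 + 6 * rr * f / t))).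
   by field; rewrite gt_eqF.
  rewrite ler_pM2l ?powR_gt0// ler_pM2l//; apply: lerD; first by rewrite ler_pM2r ?invr_gt0.
  rewrite mulrDl; apply: lerD; first by rewrite mul1r mulrC ler_pM2r ?invr_gt0 ?exprn_gt0.
  by rewrite mulrAC ler_pM2r ?invr_gt0.
 have := hK n t t0; rewrite -/rr => hKn.
 apply: (@le_trans _ _ (180 * (K * t `^ (- (gamma / bt))) * f / t)).
  by rewrite ler_pM2r ?invr_gt0//; apply: ler_wpM2r => //; rewrite ler_pM2l.
 have -> : t `^ (- (E0 + 1 / 2)) = t `^ (- (gamma / bt)) / t.
  rewrite -(powR_inv1 (ltW t0)) -powRD ?(gt_eqF t0) ?implybT//; congr (_ `^ _).
  by rewrite /E0; set q := gamma / bt; field.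
 by apply: le_of_eq; field; rewrite !gt_eqF.
- move=> N; under eq_bigr do rewrite expr_div_n.
 by rewrite -mulr_suml ler_pdivrMr ?mul1r ?exprn_gt0.
Qed.
End steered.

(** Collects all that depends on the probability space, so that the constants of [free_steer] and
    [drift_steer] are chosen before it, as the final constant must be. *)
Definition noise_on d (Omega : measurableType d) (P : probability Omega R) (T : R)
  (Z : R -> Omega -> H) := exists (F : R -> set (set Omega)) g b,
 [/\ normal_filtration P T F, cylindrical_wiener P T F g b & forall t, 0 <= t <= T ->
  stochastic_integral P g b t (fun s v => S (t - s) (opG mu e gamma v)) (Z t)].

Lemma free_steer : exists2 C : R, 0 < C &
 forall d (Omega : measurableType d) (P : probability Omega R) T Z u r h, noise_on P T Z ->
 0 <= u -> u < r -> r <= T -> r - u <= 1 ->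
 Harn P (noise Z u r) (- S (r - u) h) ((C * (r - u) `^ (- k1) * hnorm h) ^+ 2).
Proof.
have [c c0 hc] := mode_decay he mu0 muS rho0 alpha01 hS; have [C C0 hC] := free_cost c0.
exists (24 * C * 2 `^ k1); first by rewrite !mulr_gt0.
move=> d Omega P T Z u r h [F [g [b [hF hW IZ]]]].
exact: (free_steer_with hF hW IZ h C0 (coef_decay c0 hc) hC).
Qed.

Lemma drift_steer : exists2 C : R, 0 < C &
 forall d (Omega : measurableType d) (P : probability Omega R) T Z u r l M h, noise_on P T Z ->
 0 <= u -> u < r -> r <= T -> r - u <= 1 ->
 0 < l -> l <= 4 * (r - u) -> 0 < M -> drift_class l M h ->
 Harn P (noise Z u r) (- S (r - u) h) ((C * (r - u) `^ (- (1 / 2 + gamma / bt)) * (M * l)) ^+ 2).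
Proof.
have [c c0 hc] := mode_decay he mu0 muS rho0 alpha01 hS; have [g0 _] := andP gamma0.
have [K K0 hK] := rate_powR c0 g0.
exists (180 * K * 2 `^ (1 / 2 + gamma / bt)); first by rewrite !mulr_gt0.
move=> d Omega P T Z u r l M h [F [g [b [hF hW IZ]]]].
exact: (drift_steer_with hF hW IZ c0 K0 hc hK).
Qed.
End cost.

(** * Mean squares of finitely many coordinates *)

Lemma subr_exchange (V : zmodType) (x y z t : V) : x - y - (z - t) = x - z - (y - t).
Proof. by rewrite !opprB [t - z]addrC addrACA [- y + t]addrC. Qed.

Lemma sum_cells (V : nmodType) (F : nat -> V) k p :
 \sum_(j < k * p) F j = \sum_(c < p) \sum_(r < k) F (k * c + r)%N.
Proof.
elim: p => [|p IH]; first by rewrite muln0 !big_ord0.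
by rewrite mulnSr big_split_ord IH big_ord_recr.
Qed.

(** Index arithmetic of one dyadic refinement: a block of length [2 * k] consists of two blocks of
    length [k], and [r %/ k] tells which of them contains position [r]. *)
Lemma half_cell (k c r : nat) : (0 < k)%N -> (r < 2 * k)%N ->
 [/\ (2 * k * c.+1 + r = k * (2 * c + 1 + r %/ k).+1 + r %% k)%N,
   (k * (2 * c + 1 + r %/ k) = 2 * k * c + k + k * (r %/ k))%N,
   (2 * k * c < 2 * k * c + k + k * (r %/ k))%N,
   (2 * k * c + k + k * (r %/ k) <= 2 * k * c.+1)%N &
   (2 * k * c + k + k * (r %/ k) + k <= 2 * k * c.+1 + r)%N /\
   (2 * k * c + k + k * (r %/ k) - 2 * k * c <= 2 * k)%N].
Proof.
move=> k0 rk; have rk1 : (r %/ k <= 1)%N by rewrite -ltnS ltn_divLR.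
have := divn_eq r k; have := ltn_pmod r k0.
case: (r %/ k)%N rk1 (r %% k)%N => [|[|//]] _ s sk rE; rewrite rE; split; try split; lia.
Qed.

Lemma four_split (V : zmodType) (p1 p2 y1 y2 z : V) :
 p1 - p2 - (y1 - y2) = p1 - y1 - (z - y2) + (z - p2).
Proof. by rewrite subr_exchange -[RHS]addrA; congr (_ + _); rewrite !opprB subrKA. Qed.

Lemma powR2_gt1 (R : realType) (ep : R) : 0 < ep -> 1 < 2 `^ ep.
Proof.
move=> ep0; rewrite /powR pnatr_eq0 expR_gt1 mulr_gt0// ln_gt0//.
lra.
Qed.

Lemma sqr_inf (R : realType) (A p : R) : 0 <= p -> (forall p', p < p' -> A <= p' ^+ 2) -> A <= p ^+ 2.
Proof.
move=> p0 h; apply/ler_addgt0Pr => eps eps0.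
pose del := Num.min 1 (eps / (2 * p + 1)).
have p1 : 0 < 2 * p + 1 by lra.
have d0 : 0 < del by rewrite lt_min ltr01 divr_gt0.
have d1 : del <= 1 by rewrite ge_min lexx.
have d2 : del * (2 * p + 1) <= eps by rewrite -ler_pdivlMr// ge_min lexx orbT.
have := h (p + del); rewrite ltrDl => /(_ d0) hh; apply: le_trans hh _.
by rewrite sqrrD -addrA lerD2l; nra.
Qed.

Section mean_square_vectors.
Context (R : realType) d (Omega : measurableType d) (P : probability Omega R) (J : nat).
Implicit Types (Y Z : nat -> Omega -> R) (p q : R).
Notation Ex := (Ex P).
Notation abd := (abd P).

Definition sqn Y : R := \sum_(k < J) Ex (fun w => Y k w ^+ 2).

(* The open condition makes the triangle inequality below free of the case p q = 0. *)
Definition le2 Y p := forall p', p < p' -> sqn Y <= p' ^+ 2.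

Lemma le2_sqn Y p : 0 <= p -> sqn Y <= p ^+ 2 -> le2 Y p.
Proof. by move=> p0 h p' pp; apply: le_trans h _; rewrite ler_sqr ?nnegrE ?(le_trans p0)// ltW. Qed.

Lemma sqn_le2 Y p : 0 <= p -> le2 Y p -> sqn Y <= p ^+ 2.
Proof. exact: sqr_inf. Qed.

Lemma le2_le Y p q : p <= q -> le2 Y p -> le2 Y q.
Proof. by move=> pq h p' qp; apply: h; exact: le_lt_trans qp. Qed.

Lemma le2_ext Y Z p : (forall k w, (k < J)%N -> Y k w = Z k w) -> le2 Z p -> le2 Y p.
Proof.
move=> e h p' pp; apply: le_trans (h p' pp); apply: le_of_eq.
by apply: eq_bigr => k _; congr Ex; apply/funext => w; rewrite e.
Qed.

Lemma sqn_le Y (f : Omega -> R) p : (forall k, abd (Y k)) -> abd f ->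
 {ae P, forall w, \sum_(k < J) Y k w ^+ 2 <= f w} -> Ex f <= p -> sqn Y <= p.
Proof.
move=> aY af h; apply: le_trans; rewrite /sqn -Ex_sum; last by move=> k _; exact: abdX.
by apply: Ex_ae_le => //; apply: abd_sum => k _; exact: abdX.
Qed.

Lemma amgm_split (x y s : R) : 0 < s -> (x + y) ^+ 2 <= (1 + s) * x ^+ 2 + (1 + s^-1) * y ^+ 2.
Proof.
move=> s0; have : 0 <= s^-1 * (s * x - y) ^+ 2 by rewrite mulr_ge0 ?sqr_ge0// invr_ge0 ltW.
have -> : s^-1 * (s * x - y) ^+ 2 = s * x ^+ 2 - 2 * (x * y) + s^-1 * y ^+ 2.
 by field; rewrite gt_eqF.
lra.
Qed.

(** Minkowski's inequality, from [(x + y)^2 <= (1 + s) x^2 + (1 + 1/s) y^2] at the optimal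
    [s = q' / p'], which is defined and positive since [p'] and [q'] exceed [p] and [q]. *)
Lemma le2D Y Z p q : (forall k, abd (Y k)) -> (forall k, abd (Z k)) -> 0 <= p -> 0 <= q ->
 le2 Y p -> le2 Z q -> le2 (fun k w => Y k w + Z k w) (p + q).
Proof.
move=> aY aZ p0 q0 hY hZ s' ss; pose del := (s' - (p + q)) / 2.
have d0 : 0 < del by rewrite divr_gt0// subr_gt0.
pose p' := p + del; pose q' := q + del.
have p'0 : 0 < p' by rewrite ltr_wpDl. have q'0 : 0 < q' by rewrite ltr_wpDl.
have hp : sqn Y <= p' ^+ 2 by apply: hY; rewrite ltrDl.
have hq : sqn Z <= q' ^+ 2 by apply: hZ; rewrite ltrDl.
have s0 : 0 < q' / p' by rewrite divr_gt0.
have h1 : sqn (fun k w => Y k w + Z k w) <= (1 + q' / p') * sqn Y + (1 + (q' / p')^-1) * sqn Z.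
 rewrite !mulr_sumr -big_split; apply: ler_sum => k _ /=.
 have b1 : abd (fun w => (1 + q' / p') * Y k w ^+ 2) by apply: abdZ; exact: abdX.
 have b2 : abd (fun w => (1 + (q' / p')^-1) * Z k w ^+ 2) by apply: abdZ; exact: abdX.
 rewrite -(ExZ (1 + q' / p') (abdX 2 (aY k))) -(ExZ (1 + (q' / p')^-1) (abdX 2 (aZ k))) -(ExD b1 b2).
 apply: Ex_le; [by apply: abdX; exact: abdD|exact: abdD|] => w.
 exact: amgm_split.
apply: le_trans h1 _; have -> : s' = p' + q' by rewrite /p' /q' /del; field.
have -> : (p' + q') ^+ 2 = (1 + q' / p') * p' ^+ 2 + (1 + (q' / p')^-1) * q' ^+ 2.
 by field; rewrite !gt_eqF.
by apply: lerD; apply: ler_wpM2l => //; rewrite addr_ge0// ?invr_ge0 ltW.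
Qed.

Lemma le2_zero p : 0 <= p -> le2 (fun _ _ => 0) p.
Proof.
move=> p0; apply: le2_sqn => //; rewrite /sqn big1 ?sqr_ge0// => k _.
by rewrite expr0n Ex_cst.
Qed.

Lemma le2Z a Y p : (forall k, abd (Y k)) -> 0 <= a -> 0 <= p -> le2 Y p -> le2 (fun k w => a * Y k w) (a * p).
Proof.
move=> aY a0 p0 h; apply: le2_sqn; first exact: mulr_ge0.
have -> : sqn (fun k w => a * Y k w) = a ^+ 2 * sqn Y.
 rewrite mulr_sumr; apply: eq_bigr => k _; rewrite -(ExZ (a ^+ 2) (abdX 2 (aY k))).
 by congr Ex; apply/funext => w; rewrite exprMn.
by rewrite exprMn; apply: ler_wpM2l; [exact: sqr_ge0|exact: sqn_le2].
Qed.

Lemma le2_sum (I : eqType) (s : seq I) (Y : I -> nat -> Omega -> R) (p : I -> R) :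
 (forall i k, abd (Y i k)) -> (forall i, i \in s -> 0 <= p i) -> (forall i, i \in s -> le2 (Y i) (p i)) ->
 le2 (fun k w => \sum_(i <- s) Y i k w) (\sum_(i <- s) p i).
Proof.
move=> aY; elim: s => [|i s IH] p0 h.
 by rewrite big_nil; apply: (@le2_ext _ (fun _ _ => 0)); [move=> k w _; rewrite big_nil|exact: le2_zero].
rewrite big_cons; apply: (@le2_ext _ (fun k w => Y i k w + \sum_(j <- s) Y j k w)).
 by move=> k w _; rewrite big_cons.
have ps j : j \in s -> 0 <= p j by move=> js; apply: p0; rewrite inE js orbT.
apply: le2D => //.
- by move=> k; apply: abd_sum.
- by apply: p0; rewrite inE eqxx.
- by rewrite big_seq; apply: sumr_ge0.
- by apply: h; rewrite inE eqxx.
- by apply: IH => // j js; apply: h; rewrite inE js orbT.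
Qed.

Lemma sqn_orth n (Y : nat -> nat -> Omega -> R) : (forall i k, (i < n)%N -> abd (Y i k)) ->
 (forall i j k, (i < j < n)%N -> Ex (fun w => Y i k w * Y j k w) = 0) ->
 sqn (fun k w => \sum_(i < n) Y i k w) = \sum_(i < n) sqn (Y i).
Proof.
elim: n => [|n IH] aY o.
 by rewrite big_ord0 /sqn big1// => k _; rewrite -[RHS](Ex_cst P); congr Ex; apply/funext => w; rewrite big_ord0 expr0n.
rewrite big_ord_recr/= -IH; last first.
- by move=> i j k /andP[ij jn]; apply: o; rewrite ij (ltn_trans jn).
- by move=> i k ik; apply: aY; rewrite ltnW.
rewrite -big_split; apply: eq_bigr => k _ /=.
pose A w := \sum_(i < n) Y i k w.
have aYi (i : 'I_n) : abd (Y i k) by apply: aY; rewrite ltnS ltnW.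
have aYn : abd (Y n k) by exact: aY.
have aA : abd A by apply: abd_sum.
have a0 : Ex (fun w => A w * Y n k w) = 0.
 rewrite (_ : (fun w => _) = (fun w => \sum_(i < n) Y i k w * Y n k w)); last first.
  by apply/funext => w; rewrite mulr_suml.
 rewrite Ex_sum; last by move=> i _; exact: abdM.
 by rewrite big1// => i _; apply: o; rewrite ltn_ord ltnSn.
have e : (fun w => (\sum_(i < n.+1) Y i k w) ^+ 2) = (fun w => A w ^+ 2 + Y n k w ^+ 2 + 2 * (A w * Y n k w)).
 by apply/funext => w; rewrite big_ord_recr/= -/(A w); ring.
rewrite e ExD; [|by apply: abdD; exact: abdX|by apply: abdZ; exact: abdM].
by rewrite ExD ?ExZ ?a0 ?mulr0 ?addr0//; [exact: abdM|exact: abdX|exact: abdX].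
Qed.

(** Test with [y] proportional to [x]. Scalar estimates for combinations of coordinates thus become
    estimates for the [J] coordinates together, with the same constant for every [J]. *)
Lemma dual_norm (x : nat -> R) (B : R) : 0 <= B ->
 (forall y : nat -> R, \sum_(k < J) y k ^+ 2 <= 1 -> `|\sum_(k < J) y k * x k| <= B) ->
 \sum_(k < J) x k ^+ 2 <= B ^+ 2.
Proof.
move=> B0 h; set s := \sum_(k < J) x k ^+ 2.
have s0 : 0 <= s by apply: sumr_ge0 => k _; exact: sqr_ge0.
have [s1|s1] := eqVneq s 0; first by rewrite s1 sqr_ge0.
have sp : 0 < Num.sqrt s by rewrite sqrtr_gt0 lt_def s1.
have ss : Num.sqrt s ^+ 2 = s by rewrite sqr_sqrtr.
have := h (fun k => x k / Num.sqrt s).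
under eq_bigr do rewrite expr_div_n ss; rewrite -mulr_suml divff// lexx => /(_ isT).
under eq_bigr do rewrite mulrAC -expr2; rewrite -mulr_suml -/s -{1}ss expr2 mulfK ?gt_eqF//.
by rewrite gtr0_norm// => hb; rewrite -{1}ss ler_sqr ?nnegrE// ltW.
Qed.
End mean_square_vectors.

(** * Smoothing by the drift-free transition operators *)

Section smoothing.
Context (R : realType) (m : nat) d (Omega : measurableType d) (P : probability Omega R).
Notation H := (Hsp R m).
Notation Ex := (Ex P).
Variables (sH : @sepa R H) (T : R) (F : R -> set (set Omega)) (hF : normal_filtration P T F) (S : R -> H -> H)
 (SDh : forall t x y, 0 <= t -> S t (x + y) = S t x + S t y) (SZh : forall t a x, 0 <= t -> S t (a *: x) = a *: S t x)
 (Scon : forall t x, 0 <= t -> hnorm (S t x) <= hnorm x)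
 (Sadd : forall s t x, 0 <= s -> 0 <= t -> S (s + t) x = S s (S t x)) (N : R -> R -> Omega -> H)
 (mN : forall u r, 0 <= u -> u < r -> r <= T -> vmeas (N u r))
 (aN : forall u r, 0 <= u -> u < r -> r <= T -> apx P (F r) (N u r))
 (iN : forall u r, 0 <= u -> u < r -> r <= T -> indep P (F u) (N u r))
 (cN : forall u w r o, u <= w -> w <= r -> N u r o = S (r - w) (N u w o) + N w r o) (theta : R) (th01 : 0 < theta < 1).

Definition hol (K : R) (f : H -> R) := (forall x, `|f x| <= K) /\
 forall x y, `|f x - f y| <= K * hnorm (x - y) `^ theta.

Lemma hol_ucb K f : hol K f -> ucb f.
Proof.
move=> [fK fh]; split; first by exists K.
have [t0 _] := andP th01.
have K0 : 0 <= K by apply: le_trans (fK 0).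
move=> e e0; have e1 : 0 < e / (K + 1) by rewrite divr_gt0// ltr_wpDl.
exists ((e / (K + 1)) `^ theta^-1 / 2) => [|x y xy]; first by rewrite divr_gt0 ?powR_gt0.
apply: le_trans (fh x y) _.
have h1 : hnorm (x - y) `^ theta <= e / (K + 1).
 apply: (@le_trans _ _ (((e / (K + 1)) `^ theta^-1) `^ theta)).
  apply: ge0_ler_powR; rewrite ?nnegrE ?powR_ge0 ?hnorm_ge0 ?(ltW t0)//.
  by apply: le_trans (hnorm_le_norm _) _; rewrite mulrC -ler_pdivlMr.
 by rewrite -powRrM mulVf ?gt_eqF// powRr1// ltW.
apply: le_trans (ler_wpM2l K0 h1) _.
by apply: mul_div_le => //; [rewrite lerDl|rewrite ltr_wpDl|exact: ltW].
Qed.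

(** Transition operator over [[u, r]] of the linear equation without drift. By [freeze],
    conditioning a function of the free flow on the past amounts to applying it. *)
Definition phi u r f x := Ex (fun w => f (S (r - u) x + N u r w)).

Lemma hnorm_S_sub t x y : 0 <= t -> hnorm (S t x - S t y) <= hnorm (x - y).
Proof.
move=> t0; have -> : S t x - S t y = S t (x - y) by rewrite SDh// -(scaleN1r y) SZh// scaleN1r.
exact: Scon.
Qed.

Lemma ucb_shiftl (f : H -> R) y : ucb f -> ucb (fun x => f (y + x)).
Proof.
move=> hf; have := ucb_shift y hf; congr ucb; apply/funext => x; by rewrite addrC.
Qed.

Lemma abd_shift u r f x : 0 <= u -> u < r -> r <= T -> ucb f -> abd P (fun w => f (x + N u r w)).
Proof.
by move=> u0 ur rT hf; exact: (abd_ucb P (ucb_shiftl x hf) (mN u0 ur rT)).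
Qed.

Lemma phi_hol u r K f : 0 <= u -> u < r -> r <= T -> hol K f -> hol K (phi u r f).
Proof.
move=> u0 ur rT hK; have hf := hol_ucb hK; have [fK fh] := hK.
have [t0 _] := andP th01; have K0 : 0 <= K by apply: le_trans (fK 0).
split => [x|x y].
 by apply: Ex_bnd; [exact: abd_shift|apply: aeW => w; exact: fK].
rewrite -ExB; [|exact: abd_shift|exact: abd_shift].
apply: Ex_bnd; first by apply: abdB; exact: abd_shift.
apply: aeW => w; apply: le_trans (fh _ _) _; rewrite opprD addrACA subrr addr0.
apply: ler_wpM2l => //; apply: ge0_ler_powR; rewrite ?nnegrE ?hnorm_ge0 ?(ltW t0)//.
by apply: hnorm_S_sub; rewrite subr_ge0 ltW.
Qed.

(** The increment over [[u, w]] is known at time [w] and the one over [[w, r]] is independent of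
    that past, so [freeze] integrates the latter out first. *)
Lemma Chapman_Kolmogorov u w r K f x : 0 <= u -> u < w -> w < r -> r <= T -> hol K f ->
 phi u r f x = phi u w (phi w r f) x.
Proof.
move=> u0 uw wr rT hK; have hf := hol_ucb hK.
have w0 : 0 <= w by lra.
have wT : w <= T by lra.
have wI : 0 <= w <= T by lra.
have rw0 : 0 <= r - w by lra.
have wu0 : 0 <= w - u by lra.
have sF := filtration_sa hF wI; have Fm := filtration_meas hF wI.
have E o : S (r - u) x + N u r o = S (r - w) (S (w - u) x + N u w o) + N w r o.
 by rewrite (cN _ (ltW uw) (ltW wr)) SDh// addrA -Sadd// subrKA.
have mY : vmeas (fun o => S (w - u) x + N u w o) by apply: vmeasD => //; [exact: vmeas_cst|exact: mN].
have aY : apx P (F w) (fun o => S (w - u) x + N u w o).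
 apply: apxD => //; [exact: (sa_setI sF)|exact: vmeas_cst|exact: mN|apply: apx_cst; exact: (sa_setT sF)|exact: aN].
have mS : vmeas (fun o => S (r - w) (S (w - u) x + N u w o)).
 exact: vmeas_comp (S_continuous SDh SZh Scon rw0) mY.
have aS : apx P (F w) (fun o => S (r - w) (S (w - u) x + N u w o)).
 apply: apx_comp => //; [exact: (sa_setI sF)|exact: (S_continuous SDh SZh Scon rw0)|].
 move=> eps eps0; exists (eps / 2); first by rewrite divr_gt0.
 move=> z z' hz; apply: le_trans (S_lip SDh SZh Scon _ _ rw0) _.
 lra.
pose Y o := S (r - w) (S (w - u) x + N u w o).
have fz : Ex (fun o => 1 * f (Y o + N w r o)) = Ex (fun o => 1 * Ex (fun o' => f (Y o + N w r o'))).
 apply: (freeze (Acl := F w) (B := 1)) => //.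
 - exact: (sa_setI sF).
 - exact: sepa_R.
 - exact: mN.
 - exact: iN.
 - by move=> o; rewrite normr1.
 - by apply: apx_cst; exact: (sa_setT sF).
rewrite /phi.
have -> : (fun o => f (S (r - u) x + N u r o)) = (fun o => 1 * f (Y o + N w r o)).
 by apply/funext => o; rewrite E mul1r.
rewrite fz.
by congr Ex; apply/funext => o; rewrite mul1r.
Qed.

Variables (k1 k2 C1 C2 : R) (cls : R -> R -> H -> Prop) (C10 : 0 < C1) (C20 : 0 < C2) (k10 : 0 <= k1) (k20 : 0 <= k2).
Hypothesis free : forall u r h, 0 <= u -> u < r -> r <= T -> r - u <= 1 ->
 Harn P (N u r) (- S (r - u) h) ((C1 * (r - u) `^ (- k1) * hnorm h) ^+ 2).
Hypothesis drift : forall u r l M h, 0 <= u -> u < r -> r <= T -> r - u <= 1 ->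
 0 < l -> l <= 4 * (r - u) -> 0 < M -> cls l M h ->
 Harn P (N u r) (- S (r - u) h) ((C2 * (r - u) `^ (- k2) * (M * l)) ^+ 2).
Notation a := (k1 * (1 - theta)).

Lemma SN t h : 0 <= t -> S t (- h) = - S t h.
Proof. by move=> t0; rewrite -scaleN1r SZh// scaleN1r. Qed.

Lemma powR_anti (x y p : R) : 0 < x -> x <= y -> p <= 0 -> y `^ p <= x `^ p.
Proof.
move=> x0 xy p0; rewrite -(opprK p) [y `^ _]powRN [x `^ _]powRN lef_pV2 ?posrE ?powR_gt0 ?(lt_le_trans x0 xy)//.
by apply: ge0_ler_powR; rewrite ?nnegrE ?oppr_ge0 ?(ltW x0)// (le_trans (ltW x0) xy).
Qed.

(* The average of f over the shifts j S h, j < n, varies by 1 / n of a variation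
  of f, and it is close to f; n is chosen to balance the two contributions. *)
Lemma phi_lip u r K f x y : 0 <= u -> u < r -> r <= T -> r - u <= 1 -> hol K f ->
 `|phi u r f x - phi u r f y| <= (10 * C1 + 1) * K * (r - u) `^ (- a) * hnorm (x - y).
Proof.
move=> u0 ur rT ru1 hK; have hf := hol_ucb hK; have [fK fh] := hK.
have [t0 t1] := andP th01; have K0 : 0 <= K by apply: le_trans (fK 0).
have ru : 0 < r - u by rewrite subr_gt0.
pose h := x - y; pose tau := r - u; pose D := tau `^ k1.
have D0 : 0 < D by rewrite powR_gt0.
have DE : D `^ (theta - 1) = tau `^ (- a) by rewrite -powRrM; congr (_ `^ _); ring.
have C11 : 1 <= 10 * C1 + 1 by rewrite lerDr mulr_ge0// ltW.
have [hn0|hn0] := eqVneq (hnorm h) 0.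
 have [_ /(_ x y)] := phi_hol u0 ur rT hK.
 by rewrite hn0 powR0 ?gt_eqF// !mulr0.
have h0 : 0 < hnorm h by rewrite lt_def hn0 hnorm_ge0.
have split (z : R) : 0 < z -> z `^ theta = z * z `^ (theta - 1).
 by move=> z0; rewrite -{2}(powRr1 (ltW z0)) -powRD ?(gt_eqF z0) ?implybT//; congr (_ `^ _); ring.
have th1 : theta - 1 <= 0 by rewrite subr_le0 ltW.
(* Beyond the distance [D] the Hoelder bound already implies the Lipschitz one, since D^(theta - 1)
   = tau^(- a). *)
have [Dh|hD] := leP D (hnorm h).
 have [_ /(_ x y) hxy] := phi_hol u0 ur rT hK; apply: le_trans hxy _.
 rewrite split// -DE mulrCA mulrC; apply: ler_wpM2r; first exact: hnorm_ge0.
 apply: ler_pM; rewrite ?powR_ge0//; first by rewrite -{1}[K]mul1r ler_wpM2r.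
 exact: powR_anti.
have q0 : 0 <= D / hnorm h by rewrite divr_ge0// ltW.
pose n := (Num.truncn (D / hnorm h)).+1.
have [n1 n2] : D <= n%:R * hnorm h /\ n%:R * hnorm h <= 2 * D.
 have /andP[h1 h2] := truncn_itv q0; split.
  by rewrite -ler_pdivrMr// ltW.
 rewrite /n -natr1 mulrDl mul1r [leRHS]mulr_natl mulr2n; apply: lerD; last exact: ltW.
 by rewrite -ler_pdivlMr.
pose s := S tau h; have tau0 : 0 <= tau by rewrite ltW.
pose fb (z : H) := n%:R^-1 * \sum_(j < n) f (z + j%:R *: s).
have hsum : ucb (fun z => \sum_(j < n) f (z + j%:R *: s)).
 by apply: (@ucb_sum _ _ n (fun j z => f (z + j%:R *: s))) => j; exact: ucb_shift.
have hfb : ucb fb by exact: ucbZ.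
have fbs z : fb (z + s) - fb z = n%:R^-1 * (f (z + n%:R *: s) - f z).
 rewrite -mulrBr; congr (_ * _).
 have -> : \sum_(j < n) f (z + s + j%:R *: s) = \sum_(j < n) f (z + j.+1%:R *: s).
  by apply: eq_bigr => j _; congr f; rewrite -addrA -natr1 scalerDl scale1r (addrC s).
 rewrite -sumrB -(big_mkord xpredT (fun j => f (z + j.+1%:R *: s) - f (z + j%:R *: s))).
 by rewrite (telescope_sumr (fun j => f (z + j%:R *: s)))// scale0r addr0.
have s_le j : hnorm (j%:R *: s) <= j%:R * hnorm h.
 by rewrite hnormZ ger0_norm//; apply: ler_wpM2l => //; exact: Scon.
have sj (j : 'I_n) z : `|f z - f (z + j%:R *: s)| <= 2 * K * D `^ theta.
 apply: le_trans (fh _ _) _; rewrite opprD addNKr hnormN -mulrA mulrCA; apply: ler_wpM2l => //.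
 apply: (@le_trans _ _ ((2 * D) `^ theta)).
  apply: ge0_ler_powR; rewrite ?nnegrE ?hnorm_ge0 ?mulr_ge0 ?(ltW t0) ?(ltW D0)//.
  apply: le_trans (s_le j) _; apply: le_trans n2; apply: ler_wpM2r; first exact: hnorm_ge0.
  by rewrite ler_nat ltnW.
 rewrite powRM ?(ltW D0)// ler_pM2r ?powR_gt0// -{2}(powRr1 (ler0n R 2)).
 by apply: ler_powR; [rewrite ler1n|exact: ltW].
have ffb z : `|f z - fb z| <= 2 * K * D `^ theta.
 have -> : f z - fb z = n%:R^-1 * \sum_(j < n) (f z - f (z + j%:R *: s)).
  by rewrite sumrB mulrBr sumr_const card_ord -[f z *+ n]mulr_natl mulKf ?gt_eqF.
 rewrite normrM ger0_norm// mulrC ler_pdivrMr//; apply: le_trans (ler_norm_sum _ _ _) _.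
 apply: (@le_trans _ _ (\sum_(j < n) 2 * K * D `^ theta)); first by apply: ler_sum => j _; exact: sj.
 by rewrite sumr_const card_ord -[_ *+ n]mulr_natr.
pose Y := S tau y; pose g z := f (Y + z) - fb (Y + z).
have hg : ucb g by apply: ucbB; exact: ucb_shiftl.
have mNr := mN u0 ur rT.
pose kk := C1 * tau `^ (- k1) * hnorm h.
have kk0 : 0 < kk by rewrite !mulr_gt0// powR_gt0.
have hN : Harn P (N u r) s (kk ^+ 2).
 by have := free (- h) u0 ur rT ru1; rewrite SN// opprK hnormN.
have tv := Harn_tv mNr kk0 hN hg (fun z => ffb (Y + z)).
have ab1 z : abd P (fun w => f (z + N u r w)) by exact: abd_shift.
have ab2 z : abd P (fun w => fb (z + N u r w)) by exact: abd_shift.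
have abN z : abd P (fun w => f (Y + (N u r w + z))).
 have := ab1 (Y + z); congr abd; apply/funext => w; by rewrite -addrA (addrC z).
have abM z : abd P (fun w => fb (Y + (N u r w + z))).
 have := ab2 (Y + z); congr abd; apply/funext => w; by rewrite -addrA (addrC z).
have px : phi u r f x = Ex (fun w => f (Y + (N u r w + s))).
 rewrite /phi; congr Ex; apply/funext => w; rewrite addrCA addrC.
 by rewrite -SDh// (addrC y) subrK addrC.
have py : phi u r f y = Ex (fun w => f (Y + N u r w)) by [].
have E : phi u r f x - phi u r f y = (Ex (fun w => g (N u r w + s)) - Ex (fun w => g (N u r w))) +
  n%:R^-1 * (Ex (fun w => f (Y + (N u r w + n%:R *: s))) - Ex (fun w => f (Y + N u r w))).
 rewrite !ExB// px py.
 have fbE : Ex (fun w => fb (Y + (N u r w + s))) - Ex (fun w => fb (Y + N u r w)) =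
   n%:R^-1 * (Ex (fun w => f (Y + (N u r w + n%:R *: s))) - Ex (fun w => f (Y + N u r w))).
  rewrite -!ExB// -ExZ; last by apply: abdB.
  by congr Ex; apply/funext => w; rewrite !addrA fbs.
 by rewrite -fbE; ring.
rewrite E; apply: le_trans (ler_normD _ _) _.
have b1 : 5 * kk * (2 * K * D `^ theta) = 10 * C1 * K * tau `^ (- a) * hnorm h.
 rewrite -DE split// /kk powRN -/D; field.
 by rewrite gt_eqF.
have b2 : `|n%:R^-1 * (Ex (fun w => f (Y + (N u r w + n%:R *: s))) - Ex (fun w => f (Y + N u r w)))| <=
  K * tau `^ (- a) * hnorm h.
 rewrite normrM ger0_norm// mulrC ler_pdivrMr// -ExB//.
 apply: Ex_bnd; first exact: abdB.
 apply: aeW => w; apply: le_trans (fh _ _) _.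
 have -> : Y + (N u r w + n%:R *: s) - (Y + N u r w) = n%:R *: s by rewrite opprD addrACA subrr add0r addrC addKr.
 rewrite -!mulrA; apply: ler_wpM2l => //.
 apply: (@le_trans _ _ ((n%:R * hnorm h) `^ theta)).
  by apply: ge0_ler_powR; rewrite ?nnegrE ?mulr_ge0 ?hnorm_ge0 ?(ltW t0).
 rewrite split ?mulr_gt0// -DE mulrC [hnorm h * _]mulrC; apply: ler_wpM2r.
  by rewrite mulr_ge0 ?hnorm_ge0.
 exact: powR_anti.
apply: le_trans (lerD tv b2) _; rewrite b1 -/tau.
by apply: le_of_eq; ring.
Qed.

(** The midpoint [w] separates the two displacements. Smoothing over [[w, r]] makes [psi] Lipschitz,
    so its difference [g] along [x - y] is bounded by [M1]; the displacement by [b] is then absorbed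
    by the noise of [[u, w]] through [Harn_tv], at the cost of the drift class. *)
Lemma phi_four u r l M K f x y b : 0 <= u -> u < r -> r <= T -> r - u <= 1 -> hol K f ->
 0 < l -> l <= 2 * (r - u) -> 0 < M -> cls l M b ->
 `|phi u r f (x + b) - phi u r f x - (phi u r f (y + b) - phi u r f y)| <=
 5 * C2 * (10 * C1 + 1) * 2 `^ (a + k2) * K * (r - u) `^ (- (a + k2)) * (M * l) * hnorm (x - y).
Proof.
move=> u0 ur rT ru1 hK l0 lr M0 hb; have ru : 0 < r - u by rewrite subr_gt0.
have K0 : 0 <= K by have [fK _] := hK; apply: le_trans (fK 0).
have [t tE] : exists t : R, t = (r - u) / 2 by exists ((r - u) / 2).
have t0 : 0 < t by rewrite tE divr_gt0.
have t1 : t <= 1 by rewrite tE; lra.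
have lt4 : l <= 4 * t by rewrite tE; lra.
pose w := u + t; have uw : w - u = t by rewrite addrC addKr.
have wr : r - w = t by rewrite /w tE; field.
have lt1 : u < w by rewrite -subr_gt0 uw.
have lt2 : w < r by rewrite -subr_gt0 wr.
have w0 : 0 <= w by exact: le_trans (ltW lt1).
have wT : w <= T by exact: le_trans (ltW lt2) rT.
have [psi psiE] : exists psi, psi = phi w r f by exists (phi w r f).
have hpsi : hol K psi by rewrite psiE; exact: phi_hol.
have upsi := hol_ucb hpsi.
have CK z : phi u r f z = Ex (fun o => psi (S t z + N u w o)).
 by rewrite (Chapman_Kolmogorov z u0 lt1 lt2 rT hK) psiE {1}/phi uw.
pose s := S t (x - y); pose Y := S t y.
pose g z := psi (Y + s + z) - psi (Y + z).
have hg : ucb g by apply: ucbB; exact: ucb_shiftl.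
pose M1 := (10 * C1 + 1) * K * t `^ (- a) * hnorm (x - y).
have C11 : 0 <= 10 * C1 + 1 by rewrite addr_ge0// mulr_ge0// ltW.
have gM z : `|g z| <= M1.
 have := phi_lip (Y + s + z) (Y + z) w0 lt2 rT; rewrite wr => /(_ _ _ t1 hK) h.
 rewrite /g psiE; apply: le_trans h _.
 have -> : Y + s + z - (Y + z) = s by rewrite opprD addrACA subrr addr0 addrC addKr.
 by apply: ler_wpM2l; [rewrite !mulr_ge0 ?powR_ge0|exact: Scon (ltW t0)].
have mNw := mN u0 lt1 wT.
pose kk := C2 * t `^ (- k2) * (M * l).
have kk0 : 0 < kk by rewrite !mulr_gt0// powR_gt0.
have clsN : Harn P (N u w) (- S t b) (kk ^+ 2).
 by have := drift u0 lt1 wT; rewrite uw => /(_ l M b t1 l0 lt4 M0 hb).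
pose g' z := g (z + S t b).
have hg' : ucb g' by exact: ucb_shift.
have tv := Harn_tv mNw kk0 clsN hg' (fun z => gM (z + S t b)).
have xE : S t x = Y + s by rewrite /Y /s -SDh ?(ltW t0)// addrC subrK.
have ab z : abd P (fun o => psi (z + N u w o)) by exact: abd_shift.
have E : phi u r f (x + b) - phi u r f x - (phi u r f (y + b) - phi u r f y) =
  Ex (fun o => g' (N u w o)) - Ex (fun o => g' (N u w o + - S t b)).
 have e1 : Ex (fun o => g' (N u w o)) = phi u r f (x + b) - phi u r f (y + b).
  rewrite (CK (x + b)) (CK (y + b)) -(ExB (ab (S t (x + b))) (ab (S t (y + b)))); congr (Ex _); apply/funext => o; rewrite /g.
  rewrite (SDh x b (ltW t0)) (SDh y b (ltW t0)) xE; congr (psi _ - psi _).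
   by rewrite -[RHS]addrA; congr (_ + _); rewrite addrC.
  by rewrite -[RHS]addrA; congr (_ + _); rewrite addrC.
 have e2 : Ex (fun o => g' (N u w o + - S t b)) = phi u r f x - phi u r f y.
  by rewrite (CK x) (CK y) -(ExB (ab (S t x)) (ab (S t y))); congr (Ex _); apply/funext => o; rewrite /g' subrK xE.
 by rewrite e1 e2; ring.
rewrite E distrC; apply: le_trans tv _.
apply: le_of_eq; rewrite /kk /M1.
have -> : (r - u) `^ (- (a + k2)) = 2 `^ (- (a + k2)) * (t `^ (- a) * t `^ (- k2)).
 have -> : r - u = 2 * t by rewrite tE; field.
 rewrite powRM ?(ltW t0)// -[t `^ (- a) * _]powRD ?(gt_eqF t0) ?implybT//; congr (_ * _ `^ _); ring.
rewrite [2 `^ (- _)]powRN; field.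
by rewrite gt_eqF// powR_gt0.
Qed.
Variable J : nat.
Implicit Types (g : nat -> H -> R).

(** Combinations with coefficients in the unit ball are what [dual_norm] consumes. The first clause
    covers the components of every index, also those beyond [J]. *)
Definition vhol K g := (forall k, hol K (g k)) /\
 forall y : nat -> R, \sum_(k < J) y k ^+ 2 <= 1 -> hol K (fun x => \sum_(k < J) y k * g k x).

Lemma hol_ge0 K f : hol K f -> 0 <= K.
Proof. by move=> [fK _]; apply: le_trans (fK 0). Qed.

Lemma phi_comb u r K g (y : nat -> R) x : 0 <= u -> u < r -> r <= T -> (forall k, hol K (g k)) ->
 phi u r (fun z => \sum_(k < J) y k * g k z) x = \sum_(k < J) y k * phi u r (g k) x.
Proof.
move=> u0 ur rT hg; rewrite /phi Ex_sum; last first.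
 by move=> k _; apply: abdZ; apply: abd_shift => //; exact: (hol_ucb (hg k)).
apply: eq_bigr => k _; rewrite ExZ//; apply: abd_shift => //; exact: (hol_ucb (hg k)).
Qed.

Lemma vhol_phi u r K g : 0 <= u -> u < r -> r <= T -> vhol K g -> vhol K (fun k => phi u r (g k)).
Proof.
move=> u0 ur rT [h1 h2]; split=> [k|y /h2 hy]; first exact: phi_hol.
have := phi_hol u0 ur rT hy; congr hol; apply/funext => x; exact: phi_comb.
Qed.

Lemma vec_bnd K g x : vhol K g -> \sum_(k < J) g k x ^+ 2 <= K ^+ 2.
Proof.
move=> [h1 h2]; apply: (@dual_norm _ J (fun k => g k x)); first exact: hol_ge0 (h1 0%N).
by move=> y /h2[hy _]; exact: hy.
Qed.

Lemma vec_hol K g x z : vhol K g ->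
 \sum_(k < J) (g k x - g k z) ^+ 2 <= (K * hnorm (x - z) `^ theta) ^+ 2.
Proof.
move=> [h1 h2]; apply: (@dual_norm _ J (fun k => g k x - g k z)).
 by rewrite mulr_ge0 ?powR_ge0// (hol_ge0 (h1 0%N)).
move=> y /h2[_ /(_ x z)]; rewrite -sumrB.
by under eq_bigr do rewrite -mulrBr.
Qed.

Definition cL := 10 * C1 + 1.
Definition c4 := 5 * C2 * (10 * C1 + 1) * 2 `^ (a + k2).

Lemma cL_gt0 : 0 < cL. Proof. by rewrite addr_gt0// mulr_gt0. Qed.
Lemma c4_gt0 : 0 < c4. Proof. by rewrite !mulr_gt0//// cL_gt0. Qed.

Lemma vec_lip u r K g x z : 0 <= u -> u < r -> r <= T -> r - u <= 1 -> vhol K g ->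
 \sum_(k < J) (phi u r (g k) x - phi u r (g k) z) ^+ 2 <=
 (cL * K * (r - u) `^ (- a) * hnorm (x - z)) ^+ 2.
Proof.
move=> u0 ur rT ru1 [h1 h2]; apply: (@dual_norm _ J (fun k => phi u r (g k) x - phi u r (g k) z)).
 by rewrite !mulr_ge0 ?powR_ge0 ?hnorm_ge0 ?(ltW cL_gt0)// (hol_ge0 (h1 0%N)).
move=> y /h2 hy; apply: le_trans (phi_lip x z u0 ur rT ru1 hy).
by rewrite !(phi_comb y _ u0 ur rT h1) -sumrB; under eq_bigr do rewrite mulrBr.
Qed.

Lemma vec_four u r l M K g x z b : 0 <= u -> u < r -> r <= T -> r - u <= 1 -> vhol K g ->
 0 < l -> l <= 2 * (r - u) -> 0 < M -> cls l M b ->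
 \sum_(k < J) (phi u r (g k) (x + b) - phi u r (g k) x - (phi u r (g k) (z + b) - phi u r (g k) z)) ^+ 2 <=
 (c4 * K * (r - u) `^ (- (a + k2)) * (M * l) * hnorm (x - z)) ^+ 2.
Proof.
move=> u0 ur rT ru1 [h1 h2] l0 lr M0 hb; have K0 := hol_ge0 (h1 0%N).
apply: (@dual_norm _ J (fun k => phi u r (g k) (x + b) - phi u r (g k) x - (phi u r (g k) (z + b) - phi u r (g k) z))).
 apply: mulr_ge0; last exact: hnorm_ge0.
 apply: mulr_ge0; last by rewrite mulr_ge0 ?ltW.
 by apply: mulr_ge0; [apply: mulr_ge0 => //; exact: ltW c4_gt0|exact: powR_ge0].
move=> y /h2 hy; apply: le_trans (phi_four x z u0 ur rT ru1 hy l0 lr M0 hb).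
by rewrite !(phi_comb y _ u0 ur rT h1) -!sumrB; under eq_bigr do rewrite !mulrBr.
Qed.

(** * Free flows of the two solutions and their martingale increments *)

Variables (X : bool -> R -> Omega -> H) (s0 s1 : R) (s00 : 0 <= s0) (s1T : s1 <= T)
 (mX : forall c t, s0 <= t <= s1 -> vmeas (X c t)) (aX : forall c t, s0 <= t <= s1 -> apx P (F t) (X c t)).

(** The solution restarted at time [u] and run without drift; conditional expectations along it are
    explicit. *)
Definition free_flow c u w o := S (w - u) (X c u o) + N u w o.
Notation Y := free_flow.

Lemma flow_meas c u w : s0 <= u -> u < w -> w <= s1 ->
 [/\ vmeas (fun o => S (w - u) (X c u o)), apx P (F u) (fun o => S (w - u) (X c u o)),
   vmeas (Y c u w) & apx P (F w) (Y c u w)].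
Proof.
move=> u0 uw ws; have ui : s0 <= u <= s1 by rewrite u0 (le_trans (ltW uw)).
have wu0 : 0 <= w - u by rewrite subr_ge0 ltW.
have u0' : 0 <= u by exact: le_trans u0. have wT : w <= T by exact: le_trans ws _.
have uI : 0 <= u <= T by rewrite u0' (le_trans (ltW uw)).
have wI : 0 <= w <= T by rewrite wT (le_trans u0' (ltW uw)).
have mS : vmeas (fun o => S (w - u) (X c u o)) by exact: vmeas_comp (S_continuous SDh SZh Scon wu0) (mX c ui).
have aS : apx P (F u) (fun o => S (w - u) (X c u o)).
 apply: apx_comp => //; [exact: (filtration_meas hF uI)|exact: (sa_setI (filtration_sa hF uI))|exact: mX|exact: (S_continuous SDh SZh Scon wu0)| |exact: aX].
 move=> eps eps0; exists (eps / 2); first by rewrite divr_gt0.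
 move=> z z' hz; apply: le_trans (S_lip SDh SZh Scon _ _ wu0) _.
 by rewrite mulrC -ler_pdivlMr.
have mY : vmeas (Y c u w) by apply: vmeasD => //; exact: mN.
split; [exact: mS|exact: aS|exact: mY|].
apply: apxD.
- exact: (filtration_meas hF wI).
- exact: (sa_setI (filtration_sa hF wI)).
- exact: sH.
- exact: mS.
- exact: mN.
- by apply: apx_sub aS; exact: (filtration_sub hF u0' (ltW uw) wT).
- exact: aN.
Qed.

(** Value along the free flow minus its conditional expectation at time [u], for the difference of
    the two solutions: a martingale increment, orthogonal to the past by [mart_orth]. *)
Definition mart u w (f : H -> R) o :=
 f (Y true u w o) - f (Y false u w o) - (phi u w f (X true u o) - phi u w f (X false u o)).

Section martingale.
Variables (u w K : R) (f : H -> R) (u0 : s0 <= u) (uw : u < w) (ws : w <= s1) (hK : hol K f).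

Let hf : ucb f := hol_ucb hK.
Let u0' : 0 <= u. Proof. exact: le_trans u0. Qed.
Let wT : w <= T. Proof. exact: le_trans ws _. Qed.
Let ui : s0 <= u <= s1. Proof. by rewrite u0 (le_trans (ltW uw)). Qed.
Let uI : 0 <= u <= T. Proof. by rewrite u0' (le_trans (ltW uw)). Qed.
Let wI : 0 <= w <= T. Proof. by rewrite wT (le_trans u0' (ltW uw)). Qed.
Let hphi : ucb (phi u w f). Proof. exact: (hol_ucb (phi_hol u0' uw wT hK)). Qed.

Lemma abd_Y c : abd P (fun o => f (Y c u w o)).
Proof. by have [_ _ mY _] := flow_meas c u0 uw ws; exact: abd_ucb. Qed.

Lemma abd_phiX c : abd P (fun o => phi u w f (X c u o)).
Proof. by apply: abd_ucb => //; exact: mX. Qed.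

Lemma mart_abd : abd P (mart u w f).
Proof. by apply: abdB; apply: abdB; solve [exact: abd_Y|exact: abd_phiX]. Qed.

Lemma mart_bnd o : `|mart u w f o| <= 4 * K.
Proof.
have [fK _] := hK; have [pK _] := phi_hol u0' uw wT hK.
apply: le_trans (ler_normB _ _) _; rewrite (_ : 4 * K = (K + K) + (K + K)); last by ring.
by apply: lerD; apply: le_trans (ler_normB _ _) _; apply: lerD.
Qed.

Lemma mart_apx : apx P (F w) (mart u w f : Omega -> R^o).
Proof.
have sw := filtration_sa hF wI; have Fw := filtration_meas hF wI.
have aB (x y : Omega -> R) : abd P x -> abd P y -> apx P (F w) (x : Omega -> R^o) ->
  apx P (F w) (y : Omega -> R^o) -> apx P (F w) ((fun o => x o - y o) : Omega -> R^o).
 move=> ax ay px py; have [mx _] := ax; have [my _] := ay.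
 by apply: apx_sub_real => //; exact: (sa_setI sw).
have pY c : apx P (F w) ((fun o => f (Y c u w o)) : Omega -> R^o).
 have [_ _ mY aY] := flow_meas c u0 uw ws.
 by apply: apx_ucb => //; [exact: (sa_setI sw)|exact: sepa_R].
have pX c : apx P (F w) ((fun o => phi u w f (X c u o)) : Omega -> R^o).
 apply: (@apx_sub _ _ _ _ _ (F u)); first exact: (filtration_sub hF u0' (ltW uw) wT).
 have su := filtration_sa hF uI.
 apply: apx_ucb => //; [exact: (filtration_meas hF uI)|exact: (sa_setI su)|exact: sepa_R|exact: mX|exact: aX].
apply: (aB); [by apply: abdB; exact: abd_Y|by apply: abdB; exact: abd_phiX| |].
 by apply: (aB); solve [exact: abd_Y|exact: pY].
by apply: (aB); solve [exact: abd_phiX|exact: pX].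
Qed.

Lemma mart_orth (xi : Omega -> R) B : measurable_fun setT xi -> (forall o, `|xi o| <= B) ->
 apx P (F u) (xi : Omega -> R^o) -> Ex (fun o => xi o * mart u w f o) = 0.
Proof.
move=> mxi bxi axi; have su := filtration_sa hF uI.
have ax : abd P xi by exact: abd_bnd bxi.
have fz c : Ex (fun o => xi o * f (Y c u w o)) = Ex (fun o => xi o * phi u w f (X c u o)).
 have [mS aS _ _] := flow_meas c u0 uw ws.
 apply: (freeze (Acl := F u) (B := B)) => //.
 - exact: (filtration_meas hF uI).
 - exact: (sa_setI su).
 - exact: sepa_R.
 - exact: mN.
 - exact: iN.
rewrite (_ : (fun o => _) = (fun o => (xi o * f (Y true u w o) - xi o * f (Y false u w o)) -
  (xi o * phi u w f (X true u o) - xi o * phi u w f (X false u o)))); last first.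
 by apply/funext => o; rewrite /mart; ring.
have aY c : abd P (fun o => xi o * f (Y c u w o)) by apply: abdM => //; exact: abd_Y.
have aP c : abd P (fun o => xi o * phi u w f (X c u o)) by apply: abdM => //; exact: abd_phiX.
by rewrite (ExB (abdB (aY true) (aY false)) (abdB (aP true) (aP false))) (ExB (aY true) (aY false)) (ExB (aP true) (aP false)) !fz subrr.
Qed.

(** The conditional variance is at most the conditional second moment: the conditional mean [V] is
    orthogonal to the martingale increment. *)
Lemma mart_sqr : Ex (fun o => mart u w f o ^+ 2) <= Ex (fun o => (f (Y true u w o) - f (Y false u w o)) ^+ 2).
Proof.
pose V o := phi u w f (X true u o) - phi u w f (X false u o).
have aV : abd P V by apply: abdB; exact: abd_phiX.
have [pK _] := phi_hol u0' uw wT hK; have su := filtration_sa hF uI.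
have pX c : apx P (F u) ((fun o => phi u w f (X c u o)) : Omega -> R^o).
 apply: apx_ucb => //; [exact: (filtration_meas hF uI)|exact: (sa_setI su)|exact: sepa_R|exact: mX|exact: aX].
have pV : apx P (F u) (V : Omega -> R^o).
 have [m1 _] := abd_phiX true; have [m2 _] := abd_phiX false.
 by apply: apx_sub_real => //; [exact: (filtration_meas hF uI)|exact: (sa_setI su)].
have [mV _] := aV; have VK o : `|V o| <= K + K by apply: le_trans (ler_normB _ _) _; apply: lerD.
have o0 := mart_orth mV VK pV.
have aM := mart_abd; have aVM := abdM aV aM.
rewrite [leRHS](_ : _ = Ex (fun o => mart u w f o ^+ 2 + V o ^+ 2 + 2 * (V o * mart u w f o))); last first.
 by congr Ex; apply/funext => o; rewrite /V /mart; ring.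
rewrite (ExD (abdD (abdX 2 aM) (abdX 2 aV)) (abdZ 2 aVM)) (ExZ 2 aVM) o0 mulr0 addr0 (ExD (abdX 2 aM) (abdX 2 aV)) lerDl.
by apply: Ex_ge0 => o; exact: sqr_ge0.
Qed.
End martingale.

(** * Difference between the solutions and their free flows on one interval *)

Variables (M mm q : R) (M0 : 0 < M) (mm0 : 0 <= mm) (q0 : 0 <= q)
 (cls_norm : forall l h, 0 < l -> cls l M h -> hnorm h <= 2 * (M * l)).
Definition drift_error c u w o := X c w o - Y c u w o.
Notation bb := drift_error.
Hypothesis hb : forall c u w, s0 <= u -> u < w -> w <= s1 -> {ae P, forall o, cls (w - u) M (bb c u w o)}.
Definition gap u o := X true u o - X false u o.
Definition gap_error u w o := gap w o - S (w - u) (gap u o).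
Hypotheses (agap : forall u, s0 <= u <= s1 -> abd P (fun o => hnorm (gap u o) ^+ 2))
 (hgap : forall u, s0 <= u <= s1 -> Ex (fun o => hnorm (gap u o) ^+ 2) <= mm ^+ 2)
 (aerr : forall u w, s0 <= u -> u < w -> w <= s1 -> abd P (fun o => hnorm (gap_error u w o) ^+ 2)).
Hypothesis herr : forall u w, s0 <= u -> u < w -> w <= s1 ->
 Ex (fun o => hnorm (gap_error u w o) ^+ 2) <= q ^+ 2 * (w - u).

Lemma flow_diff u w o : u < w -> Y true u w o - Y false u w o = S (w - u) (gap u o).
Proof.
move=> uw; have wu0 : 0 <= w - u by rewrite subr_ge0 ltW.
by rewrite opprD addrACA subrr addr0 SDh// SN.
Qed.

Lemma error_diff u w o : u < w -> bb true u w o - bb false u w o = gap_error u w o.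
Proof. by move=> uw; rewrite /gap_error -flow_diff// subr_exchange. Qed.

Lemma flow_sqn u w K g (B : R) : s0 <= u -> u < w -> w <= s1 -> 0 <= B -> vhol K g ->
 (forall x z, \sum_(k < J) (g k x - g k z) ^+ 2 <= (B * hnorm (x - z)) ^+ 2) ->
 sqn P J (fun k => mart u w (g k)) <= (B * mm) ^+ 2.
Proof.
move=> u0 uw ws B0 [gh _] hg; have ui : s0 <= u <= s1 by rewrite u0 (le_trans (ltW uw)).
apply: (@le_trans _ _ (sqn P J (fun k o => g k (Y true u w o) - g k (Y false u w o)))).
 by apply: ler_sum => k _; exact: (mart_sqr u0 uw ws (gh k)).
apply: (@sqn_le _ _ _ P J _ (fun o => B ^+ 2 * hnorm (gap u o) ^+ 2)).
- by move=> k; apply: abdB; exact: (abd_Y u0 uw ws (gh k)).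
- by apply: abdZ; exact: agap.
- apply: aeW => o; apply: le_trans (hg _ _) _.
 rewrite flow_diff// exprMn ler_wpM2l ?sqr_ge0// ler_sqr ?nnegrE ?hnorm_ge0//.
 by apply: Scon; rewrite subr_ge0 ltW.
- by rewrite (ExZ _ (agap ui)) exprMn ler_wpM2l ?sqr_ge0// hgap.
Qed.

Lemma mart_sqn u w r K g : s0 <= u -> u < w -> w < r -> r <= s1 -> s1 - s0 <= 1 -> vhol K g ->
 sqn P J (fun k => mart u w (phi w r (g k))) <= (cL * K * (r - w) `^ (- a) * mm) ^+ 2.
Proof.
move=> u0 uw wr rs len hg; have [gh _] := hg; have K0 := hol_ge0 (gh 0%N).
have w0 : s0 <= w by exact: le_trans (ltW uw).
have w00 : 0 <= w by exact: le_trans w0.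
have rT : r <= T by exact: le_trans s1T.
apply: (@flow_sqn _ _ K) => //; first exact: le_trans (ltW wr) rs.
- by apply: mulr_ge0; [apply: mulr_ge0 => //; exact: ltW cL_gt0|exact: powR_ge0].
- exact: vhol_phi.
- move=> x z; apply: vec_lip => //; lra.
Qed.

(** Both solutions are displaced from their free flows. [A] displaces the two base points by the
    same vector and is bounded by [vec_four], with the gap [mm] and the cheaper cost of the drift
    class. [B] compares the two displacements from one base point; they differ by [gap_error],
    whence the factor [q]. *)
Lemma rest_le2 u w r K g : s0 <= u -> u < w -> w < r -> r <= s1 -> s1 - s0 <= 1 -> vhol K g ->
 w - u <= 2 * (r - w) ->
 le2 P J (fun k o => phi w r (g k) (X true w o) - phi w r (g k) (X false w o) -
   (phi w r (g k) (Y true u w o) - phi w r (g k) (Y false u w o)))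
  (c4 * K * (r - w) `^ (- (a + k2)) * (M * (w - u)) * mm +
   cL * K * (r - w) `^ (- a) * (q * Num.sqrt (w - u))).
Proof.
move=> u0 uw wr rs len hg lw; have [gh _] := hg; have K0 := hol_ge0 (gh 0%N).
have w0 : s0 <= w by exact: le_trans (ltW uw).
have ws : w <= s1 by exact: le_trans (ltW wr) rs.
have wi : s0 <= w <= s1 by rewrite w0. have ui : s0 <= u <= s1 by rewrite u0 (le_trans (ltW uw)).
have w00 : 0 <= w by exact: le_trans w0. have rT : r <= T by exact: le_trans s1T.
have rw1 : r - w <= 1 by lra. have wu : 0 < w - u by rewrite subr_gt0.
pose f k := phi w r (g k); have hf k : ucb (f k) by exact: (hol_ucb (phi_hol w00 wr rT (gh k))).
have mY c : vmeas (Y c u w) by have [_ _ ? _] := flow_meas c u0 uw ws.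
have mb c : vmeas (bb c u w) by apply: vmeasB => //; exact: mX.
have ab (Z : Omega -> H) k : vmeas Z -> abd P (fun o => f k (Z o)) by move=> mZ; exact: abd_ucb.
have mYb c c' : vmeas (fun o => Y c u w o + bb c' u w o) by exact: vmeasD.
have XE c o : X c w o = Y c u w o + bb c u w o by rewrite addrC subrK.
pose A k o := f k (Y true u w o + bb true u w o) - f k (Y true u w o) -
 (f k (Y false u w o + bb true u w o) - f k (Y false u w o)).
pose B k o := f k (Y false u w o + bb true u w o) - f k (Y false u w o + bb false u w o).
have aA k : abd P (A k) by apply: abdB; apply: abdB; exact: ab.
have aB k : abd P (B k) by apply: abdB; exact: ab.
have p1 : 0 <= c4 * K * (r - w) `^ (- (a + k2)) * (M * (w - u)).
 apply: mulr_ge0; last by rewrite mulr_ge0 ?ltW.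
 by apply: mulr_ge0; [apply: mulr_ge0 => //; exact: ltW c4_gt0|exact: powR_ge0].
have p2 : 0 <= cL * K * (r - w) `^ (- a).
 by apply: mulr_ge0; [apply: mulr_ge0 => //; exact: ltW cL_gt0|exact: powR_ge0].
have p3 : 0 <= q * Num.sqrt (w - u) by rewrite mulr_ge0.
apply: (@le2_ext _ _ _ P J _ (fun k o => A k o + B k o)).
 by move=> k o _; rewrite !XE; exact: four_split.
apply: le2D => //; [exact: mulr_ge0|exact: mulr_ge0| |].
 apply: le2_sqn; first exact: mulr_ge0.
 set c := c4 * K * (r - w) `^ (- (a + k2)) * (M * (w - u)) in p1 *.
 apply: (@sqn_le _ _ _ P J _ (fun o => c ^+ 2 * hnorm (gap u o) ^+ 2)) => //.
 - by apply: abdZ; exact: agap.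
 - apply: filterS (hb true u0 uw ws) => o ho.
  apply: le_trans (vec_four (Y true u w o) (Y false u w o) w00 wr rT rw1 hg wu lw M0 ho) _.
  rewrite flow_diff// exprMn ler_wpM2l ?sqr_ge0// ler_sqr ?nnegrE ?hnorm_ge0//.
  exact: Scon (ltW wu).
 - by rewrite (ExZ _ (agap ui)) [leRHS]exprMn ler_wpM2l ?sqr_ge0// hgap.
apply: le2_sqn; first exact: mulr_ge0.
set c := cL * K * (r - w) `^ (- a) in p2 *.
apply: (@sqn_le _ _ _ P J _ (fun o => c ^+ 2 * hnorm (gap_error u w o) ^+ 2)) => //.
- by apply: abdZ; exact: aerr.
- apply: aeW => o; apply: le_trans (vec_lip _ _ w00 wr rT rw1 hg) _.
 by rewrite -error_diff// opprD addrACA subrr add0r exprMn.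
- rewrite (ExZ _ (aerr u0 uw ws)) [leRHS]exprMn ler_wpM2l ?sqr_ge0//.
 by apply: le_trans (herr u0 uw ws) _; rewrite exprMn sqr_sqrtr// ltW.
Qed.

(** At the finest scale no time is left for smoothing, and only the Hoelder bound with the size of
    the displacements is available. *)
Lemma last_rest_le2 u w K g : s0 <= u -> u < w -> w <= s1 -> vhol K g ->
 le2 P J (fun k o => g k (X true w o) - g k (X false w o) -
   (g k (Y true u w o) - g k (Y false u w o))) (2 * K * (2 * (M * (w - u))) `^ theta).
Proof.
move=> u0 uw ws hg; have [gh _] := hg; have K0 := hol_ge0 (gh 0%N).
have [t0 _] := andP th01.
have w0 : s0 <= w by exact: le_trans (ltW uw).
have wi : s0 <= w <= s1 by rewrite w0.
have wu : 0 < w - u by rewrite subr_gt0.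
have hf k := hol_ucb (gh k).
have mY c : vmeas (Y c u w) by have [_ _ ? _] := flow_meas c u0 uw ws.
have ab (Z : Omega -> H) k : vmeas Z -> abd P (fun o => g k (Z o)) by move=> mZ; exact: abd_ucb.
pose A c k o := g k (X c w o) - g k (Y c u w o).
have aA c k : abd P (A c k) by apply: abdB; apply: ab => //; exact: mX.
set B := (2 * (M * (w - u))) `^ theta; have B0 : 0 <= B by exact: powR_ge0.
have h1 c : sqn P J (A c) <= (K * B) ^+ 2.
 apply: (@sqn_le _ _ _ P J _ (cst ((K * B) ^+ 2))) => //; [exact: abd_cst| |by rewrite Ex_cst].
 apply: filterS (hb c u0 uw ws) => o ho; apply: le_trans (vec_hol _ _ hg) _.
 rewrite ler_sqr ?nnegrE ?mulr_ge0 ?powR_ge0//; apply: ler_wpM2l => //.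
 apply: ge0_ler_powR; rewrite ?nnegrE ?hnorm_ge0 ?mulr_ge0 ?(ltW t0) ?(ltW M0) ?(ltW wu)//.
 exact: cls_norm.
have h2 : sqn P J (fun k o => - A false k o) = sqn P J (A false).
 by apply: eq_bigr => k _; congr (Ex _); apply/funext => o; rewrite sqrrN.
apply: (@le2_ext _ _ _ P J _ (fun k o => A true k o + - A false k o)).
 by move=> k o _; rewrite /A; ring.
have -> : 2 * K * B = K * B + K * B by ring.
apply: le2D => //; [by move=> k; exact: abdN|exact: mulr_ge0|exact: mulr_ge0| |].
 by apply: le2_sqn; first exact: mulr_ge0.
by apply: le2_sqn; [exact: mulr_ge0|rewrite h2].
Qed.

(** * Stochastic sewing over a dyadic mesh *)

Variables (g : nat -> nat -> H -> R) (K x0 del ep : R) (n : nat) (hg : forall j, vhol K (g j))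
 (del0 : 0 < del) (x00 : s0 <= x0) (len : s1 - s0 <= 1) (L1 : n%:R * del <= 1).
Definition tick (j : nat) := x0 + j%:R * del.
Notation t := tick.
Hypotheses (tn : forall j, (j < n)%N -> t j <= s1) (ep0 : 0 < ep) (a_ep : a <= 1 / 2 - ep) (ak_ep : a + k2 <= 1 - ep).

Let K0 : 0 <= K. Proof. by have [gh _] := hg 0%N; exact: hol_ge0 (gh 0%N). Qed.

Lemma tick_lt i j : (i < j)%N -> t i < t j.
Proof. by move=> ij; rewrite ltrD2l ltr_pM2r// ltr_nat. Qed.

Lemma tick_ge i : s0 <= t i.
Proof. by apply: le_trans x00 _; rewrite lerDl mulr_ge0// ltW. Qed.

Lemma tickB i j : (i <= j)%N -> t j - t i = (j - i)%:R * del.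
Proof. by move=> ij; rewrite /t natrB//; ring. Qed.

(** Start of the block before the one that contains [j], so that at least [k] ticks lie between
    conditioning and evaluation ([cond_lt]). For [j < k] there is no such block and [.-1] yields 0;
    [lev] is 0 there. *)
Definition cond k j := (k * (j %/ k).-1)%N.

Lemma cond_cell k c r : (r < k)%N -> cond k (k * c.+1 + r) = (k * c)%N.
Proof.
move=> rk; have k0 : (0 < k)%N by exact: leq_ltn_trans rk.
rewrite /cond; by have -> : ((k * c.+1 + r) %/ k = c.+1)%N by rewrite mulnC divnMDl// divn_small// addn0.
Qed.

(** Expectation of the difference at tick [j], conditioned at tick [cond k j] along the free flows.
    As [k] doubles the conditioning recedes: at [k = 1] the value is almost recovered, and at
    [k = n] nothing is left. *)
Definition lev k j e o := if (k <= j)%N then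
 phi (t (cond k j)) (t j) (g j e) (X true (t (cond k j)) o) -
 phi (t (cond k j)) (t j) (g j e) (X false (t (cond k j)) o) else 0.

Lemma cond_lt k j : (0 < k)%N -> (k <= j)%N -> (cond k j + k <= j)%N.
Proof.
move=> k0 kj; have : (0 < j %/ k)%N by rewrite divn_gt0.
rewrite /cond; case: (j %/ k)%N (leq_divM j k) => //= c hc _.
by rewrite addnC -mulnS mulnC.
Qed.

Lemma abd_lev k j e : (0 < k)%N -> (j < n)%N -> abd P (lev k j e).
Proof.
move=> k0 jn; rewrite /lev; case: leqP => kj; last exact: abd_cst.
have cj : (cond k j < j)%N by apply: leq_trans (cond_lt k0 kj); rewrite -addn1 leq_add2l.
have [gh _] := hg j.
by apply: abdB; exact: (abd_phiX (tick_ge _) (tick_lt cj) (tn jn) (gh e)).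
Qed.

Lemma lev_lip k j : (0 < k)%N -> (k <= j)%N -> (j < n)%N ->
 sqn P J (lev k j) <= (cL * K * (k%:R * del) `^ (- a) * mm) ^+ 2.
Proof.
move=> k0 kj jn; have cj := cond_lt k0 kj.
have cj' : (cond k j < j)%N by apply: leq_trans cj; rewrite -addn1 leq_add2l.
have u0 := tick_ge (cond k j); have uw := tick_lt cj'; have ws := tn jn.
have ui : s0 <= t (cond k j) <= s1 by rewrite u0 (le_trans (ltW uw)).
have u00 : 0 <= t (cond k j) by exact: le_trans u0.
have cL0 : 0 <= cL := ltW cL_gt0.
have cLK : 0 <= cL * K by rewrite mulr_ge0.
have kd0 : 0 < k%:R * del by rewrite mulr_gt0// ltr0n.
have a0 : 0 <= a by have [_ t1] := andP th01; rewrite mulr_ge0// subr_ge0 ltW.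
have mono : (t j - t (cond k j)) `^ (- a) <= (k%:R * del) `^ (- a).
 apply: powR_anti => //; last by rewrite oppr_le0.
 by rewrite tickB ?(ltnW cj')// ler_pM2r// ler_nat leq_subRL ?(ltnW cj').
set B := cL * K * _; apply: (@sqn_le _ _ _ P J _ (fun o => B ^+ 2 * hnorm (gap (t (cond k j)) o) ^+ 2)).
- by move=> e; exact: abd_lev.
- by apply: abdZ; exact: agap.
- apply: aeW => o; rewrite /lev kj.
 apply: le_trans (vec_lip _ _ u00 uw (le_trans ws s1T) _ (hg j)) _; first by have := len; lra.
 rewrite -exprMn ler_sqr ?nnegrE ?mulr_ge0 ?powR_ge0 ?hnorm_ge0//.
 by apply: ler_wpM2r; [exact: hnorm_ge0|exact: ler_wpM2l].
- by rewrite (ExZ _ (agap ui)) [leRHS]exprMn ler_wpM2l ?sqr_ge0// hgap.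
Qed.

Section level.
Variables (k p : nat) (k0 : (0 < k)%N) (nk : n = (2 * k * p.+1)%N).
Notation kd := (k%:R * del).

Let kd0 : 0 < kd. Proof. by rewrite mulr_gt0// ltr0n. Qed.
Let a0 : 0 <= a.
Proof. by have [_ t1] := andP th01; rewrite mulr_ge0// subr_ge0 ltW. Qed.
Let kd_pL : (2 * k)%:R * (p.+1)%:R * del <= 1. Proof. by rewrite -natrM -nk. Qed.
Let kd1 : kd <= 1.
Proof.
apply: le_trans L1; by rewrite ler_pM2r// ler_nat nk mulnAC leq_pmull// muln_gt0.
Qed.

Definition cell c e o := \sum_(r < 2 * k) del * (lev k (2 * k * c + r) e o - lev (2 * k) (2 * k * c + r) e o).

Let lt_n c r : (c < p.+1)%N -> (r < 2 * k)%N -> (2 * k * c + r < n)%N.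
Proof.
move=> cp rk; rewrite nk; apply: (@leq_trans (2 * k * c.+1)); first by rewrite mulnS addnC ltn_add2r.
by rewrite leq_mul2l cp orbT.
Qed.

Lemma first_cell : le2 P J (cell 0) ((2 * k)%:R * (del * (cL * K * kd `^ (- a) * mm))).
Proof.
set B := cL * K * kd `^ (- a) * mm.
have B0 : 0 <= B by rewrite !mulr_ge0 ?powR_ge0// ltW// cL_gt0.
have -> : (2 * k)%:R * (del * B) = \sum_(r < 2 * k) del * B by rewrite sumr_const card_ord mulr_natl.
apply: (@le2_ext _ _ _ P J _ (fun e o => \sum_(r < 2 * k) del * lev k r e o)).
 move=> e o _; rewrite /cell muln0; apply: eq_bigr => r _; rewrite add0n.
 by rewrite {2}/lev leqNgt ltn_ord subr0.
have al (r : 'I_(2 * k)) e : abd P (lev k r e).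
 by apply: abd_lev => //; have := @lt_n 0%N r isT (ltn_ord r); rewrite muln0.
apply: le2_sum => [r e|r _|r _]; first by apply: abdZ.
 by rewrite mulr_ge0// ltW.
apply: le2Z => //; first exact: ltW.
apply: le2_sqn => //; case: (leqP k r) => kr.
 by apply: lev_lip => //; have := @lt_n 0%N r isT (ltn_ord r); rewrite muln0.
rewrite /sqn big1 ?sqr_ge0// => e _; rewrite -[RHS](Ex_cst P); congr (Ex _); apply/funext => o.
by rewrite /lev leqNgt kr expr0n.
Qed.

(** Conditioning tick of level [k] for position [r] of cell [c.+1]. It comes after [2 * k * c], the
    conditioning tick of level [2 * k]; refining a level replaces the latter by the former. *)
Definition mid c r := (2 * k * c + k + k * (r %/ k))%N.

Lemma cell_index c r : (r < 2 * k)%N ->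
 [/\ cond (2 * k) (2 * k * c.+1 + r) = (2 * k * c)%N, cond k (2 * k * c.+1 + r) = mid c r,
   (2 * k * c < mid c r)%N, (mid c r <= 2 * k * c.+1)%N &
   (mid c r + k <= 2 * k * c.+1 + r)%N /\ (mid c r - 2 * k * c <= 2 * k)%N].
Proof.
move=> rk; have [e1 e2 h1 h2 h3] := half_cell c k0 rk; split=> //; first exact: cond_cell.
by rewrite e1 cond_cell ?ltn_mod.
Qed.

(** The part of the refinement of cell [c.+1] that is orthogonal to the past at tick [2 * k * c].
    These parts are summed in mean square, the remainders [qcell] by the triangle inequality. *)
Definition mcell c e o := \sum_(r < 2 * k) del *
 mart (t (2 * k * c)) (t (mid c r)) (phi (t (mid c r)) (t (2 * k * c.+1 + r)) (g (2 * k * c.+1 + r) e)) o.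

Definition qcell c e o := cell c.+1 e o - mcell c e o.

Section one_cell.
Variables (c : nat) (r : 'I_(2 * k)) (cp : (c < p)%N).
Notation i := (2 * k * c)%N.
Notation i' := (mid c r).
Notation j := (2 * k * c.+1 + r)%N.

Lemma cell_times : [/\ s0 <= t i, t i < t i', t i' < t j & t j <= s1] /\
 [/\ kd <= t j - t i', t i' - t i <= 2 * kd & t i' - t i <= 2 * (t j - t i')].
Proof.
have [_ _ h1 h2 [h3 h4]] := cell_index c (ltn_ord r).
have h5 : (i' < j)%N by apply: leq_trans h3; rewrite -addn1 leq_add2l.
have e1 : kd <= t j - t i' by rewrite tickB ?(ltnW h5)// ler_pM2r// ler_nat leq_subRL ?(ltnW h5).
have e2 : t i' - t i <= 2 * kd by rewrite tickB ?(ltnW h1)// mulrA -natrM ler_pM2r// ler_nat.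
split; split => //; [exact: tick_ge|exact: tick_lt|exact: tick_lt|exact: (tn (lt_n (cp : (c.+1 < p.+1)%N) (ltn_ord r)))|].
by apply: le_trans e2 _; rewrite ler_pM2l.
Qed.

Lemma lev_split e o : lev k j e o - lev (2 * k) j e o =
 mart (t i) (t i') (phi (t i') (t j) (g j e)) o +
 (phi (t i') (t j) (g j e) (X true (t i') o) - phi (t i') (t j) (g j e) (X false (t i') o) -
  (phi (t i') (t j) (g j e) (Y true (t i) (t i') o) - phi (t i') (t j) (g j e) (Y false (t i) (t i') o))).
Proof.
have [e1 e2 h1 h2 [h3 h4]] := cell_index c (ltn_ord r).
have [[u0 uw wr rs] _] := cell_times; have [gh _] := hg j.
have kj : (2 * k <= j)%N by apply: leq_trans (leq_addr _ _); rewrite leq_pmulr.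
have kj' : (k <= j)%N by apply: leq_trans kj; rewrite leq_pmull.
rewrite /lev kj kj' e1 e2 /mart.
have u00 : 0 <= t i by exact: le_trans u0.
rewrite (Chapman_Kolmogorov (X true (t i) o) u00 uw wr (le_trans rs s1T) (gh e)).
rewrite (Chapman_Kolmogorov (X false (t i) o) u00 uw wr (le_trans rs s1T) (gh e)).
by rewrite [RHS]addrC subrKA.
Qed.

Lemma mart_cell : sqn P J (fun e => mart (t i) (t i') (phi (t i') (t j) (g j e))) <=
 (cL * K * kd `^ (- a) * mm) ^+ 2.
Proof.
have [[u0 uw wr rs] [h1 h2 h3]] := cell_times.
apply: le_trans (mart_sqn u0 uw wr rs len (hg j)) _.
have cL0 : 0 <= cL := ltW cL_gt0.
have cLK : 0 <= cL * K by rewrite mulr_ge0.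
rewrite ler_sqr ?nnegrE ?mulr_ge0 ?powR_ge0//; apply: ler_wpM2r => //; apply: ler_wpM2l => //.
by apply: powR_anti => //; rewrite oppr_le0.
Qed.

Lemma rest_cell : le2 P J (fun e o =>
 phi (t i') (t j) (g j e) (X true (t i') o) - phi (t i') (t j) (g j e) (X false (t i') o) -
  (phi (t i') (t j) (g j e) (Y true (t i) (t i') o) - phi (t i') (t j) (g j e) (Y false (t i) (t i') o)))
 (K * kd `^ ep * (2 * c4 * M * mm + 2 * cL * q)).
Proof.
have [[u0 uw wr rs] [h1 h2 h3]] := cell_times.
have c40 := ltW c4_gt0; have cL0 := ltW cL_gt0.
apply: le2_le (rest_le2 u0 uw wr rs len (hg j) h3).
have wu0 : 0 <= t i' - t i by rewrite subr_ge0 ltW.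
have ak0 : - (a + k2) <= 0 by rewrite oppr_le0 addr_ge0.
have p1 : (t j - t i') `^ (- (a + k2)) * (M * (t i' - t i)) <= 2 * M * kd `^ ep.
 apply: (@le_trans _ _ (kd `^ (- (a + k2)) * (M * (2 * kd)))).
  apply: ler_pM; rewrite ?powR_ge0 ?mulr_ge0 ?(ltW M0)//; first exact: powR_anti.
  by rewrite ler_pM2l.
 have -> : kd `^ (- (a + k2)) * (M * (2 * kd)) = 2 * M * (kd `^ (- (a + k2)) * kd) by ring.
 rewrite ler_pM2l ?mulr_gt0// -{2}(powRr1 (ltW kd0)) -powRD ?(gt_eqF kd0) ?implybT//.
 by apply: powR_small => //; move: ak_ep; lra.
have p2 : (t j - t i') `^ (- a) * Num.sqrt (t i' - t i) <= 2 * kd `^ ep.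
 apply: (@le_trans _ _ (kd `^ (- a) * (2 * kd `^ (1 / 2)))).
  apply: ler_pM; rewrite ?powR_ge0//.
   by apply: powR_anti => //; rewrite oppr_le0.
  rewrite -ler_sqr ?nnegrE ?mulr_ge0 ?powR_ge0// sqr_sqrtr//; apply: le_trans h2 _.
  have sq : (kd `^ (1 / 2)) ^+ 2 = kd.
   by rewrite -powR_mulrn ?powR_ge0// -powRrM (_ : 1 / 2 * 2%:R = 1) ?powRr1 ?(ltW kd0)//; field.
  by rewrite exprMn sq ler_pM2r// expr2; lra.
 rewrite mulrCA ler_pM2l// -powRD ?(gt_eqF kd0) ?implybT//.
 by apply: powR_small => //; move: a_ep; lra.
have b1 := ler_wpM2l (mulr_ge0 (mulr_ge0 c40 K0) mm0) p1.
have b2 := ler_wpM2l (mulr_ge0 (mulr_ge0 cL0 K0) q0) p2.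
have e1 : c4 * K * (t j - t i') `^ (- (a + k2)) * (M * (t i' - t i)) * mm +
  cL * K * (t j - t i') `^ (- a) * (q * Num.sqrt (t i' - t i)) =
  c4 * K * mm * ((t j - t i') `^ (- (a + k2)) * (M * (t i' - t i))) +
  cL * K * q * ((t j - t i') `^ (- a) * Num.sqrt (t i' - t i)) by ring.
rewrite e1; apply: le_trans (lerD b1 b2) _.
by apply: le_of_eq; ring.
Qed.

Lemma abd_mart_cell e : abd P (mart (t i) (t i') (phi (t i') (t j) (g j e))).
Proof.
have [[u0 uw wr rs] _] := cell_times; have [gh _] := hg j.
have w0 : 0 <= t i' by apply: le_trans (tick_ge _).
exact: (mart_abd u0 uw (le_trans (ltW wr) rs) (phi_hol w0 wr (le_trans rs s1T) (gh e))).
Qed.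

Lemma abd_lev_cell e : abd P (fun o => lev k j e o - lev (2 * k) j e o).
Proof.
have jn : (j < n)%N by exact: (lt_n (cp : (c.+1 < p.+1)%N) (ltn_ord r)).
by apply: abdB; apply: abd_lev => //; rewrite muln_gt0.
Qed.
End one_cell.

Notation G0 := (2 * cL * K * mm * kd `^ (1 - a)).

Lemma abd_mcell c e : (c < p)%N -> abd P (mcell c e).
Proof. by move=> cp; apply: abd_sum => r _; apply: abdZ; exact: abd_mart_cell. Qed.

Lemma abd_cell c e : (c < p)%N -> abd P (cell c.+1 e).
Proof. by move=> cp; apply: abd_sum => r _; apply: abdZ; exact: abd_lev_cell. Qed.

Let G00 : 0 <= G0. Proof. by rewrite !mulr_ge0 ?powR_ge0// ltW// cL_gt0. Qed.

Let G0E : (2 * k)%:R * (del * (cL * K * kd `^ (- a) * mm)) = G0.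
Proof.
have -> : kd `^ (1 - a) = kd * kd `^ (- a).
 by rewrite -{2}(powRr1 (ltW kd0)) -powRD ?(gt_eqF kd0) ?implybT.
by rewrite natrM; ring.
Qed.

Lemma mcell_sqn c : (c < p)%N -> sqn P J (mcell c) <= G0 ^+ 2.
Proof.
move=> cp; set B := cL * K * kd `^ (- a) * mm.
have cL0 : 0 <= cL := ltW cL_gt0.
have B0 : 0 <= B by rewrite !mulr_ge0 ?powR_ge0.
apply: sqn_le2 => //; rewrite -G0E -/B.
have -> : (2 * k)%:R * (del * B) = \sum_(r < 2 * k) del * B by rewrite sumr_const card_ord mulr_natl.
apply: le2_sum => [r e|r _|r _]; first by apply: abdZ; exact: abd_mart_cell.
 by rewrite mulr_ge0// ltW.
apply: le2Z => //; [by move=> e; exact: abd_mart_cell|exact: ltW|].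
by apply: le2_sqn => //; exact: mart_cell.
Qed.

(** The martingale increments of [c] are known at the tick [mid c r], which is at most
    [2 * k * c.+1] and hence at most [2 * k * c'], the tick from which those of [c'] start. *)
Lemma mcell_orth c c' e : (c < c' < p)%N -> Ex (fun o => mcell c e o * mcell c' e o) = 0.
Proof.
move=> /andP[cc cp]; have cp' : (c < p)%N by exact: ltn_trans cp.
pose N1 c0 r := mart (t (2 * k * c0)) (t (mid c0 r)) (phi (t (mid c0 r)) (t (2 * k * c0.+1 + r)) (g (2 * k * c0.+1 + r) e)).
have a1 (r : 'I_(2 * k)) : abd P (N1 c r) by exact: abd_mart_cell.
have a2 (r : 'I_(2 * k)) : abd P (N1 c' r) by exact: abd_mart_cell.
rewrite (_ : (fun o => _) = (fun o => \sum_(r < 2 * k) \sum_(r' < 2 * k) del ^+ 2 * (N1 c r o * N1 c' r' o))); last first.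
 apply/funext => o; rewrite mulr_suml; apply: eq_bigr => r _; rewrite mulr_sumr; apply: eq_bigr => r' _.
 by rewrite expr2; exact: mulrACA.
have a3 (r r' : 'I_(2 * k)) : abd P (fun o => N1 c r o * N1 c' r' o) by exact: abdM.
rewrite Ex_sum; last by move=> r _; apply: abd_sum => r' _; exact: abdZ.
rewrite big1// => r _; rewrite Ex_sum; last by move=> r' _; exact: abdZ.
rewrite big1// => r' _; rewrite (ExZ _ (a3 r r')).
have [[u0 uw wr rs] _] := cell_times r cp'; have [[u0' uw' wr' rs'] _] := cell_times r' cp.
have hphi c0 (r0 : 'I_(2 * k)) : (c0 < p)%N -> hol K (phi (t (mid c0 r0)) (t (2 * k * c0.+1 + r0)) (g (2 * k * c0.+1 + r0) e)).
 move=> c0p; have [[_ _ w1 w2] _] := cell_times r0 c0p; have [gh _] := hg (2 * k * c0.+1 + r0)%N.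
 by apply: phi_hol => //; [exact: le_trans (tick_ge _)|exact: le_trans w2 _].
have ws : t (mid c r) <= s1 by exact: le_trans (ltW wr) rs.
have ws' : t (mid c' r') <= s1 by exact: le_trans (ltW wr') rs'.
rewrite (mart_orth (B := 4 * K) u0' uw' ws' (hphi _ _ cp)) ?mulr0//.
- by have [] := a1 r.
- by move=> o; exact: mart_bnd (hphi _ _ cp') o.
- apply: (@apx_sub _ _ _ _ _ (F (t (mid c r)))); last exact: (mart_apx u0 uw ws (hphi _ _ cp')).
 apply: (filtration_sub hF); first by exact: le_trans (tick_ge _).
  rewrite lerD2l ler_pM2r// ler_nat; have [_ _ _ h2 _] := cell_index c (ltn_ord r).
  by apply: leq_trans h2 _; rewrite leq_mul2l cc orbT.
 by apply: le_trans (le_trans (ltW uw') ws') s1T.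
Qed.

Lemma qcell_le2 c : (c < p)%N ->
 le2 P J (qcell c) ((2 * k)%:R * (del * (K * kd `^ ep * (2 * c4 * M * mm + 2 * cL * q)))).
Proof.
move=> cp; set B := K * kd `^ ep * _.
have B0 : 0 <= B.
 have c40 := ltW c4_gt0; have cL0 := ltW cL_gt0; have M00 := ltW M0.
 apply: mulr_ge0; first by rewrite mulr_ge0 ?powR_ge0.
 apply: addr_ge0; last by apply: mulr_ge0 => //; exact: mulr_ge0.
 by apply: mulr_ge0 => //; apply: mulr_ge0 => //; exact: mulr_ge0.
have -> : (2 * k)%:R * (del * B) = \sum_(r < 2 * k) del * B by rewrite sumr_const card_ord mulr_natl.
pose m0 r e o := mart (t (2 * k * c)) (t (mid c r)) (phi (t (mid c r)) (t (2 * k * c.+1 + r)) (g (2 * k * c.+1 + r) e)) o.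
pose l0 r e o := lev k (2 * k * c.+1 + r) e o - lev (2 * k) (2 * k * c.+1 + r) e o.
apply: (@le2_ext _ _ _ P J _ (fun e o => \sum_(r < 2 * k) del * (l0 r e o - m0 r e o))).
 by move=> e o _; rewrite /qcell -sumrB; apply: eq_bigr => r _; rewrite -mulrBr.
have am (r : 'I_(2 * k)) e : abd P (fun o => l0 r e o - m0 r e o).
 by apply: abdB; [exact: abd_lev_cell|exact: abd_mart_cell].
apply: le2_sum => [r e|r _|r _]; first exact: abdZ.
 by rewrite mulr_ge0// ltW.
apply: le2Z => //; first exact: ltW.
apply: le2_ext (rest_cell r cp) => e o _.
by rewrite /l0 lev_split// addrC addKr.
Qed.

(** With [L = n * del] there are about [L / kd] cells. Orthogonality sums the martingale parts to
    the square root of that number times [kd^(1 - a)], that is [sqrt L * kd^(1/2 - a)]; the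
    remainders sum to [L * kd^ep]. By the bound on [a], and since [L <= 1], both are of order at
    most [sqrt L * kd^ep]; the bound on [a + k2] serves in the remainders themselves. *)
Lemma level_le2 : le2 P J (fun e o => \sum_(j < n) del * (lev k j e o - lev (2 * k) j e o))
 (K * (4 * cL + 2 * c4 * M) * (mm + q) * Num.sqrt (n%:R * del) * kd `^ ep).
Proof.
set L := n%:R * del; have cL0 : 0 <= cL := ltW cL_gt0; have c40 : 0 <= c4 := ltW c4_gt0.
have M00 := ltW M0; have d00 := ltW del0.
have LE : L = 2 * kd * p.+1%:R by rewrite /L nk !natrM; ring.
have L0 : 0 <= L by rewrite /L mulr_ge0// ltW.
pose Bq := K * kd `^ ep * (2 * c4 * M * mm + 2 * cL * q).
have Bq0 : 0 <= Bq.
 apply: mulr_ge0; first by rewrite mulr_ge0 ?powR_ge0.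
 apply: addr_ge0; last by apply: mulr_ge0 => //; exact: mulr_ge0.
 by apply: mulr_ge0 => //; apply: mulr_ge0 => //; exact: mulr_ge0.
have aq c e : (c < p)%N -> abd P (qcell c e) by move=> cp; apply: abdB; [exact: abd_cell|exact: abd_mcell].
have a1 e : abd P (cell 0 e).
 apply: abd_sum => r _; apply: abdZ; apply: abdB; apply: abd_lev => //; try exact: lt_n.
 by rewrite muln_gt0.
have sL0 := sqrtr_ge0 L.
have G0L : G0 <= 2 * cL * K * mm * Num.sqrt L * kd `^ ep.
 have -> : kd `^ (1 - a) = kd `^ (1 / 2) * kd `^ (1 / 2 - a).
  by rewrite -powRD ?(gt_eqF kd0) ?implybT//; congr (_ `^ _); field.
 rewrite -[leRHS]mulrA; apply: ler_wpM2l; first by rewrite !mulr_ge0.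
 apply: ler_pM; rewrite ?powR_ge0//; last by apply: powR_small => //; move: a_ep; lra.
 rewrite -ler_sqr ?nnegrE ?powR_ge0// sqr_sqrtr//.
 have -> : (kd `^ (1 / 2)) ^+ 2 = kd.
  by rewrite -powR_mulrn ?powR_ge0// -powRrM (_ : 1 / 2 * 2%:R = 1) ?powRr1 ?(ltW kd0)//; field.
 rewrite LE; have : 1 <= p.+1%:R :> R by rewrite ler1n.
 have := kd0; nra.
pose A e o := cell 0 e o + \sum_(c < p) mcell c e o + \sum_(c < p) qcell c e o.
apply: (@le2_ext _ _ _ P J _ A).
 move=> e o _; rewrite /A -addrA -big_split/= nk (sum_cells (fun j => del * (lev k j e o - lev (2 * k) j e o))).
 rewrite big_ord_recl; congr (_ + _); apply: eq_bigr => c _.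
 by rewrite /qcell addrC subrK /cell lift0.
have hM : le2 P J (fun e o => \sum_(c < p) mcell c e o) (2 * cL * K * mm * Num.sqrt L * kd `^ ep).
 apply: le2_sqn; first by rewrite !mulr_ge0 ?powR_ge0.
 rewrite sqn_orth; [|by move=> c e; exact: abd_mcell|by move=> c c' e; exact: mcell_orth].
 apply: (@le_trans _ _ (\sum_(c < p) G0 ^+ 2)).
  by apply: ler_sum => c _; exact: mcell_sqn.
 have -> : \sum_(c < p) G0 ^+ 2 = G0 ^+ 2 * p%:R by rewrite sumr_const card_ord mulr_natr.
 have -> : kd `^ (1 - a) = kd `^ (1 / 2) * kd `^ (1 / 2 - a).
  by rewrite -powRD ?(gt_eqF kd0) ?implybT//; congr (_ `^ _); field.
 have s1' : (kd `^ (1 / 2)) ^+ 2 = kd.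
  by rewrite -powR_mulrn ?powR_ge0// -powRrM (_ : 1 / 2 * 2%:R = 1) ?powRr1 ?(ltW kd0)//; field.
 have -> : (2 * cL * K * mm * (kd `^ (1 / 2) * kd `^ (1 / 2 - a))) ^+ 2 * p%:R =
   (2 * cL * K * mm * kd `^ (1 / 2 - a)) ^+ 2 * ((kd `^ (1 / 2)) ^+ 2 * p%:R) by ring.
 have -> : (2 * cL * K * mm * Num.sqrt L * kd `^ ep) ^+ 2 = (2 * cL * K * mm * kd `^ ep) ^+ 2 * Num.sqrt L ^+ 2.
  by ring.
 rewrite s1' sqr_sqrtr//; apply: ler_pM; rewrite ?sqr_ge0 ?mulr_ge0 ?(ltW kd0)//.
  rewrite ler_sqr ?nnegrE ?mulr_ge0 ?powR_ge0//; apply: ler_wpM2l; first by rewrite !mulr_ge0.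
  by apply: powR_small => //; move: a_ep; lra.
 rewrite LE; have : p%:R <= p.+1%:R :> R by rewrite ler_nat.
 have : 0 <= p%:R :> R by []. have := kd0; nra.
have hQ : le2 P J (fun e o => \sum_(c < p) qcell c e o) (L * Bq).
 apply: (@le2_le _ _ _ P J _ (\sum_(c < p) (2 * k)%:R * (del * Bq))).
  rewrite sumr_const card_ord -[_ *+ p]mulr_natr (_ : _ * p%:R = (2 * kd * p%:R) * Bq); last by rewrite natrM; ring.
  apply: ler_wpM2r => //; rewrite LE; apply: ler_wpM2l; last by rewrite ler_nat.
  by apply: mulr_ge0 => //; exact: ltW kd0.
 apply: (@le2_sum _ _ _ _ _ _ _ (fun c : 'I_p => qcell c)) => [c e|c _|c _]; first exact: aq.
  by rewrite mulr_ge0// mulr_ge0// ltW.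
 exact: qcell_le2.
have h0 : le2 P J (cell 0) (2 * cL * K * mm * Num.sqrt L * kd `^ ep).
 by apply: le2_le G0L _; rewrite -G0E; exact: first_cell.
have s1'' : 0 <= 2 * cL * K * mm * Num.sqrt L * kd `^ ep by rewrite !mulr_ge0 ?powR_ge0.
have am e : abd P (fun o => \sum_(c < p) mcell c e o) by apply: abd_sum => c _; exact: abd_mcell.
have aQ e : abd P (fun o => \sum_(c < p) qcell c e o) by apply: abd_sum => c _; exact: aq.
apply: le2_le (le2D (fun e => abdD (a1 e) (am e)) aQ (addr_ge0 s1'' s1'') (mulr_ge0 L0 Bq0) (le2D a1 am s1'' s1'' h0 hM) hQ).
have LsL : L <= Num.sqrt L.
 rewrite -{1}(sqr_sqrtr L0) expr2; apply: ler_piMl => //.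
 by rewrite -sqrtr1; apply: ler_wsqrtr.
have h3 := ler_wpM2r Bq0 LsL.
apply: le_trans (lerD (lexx _) h3) _.
have -> : 2 * cL * K * mm * Num.sqrt L * kd `^ ep + 2 * cL * K * mm * Num.sqrt L * kd `^ ep + Num.sqrt L * Bq =
  K * Num.sqrt L * kd `^ ep * ((4 * cL + 2 * c4 * M) * mm + 2 * cL * q) by rewrite /Bq; ring.
have -> : K * (4 * cL + 2 * c4 * M) * (mm + q) * Num.sqrt L * kd `^ ep =
  K * Num.sqrt L * kd `^ ep * ((4 * cL + 2 * c4 * M) * mm + (4 * cL + 2 * c4 * M) * q) by ring.
apply: ler_wpM2l; first by rewrite !mulr_ge0 ?powR_ge0.
rewrite lerD2l; apply: ler_wpM2r => //; have : 0 <= c4 * M by rewrite mulr_ge0.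
rewrite -mulrA; lra.
Qed.
End level.
(** The bounds at the scales 2^i form a geometric progression of ratio [w], greater than 1, so the
    largest scale dominates. At scale [n] every [lev] vanishes, and the telescoping sum leaves level
    1. *)
Lemma levels_le2 nu : n = (2 ^ nu)%N ->
 le2 P J (fun e o => \sum_(j < n) del * lev 1 j e o)
 (K * (4 * cL + 2 * c4 * M) * (mm + q) * Num.sqrt (n%:R * del) * ((n%:R * del) `^ ep / (2 `^ ep - 1))).
Proof.
move=> nN; have cL0 : 0 <= cL := ltW cL_gt0; have c40 : 0 <= c4 := ltW c4_gt0.
have M00 := ltW M0; have d00 := ltW del0.
set B := K * _ * _ * _; have B0 : 0 <= B.
 apply: mulr_ge0; last exact: sqrtr_ge0.
 apply: mulr_ge0; last exact: addr_ge0.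
 apply: mulr_ge0 => //; apply: addr_ge0; first exact: mulr_ge0.
 by apply: mulr_ge0 => //; exact: mulr_ge0.
pose w := 2 `^ ep : R.
have w1 : 1 < w by exact: powR2_gt1.
have w10 : 0 < w - 1 by rewrite subr_gt0.
have pw i : (2 ^ i)%:R `^ ep = w ^+ i.
 by rewrite natrX -powR_mulrn// powRAC powR_mulrn.
have C0 i : 0 <= B * (del `^ ep * ((w ^+ i - 1) / (w - 1))).
 apply: mulr_ge0 => //; apply: mulr_ge0; first exact: powR_ge0.
 by rewrite divr_ge0 ?(ltW w10)// subr_ge0 exprn_ege1// ltW.
have an i (j : 'I_n) e : abd P (lev (2 ^ i) j e) by apply: abd_lev; rewrite ?expn_gt0.
have tel i : (i <= nu)%N -> le2 P J (fun e o => \sum_(j < n) del * (lev 1 j e o - lev (2 ^ i) j e o))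
  (B * (del `^ ep * ((w ^+ i - 1) / (w - 1)))).
 elim: i => [|i IH] inu.
  rewrite expr0 subrr mul0r !mulr0; apply: (@le2_ext _ _ _ P J _ (fun _ _ => 0)); last exact: le2_zero.
  by move=> e o _; rewrite big1// => j _; rewrite subrr mulr0.
 have [p pE] : exists p, (2 ^ (nu - i.+1) = p.+1)%N.
  by exists (2 ^ (nu - i.+1)).-1; rewrite prednK// expn_gt0.
 have nk : n = (2 * 2 ^ i * p.+1)%N by rewrite nN -pE -expnS -expnD subnKC.
 have k0 : (0 < 2 ^ i)%N by rewrite expn_gt0.
 have hl := level_le2 k0 nk.
 rewrite powRM// pw in hl.
 have b1 : 0 <= B * (w ^+ i * del `^ ep).
  by apply: mulr_ge0 => //; rewrite mulr_ge0 ?powR_ge0// exprn_ge0// ltW// (lt_trans ltr01).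
 have a1 e : abd P (fun o => \sum_(j < n) del * (lev 1 j e o - lev (2 ^ i) j e o)).
  by apply: abd_sum => j _; apply: abdZ; apply: abdB; [exact: (an 0%N)|exact: an].
 have a2 e : abd P (fun o => \sum_(j < n) del * (lev (2 ^ i) j e o - lev (2 * 2 ^ i) j e o)).
  by apply: abd_sum => j _; apply: abdZ; apply: abdB; [exact: an|rewrite -expnS; exact: an].
 have -> : B * (del `^ ep * ((w ^+ i.+1 - 1) / (w - 1))) =
   B * (del `^ ep * ((w ^+ i - 1) / (w - 1))) + B * (w ^+ i * del `^ ep).
  by rewrite exprS; field; rewrite gt_eqF.
 apply: (@le2_ext _ _ _ P J _ _ _ _ (le2D a1 a2 (C0 i) b1 (IH (ltnW inu)) hl)) => e o _.
 rewrite -big_split/=; apply: eq_bigr => j _.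
 by rewrite -mulrDr expnS subrKA.
have := tel nu (leqnn _).
have -> : n%:R * del = (2 ^ nu)%:R * del by rewrite nN.
move=> h; apply: le2_le (@le2_ext _ _ _ P J _ _ _ _ h).
 rewrite powRM// pw; apply: ler_wpM2l => //; rewrite -/w.
 rewrite mulrA ler_pM2r ?invr_gt0// mulrC ler_wpM2r ?powR_ge0//; lra.
move=> e o _; apply: eq_bigr => j _; rewrite {3}/lev leqNgt -nN ltn_ord.
by rewrite subr0.
Qed.

(** Value minus level 1 is a martingale increment over one tick plus a remainder. The three terms
    come from the first tick, the martingale increments and the remainders; all vanish with [del],
    which is why crude bounds without the factor [mm] suffice. *)
Lemma finest_le2 n' : n = n'.+1 ->
 le2 P J (fun e o => \sum_(j < n) del * (g j e (X true (t j) o) - g j e (X false (t j) o) - lev 1 j e o))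
 (2 * K * del + 2 * K * Num.sqrt (n%:R * del * del) + n%:R * del * (2 * K * (2 * (M * del)) `^ theta)).
Proof.
move=> nE; have d00 := ltW del0; have M00 := ltW M0.
pose m0 j e o := mart (t j) (t j.+1) (g j.+1 e) o.
pose r0 j e o := g j.+1 e (X true (t j.+1) o) - g j.+1 e (X false (t j.+1) o) -
 (g j.+1 e (Y true (t j) (t j.+1) o) - g j.+1 e (Y false (t j) (t j.+1) o)).
pose z0 e o := g 0%N e (X true (t 0) o) - g 0%N e (X false (t 0) o).
have jt j : (j < n')%N -> [/\ s0 <= t j, t j < t j.+1 & t j.+1 <= s1].
 by move=> jn; split; [exact: tick_ge|exact: tick_lt|apply: tn; rewrite nE].
have gh j e : hol K (g j e) by have [] := hg j.
have am j e : (j < n')%N -> abd P (m0 j e) by move=> /jt[u0 uw ws]; exact: (mart_abd u0 uw ws (gh _ _)).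
have aX' c j e : (j < n)%N -> abd P (fun o => g j e (X c (t j) o)).
 by move=> jn; apply: abd_ucb; [exact: (hol_ucb (gh j e))|apply: mX; rewrite tick_ge tn].
have ar j e : (j < n')%N -> abd P (r0 j e).
 move=> jn; have [u0 uw ws] := jt _ jn; apply: abdB; apply: abdB; try by apply: aX'; rewrite nE.
  exact: (abd_Y u0 uw ws (gh _ _)).
 exact: (abd_Y u0 uw ws (gh _ _)).
have az e : abd P (z0 e) by apply: abdB; apply: aX'; rewrite nE.
have bnd (x y : nat -> R) : \sum_(k < J) x k ^+ 2 <= K ^+ 2 -> \sum_(k < J) y k ^+ 2 <= K ^+ 2 ->
  \sum_(k < J) (x k - y k) ^+ 2 <= (2 * K) ^+ 2.
 move=> hx hy; apply: (@le_trans _ _ (\sum_(k < J) (2 * x k ^+ 2 + 2 * y k ^+ 2))).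
  by apply: ler_sum => k _; have := sqr_ge0 (x k + y k); nra.
 by rewrite big_split/= -!mulr_sumr exprMn; lra.
have K2 : 0 <= 2 * K by rewrite mulr_ge0.
have hz : le2 P J (fun e o => del * z0 e o) (2 * K * del).
 rewrite mulrC; apply: le2Z => //; apply: le2_sqn => //.
 apply: (@sqn_le _ _ _ P J _ (cst ((2 * K) ^+ 2))) => //; [exact: abd_cst| |by rewrite Ex_cst].
 by apply: aeW => o; apply: (bnd (fun k => g 0%N k (X true (t 0) o)) (fun k => g 0%N k (X false (t 0) o))); exact: vec_bnd.
have mj j : (j < n')%N -> sqn P J (m0 j) <= (2 * K) ^+ 2.
 move=> jn; have [u0 uw ws] := jt _ jn.
 apply: (@le_trans _ _ (sqn P J (fun k o => g j.+1 k (Y true (t j) (t j.+1) o) - g j.+1 k (Y false (t j) (t j.+1) o)))).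
  by apply: ler_sum => k _; exact: (mart_sqr u0 uw ws (gh _ _)).
 apply: (@sqn_le _ _ _ P J _ (cst ((2 * K) ^+ 2))) => //; [|exact: abd_cst| |by rewrite Ex_cst].
  by move=> k; apply: abdB; exact: (abd_Y u0 uw ws (gh _ _)).
 by apply: aeW => o; apply: (bnd (fun k => g j.+1 k (Y true _ _ o)) (fun k => g j.+1 k (Y false _ _ o))); exact: vec_bnd.
have orth i j e : (i < j < n')%N -> Ex (fun o => (del * m0 i e o) * (del * m0 j e o)) = 0.
 move=> /andP[ij jn]; have jn' : (i < n')%N by exact: ltn_trans jn.
 have [u0 uw ws] := jt _ jn'; have [u0' uw' ws'] := jt _ jn.
 rewrite (_ : (fun o => _) = (fun o => del ^+ 2 * (m0 i e o * m0 j e o))); last first.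
  by apply/funext => o; rewrite expr2; exact: mulrACA.
 rewrite (ExZ _ (abdM (am i e jn') (am j e jn))).
 rewrite (mart_orth (B := 4 * K) u0' uw' ws' (gh _ _)) ?mulr0//.
 - by have [] := am i e jn'.
 - by move=> o; exact: (mart_bnd u0 uw ws (gh _ _)).
 - apply: (@apx_sub _ _ _ _ _ (F (t i.+1))); last exact: (mart_apx u0 uw ws (gh _ _)).
  apply: (filtration_sub hF); first by exact: le_trans (tick_ge _).
   by rewrite lerD2l ler_pM2r// ler_nat.
  by apply: le_trans (le_trans (ltW uw') ws') s1T.
have hm : le2 P J (fun e o => \sum_(j < n') del * m0 j e o) (2 * K * Num.sqrt (n%:R * del * del)).
 apply: le2_sqn; first by rewrite mulr_ge0.
 rewrite (@sqn_orth _ _ _ P J n' (fun j e o => del * m0 j e o)); last 2 first.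
 - by move=> j e jn; apply: abdZ; exact: am.
 - by move=> i j e; exact: orth.
 apply: (@le_trans _ _ (\sum_(j < n') (del * (2 * K)) ^+ 2)).
  apply: ler_sum => j _; apply: sqn_le2; first exact: mulr_ge0.
  by apply: le2Z => //; [by move=> e; exact: am|apply: le2_sqn => //; exact: mj].
 rewrite sumr_const card_ord exprMn [leRHS]exprMn sqr_sqrtr ?mulr_ge0//.
 rewrite -[_ *+ n']mulr_natr nE; have : n'%:R <= n'.+1%:R :> R by rewrite ler_nat.
 have e0 : 0 <= del ^+ 2 * (2 * K) ^+ 2 by rewrite mulr_ge0 ?sqr_ge0.
 move=> /(ler_wpM2l e0) h; apply: le_trans h _.
 by apply: le_of_eq; ring.
set B := 2 * K * (2 * (M * del)) `^ theta; have B0 : 0 <= B by rewrite mulr_ge0 ?powR_ge0.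
have hr : le2 P J (fun e o => \sum_(j < n') del * r0 j e o) (n%:R * del * B).
 apply: (@le2_le _ _ _ P J _ (\sum_(j < n') del * B)).
  rewrite sumr_const card_ord -[_ *+ n']mulr_natl mulrA; apply: ler_wpM2r => //; apply: ler_wpM2r => //.
  by rewrite nE ler_nat.
 apply: (@le2_sum _ _ _ _ _ _ _ (fun (j : 'I_n') e o => del * r0 j e o)) => [j e|j _|j _].
 - by apply: abdZ; exact: ar.
 - exact: mulr_ge0.
 - apply: le2Z => //; first by move=> e; exact: ar.
  have [u0 uw ws] := jt _ (ltn_ord j).
  have := last_rest_le2 u0 uw ws (hg j.+1).
  by rewrite tickB// subSnn mul1r.
have a2 e : abd P (fun o => \sum_(j < n') del * m0 j e o) by apply: abd_sum => j _; apply: abdZ; exact: am.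
have a3 e : abd P (fun o => \sum_(j < n') del * r0 j e o) by apply: abd_sum => j _; apply: abdZ; exact: ar.
have a1 e : abd P (fun o => del * z0 e o) by exact: abdZ.
have p1 : 0 <= 2 * K * del by rewrite mulr_ge0.
have p2 : 0 <= 2 * K * Num.sqrt (n%:R * del * del) by rewrite mulr_ge0.
have p3 : 0 <= n%:R * del * B by apply: mulr_ge0 => //; exact: mulr_ge0.
apply: (@le2_ext _ _ _ P J _ _ _ _ (le2D (fun e => abdD (a1 e) (a2 e)) a3 (addr_ge0 p1 p2) p3 (le2D a1 a2 p1 p2 hz hm) hr)) => e o _.
rewrite nE big_ord_recl -[RHS]addrA -big_split/=; congr (_ + _).
 by rewrite /lev ltnn subr0.
apply: eq_bigr => j _; rewrite -mulrDr; congr (_ * _); rewrite /bump leq0n add1n.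
have cj : cond 1 j.+1 = j by rewrite /cond mul1n divn1.
rewrite /lev ltn0Sn cj /mart.
by rewrite [RHS]addrC subrKA.
Qed.

Lemma sewing_le2 nu : n = (2 ^ nu)%N ->
 le2 P J (fun e o => \sum_(j < n) del * (g j e (X true (t j) o) - g j e (X false (t j) o)))
 (K * (4 * cL + 2 * c4 * M) * (mm + q) * Num.sqrt (n%:R * del) * ((n%:R * del) `^ ep / (2 `^ ep - 1)) +
  (2 * K * del + 2 * K * Num.sqrt (n%:R * del * del) + n%:R * del * (2 * K * (2 * (M * del)) `^ theta))).
Proof.
move=> nN; have [n' nE] : exists n', n = n'.+1 by exists n.-1; rewrite prednK// nN expn_gt0.
have h1 := levels_le2 nN; have h2 := finest_le2 nE.
have al (j : 'I_n) e : abd P (lev 1 j e) by exact: abd_lev.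
have gh j e : hol K (g j e) by have [] := hg j.
have aX' c (j : 'I_n) e : abd P (fun o => g j e (X c (t j) o)).
 by apply: abd_ucb; [exact: (hol_ucb (gh j e))|apply: mX; rewrite tick_ge tn].
have a1 e : abd P (fun o => \sum_(j < n) del * lev 1 j e o) by apply: abd_sum => j _; exact: abdZ.
have a2 e : abd P (fun o => \sum_(j < n) del * (g j e (X true (t j) o) - g j e (X false (t j) o) - lev 1 j e o)).
 by apply: abd_sum => j _; apply: abdZ; apply: abdB => //; exact: abdB.
have cL0 : 0 <= cL := ltW cL_gt0; have c40 : 0 <= c4 := ltW c4_gt0.
have M00 := ltW M0; have d00 := ltW del0.
have w1 : 1 < (2 : R) `^ ep by exact: powR2_gt1.
have p1 : 0 <= K * (4 * cL + 2 * c4 * M) * (mm + q) * Num.sqrt (n%:R * del) * ((n%:R * del) `^ ep / (2 `^ ep - 1)).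
 apply: mulr_ge0; last by rewrite divr_ge0 ?powR_ge0// subr_ge0 ltW.
 apply: mulr_ge0; last exact: sqrtr_ge0.
 apply: mulr_ge0; last exact: addr_ge0.
 apply: mulr_ge0 => //; apply: addr_ge0; first exact: mulr_ge0.
 by apply: mulr_ge0 => //; exact: mulr_ge0.
have p2 : 0 <= 2 * K * del + 2 * K * Num.sqrt (n%:R * del * del) + n%:R * del * (2 * K * (2 * (M * del)) `^ theta).
 by rewrite !addr_ge0 ?mulr_ge0 ?powR_ge0.
apply: (@le2_ext _ _ _ P J _ _ _ _ (le2D a1 a2 p1 p2 h1 h2)) => e o _.
by rewrite -big_split/=; apply: eq_bigr => j _; rewrite -mulrDr [lev _ _ _ _ + _]addrC subrK.
Qed.
End smoothing.

(** * Time integrals as averages of Riemann sums *)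

Section time_integrals.
Context (R : realType).
Notation leb := (@lebesgue_measure R).
Notation RT := (measurableTypeR R).
Notation "\i_ ( u , w ) f" := (\int[leb]_(r in `]u : R, w : R]%classic) f r)
 (at level 41, u, w at level 35).

Lemma shift_lebesgue (c : R) (A : set RT) : measurable A ->
 leb ((fun x : RT => (c + x : R) : RT) @^-1` A) = leb A.
Proof.
move=> mA; have mphi : measurable_fun setT (fun x : RT => (c + x : R) : RT).
 by apply: measurable_funD => //; exact: measurable_cst.
pose nu : {measure set RT -> \bar R} := measure_function_pushforward__canonical__measure_function_Measure leb mphi.
have := @lebesgue_measure_unique R nu _ A mA; rewrite /= /pushforward => -> // X.
move=> [[x y] _ <-]; have -> : (fun x0 : RT => (c + x0 : R) : RT) @^-1` `]x, y]%classic = `](x - c), (y - c)]%classic.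
 by apply/seteqP; split => z /=; rewrite !in_itv/= ltrBlDl lerBrDl.
rewrite /= !lebesgue_measure_itv/= !lte_fin ltrD2r; case: ifPn => // _.
by rewrite -!EFinB; congr EFin; ring.
Qed.

Definition bmeas (f : R -> R) := measurable_fun (setT : set RT) f /\ exists M : R, forall x, `|f x| <= M.

Lemma bmeas_norm f : bmeas f -> bmeas (fun x => `|f x|).
Proof.
move=> [mf [M fM]]; split; last by exists M => x; rewrite normr_id.
by apply: measurableT_comp => //; exact: normr_measurable.
Qed.

Lemma bmeas_shift f c : bmeas f -> bmeas (fun x => f (c + x)).
Proof.
move=> [mf [M fM]]; split; last by exists M.
by apply: measurableT_comp => //; apply: measurable_funD => //; exact: measurable_cst.
Qed.

Lemma bmeas_intble f (i : interval R) : bmeas f -> (leb [set` i] < +oo)%E -> leb.-integrable [set` i] (EFin \o f).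
Proof.
move=> [mf [M fM]] fin; apply: measurable_bounded_integrable => //.
 by apply: measurable_funS mf.
exists M; split; first exact: num_real.
by move=> x Mx y _ /=; apply: le_trans (fM y) (ltW Mx).
Qed.

Lemma itv_fin (u w : R) a b : (leb [set` Interval (BSide a u) (BSide b w)] < +oo)%E.
Proof. by rewrite lebesgue_measure_itv/=; case: ifP => //; rewrite -EFinB ltry. Qed.

Section cells.
Variables (del : R) (del0 : 0 < del).
Definition unif := uniform_prob del0.

Lemma cell_uniform f (c : R) : bmeas f -> \i_(c, c + del) f = del * Ex unif (fun th => f (c + th)).
Proof.
have pos g : bmeas g -> (forall x, 0 <= g x) -> \i_(c, c + del) g = del * Ex unif (fun th => g (c + th)).
 move=> bg g0; have [mg [M gM]] := bg; have [mc _] := bmeas_shift c bg.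
 have ac : abd unif (fun th => g (c + th)) by apply: (@abd_bnd _ _ _ _ _ M).
 rewrite Rintegral_itv_obnd_cbnd; last by apply: bmeas_intble => //; exact: itv_fin.
 apply: EFin_inj; rewrite EFinM (EFin_Ex ac).
 rewrite (integral_uniform del0 (f := fun th => (g (c + th))%:E)); last 2 first.
 - exact/measurable_EFinP.
 - by move=> x; rewrite lee_fin.
 rewrite subr0 muleA -EFinM divff ?gt_eqF// mul1e.
 have ig := bmeas_intble bg (itv_fin c (c + del) true false).
 rewrite /Rintegral fineK; last exact: integrable_fin_num.
 have mphi : measurable_fun setT (fun x : RT => (c + x : R) : RT).
  by apply: measurable_funD => //; exact: measurable_cst.
 have := @ge0_integral_pushforward _ _ RT RT R (fun x : RT => (c + x : R)) mphi leb (`[c, c + del]%classic) (EFin \o g).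
 have D0 : `[0%R, del]%classic = (fun x : RT => (c + x : R) : RT) @^-1` `[c, c + del]%classic.
  by apply/seteqP; split => x /=; rewrite !in_itv/= lerDl lerD2l.
 move=> /(_ (measurable_itv _)) h; rewrite D0; apply: etrans (h _ _).
 - by apply: eq_measure_integral => A mA _; rewrite /= /pushforward shift_lebesgue.
 - by apply/measurable_EFinP; apply: measurable_funS mg.
 - by move=> x _; rewrite lee_fin.
(* Adding the bound [M] reduces signed functions to nonnegative ones. *)
move=> bf; have [mf [M fM]] := bf.
have [mc _] := bmeas_shift c bf.
have ac : abd unif (fun th => f (c + th)) by apply: (@abd_bnd _ _ _ _ _ M).
have b1 : bmeas (fun x => f x + M).
 split; first by apply: measurable_funD => //; exact: measurable_cst.
 by exists (M + `|M|) => x; apply: le_trans (ler_normD _ _) _; rewrite lerD2r.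
have b2 : bmeas (fun=> M) by split; [exact: measurable_cst|exists `|M|].
have M0 x : 0 <= f x + M by rewrite -lerBlDr sub0r; have := fM x; rewrite ler_norml => /andP[].
have Mp : 0 <= M by exact: le_trans (fM 0).
have := pos _ b1 M0; rewrite (ExD ac (abd_cst _ M)) mulrDr -(pos _ b2 (fun=> Mp)).
rewrite RintegralD//; last 2 first.
- by apply: bmeas_intble => //; exact: itv_fin.
- by apply: bmeas_intble => //; exact: itv_fin.
exact: addIr.
Qed.

Lemma sum_cells_itv f u n : bmeas f -> \i_(u, u + n%:R * del) f = \sum_(j < n) \i_(u + j%:R * del, u + j%:R * del + del) f.
Proof.
move=> bf; elim: n => [|n IH]; first by rewrite big_ord0 mul0r addr0 set_itv_ge ?bnd_simp ?ltxx// Rintegral_set0.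
rewrite big_ord_recr/= -IH.
have -> : u + n.+1%:R * del = u + n%:R * del + del by lra.
have h := @Rintegral_itvB R f (BRight u) (BRight (u + n%:R * del + del)) (u + n%:R * del) _ _ _.
rewrite -h; first by rewrite addrC subrK.
- by apply: bmeas_intble => //; exact: itv_fin.
- by rewrite bnd_simp lerDl mulr_ge0// ltW.
- by rewrite bnd_simp lerDl ltW.
Qed.

Lemma integral_uniform_cells f u n : bmeas f ->
 \i_(u, u + n%:R * del) f = Ex unif (fun th => \sum_(j < n) del * f (u + th + j%:R * del)).
Proof.
move=> bf; rewrite sum_cells_itv// Ex_sum; last first.
 move=> j _; apply: abdZ; have [mc [M cM]] := bmeas_shift (u + j%:R * del) bf.
 have -> : (fun w => f (u + w + j%:R * del)) = (fun w => f (u + j%:R * del + w)) by apply/funext => w; rewrite addrAC.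
 exact: (abd_bnd _ mc cM).
apply: eq_bigr => j _; rewrite cell_uniform// ExZ.
 by congr (_ * _); congr (Ex _ _); apply/funext => w; rewrite addrAC.
have [mc [M cM]] := bmeas_shift (u + j%:R * del) bf.
have -> : (fun w => f (u + w + j%:R * del)) = (fun w => f (u + j%:R * del + w)) by apply/funext => w; rewrite addrAC.
exact: (abd_bnd _ mc cM).
Qed.

(** The mean of the Riemann sums over a uniform shift [th] of the mesh is exactly the integral,
    whatever the regularity in time. The inequality between squared mean and mean square, with
    Tonelli's theorem, carries over a bound that holds for every shift. *)
Lemma averaging d (Omega : measurableType d) (P : probability Omega R) J n u (B Bd : R)
  (h : nat -> R -> Omega -> R) (V : nat -> Omega -> R) : 0 <= B ->
 (forall k, measurable_fun setT (fun z : RT * Omega => h k z.1 z.2)) ->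
 (forall k r o, `|h k r o| <= Bd) -> (forall k, abd P (V k)) ->
 (forall k, {ae P, forall o, V k o = \i_(u, u + n%:R * del) (h k ^~ o)}) ->
 (forall th, 0 <= th <= del -> sqn P J (fun k o => \sum_(j < n) del * h k (u + th + j%:R * del) o) <= B ^+ 2) ->
 sqn P J V <= B ^+ 2.
Proof.
move=> B0 mh hB aV VE hth.
pose G k th o := \sum_(j < n) del * h k (u + th + j%:R * del) o.
have mG k : measurable_fun setT (fun z : Omega * RT => G k z.2 z.1).
 apply: measurable_sum => j; apply: measurable_funM; first exact: measurable_cst.
 have mg : measurable_fun setT (fun z : Omega * RT => ((u + z.2 + j%:R * del : R) : RT, z.1)).
  apply/measurable_fun_pairP; split=> /=; last exact: measurable_fst.
  apply: measurable_funD; last exact: measurable_cst.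
  by apply: measurable_funD; [exact: measurable_cst|exact: measurable_snd].
 exact: (measurableT_comp (mh k) mg).
have GB k th o : `|G k th o| <= \sum_(j < n) del * Bd.
 apply: le_trans (ler_norm_sum _ _ _) _; apply: ler_sum => j _.
 by rewrite normrM gtr0_norm// ler_pM2l.
have aG1 k o : abd unif (G k ^~ o).
 exact: (abd_bnd unif (measurableT_comp (mG k) (measurable_pair1 o)) (fun th => GB k th o)).
have aG2 k th : abd P (G k th).
 exact: (abd_bnd P (measurableT_comp (mG k) (measurable_pair2 (th : RT))) (GB k th)).
have bh k o : bmeas (h k ^~ o).
 split; last by exists Bd => x; exact: hB.
 exact: (measurableT_comp (mh k) (measurable_pair2 o)).
pose f k (z : Omega * RT) := ((G k z.2 z.1) ^+ 2)%:E.
have mf k : measurable_fun setT (f k) by apply/measurable_EFinP; exact: measurable_funX.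
have f0 k z : (0 <= f k z)%E by rewrite lee_fin sqr_ge0.
have step k : ((Ex P (fun o => V k o ^+ 2))%:E <= \int[P]_o \int[unif]_th f k (o, th))%E.
 rewrite (EFin_Ex (abdX 2 (aV k))); apply: ae_ge0_le_integral => //.
 - by move=> o _; rewrite lee_fin sqr_ge0.
 - by apply/measurable_EFinP; apply: measurable_funX; have [] := aV k.
 - by move=> o _; apply: integral_ge0 => th _; exact: f0.
 - exact: (measurable_fun_fubini_tonelli_F (f k) (mf k) (f0 k)).
 - apply: filterS (VE k) => o hV _; rewrite hV integral_uniform_cells//.
  have h1 := EFin_Ex (abdX 2 (aG1 k o)); rewrite /f/= -h1 lee_fin.
  by have := Ex_sqr (aG1 k o).
have tot : ((\sum_(k < J) Ex P (fun o => V k o ^+ 2))%:E <= \int[unif]_th (sqn P J (G ^~ th))%:E)%E.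
 rewrite -sumEFin; apply: (@le_trans _ _ (\sum_(k < J) \int[P]_o \int[unif]_th f k (o, th))%E).
  by apply: lee_sum => k _; exact: step.
 under eq_bigr do rewrite fubini_tonelli//.
 rewrite -ge0_integral_sum//.
 - apply: le_of_eq; apply: eq_integral => th _.
  rewrite /sqn -sumEFin; apply: eq_bigr => k _.
  by rewrite -(EFin_Ex (abdX 2 (aG2 k th))).
 - by move=> k; exact: (measurable_fun_fubini_tonelli_G (f k) (mf k) (f0 k)).
 - by move=> k th _; apply: integral_ge0 => o _; exact: f0.
rewrite -lee_fin; apply: le_trans tot _.
have ms : measurable_fun setT (fun th : RT => (sqn P J (G ^~ th))%:E).
 apply/measurable_EFinP; apply: measurable_sum => k; apply/measurable_EFinP.
 have := measurable_fun_fubini_tonelli_G (f k) (mf k) (f0 k) (m1 := P).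
 by congr measurable_fun; apply/funext => th; rewrite -[LHS]/(\int[P]_o f k (o, th))%E /f/= -(EFin_Ex (abdX 2 (aG2 k th))).
have s0 th : (0 <= (sqn P J (G ^~ th))%:E)%E.
 by rewrite lee_fin; apply: sumr_ge0 => k _; apply: Ex_ge0 => o; exact: sqr_ge0.
rewrite integral_uniform// subr0.
apply: (@le_trans _ _ (del^-1%:E * \int[leb]_(th in `[0%R, del]) (B ^+ 2)%:E)%E).
 apply: lee_pmul => //; rewrite ?lee_fin ?invr_ge0 ?(ltW del0)//; first exact: integral_ge0.
 apply: ge0_le_integral => //.
 - exact: measurable_funS ms.
rewrite integral_cst//= lebesgue_measure_itv/= lte_fin del0 oppr0 adde0 -!EFinM lee_fin.
by rewrite mulrCA mulVf ?mulr1// gt_eqF.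
Qed.
End cells.
End time_integrals.

(** * Bochner integrals under continuous functionals *)

Section drift_integral.
Context (R : realType) (m : nat).
Notation H := (Hsp R m).
Notation leb := (@lebesgue_measure R).
Notation RT := (measurableTypeR R).

(** No measurability is assumed: the integral of a nonnegative function is a supremum over the
    simple functions below it. This allows for the norm in the definition of the Bochner integral,
    whose measurability is not part of the data. *)
Lemma integral_mono (D : set RT) (f1 f2 : RT -> \bar R) : (forall x, D x -> (0 <= f1 x)%E) ->
 (forall x, D x -> (f1 x <= f2 x)%E) -> (\int[leb]_(x in D) f1 x <= \int[leb]_(x in D) f2 x)%E.
Proof.
move=> f0 f12; rewrite integral_mkcond [leRHS]integral_mkcond.
rewrite !ge0_integralTE => [|x|x]; last 2 first.
- by rewrite patchE; case: ifP => // /set_mem xD; apply: le_trans (f12 x xD); exact: f0.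
- by rewrite patchE; case: ifP => // /set_mem; exact: f0.
apply: ereal_sup_le => _ [h hf <-]; exists h => //= x; apply: le_trans (hf x) _.
by rewrite !patchE; case: ifP => // /set_mem; exact: f12.
Qed.

Lemma indic_intble (D A : set RT) : measurable D -> measurable A -> (leb D < +oo)%E ->
 leb.-integrable D (EFin \o \1_A).
Proof.
move=> mD mA fD; apply: measurable_bounded_integrable => //.
exists 1; split; first exact: num_real.
by move=> x x1 y _ /=; rewrite indicE; case: (_ \in _); rewrite ?normr1 ?normr0 ltW// (lt_trans ltr01).
Qed.

Lemma simple_functional (l : H -> R) (D : set RT) (s : seq (set RT * H)) : measurable D -> (leb D < +oo)%E -> functional l ->
 (forall p, p \in s -> [/\ measurable p.1, p.1 `<=` D & (leb p.1 < +oo)%E]) ->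
 leb.-integrable D (EFin \o (fun x => l (simple_val s x))) /\
 \int[leb]_(x in D) l (simple_val s x) = l (simple_int leb s).
Proof.
move=> mD fD [lD lZ _]; have l0 : l 0 = 0 by rewrite -(scale0r 0) lZ mul0r.
elim: s => [|p s IH] hs.
 split; last by rewrite /simple_int big_nil l0 (eq_Rintegral _ (g := fun=> 0)) ?/Rintegral ?integral0// => x _; rewrite /simple_val big_nil l0.
 by apply: eq_integrable (integrable0 leb D) => // x _ /=; rewrite /simple_val big_nil l0.
have [i1 e1] : leb.-integrable D (EFin \o (fun x => l (simple_val s x))) /\
  \int[leb]_(x in D) l (simple_val s x) = l (simple_int leb s).
 by apply: IH => q qs; apply: hs; rewrite inE qs orbT.
have [mp pD pf] := hs p (mem_head _ _).
have i2 : leb.-integrable D (EFin \o (fun x => \1_(p.1) x * l p.2)).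
 apply: (@eq_integrable _ _ _ leb D mD (fun x => (l p.2)%:E * (\1_(p.1) x)%:E)%E).
  by move=> x _; rewrite /= mulrC EFinM.
 by apply: integrableZl => //; exact: indic_intble.
have E x : l (simple_val (p :: s) x) = \1_(p.1) x * l p.2 + l (simple_val s x).
 by rewrite /simple_val big_cons lD lZ.
split.
 by apply: eq_integrable (integrableD mD i2 i1) => // x _ /=; rewrite E EFinD.
under eq_Rintegral do rewrite E.
rewrite RintegralD// e1 /simple_int big_cons lD lZ; congr (_ + _).
rewrite RintegralZr//; last exact: indic_intble.
congr (_ * _); rewrite /Rintegral integral_indic// setIidl//.
Qed.

(** Integrability of [l o f] is left to the places where it is explicit; the images of the simple
    functions under [l] then converge in L1 because [|l x| <= |x|]. *)
Lemma bochner_functional (l : H -> R) (D : set RT) (f : RT -> H) I : measurable D -> (leb D < +oo)%E -> functional l ->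
 (forall x, `|l x| <= `|x|) -> leb.-integrable D (EFin \o (l \o f)) ->
 bochner_integral leb D f I -> l I = \int[leb]_(x in D) l (f x).
Proof.
move=> mD fD hl lK il [s [hs _ cI cS]]; have [lD lZ lc] := hl.
have h1 : (fun n => l (simple_int leb (s n))) @ \oo --> (l I : R^o) by exact: cvg_comp cS (lc _).
suff h2 : (fun n => l (simple_int leb (s n))) @ \oo --> (\int[leb]_(x in D) l (f x) : R^o).
 exact: cvg_unique h1 h2.
apply/cvgrPdist_le => eps eps0.
have i0 n : (0 <= \int[leb]_(x in D) `|f x - simple_val (s n) x|%:E)%E.
 by apply: integral_ge0 => x _; rewrite lee_fin.
have [N _ hN] := cvge0_le cI i0 eps0.
exists N => // n /hN{}hN /=; have [i e] := simple_functional mD fD hl (hs n).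
have ib : leb.-integrable D (EFin \o (fun x => l (f x) - l (simple_val (s n) x))).
 by apply: eq_integrable (integrableB mD il i) => // x _ /=; rewrite EFinB.
rewrite -e -RintegralB//; apply: le_trans (le_normr_Rintegral mD ib) _.
have in1 : leb.-integrable D (EFin \o (fun x => `|l (f x) - l (simple_val (s n) x)|)).
 by apply: eq_integrable (integrable_abse ib).
rewrite -lee_fin; apply: le_trans hN; rewrite fineK; last exact: integrable_fin_num.
apply: integral_mono => x _; rewrite lee_fin//.
have -> : l (f x) - l (simple_val (s n) x) = l (f x - simple_val (s n) x).
 by rewrite lD -(scaleN1r (simple_val _ _)) lZ mulN1r.
exact: lK.
Qed.
End drift_integral.

(** * Almost sure uniqueness of the stochastic convolution *)

Section uniqueness.
Context (R : realType) (m : nat) d (Omega : measurableType d) (P : probability Omega R).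
Notation H := (Hsp R m).

Lemma far_null (sH : @sepa R H) (Y Z : Omega -> H) : vmeas Y -> vmeas Z ->
 (forall e : R, 0 < e -> pr P (far e Y Z) <= e) -> {ae P, forall w, Y w = Z w}.
Proof.
move=> mY mZ h; have z (k : nat) : P (far k.+1%:R^-1 Y Z) = 0%E.
 have mf := measurable_far (k.+1%:R^-1) sH mY mZ.
 rewrite -(EFin_pr P mf); congr EFin; apply/eqP; rewrite eq_le pr_ge0 andbT.
 apply/ler_addgt0Pr => e e0; rewrite add0r.
 pose e' := Num.min e k.+1%:R^-1.
 have e'0 : 0 < e' by rewrite lt_min e0 invr_gt0 ltr0n.
 apply: (@le_trans _ _ e'); last by rewrite ge_min lexx.
 apply: le_trans (h e' e'0); apply: pr_le => //; first exact: measurable_far.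
 by move=> w; rewrite /far; apply: le_lt_trans; rewrite ge_min lexx orbT.
apply: (@negligibleS _ _ _ _ (\bigcup_k far k.+1%:R^-1 Y Z)).
 move=> w /= /eqP ne; have n0 : 0 < `|Y w - Z w| by rewrite normr_gt0 subr_eq0.
 have [k _ hk] := near_infty_natSinv_lt (PosNum n0).
 by exists k => //; exact: (hk k (leqnn k)).
by apply: negligible_bigcup => k; apply/negligibleP; [exact: measurable_far|exact: z].
Qed.

Lemma ae_all (Q : nat -> Omega -> Prop) : (forall n, {ae P, forall w, Q n w}) -> {ae P, forall w, forall n, Q n w}.
Proof.
move=> h; apply: (@negligibleS _ _ _ _ (\bigcup_n ~` [set w | Q n w])); last exact: negligible_bigcup.
by move=> w /= /existsNP[n hn]; exists n.
Qed.

Lemma cvg_L2_null (sH : @sepa R H) (Y : Omega -> H) (Z : nat -> Omega -> H) : vmeas Y -> (forall n, vmeas (Z n)) ->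
 cvg_L2_H P Z Y -> (forall n, {ae P, forall w, Z n w = 0}) -> {ae P, forall w, Y w = 0}.
Proof.
move=> mY mZ cY z; apply: (far_null sH mY (vmeas_cst _ (0 : H))) => e e0; have e3 : 0 < e ^+ 3 by rewrite exprn_gt0.
have [n _ /(_ n (leqnn n)) hn] := cvge0_le cY (fun n => E2_ge0 _ _ _) e3.
have h1 := E2_far sH (mZ n) mY e0 hn.
have m0 : measurable (far 0 (Z n) (cst 0)) by apply: measurable_far => //; exact: vmeas_cst.
have p0 : pr P (far 0 (Z n) (cst 0)) = 0.
 rewrite /pr (measure_negligible m0)//; apply: negligibleS (z n) => w /=.
 by rewrite /far/= subr0 normr_gt0 => /eqP.
rewrite -[e]addr0 -p0; apply: le_trans (lerD h1 (lexx _)).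
apply: pr_leU => //; [by apply: measurable_far => //; exact: vmeas_cst|exact: measurable_far|].
move=> w; rewrite /far/= => hw; have [->|ne] := eqVneq (Z n w) 0.
 by left; move: hw; rewrite p0 addr0 subr0 sub0r normrN.
by right; rewrite subr0 normr_gt0.
Qed.

Lemma stochastic_integral0 (g : nat -> Usp R m) (b : nat -> R -> Omega -> R) Phi I (sH : @sepa R H) :
 stochastic_integral P g b 0 Phi I -> {ae P, forall w, I w = 0}.
Proof.
move=> [mI [J [hJ cI]]]; have mJ k : vmeas (J k) by have [] := hJ k.
apply: (cvg_L2_null sH mI _ cI) => n; first by exact: (vmeas_sum (index_enum _) sH (fun k : 'I_n => mJ k)).
have J0 k : {ae P, forall w, J k w = 0}.
 have [_ [s [vs _ cJ]]] := hJ k.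
 have e : (fun n => step_int (b k) (s n)) = fun _ _ => 0.
  apply/funext => n'; apply/funext => w; rewrite /step_int big_seq big1// => p /(allP (vs n')).
  move=> /andP[h1 /andP[h2 h3]]; have z1 : p.1.1 = 0 by apply/eqP; rewrite eq_le h1 (le_trans h2).
  have z2 : p.1.2 = 0 by lra.
  by rewrite z1 z2 subrr scale0r.
 rewrite e in cJ; apply: (cvg_L2_null sH (mJ k) _ cJ) => n'; first exact: vmeas_cst.
 exact: aeW.
by apply: filterS (ae_all J0) => w hw; rewrite big1.
Qed.

(** Every mild solution comes with its own version of the stochastic integral. Two versions are
    limits of the same sums [gsum], hence agree almost surely, and the noise cancels in the
    difference of two solutions. *)
Lemma increment_unique (T : R) (F : R -> set (set Omega)) (g : nat -> Usp R m) (b : nat -> R -> Omega -> R)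
  (S : R -> H -> H) (G : Usp R m -> H) (r : R) (Z0 Z1 Z2 : Omega -> H) :
 cylindrical_wiener P T F g b ->
 (forall t x y, 0 <= t -> S t (x + y) = S t x + S t y) ->
 (forall t a x, 0 <= t -> S t (a *: x) = a *: S t x) ->
 (forall t x, 0 <= t -> hnorm (S t x) <= hnorm x) ->
 (forall s t x, 0 <= s -> 0 <= t -> S (s + t) x = S s (S t x)) ->
 (forall x, continuous (fun t : R => S `|t| x)) -> 0 < r -> r <= T ->
 stochastic_integral P g b 0 (fun s v => S (0 - s) (G v)) Z0 ->
 stochastic_integral P g b r (fun s v => S (r - s) (G v)) Z1 ->
 stochastic_integral P g b r (fun s v => S (r - s) (G v)) Z2 ->
 {ae P, forall w, Z1 w = Z2 w}.
Proof.
move=> hW SDh SZh Scon Sadd Sst r0 rT I0 I1 I2.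
have sH := sepa_Hsp (wiener_basis hW).
have [m1 _] := I1; have [m2 _] := I2.
apply: far_null => // e e0; have e2 : 0 < e / 2 by rewrite divr_gt0.
have [L1 h1] := gsum_near hW SDh SZh Scon Sadd Sst (lexx 0) r0 rT I0 I1 e2.
have [L2 h2] := gsum_near hW SDh SZh Scon Sadd Sst (lexx 0) r0 rT I0 I2 e2.
have [K1 {}h1] := h1 _ (leq_maxl L1 L2); have [K2 {}h2] := h2 _ (leq_maxr L1 L2).
have {}h1 := h1 _ (leq_maxl K1 K2); have {}h2 := h2 _ (leq_maxr K1 K2).
have mg : vmeas (gsum g b S G 0 r (maxn L1 L2) (maxn K1 K2)) by exact: (vmeas_gsum hW S G (lexx 0) r0 rT).
have mi1 := vmeas_increment hW SDh SZh Scon r0 I0 I1.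
have mi2 := vmeas_increment hW SDh SZh Scon r0 I0 I2.
rewrite (splitr e); apply: le_trans (lerD h1 h2).
apply: pr_leU; try exact: measurable_far.
move=> w; rewrite /far/= => hw; apply/orP; rewrite -[_ || _]negbK negb_or -!leNgt; apply/negP => /andP[a1 a2].
move: hw; rewrite ltNge => /negP; apply.
have -> : Z1 w - Z2 w = (increment S 0 r Z0 Z1 w - gsum g b S G 0 r (maxn L1 L2) (maxn K1 K2) w) -
  (increment S 0 r Z0 Z2 w - gsum g b S G 0 r (maxn L1 L2) (maxn K1 K2) w).
 by rewrite subr_exchange subrr subr0 subr_exchange subrr subr0.
by apply: le_trans (ler_normB _ _) _; exact: lerD.
Qed.
End uniqueness.

(** * Bounds on the nonlinearity and its coordinates *)

Section coefficients.
Context (R : realType) (m : nat) (mu : nat -> R) (e : nat -> Usp R m)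
 (he : orthogonal_basis e) (mu0 : forall n, 0 < mu n) (muS : {homo mu : i j / (i <= j)%N >-> i <= j}).
Notation V := (Usp R m).
Notation H := (Hsp R m).
Notation h n := (unitv e n).
Variables (theta : R) (th01 : 0 < theta < 1).

(** A finite sum of two nonnegative suprema has finite terms. The Hoelder supremum is nonnegative
    because it is taken over a nonempty set, for which the nonzero vector [z] is produced. *)
Lemma C_b_bounds (C : H -> V) : C_b theta C -> exists K : R, [/\ 0 <= K, forall x, `|C x| <= K &
 forall x y, `|C x - C y| <= K * hnorm (x - y) `^ theta].
Proof.
rewrite /C_b /cb_norm; set A := ereal_sup _; set B := ereal_sup _ => AB.
have hA x : (`|C x|%:E <= A)%E by apply: ereal_sup_ubound; exists x.
have A0 : (0 <= A)%E by apply: le_trans (hA 0); rewrite lee_fin.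
have [K1 K10 hK1] : exists2 K1 : R, 0 <= K1 & forall x, `|C x| <= K1.
 have Af : A \is a fin_num.
  rewrite ge0_fin_numE//; have [z z0] : exists z : H, z != 0.
   exists (unitv e 0%N, 0); apply/eqP => /(congr1 (fun z : H => `|z.1|)).
   by rewrite (unitv_norm he) normr0 => /eqP; rewrite oner_eq0.
  have B0 : (0 <= B)%E.
   apply: le_trans (ereal_sup_ubound _); last by exists (z, 0).
   by rewrite lee_fin mulr_ge0// invr_ge0 powR_ge0.
  by apply: le_lt_trans AB; rewrite leeDl.
 exists (fine A) => [|x]; first exact: fine_ge0.
 by have := hA x; rewrite -{1}[A]fineK// lee_fin.
have [z z0] : exists z : H, z != 0.
 exists (unitv e 0%N, 0); apply/eqP => /(congr1 (fun z : H => `|z.1|)).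
 by rewrite (unitv_norm he) normr0 => /eqP; rewrite oner_eq0.
have B0 : (0 <= B)%E.
 apply: le_trans (ereal_sup_ubound _); last by exists (z, 0).
 by rewrite lee_fin mulr_ge0// invr_ge0 powR_ge0.
have Bf : B \is a fin_num by rewrite ge0_fin_numE//; apply: le_lt_trans AB; rewrite leeDr.
exists (K1 + fine B); split => [|x|x y]; first by rewrite addr_ge0// fine_ge0.
 by apply: le_trans (hK1 x) _; rewrite lerDl fine_ge0.
have [->|xy] := eqVneq x y; first by rewrite subrr normr0 mulr_ge0 ?powR_ge0// addr_ge0// fine_ge0.
have hp : 0 < hnorm (x - y).
 by apply: lt_le_trans (norm_le_hnorm _); rewrite normr_gt0 subr_eq0.
rewrite -ler_pdivrMr ?powR_gt0//; apply: (@le_trans _ _ (fine B)); last by rewrite lerDr.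
by rewrite -lee_fin fineK//; apply: ereal_sup_ubound; exists (x, y).
Qed.

Lemma opB_bounds (C : H -> V) : C_b theta C -> exists K : R, [/\ 0 < K, forall x, `|(opB mu e C x).2| <= K &
 forall x y, `|(opB mu e C x).2 - (opB mu e C y).2| <= K * hnorm (x - y) `^ theta].
Proof.
move=> /C_b_bounds[K [K0 hK hC]]; have [t0 _] := andP th01.
pose k := 1 + mu 0%N `^ (- (1 / 2)); have k1 : 1 <= k by rewrite lerDl powR_ge0.
have kt : 1 <= k `^ theta by rewrite -(powRr0 k); apply: ler_powR => //; exact: ltW.
have k0 : 0 <= k by lra.
exists (K * k `^ theta + 1); split => [|x|x y].
- by rewrite ltr_wpDl// mulr_ge0// powR_ge0.
- rewrite /opB; apply: le_trans (hK _) _; apply: (@le_trans _ _ (K * k `^ theta)); last by rewrite lerDl.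
 by rewrite -{1}[K]mulr1; apply: ler_wpM2l.
rewrite /opB; apply: le_trans (hC _ _) _.
apply: (@le_trans _ _ (K * (k * hnorm (x - y)) `^ theta)).
 apply: ler_wpM2l => //; apply: ge0_ler_powR; rewrite ?nnegrE ?mulr_ge0 ?hnorm_ge0 ?(ltW t0)//.
 rewrite -ler_sqr ?nnegrE ?mulr_ge0 ?hnorm_ge0// exprMn !hnorm_sqr/=.
 have h2 : 0 <= 1 / 2 :> R by [].
 rewrite (powN_B he mu0 muS _ _ h2) mulrDr; have hN := powN_norm he mu0 muS (x.1 - y.1) h2.
 apply: lerD.
  rewrite -exprMn ler_sqr ?nnegrE ?mulr_ge0//; apply: le_trans hN _.
  by apply: ler_wpM2r => //; rewrite lerDr.
 by rewrite ler_peMl// -(expr1n _ 2) ler_sqr ?nnegrE.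
rewrite powRM ?hnorm_ge0// mulrA; apply: ler_wpM2r; first exact: powR_ge0.
lra.
Qed.

Lemma cauchy_sum J (y a : nat -> R) B : 0 < B -> \sum_(k < J) y k ^+ 2 <= 1 -> \sum_(k < J) a k ^+ 2 <= B ^+ 2 ->
 `|\sum_(k < J) y k * a k| <= B.
Proof.
move=> B0 hy ha; apply: le_trans (ler_norm_sum _ _ _) _.
apply: (@le_trans _ _ (\sum_(k < J) (B / 2 * y k ^+ 2 + (2 * B)^-1 * a k ^+ 2))).
 apply: ler_sum => k _; rewrite normrM -(real_normK (num_real (y k))) -(real_normK (num_real (a k))).
 have : 0 <= (2 * B)^-1 * (B * `|y k| - `|a k|) ^+ 2 by rewrite mulr_ge0 ?sqr_ge0 ?invr_ge0 ?mulr_ge0 ?ltW.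
 have -> : (2 * B)^-1 * (B * `|y k| - `|a k|) ^+ 2 = B / 2 * `|y k| ^+ 2 + (2 * B)^-1 * `|a k| ^+ 2 - `|y k| * `|a k|.
  by field; rewrite gt_eqF.
 lra.
rewrite big_split -!mulr_sumr.
have h1 := ler_wpM2l (ltW (divr_gt0 B0 (ltr0n R 2))) hy.
have B2 : 0 <= (2 * B)^-1 by rewrite invr_ge0 mulr_ge0 ?ltW.
have h2 := ler_wpM2l B2 ha; apply: le_trans (lerD h1 h2) _.
by apply: le_of_eq; field; rewrite gt_eqF.
Qed.

Variables (B2 : H -> V) (KB : R) (KB0 : 0 < KB) (Bb : forall x, `|B2 x| <= KB)
 (Bh : forall x y, `|B2 x - B2 y| <= KB * hnorm (x - y) `^ theta).

Definition fc n x := dot (B2 x) (h n).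

(** A combination with unit coefficients is the scalar product of [B2] with a vector of norm at most
    [W], so that the bounds on [B2] apply with a constant independent of [J]. *)
Lemma vhol_coef J (w : nat -> R) W : 0 < W -> (forall k, `|w k| <= W) -> vhol theta J (W * KB) (fun k x => w k * fc k x).
Proof.
move=> W0 hw; have one (c : nat -> R) N : \sum_(k < N) c k ^+ 2 <= W ^+ 2 ->
  hol theta (W * KB) (fun x => \sum_(k < N) c k * fc k x).
 move=> hc; pose z := \sum_(k < N) c k *: h k.
 have zW : `|z| <= W by rewrite -ler_sqr ?nnegrE ?(ltW W0)// (norm_span he).
 have E x : \sum_(k < N) c k * fc k x = dot (B2 x) z.
  by rewrite dot_sumr; apply: eq_bigr => k _; exact: (esym (dotZr _ _ _)).
 split=> [x|x y]; rewrite !E.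
  by apply: le_trans (dot_le _ _) _; rewrite mulrC; apply: ler_pM.
 rewrite -dotBl; apply: le_trans (dot_le _ _) _; rewrite mulrC -mulrA; apply: ler_pM => //; exact: Bh.
have wk k : w k ^+ 2 <= W ^+ 2 by rewrite -real_normK ?num_real// ler_sqr ?nnegrE ?(ltW W0).
split=> [k|y hy].
 have := one (fun i => if i == k then w k else 0) k.+1; rewrite big_ord_recr/= eqxx big1 => [|i _]; last first.
  by rewrite (ltn_eqF (ltn_ord i)) expr0n.
 rewrite add0r => /(_ (wk k)); congr hol; apply/funext => x; rewrite big_ord_recr/= eqxx big1 ?add0r// => i _.
 by rewrite (ltn_eqF (ltn_ord i)) mul0r.
have := one (fun k => y k * w k) J; rewrite (_ : (fun x => _) = (fun x => \sum_(k < J) y k * (w k * fc k x))); last first.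
 by apply/funext => x; apply: eq_bigr => k _; rewrite mulrA.
apply; apply: (@le_trans _ _ (\sum_(k < J) W ^+ 2 * y k ^+ 2)).
 by apply: ler_sum => k _; rewrite exprMn mulrC; apply: ler_wpM2r; [exact: sqr_ge0|exact: wk].
by rewrite -mulr_sumr ler_piMr ?sqr_ge0.
Qed.

Lemma fc_sqr N x : \sum_(k < N) fc k x ^+ 2 <= KB ^+ 2.
Proof. by apply: le_trans (Bessel he _ _) _; rewrite ler_sqr ?nnegrE ?(ltW KB0). Qed.

Lemma fc_bnd n x : `|fc n x| <= KB.
Proof. by apply: le_trans (dot_le _ _) _; rewrite (unitv_norm he) mulr1. Qed.

Lemma fc_cont n : continuous (fc n : H -> R^o).
Proof.
apply: ucb_cont; apply: (hol_ucb th01 (K := KB)); split=> [x|x y]; first exact: fc_bnd.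
rewrite -dotBl; apply: le_trans (dot_le _ _) _; rewrite (unitv_norm he) mulr1; exact: Bh.
Qed.
End coefficients.

(** * Two solutions with the same noise: coordinates of the drift integrals *)

Section solution.
Context (R : realType) (m : nat) (mu : nat -> R) (e : nat -> Usp R m)
 (he : orthogonal_basis e) (mu0 : forall n, 0 < mu n) (muS : {homo mu : i j / (i <= j)%N >-> i <= j})
 (rho alpha gamma sigma theta : R)
 (rho0 : 0 < rho) (alpha01 : 0 < alpha < 1) (gamma0 : 0 <= gamma < 1 / 2) (sigma0 : 0 <= sigma) (th01 : 0 < theta < 1).
Notation V := (Usp R m).
Notation H := (Hsp R m).
Notation leb := (@lebesgue_measure R).
Notation RT := (measurableTypeR R).
Variables (S : R -> H -> H) (hS : generates (domA mu e rho alpha) (opA mu e rho alpha) S) (C : H -> V) (KB : R).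
Notation B2 := (fun x => (opB mu e C x).2).
Notation G := (opG mu e gamma).
Notation drift := (opL mu e sigma \o opB mu e C).
Hypotheses (KB0 : 0 < KB) (Bb : forall x, `|B2 x| <= KB)
 (Bh : forall x y, `|B2 x - B2 y| <= KB * hnorm (x - y) `^ theta).
Notation f := (fc e B2).

(** [row] selects position or velocity. The drift acts on the velocity, so the responses [resp] are
    the entries of the second column of the mode matrix. *)
Definition coord (row : bool) n (z : H) := if row then cx e n z else cv e n z.
Definition resp (row : bool) n (s : R) := if row then px e S n s else qv mu e rho alpha S n s.
Definition wgt row n (s : R) := resp row n s * mu n `^ (- sigma).

Lemma functional_coord row n : functional (coord row n).
Proof. by case: row; [exact: functional_cx|exact: functional_cv]. Qed.

Lemma coord_le row n z : `|coord row n z| <= `|z|.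
Proof.
have zE : `|z| = Num.max `|z.1| `|z.2| by [].
case: row; rewrite /cv; apply: le_trans (dot_le _ _) _; rewrite (unitv_norm he) mulr1 zE le_max lexx ?orbT//.
Qed.

Lemma resp_cont row n : continuous (resp row n : R -> R^o).
Proof.
case: row; first by have [_] := osc_Px he mu0 hS n.
by have [_] := osc_qv he mu0 hS n.
Qed.

Lemma resp_le row n s : 0 <= s -> `|resp row n s| <= 2.
Proof.
move=> s0; have [c c0 hc] := mode_decay he mu0 muS rho0 alpha01 hS; have [_ h2 h3 _ _] := hc n s s0.
have r1 := rate_le1 mu alpha n c0 s0.
by case: row; [apply: le_trans h2 _|apply: le_trans h3 _]; rewrite -[leRHS]mulr1 ler_pM2l.
Qed.

Lemma coord_S row n t z : 0 <= t -> coord row n (S t (drift z)) = wgt row n t * f n z.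
Proof.
move=> t0; have x0 : cx e n (drift z) = 0 by rewrite /cx dot0l.
have v0 : cv e n (drift z) = mu n `^ (- sigma) * f n z by exact: (powN_dot he mu0 muS _ n sigma0).
case: row; rewrite /coord.
 by rewrite (cx_S he mu0 rho0 hS n (drift z) t0) x0 v0 mulr0 add0r mulrA.
by rewrite (cv_S he mu0 rho0 hS n (drift z) t0) x0 v0 mulr0 add0r mulrA.
Qed.

Notation W0 := (mu 0%N `^ (- sigma)).
Lemma W0_gt0 : 0 < W0. Proof. by rewrite powR_gt0. Qed.

Lemma wgt_le row n s : 0 <= s -> `|wgt row n s| <= 2 * W0.
Proof.
move=> s0; rewrite normrM (ger0_norm (powR_ge0 _ _)); apply: ler_pM; rewrite ?powR_ge0//; first exact: resp_le.
exact: powN_le.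
Qed.

Context d (Omega : measurableType d) (P : probability Omega R)
 (T : R) (F : R -> set (set Omega)) (g : nat -> V) (b : nat -> R -> Omega -> R)
 (hF : normal_filtration P T F) (hW : cylindrical_wiener P T F g b) (x : bool -> H) (X : bool -> R -> Omega -> H)
 (hX : forall c, mild_solution P S drift G T F g b (x c) (X c)).

Let sH : @sepa R H := sepa_Hsp he.
Let Scon t z : 0 <= t -> hnorm (S t z) <= hnorm z.
Proof. exact: (S_contraction he mu0 rho0 hS). Qed.

(** Outside [[0, T]] nothing is known about a solution; the value 0 there makes joint measurability
    hold on the whole line. *)
Definition path c (s : R) o := if 0 <= s <= T then X c s o else 0.

Lemma path_meas c : vmeas (fun z : RT * Omega => path c z.1 z.2).
Proof.
move=> O oO; have [_ hm _] := hX c; have mI : measurable [set z : RT * Omega | 0 <= (z.1 : R) <= T].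
 have -> : [set z : RT * Omega | 0 <= (z.1 : R) <= T] = fst @^-1` `[0, T]%classic.
  by [].
 by rewrite -[X in measurable X]setTI; exact: measurable_fst.
have -> : (fun z : RT * Omega => path c z.1 z.2) @^-1` O =
  [set z : RT * Omega | 0 <= (z.1 : R) <= T /\ O (X c z.1 z.2)] `|` (~` [set z : RT * Omega | 0 <= (z.1 : R) <= T] `&` [set _ | O 0]).
 apply/seteqP; split => z; rewrite /path /=.
  by case: ifPn => h1 h2; [left|right; split => //; exact/negP].
 by case=> [[-> //]|[/negP/negbTE -> //]].
apply: measurableU; first exact: hm.
apply: measurableI; first exact: measurableC.
have [yO|nO] := pselect (O 0); first by rewrite (_ : [set _ | _] = setT)//; apply/seteqP; split.
by rewrite (_ : [set _ | _] = set0)//; apply/seteqP; split.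
Qed.

Definition fp n c (r : R) o := f n (path c r o).

Lemma fp_meas n c : measurable_fun setT (fun z : RT * Omega => fp n c z.1 z.2).
Proof.
have hc : continuous (f n : H -> R^o) by exact: (fc_cont he th01 Bb Bh).
have hv := vmeas_comp hc (path_meas c).
have hm := vmeas_fun hv.
exact: hm.
Qed.

Lemma fp_bnd n c r o : `|fp n c r o| <= KB. Proof. exact: (fc_bnd he Bb). Qed.

Lemma X_meas c t : 0 <= t <= T -> vmeas (X c t) /\ apx P (F t) (X c t).
Proof.
move=> tT; have [h1 _ _] := hX c; have sF := filtration_sa hF tT; have Fm := filtration_meas hF tT.
by split; [move=> O oO; apply: Fm; exact: h1|apply: apx_meas => //; exact: h1].
Qed.

(** The absolute value keeps the weight bounded for [r > w] as well, although only [r <= w] is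
    integrated. *)
Definition dens row n c w o (r : R) := wgt row n `|w - r| * fp n c r o.

Lemma dens_meas row n w c : measurable_fun setT (fun z : RT * Omega => dens row n c w z.2 z.1).
Proof.
apply: measurable_funM; last exact: fp_meas.
apply: measurable_funM; last exact: measurable_cst.
have cw : continuous (fun r : R => resp row n `|w - r| : R^o).
 move=> r; apply: (@continuous_comp _ _ _ (fun r : R => `|w - r|) (resp row n)); last exact: resp_cont.
 apply: (@continuous_comp _ _ _ (fun r : R => w - r) Num.norm); last exact: norm_continuous.
 by apply: cvgB; [exact: cvg_cst|exact: cvg_id].
exact: (measurableT_comp (continuous_measurable_fun cw) measurable_fst).
Qed.

Lemma dens_bnd row n c w o r : `|dens row n c w o r| <= 2 * W0 * KB.
Proof. by rewrite normrM; apply: ler_pM => //; [exact: wgt_le|exact: fp_bnd]. Qed.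

Lemma dens_bmeas row n c w o : bmeas (dens row n c w o).
Proof.
split; last by exists (2 * W0 * KB) => r; exact: dens_bnd.
exact: (measurableT_comp (dens_meas row n w c) (measurable_pair2 o)).
Qed.

(** One version of the stochastic convolution is fixed for both solutions at each time; outside
    [[0, T]] the choice is arbitrary. *)
Lemma noise_choice : exists Z : R -> Omega -> H, forall t, 0 <= t <= T ->
 stochastic_integral P g b t (fun s v => S (t - s) (G v)) (Z t) /\
 forall c, exists2 I1 : Omega -> H, {ae P, forall o, bochner_integral leb `[0, t] (fun s => S (t - s) (drift (X c s o))) (I1 o)} &
  {ae P, forall o, X c t o = S t (x c) + I1 o + Z t o}.
Proof.
have one t : exists Zt : Omega -> H, 0 <= t <= T ->
 stochastic_integral P g b t (fun s v => S (t - s) (G v)) Zt /\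
 forall c, exists2 I1 : Omega -> H, {ae P, forall o, bochner_integral leb `[0, t] (fun s => S (t - s) (drift (X c s o))) (I1 o)} &
  {ae P, forall o, X c t o = S t (x c) + I1 o + Zt o}.
 have [tT|] := boolP (0 <= t <= T); last by exists (fun=> 0).
 have [_ _ /(_ t tT)[I1 [Z1 [B1 Z1I E1]]]] := hX true.
 have [_ _ /(_ t tT)[I2 [Z2 [Bo2 Z2I E2']]]] := hX false.
 have ZE : {ae P, forall o, Z1 o = Z2 o}.
  have [t0 tT'] := andP tT; move: t0 Z1I Z2I; rewrite le_eqVlt => /predU1P[<-|t0] Z1I Z2I.
   by apply: filterS2 (stochastic_integral0 sH Z1I) (stochastic_integral0 sH Z2I) => o -> ->.
  have z0 : 0 <= (0 : R) <= T by lra.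
  have [_ _ /(_ 0 z0)[_ [Z0 [_ Z0I _]]]] := hX true.
  exact: (increment_unique hW (SD hS) (SZ hS) Scon (S_add hS) (S_strong hS) t0 tT' Z0I Z1I Z2I).
 exists Z1 => _; split=> // -[]; first by exists I1.
 by exists I2 => //; apply: filterS2 ZE E2' => o ->.
by have [Z hZ] := choice one; exists Z.
Qed.

Variable Z : R -> Omega -> H.
Hypothesis hZ : forall t, 0 <= t <= T ->
 stochastic_integral P g b t (fun s v => S (t - s) (G v)) (Z t) /\
 forall c, exists2 I1 : Omega -> H, {ae P, forall o, bochner_integral leb `[0, t] (fun s => S (t - s) (drift (X c s o))) (I1 o)} &
  {ae P, forall o, X c t o = S t (x c) + I1 o + Z t o}.
Notation N := (noise S Z).
Notation err := (drift_error S N X).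

Lemma error_coord c u w : 0 <= u -> u < w -> w <= T ->
 {ae P, forall o, forall row n, coord row n (err c u w o) = \int[leb]_(r in `]u, w]%classic) dens row n c w o r}.
Proof.
move=> u0 uw wT; have w0 : 0 <= w by exact: le_trans (ltW uw).
have uI : 0 <= u <= T by lra.
have wI : 0 <= w <= T by lra.
have wu0 : 0 <= w - u by lra.
have [_ /(_ c)[I1 hB1 hE1]] := hZ wI; have [_ /(_ c)[I2 hB2 hE2]] := hZ uI.
apply: filterS2 (filterI hB1 hE1) (filterI hB2 hE2) => o [b1 e1] [b2 e2] row n.
have -> : err c u w o = I1 o - S (w - u) (I2 o).
 rewrite /drift_error /free_flow e1 e2 !(SD hS)// -(S_add hS)// subrK.
 set s1 := S w _; set i2 := S (w - u) (I2 o); set s3 := S (w - u) (Z u o).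
 have -> : s1 + i2 + s3 + (Z w o - s3) = s1 + i2 + Z w o by rewrite -addrA [s3 + _]addrC subrK.
 by rewrite opprD addrACA subrr addr0 opprD addrACA subrr add0r.
have [lD lZ _] := functional_coord row n.
have dE t s : 0 <= s -> s <= t -> t <= T -> coord row n (S (t - s) (drift (X c s o))) = wgt row n (t - s) * fp n c s o.
 move=> s0 st tT; rewrite coord_S ?subr_ge0// /fp /path ifT// s0; exact: le_trans tT.
have bm := dens_bmeas row n c w o.
have i1 : leb.-integrable `[0, w]%classic (EFin \o (coord row n \o (fun s => S (w - s) (drift (X c s o))))).
 apply: eq_integrable (bmeas_intble bm (itv_fin 0 w true false)) => // s /set_mem/=; rewrite in_itv => /andP[s0 sw].
 by rewrite dE// /dens ger0_norm ?subr_ge0.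
have c1 := bochner_functional (measurable_itv _) (itv_fin _ _ _ _) (functional_coord row n) (coord_le row n) i1 b1.
(* The factor [2^-1] reconciles two norms: [S] contracts [hnorm], which is at most twice the product
   norm in which [bochner_functional] asks for [|l x| <= |x|]. *)
pose l2 z := 2^-1 * coord row n (S (w - u) z).
have fS : functional (coord row n \o S (w - u)) by apply: (functional_S hS wu0); exact: functional_coord.
have fl2 : functional l2.
 have [a1 a2 a3] := fS; split=> [z z'|a z|].
 - by rewrite -mulrDr; congr (_ * _); exact: a1.
 - by rewrite mulrCA; congr (_ * _); exact: a2.
 - by move=> z; apply: cvgMr; exact: a3.
have l2b z : `|l2 z| <= `|z|.
 rewrite normrM ger0_norm// ler_pdivrMl//; apply: le_trans (coord_le _ _ _) _.
 by apply: le_trans (norm_le_hnorm _) _; apply: le_trans (Scon _ wu0) _; exact: hnorm_le_norm.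
have dE2 s : 0 <= s -> s <= u -> l2 (S (u - s) (drift (X c s o))) = 2^-1 * dens row n c w o s.
 move=> s0 su; have us0 : 0 <= u - s by rewrite subr_ge0.
 have -> : l2 (S (u - s) (drift (X c s o))) = 2^-1 * coord row n (S (w - s) (drift (X c s o))).
  by rewrite /l2 -(S_add hS _ wu0 us0) subrKA.
 rewrite dE ?(le_trans su (ltW uw))//.
 by rewrite /dens ger0_norm// subr_ge0 (le_trans su (ltW uw)).
have bm2 : bmeas (fun s => 2^-1 * dens row n c w o s).
 have [bm1 [M bM]] := bm; split; first by apply: measurable_funM => //; exact: measurable_cst.
 by exists (2^-1 * M) => s; rewrite normrM ger0_norm// ler_pM2l.
have i2 : leb.-integrable `[0, u]%classic (EFin \o (l2 \o (fun s => S (u - s) (drift (X c s o))))).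
 apply: eq_integrable (bmeas_intble bm2 (itv_fin 0 u true false)) => // s /set_mem/=; rewrite in_itv => /andP[s0 su].
 by rewrite dE2.
have c2 := bochner_functional (measurable_itv _) (itv_fin _ _ _ _) fl2 l2b i2 b2.
rewrite lD -(scaleN1r (S _ _)) lZ mulN1r c1.
have -> : \int[leb]_(s in `[0, w]%classic) coord row n (S (w - s) (drift (X c s o))) = \int[leb]_(s in `[0, w]%classic) dens row n c w o s.
 apply: eq_Rintegral => s /set_mem/=; rewrite in_itv => /andP[s0 sw].
 by rewrite dE// /dens ger0_norm ?subr_ge0.
have -> : coord row n (S (w - u) (I2 o)) = \int[leb]_(s in `[0, u]%classic) dens row n c w o s.
 have -> : coord row n (S (w - u) (I2 o)) = 2 * l2 (I2 o) by rewrite mulrA divff ?mul1r.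
 have c3 : \int[leb]_(s in `[0, u]%classic) l2 (S (u - s) (drift (X c s o))) =
   \int[leb]_(s in `[0, u]%classic) (2^-1 * dens row n c w o s).
  by apply: eq_Rintegral => s /set_mem/=; rewrite in_itv => /andP[s0 su]; rewrite dE2.
 rewrite c2 c3.
 rewrite RintegralZl//; last exact: bmeas_intble bm (itv_fin 0 u true false).
 lra.
apply: Rintegral_itvB; first exact: bmeas_intble bm (itv_fin 0 w true false).
 by [].
by rewrite bnd_simp ltW.
Qed.

Lemma dens_int_le row n c u w o a : u <= w -> 0 <= a -> (forall r, u < r <= w -> `|resp row n `|w - r| | <= a) ->
 `|\int[leb]_(r in `]u, w]%classic) dens row n c w o r| <= a * W0 * \int[leb]_(r in `]u, w]%classic) `|fp n c r o|.
Proof.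
move=> uw a0 ha; have bm := dens_bmeas row n c w o.
have bf : bmeas (fun r => `|fp n c r o|).
 apply: bmeas_norm; split; last by exists KB => r; exact: fp_bnd.
 exact: (measurableT_comp (fp_meas n c) (measurable_pair2 o)).
have i1 := bmeas_intble bm (itv_fin u w false false); have i2 := bmeas_intble bf (itv_fin u w false false).
apply: le_trans (le_normr_Rintegral _ i1) _ => //.
rewrite -(RintegralZl (a * W0) _ i2)//; apply: le_Rintegral => //.
- exact: bmeas_intble (bmeas_norm bm) (itv_fin u w false false).
- by apply: eq_integrable (integrableZl _ (a * W0) i2).
- move=> r /=; rewrite in_itv => hr; rewrite !normrM (ger0_norm (powR_ge0 _ _)).
 apply: ler_wpM2r => //; apply: ler_pM; rewrite ?powR_ge0//; first exact: ha.
 exact: powN_le.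
Qed.

(** [fb n] is a multiple of the time integral of the absolute value of the [n]-th drift coordinate;
    duality, with the Cauchy-Schwarz inequality under the integral, makes it square summable. The
    two refined bounds on the position come from the last two bounds of [mode_decay], on [px]. *)
Lemma error_class c u w : 0 <= u -> u < w -> w <= T ->
 {ae P, forall o, drift_class mu e rho alpha (w - u) (4 * W0 * KB) (err c u w o)}.
Proof.
move=> u0 uw wT; apply: filterS (error_coord c u0 uw wT) => o ho.
pose I n := \int[leb]_(r in `]u, w]%classic) `|fp n c r o|.
have wu := ltW uw; have W00 := ltW W0_gt0.
have I0 n : 0 <= I n by apply: Rintegral_ge0.
have bf n : bmeas (fun r => `|fp n c r o|).
 apply: bmeas_norm; split; last by exists KB => r; exact: fp_bnd.
 exact: (measurableT_comp (fp_meas n c) (measurable_pair2 o)).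
have W1 : 0 < 4 * W0 by rewrite mulr_gt0// W0_gt0.
exists (fun n => 4 * W0 * I n) => [J|n].
 rewrite -mulrA; under eq_bigr do rewrite exprMn; rewrite -mulr_sumr [leRHS]exprMn ler_pM2l ?exprn_gt0//.
 have len0 : 0 <= w - u by lra.
 apply: (@dual_norm _ J I); first by rewrite mulr_ge0// ltW.
 move=> y hy; have bs : bmeas (fun r => \sum_(k < J) y k * `|fp k c r o|).
  split; last first.
   by exists KB => r; apply: (@cauchy_sum R J y (fun k => `|fp k c r o|) KB) => //; under eq_bigr do rewrite real_normK ?num_real//; exact: fc_sqr.
  by apply: measurable_sum => k; apply: measurable_funM; [exact: measurable_cst|have [] := bf k].
 have -> : \sum_(k < J) y k * I k = \int[leb]_(r in `]u, w]%classic) (\sum_(k < J) y k * `|fp k c r o|).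
  elim: (J) => [|j IH]; first by rewrite big_ord0; under eq_Rintegral do rewrite big_ord0; rewrite /Rintegral integral0.
  rewrite big_ord_recr IH; under [RHS]eq_Rintegral do rewrite big_ord_recr.
  rewrite RintegralD//; last 2 first.
  - apply: bmeas_intble (itv_fin u w false false); split; last first.
    exists (\sum_(k < j) `|y k| * KB) => r; apply: le_trans (ler_norm_sum _ _ _) _; apply: ler_sum => k _.
    by rewrite normrM normr_id; apply: ler_wpM2l => //; exact: fp_bnd.
   by apply: measurable_sum => k; apply: measurable_funM; [exact: measurable_cst|have [] := bf k].
  - apply: bmeas_intble (itv_fin u w false false); split; last first.
    by exists (`|y j| * KB) => r; rewrite normrM normr_id; apply: ler_wpM2l => //; exact: fp_bnd.
   by apply: measurable_funM; [exact: measurable_cst|have [] := bf j].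
  by congr (_ + _); rewrite -RintegralZl//; exact: bmeas_intble (bf j) (itv_fin u w false false).
 have iS := bmeas_intble bs (itv_fin u w false false).
 apply: le_trans (le_normr_Rintegral _ iS) _ => //.
 have bK : bmeas (fun=> KB) by split; [exact: measurable_cst|exists `|KB|].
 have iK := bmeas_intble bK (itv_fin u w false false).
 apply: (@le_trans _ _ (\int[leb]_(r in `]u, w]%classic) KB)).
  apply: le_Rintegral => //; first exact: bmeas_intble (bmeas_norm bs) (itv_fin u w false false).
  by move=> r _; apply: (@cauchy_sum R J y (fun k => `|fp k c r o|) KB) => //; under eq_bigr do rewrite real_normK ?num_real//; exact: fc_sqr.
 by rewrite /Rintegral integral_cst//= lebesgue_measure_itv lte_fin uw -EFinB -EFinM.
have [cc c0 hc] := mode_decay he mu0 muS rho0 alpha01 hS.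
have w1 := frq_gt0 mu0 n; have d1 := damp_gt0 mu0 alpha rho0 n.
have bnd row a : 0 <= a -> (forall r, u < r <= w -> `|resp row n `|w - r| | <= a) ->
  `|coord row n (err c u w o)| <= a * W0 * I n.
 by move=> a0 ha; rewrite ho; exact: dens_int_le.
have two row : `|coord row n (err c u w o)| <= 4 * W0 * I n.
 apply: le_trans (bnd row 2 _ _) _ => //; first by move=> r _; exact: resp_le.
 by apply: ler_wpM2r => //; rewrite ler_pM2r ?W0_gt0// ler_nat.
have sm r a k : u < r <= w -> k <= a -> `|px e S n `|w - r| | <= k * rate mu alpha cc n `|w - r| -> 0 <= k -> `|px e S n `|w - r| | <= a.
 move=> _ ka h k0; apply: le_trans h _; apply: le_trans ka; rewrite -[leRHS]mulr1; apply: ler_wpM2l => //.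
 exact: rate_le1.
split; [by rewrite mulr_ge0// mulr_ge0|exact: (two false)|exact: (two true)| |].
- have -> : frq mu n * (w - u) * (4 * W0 * I n) = (4 * frq mu n * (w - u)) * W0 * I n by ring.
 apply: (bnd true); first by rewrite !mulr_ge0 ?(ltW w1)// subr_ge0.
 move=> r hr; have [_ _ _ h4 _] := hc n `|w - r| (normr_ge0 _); have [ur rw] := andP hr.
 apply: (sm r _ _ hr _ h4); last by rewrite !mulr_ge0 ?(ltW w1).
 apply: ler_pM; rewrite ?mulr_ge0 ?(ltW w1)//; first by rewrite ler_pM2r// ler_nat.
 by rewrite ger0_norm ?subr_ge0// lerD2l lerN2 ltW.
- have -> : frq mu n / damp mu rho alpha n * (4 * W0 * I n) = (4 * (frq mu n / damp mu rho alpha n)) * W0 * I n by ring.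
 have q0 : 0 <= 4 * (frq mu n / damp mu rho alpha n) by rewrite mulr_ge0// divr_ge0// ltW.
 apply: (bnd true) => // r hr; have [_ _ _ _ h5] := hc n `|w - r| (normr_ge0 _).
 exact: (sm r _ _ hr (lexx _) h5).
Qed.

Lemma class_norm l z : 0 < l -> drift_class mu e rho alpha l (4 * W0 * KB) z -> hnorm z <= 2 * (4 * W0 * KB * l).
Proof.
move=> l0 [fb hfb h]; have B0 : 0 <= 4 * W0 * KB * l.
 by rewrite !mulr_ge0 ?(ltW W0_gt0) ?(ltW KB0) ?(ltW l0).
apply: (hnorm_le_coef he); first by rewrite mulr_ge0.
move=> J; apply: (@le_trans _ _ (\sum_(k < J) 2 * fb k ^+ 2)).
 apply: ler_sum => k _; have [f0 h1 h2 _ _] := h k.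
 have s1 (a : R) : `|a| <= fb k -> a ^+ 2 <= fb k ^+ 2 by move=> ha; rewrite -real_normK ?num_real// ler_sqr.
 by have := s1 _ h1; have := s1 _ h2; lra.
rewrite -mulr_sumr exprMn; have := hfb J; have := sqr_ge0 (4 * W0 * KB * l); lra.
Qed.
Variables (k1 C1 C2 ep : R).
Notation k2 := (1 / 2 + gamma / beta alpha).
Notation M := (4 * W0 * KB).
Hypotheses (C10 : 0 < C1) (C20 : 0 < C2) (k10 : 0 <= k1) (ep0 : 0 < ep)
 (a_ep : k1 * (1 - theta) <= 1 / 2 - ep) (ak_ep : k1 * (1 - theta) + k2 <= 1 - ep).
Hypothesis free : forall u r h, 0 <= u -> u < r -> r <= T -> r - u <= 1 ->
 Harn P (N u r) (- S (r - u) h) ((C1 * (r - u) `^ (- k1) * hnorm h) ^+ 2).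
Hypothesis steer : forall u r l M h, 0 <= u -> u < r -> r <= T -> r - u <= 1 ->
 0 < l -> l <= 4 * (r - u) -> 0 < M -> drift_class mu e rho alpha l M h ->
 Harn P (N u r) (- S (r - u) h) ((C2 * (r - u) `^ (- k2) * (M * l)) ^+ 2).
Notation gp := (gap X).
Notation ge := (gap_error S X).

Lemma M_gt0 : 0 < M. Proof. by rewrite !mulr_gt0// W0_gt0. Qed.

Lemma in_time u w : 0 <= u -> u < w -> w <= T -> (0 <= u <= T) /\ (0 <= w <= T).
Proof. lra. Qed.

Lemma gap_meas t : 0 <= t <= T -> vmeas (gp t).
Proof. by move=> tT; apply: vmeasB => //; [have [] := X_meas true tT|have [] := X_meas false tT]. Qed.

Lemma gap_error_meas u w : 0 <= u -> u < w -> w <= T -> vmeas (ge u w).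
Proof.
move=> u0 uw wT; have [uI wI] := in_time u0 uw wT; apply: vmeasB => //; first exact: gap_meas.
have wu0 : 0 <= w - u by lra.
exact: (vmeas_comp (S_cont hS wu0) (gap_meas uI)).
Qed.

Lemma gap_error_coord u w : 0 <= u -> u < w -> w <= T -> {ae P, forall o,
 hnorm (ge u w o) <= 4 * (M * (w - u)) /\ forall row n,
 coord row n (ge u w o) = \int[leb]_(r in `]u, w]%classic) (dens row n true w o r - dens row n false w o r)}.
Proof.
move=> u0 uw wT; have wu0 : 0 < w - u by rewrite subr_gt0.
apply: filterS2 (filterI (error_coord true u0 uw wT) (error_coord false u0 uw wT))
 (filterI (error_class true u0 uw wT) (error_class false u0 uw wT)) => o [a1 a2] [c1 c2]; rewrite -(error_diff (SD hS) (SZ hS) N _ _ uw).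
split=> [|row n].
 have n1 := class_norm wu0 c1; have n2 := class_norm wu0 c2.
 have L0 : 0 <= M * (w - u) by apply: ltW; rewrite pmulr_lgt0// M_gt0.
 have [L2 L4] : 0 <= 2 * (M * (w - u)) /\ 0 <= 4 * (M * (w - u)) by lra.
 rewrite -ler_sqr ?nnegrE ?hnorm_ge0//.
 apply: le_trans (hnormD_sqr _ _) _; rewrite hnormN.
 have s1 (z : H) : hnorm z <= 2 * (M * (w - u)) -> hnorm z ^+ 2 <= (2 * (M * (w - u))) ^+ 2.
  by move=> hz; rewrite ler_sqr ?nnegrE ?hnorm_ge0.
 by have := s1 _ n1; have := s1 _ n2; rewrite [leRHS]exprMn exprMn; lra.
have [lD lZ _] := functional_coord row n.
rewrite lD -(scaleN1r (drift_error _ _ _ _ _ _ _)) lZ mulN1r a1 a2 RintegralB//;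
 exact: bmeas_intble (dens_bmeas _ _ _ _ _) (itv_fin u w false false).
Qed.

Lemma abd_gap_error u w : 0 <= u -> u < w -> w <= T ->
 abd P (fun o => hnorm (ge u w o) ^+ 2) /\ forall row n, abd P (fun o => coord row n (ge u w o)).
Proof.
move=> u0 uw wT; have mg := gap_error_meas u0 uw wT; have h := gap_error_coord u0 uw wT.
split=> [|row n]; split.
- exact: measurable_hnorm2.
- exists ((4 * (M * (w - u))) ^+ 2); apply: filterS h => o [ho _].
 by rewrite ger0_norm ?sqr_ge0// ler_sqr ?nnegrE ?hnorm_ge0// (le_trans (hnorm_ge0 _) ho).
- have [_ _ lc] := functional_coord row n; exact: (vmeas_fun (vmeas_comp lc mg)).
- exists (4 * (M * (w - u))); apply: filterS h => o [ho _].
 by apply: le_trans (coord_le _ _ _) _; apply: le_trans (norm_le_hnorm _) ho.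
Qed.

(** The drift integral over [[0, 0]] vanishes, which is checked on coordinates, and both solutions
    contain the same noise term at time 0. *)
Lemma gap0 : 0 <= T -> {ae P, forall o, gp 0 o = x true - x false}.
Proof.
move=> T0; have z0 : 0 <= (0 : R) <= T by rewrite lexx.
have one c : {ae P, forall o, X c 0 o = x c + Z 0 o}.
 have [_ /(_ c)[I1 b1 e1]] := hZ z0; apply: filterS2 b1 e1 => o b1 ->.
 suff -> : I1 o = 0 by rewrite (S_id hS) addr0.
 have co row n : coord row n (I1 o) = 0.
  rewrite (bochner_functional _ _ (functional_coord row n) (coord_le row n) _ b1)//.
  - by rewrite set_itv1 Rintegral_set1.
  - exact: itv_fin.
  - apply: eq_integrable (bmeas_intble (dens_bmeas row n c 0 o) (itv_fin 0 0 true false)) => // s.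
   move=> /set_mem/=; rewrite in_itv -eq_le => /eqP<-.
   by rewrite coord_S// /dens /fp /path lexx T0 subrr normr0.
 have pe (z z' : H) : z.1 = z'.1 -> z.2 = z'.2 -> z = z' by case: z z' => [? ?] [? ?]/= -> ->.
 by apply: pe; apply: (coef_inj he) => n; rewrite dot0l; [exact: (co true n)|exact: (co false n)].
by apply: filterS2 (one true) (one false) => o; rewrite /gap => -> ->; rewrite opprD addrACA subrr addr0.
Qed.

Lemma gap_split u w o : gp w o = S (w - u) (gp u o) + ge u w o.
Proof. by rewrite addrC subrK. Qed.

Lemma abd_gap t : 0 <= t <= T -> abd P (fun o => hnorm (gp t o) ^+ 2).
Proof.
move=> /andP[t0 tT]; have T0 : 0 <= T by exact: le_trans tT.
split; first by apply: measurable_hnorm2; apply: gap_meas; rewrite t0.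
have h0 := gap0 T0; move: t0; rewrite le_eqVlt => /predU1P[<-|t0].
 by exists (hnorm (x true - x false) ^+ 2); apply: filterS h0 => o ->; rewrite ger0_norm// sqr_ge0.
have [[_ [B hB]] _] := abd_gap_error (lexx 0) t0 tT.
exists (2 * hnorm (x true - x false) ^+ 2 + 2 * B); apply: filterS2 h0 hB => o h0 hB.
rewrite ger0_norm ?sqr_ge0// (gap_split 0) subr0; apply: le_trans (hnormD_sqr _ _) _; apply: lerD.
 rewrite ler_pM2l// ler_sqr ?nnegrE ?hnorm_ge0// h0; apply: Scon; exact: ltW.
by rewrite ler_pM2l//; apply: le_trans (ler_norm _) hB.
Qed.

(** Bounds uniform in the number [J] of coordinates pass to the norm by monotone convergence. *)
Lemma Ex_hnorm_coef (z : Omega -> H) A : abd P (fun o => hnorm (z o) ^+ 2) ->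
 (forall row n, abd P (fun o => coord row n (z o))) ->
 (forall J, sqn P J (fun k o => coord true k (z o)) + sqn P J (fun k o => coord false k (z o)) <= A) ->
 Ex P (fun o => hnorm (z o) ^+ 2) <= A.
Proof.
move=> a1 a2 hA; pose s N o := \sum_(i < N) (cx e i (z o) ^+ 2 + cv e i (z o) ^+ 2).
have a2' i : abd P (fun o => cx e i (z o) ^+ 2) /\ abd P (fun o => cv e i (z o) ^+ 2).
 by split; apply: abdX; [exact: (a2 true)|exact: (a2 false)].
have sa N : abd P (s N) by apply: abd_sum => i _; apply: abdD; have [] := a2' i.
have sE N : Ex P (s N) <= A.
 rewrite Ex_sum => [|i _]; last by apply: abdD; have [] := a2' i.
 apply: le_trans (hA N); rewrite -big_split; apply: le_of_eq.
 by apply: eq_bigr => i _; have [b1 b2] := a2' i; rewrite ExD.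
have sc o : (s N o)%:E @[N --> \oo] --> (hnorm (z o) ^+ 2)%:E.
 by apply: cvg_EFin; [exact: nearW|exact: (hnorm_coef he)].
have ms n : measurable_fun setT (fun o => (s n o)%:E) by apply/measurable_EFinP; have [] := sa n.
have s0 n o : setT o -> (0 <= (s n o)%:E)%E by move=> _; rewrite lee_fin sumr_ge0// => i _; rewrite addr_ge0 ?sqr_ge0.
have sm o : setT o -> {homo (fun n => (s n o)%:E) : n k / (n <= k)%N >-> (n <= k)%E}.
 move=> _; apply/nondecreasing_seqP => n; rewrite lee_fin /s big_ord_recr lerDl addr_ge0 ?sqr_ge0//.
have h := cvg_monotone_convergence (mu := P) measurableT ms s0 sm.
rewrite -lee_fin (EFin_Ex a1) (_ : (\int[P]_o _)%E = \int[P]_o limn (fun n => (s n o)%:E))%E; last first.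
 by apply: eq_integral => o _; apply/esym/cvg_lim => //; exact: sc.
rewrite -(cvg_lim _ h)//; apply: lime_le; first by apply/cvg_ex; eexists; exact: h.
by apply: nearW => n; rewrite -EFin_Ex// lee_fin.
Qed.

Notation K := (2 * W0 * KB).
Definition Csew := K * (4 * cL C1 + 2 * c4 theta k1 k2 C1 C2 * M) / (2 `^ ep - 1).

Lemma Csew_ge0 : 0 <= Csew.
Proof.
have p1 : 0 < 2 `^ ep - 1 :> R by rewrite subr_gt0 powR2_gt1.
have h1 := ltW (cL_gt0 C10); have h2 := ltW (c4_gt0 theta k1 k2 C10 C20).
apply: divr_ge0; last exact: ltW.
apply: mulr_ge0; first by rewrite ltW// !mulr_gt0// W0_gt0.
apply: addr_ge0; first exact: mulr_ge0.
by apply: mulr_ge0; [exact: mulr_ge0|exact: (ltW M_gt0)].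
Qed.

Section interval.
Variables (s0 s1 mm q : R) (s00 : 0 <= s0) (s1T : s1 <= T) (len : s1 - s0 <= 1) (mm0 : 0 <= mm) (q0 : 0 <= q)
 (hgap : forall u, s0 <= u <= s1 -> Ex P (fun o => hnorm (gp u o) ^+ 2) <= mm ^+ 2).
Hypothesis herr : forall u w, s0 <= u -> u < w -> w <= s1 ->
 Ex P (fun o => hnorm (ge u w o) ^+ 2) <= q ^+ 2 * (w - u).

Let timeI t : s0 <= t <= s1 -> 0 <= t <= T.
Proof. by move=> /andP[h1 h2]; rewrite (le_trans s00 h1) (le_trans h2 s1T). Qed.

(** Sewing bounds the Riemann sums on a dyadic mesh for every shift, and [averaging] transfers the
    bound to the integral. The mesh error is made smaller than the margin [p' - main], where [p'] is
    any number above [main]; [sqn_le2] removes the margin. *)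
Lemma row_estimate row J u w : s0 <= u -> u < w -> w <= s1 ->
 sqn P J (fun k o => coord row k (ge u w o)) <= (Csew * (mm + q) * Num.sqrt (w - u) * (w - u) `^ ep) ^+ 2.
Proof.
move=> su uw ws; have u0 : 0 <= u by exact: le_trans su. have wT : w <= T by exact: le_trans s1T.
have K0 : 0 < K by rewrite !mulr_gt0// W0_gt0. have M0 := M_gt0.
have [_ ac] := abd_gap_error u0 uw wT.
have k20 : 0 <= k2 by have [g0 _] := andP gamma0; rewrite addr_ge0// divr_ge0// ltW// beta_gt0.
have p1 : 0 < 2 `^ ep - 1 :> R by rewrite subr_gt0 powR2_gt1.
set main := Csew * _ * _ * _; have main0 : 0 <= main.
 have C0 := Csew_ge0; rewrite /main; do 3! (apply: mulr_ge0; last by rewrite ?powR_ge0 ?sqrtr_ge0 ?addr_ge0).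
 exact: C0.
apply: (@sqn_le2 _ _ _ P) => // p' pp.
have wu0 : 0 < w - u by lra. have wu1 : w - u <= 1 by have := len; lra.
(* Each of the three terms of the mesh error [er] will be at most [2 * K * eta], a third of the
   margin; [ds] is a mesh size that ensures it. *)
pose eta := (p' - main) / (6 * K); have eta0 : 0 < eta by rewrite divr_gt0 ?subr_gt0// mulr_gt0.
have [th0 _] := andP th01.
pose ds := Num.min eta (Num.min (eta ^+ 2) (eta `^ theta^-1 / (2 * M))).
have ds0 : 0 < ds by rewrite !lt_min eta0 exprn_gt0//= divr_gt0 ?powR_gt0//; exact: mulr_gt0.
have [nu _ /(_ nu (leqnn nu))/= hnu] := near_infty_natSinv_expn_lt (PosNum ds0).
pose n := (2 ^ nu)%N; pose del := (w - u) / n%:R.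
have n0 : 0 < n%:R :> R by rewrite ltr0n expn_gt0.
have del0 : 0 < del by rewrite divr_gt0.
have nd : n%:R * del = w - u by rewrite /del mulrC divfK// gt_eqF.
have dds : del <= ds.
 apply: ltW; apply: le_lt_trans hnu; rewrite /del /n natrX ler_pM2r ?invr_gt0 ?exprn_gt0//.
have d1 : del <= eta by apply: le_trans dds _; rewrite ge_min lexx.
have d2 : Num.sqrt del <= eta.
 rewrite -(ger0_norm (ltW eta0)) -sqrtr_sqr; apply: ler_wsqrtr; apply: le_trans dds _.
 by rewrite !ge_min lexx orbT.
have d3 : (2 * (M * del)) `^ theta <= eta.
 have -> : eta = (eta `^ theta^-1) `^ theta by rewrite -powRrM mulVf ?powRr1 ?(ltW eta0)// gt_eqF.
 apply: ge0_ler_powR; rewrite ?nnegrE ?powR_ge0 ?(ltW th0)//; first exact: ltW (mulr_gt0 _ (mulr_gt0 M0 del0)).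
 rewrite mulrA mulrC -ler_pdivlMr; last exact: (mulr_gt0 _ M0).
 by apply: le_trans dds _; rewrite !ge_min lexx !orbT.
pose er := 2 * K * del + 2 * K * Num.sqrt (n%:R * del * del) + n%:R * del * (2 * K * (2 * (M * del)) `^ theta).
have er_le : er <= p' - main.
 have aux (a y : R) : y != 0 -> a = 2 * y * (a / (6 * y)) + 2 * y * (a / (6 * y)) + 2 * y * (a / (6 * y)) by move=> y0; field.
 rewrite (aux (p' - main) K); last by rewrite gt_eqF.
 have K2 : 0 < 2 * K by lra.
 rewrite /er nd; apply: lerD; first apply: lerD.
 - by rewrite ler_pM2l.
 - rewrite ler_pM2l//; apply: le_trans d2; apply: ler_wsqrtr.
  by rewrite -[leRHS]mul1r ler_pM2r.
 - rewrite mulrCA ler_pM2l//; apply: le_trans d3; rewrite -[leRHS]mul1r; apply: ler_wpM2r => //.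
  exact: powR_ge0.
have K20 : 0 <= 2 * K by exact: ltW (mulr_gt0 _ K0).
have er0 : 0 <= er.
 rewrite /er nd; apply: addr_ge0; first apply: addr_ge0.
 - exact: (mulr_ge0 K20 (ltW del0)).
 - exact: (mulr_ge0 K20 (sqrtr_ge0 _)).
 - exact: (mulr_ge0 (ltW wu0) (mulr_ge0 K20 (powR_ge0 _ _))).
have [sum0 p0] : 0 <= main + er /\ 0 <= p' by split; [exact: addr_ge0|exact: le_trans main0 (ltW pp)].
have sum_le : main + er <= p' by rewrite addrC -lerBrDr.
apply: (@le_trans _ _ ((main + er) ^+ 2)); last by rewrite ler_sqr ?nnegrE.
pose hh k r o := dens row k true w o r - dens row k false w o r.
apply: (@averaging R del del0 d Omega P J n u (main + er) (2 * K) hh (fun k o => coord row k (ge u w o))) => //.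
- by move=> k; apply: measurable_funB; exact: dens_meas.
- by move=> k r o; apply: le_trans (ler_normB _ _) _; rewrite (_ : 2 * K = K + K) ?lerD ?dens_bnd//; ring.
- by move=> k; rewrite nd addrC subrK; apply: filterS (gap_error_coord u0 uw wT) => o [_]; exact.
move=> th /andP[t0 td].
have tk j : (j < n)%N -> s0 <= u + th + j%:R * del <= w.
 move=> jn; apply/andP; split; first by rewrite -addrA ler_wpDr// addr_ge0// mulr_ge0// ltW.
 rewrite -addrA -lerBrDl -nd; apply: le_trans (_ : del + j%:R * del <= _); first by rewrite lerD2r.
 by rewrite -{1}[del]mul1r -mulrDl ler_pM2r// addrC natr1 ler_nat.
pose gg j k z := wgt row k `|w - (u + th + j%:R * del)| * f k z.
have vh j : vhol theta J K (gg j).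
 by apply: (vhol_coef he Bb Bh); [rewrite mulr_gt0// W0_gt0|move=> k; exact: wgt_le].
have mX c t : s0 <= t <= s1 -> vmeas (X c t) by move=> /timeI/(X_meas c)[].
have aX c t : s0 <= t <= s1 -> apx P (F t) (X c t) by move=> /timeI/(X_meas c)[].
have IZ t (tT : 0 <= t <= T) := (hZ tT).1.
have ecls c u' w' : s0 <= u' -> u' < w' -> w' <= s1 -> {ae P, forall o, drift_class mu e rho alpha (w' - u') M (err c u' w' o)}.
 by move=> h1 h2 h3; apply: error_class => //; [exact: le_trans h1|exact: le_trans s1T].
have nL : n%:R * del <= 1 by lra.
have := @sewing_le2 R m d Omega P sH T F hF S (SD hS) (SZ hS) Scon (S_add hS) N
 (vmeas_noise he mu0 rho0 hS hW IZ) (noise_adapted he mu0 rho0 hS hF hW IZ) (noise_indep he mu0 rho0 hS hF hW IZ)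
 (fun u' w' r o => @noise_cocycle _ _ _ _ _ _ _ hS _ _ Z u' w' r o) theta th01 k1 k2 C1 C2 (drift_class mu e rho alpha)
 C10 C20 k10 k20 free steer J X s0 s1 s00 s1T mX aX M mm q M0 mm0 q0
 (fun l z => @class_norm l z) ecls (fun t ht => abd_gap (timeI ht)) hgap
 (fun u' w' h1 h2 h3 => (abd_gap_error (le_trans s00 h1) h2 (le_trans h3 s1T)).1) herr
 gg K (u + th) del ep n vh del0.
have x00 : s0 <= u + th by lra.
have tn j : (j < n)%N -> u + th + j%:R * del <= s1 by move=> /tk/andP[_ h]; exact: le_trans h ws.
move=> /(_ x00 len nL tn ep0 a_ep ak_ep nu erefl) hsew.
apply: (@sqn_le2 _ _ _ P) => //.
apply: (@le2_ext _ _ _ P J _ _ _ _ (le2_le _ hsew)) => [k o _|].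
 apply: eq_bigr => j _; congr (_ * _); rewrite /hh /dens -mulrBr /fp /path /gg.
 have /andP[h1 h2] := tk j (ltn_ord j).
 by rewrite (le_trans s00 h1) (le_trans (le_trans h2 ws) s1T)/= mulrBr.
rewrite /er lerD2r nd /main /Csew; apply: le_of_eq; field.
lra.
Qed.

(** By smallness each row is at most [(mm + q) / 12] times the square root of the length, and the
    two rows together contribute [2 / 144], below [1 / 36]. *)
Lemma error_improve u w : 2 * Csew * (s1 - s0) `^ ep <= 1 / 6 -> s0 <= u -> u < w -> w <= s1 ->
 Ex P (fun o => hnorm (ge u w o) ^+ 2) <= ((mm + q) / 6) ^+ 2 * (w - u).
Proof.
move=> small su uw ws; have u0 : 0 <= u by exact: le_trans su. have wT : w <= T by exact: le_trans s1T.
have wu0 : 0 < w - u by lra. have [a1 a2] := abd_gap_error u0 uw wT.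
apply: (Ex_hnorm_coef a1 a2) => J.
apply: le_trans (lerD (row_estimate true J su uw ws) (row_estimate false J su uw ws)) _.
have C0 := Csew_ge0; have mq : 0 <= mm + q by exact: addr_ge0.
have pe : (w - u) `^ ep <= (s1 - s0) `^ ep.
 apply: ge0_ler_powR; rewrite ?nnegrE ?(ltW ep0) ?(ltW wu0)//; last exact: lerB.
 lra.
have sq := sqr_sqrtr (ltW wu0); have p0 := powR_ge0 (w - u) ep.
rewrite (_ : Csew * (mm + q) * Num.sqrt (w - u) * (w - u) `^ ep = (Csew * (w - u) `^ ep * (mm + q)) * Num.sqrt (w - u)); last by ring.
rewrite exprMn sq -mulrDl; apply: ler_wpM2r; first exact: ltW.
have c0 : 0 <= Csew * (w - u) `^ ep * (mm + q) by apply: mulr_ge0 => //; exact: mulr_ge0.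
have c1 : Csew * (w - u) `^ ep * (mm + q) <= (mm + q) / 12.
 rewrite [leRHS]mulrC; apply: ler_wpM2r => //.
 have := ler_wpM2l C0 pe; move: small; rewrite -mulrA => small h; apply: le_trans h _; lra.
have d0 : 0 <= (mm + q) / 12 by lra.
have c2 : (Csew * (w - u) `^ ep * (mm + q)) ^+ 2 <= ((mm + q) / 12) ^+ 2 by rewrite ler_sqr.
have e1 : ((mm + q) / 6) ^+ 2 = 4 * ((mm + q) / 12) ^+ 2 by field.
by rewrite e1; have := sqr_ge0 ((mm + q) / 12); lra.
Qed.
End interval.

(** * Contraction of the error bound on a short interval, and chaining of intervals *)

Definition error_bound s0 s1 q := forall u w, s0 <= u -> u < w -> w <= s1 ->
 Ex P (fun o => hnorm (ge u w o) ^+ 2) <= q ^+ 2 * (w - u).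

Lemma error_bound_mono s0 s1 q q' : 0 <= q -> q <= q' -> error_bound s0 s1 q -> error_bound s0 s1 q'.
Proof.
move=> q0 qq h u w su uw ws; apply: le_trans (h _ _ su uw ws) _.
by rewrite ler_pM2r ?subr_gt0// ler_sqr ?nnegrE// (le_trans q0).
Qed.

Section step.
Variables (s0 s1 m0 : R) (s00 : 0 <= s0) (s1T : s1 <= T) (len : s1 - s0 <= 1) (m00 : 0 <= m0)
 (small : 2 * Csew * (s1 - s0) `^ ep <= 1 / 6) (start : Ex P (fun o => hnorm (gp s0 o) ^+ 2) <= m0 ^+ 2).

Lemma gap_growth q t : 0 <= q -> error_bound s0 s1 q -> s0 <= t <= s1 ->
 Ex P (fun o => hnorm (gp t o) ^+ 2) <= (2 * (m0 + q)) ^+ 2.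
Proof.
move=> q0 hq /andP[st ts]; have mq := mulr_ge0 m00 q0.
have e1 : (2 * (m0 + q)) ^+ 2 = m0 ^+ 2 + 3 * m0 ^+ 2 + 4 * q ^+ 2 + 8 * (m0 * q) by ring.
have m2 := sqr_ge0 m0; have q2 := sqr_ge0 q.
move: st; rewrite le_eqVlt => /predU1P[<-|st].
 by apply: le_trans start _; rewrite e1; lra.
have tT : t <= T by exact: le_trans s1T.
have [a1 _] := abd_gap_error s00 st tT.
have a0 : abd P (fun o => hnorm (gp s0 o) ^+ 2) by apply: abd_gap; rewrite s00 (le_trans (ltW st)).
have at' : abd P (fun o => hnorm (gp t o) ^+ 2) by apply: abd_gap; rewrite tT (le_trans s00 (ltW st)).
apply: (@le_trans _ _ (Ex P (fun o => 2 * hnorm (gp s0 o) ^+ 2 + 2 * hnorm (ge s0 t o) ^+ 2))).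
 apply: Ex_le => // [|o]; first by apply: abdD; exact: abdZ.
 rewrite (gap_split s0); apply: le_trans (hnormD_sqr _ _) _; rewrite lerD2r ler_pM2l//.
 rewrite ler_sqr ?nnegrE ?hnorm_ge0//; apply: Scon; by rewrite subr_ge0 ltW.
rewrite ExD ?ExZ//; try exact: abdZ.
have h1 := hq _ _ (lexx _) st ts.
have h2 : q ^+ 2 * (t - s0) <= q ^+ 2 by rewrite ler_piMr//; have := len; have := ts; lra.
rewrite e1; have := start; lra.
Qed.

(** [error_improve] with [mm = 2 * (m0 + q)] from [gap_growth]: the new bound is
    [(2 * (m0 + q) + q) / 6 = m0 / 3 + q / 2], a contraction in [q]. *)
Lemma error_bound_improve q : 0 <= q -> error_bound s0 s1 q -> error_bound s0 s1 (m0 / 3 + q / 2).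
Proof.
move=> q0 hq u w su uw ws; have mq : 0 <= 2 * (m0 + q) by rewrite mulr_ge0// addr_ge0.
have hg v : s0 <= v <= s1 -> Ex P (fun o => hnorm (gp v o) ^+ 2) <= (2 * (m0 + q)) ^+ 2 by exact: gap_growth.
have := error_improve s00 s1T len mq q0 hg hq small su uw ws.
lra.
Qed.

(** The iteration starts from the deterministic bound that boundedness of the drift gives, whatever
    the initial gap. *)
Lemma error_bound_start : error_bound s0 s1 (4 * M).
Proof.
move=> u w su uw ws; have u0 : 0 <= u by exact: le_trans su. have wT : w <= T by exact: le_trans s1T.
have [a1 _] := abd_gap_error u0 uw wT; have wu0 : 0 < w - u by rewrite subr_gt0.
have M0 := ltW M_gt0; have c0 : 0 <= 4 * M by exact: mulr_ge0.
rewrite -[leRHS](Ex_cst P); apply: Ex_ae_le => //; first exact: abd_cst.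
apply: filterS (gap_error_coord u0 uw wT) => o [h _].
apply: (@le_trans _ _ ((4 * M * (w - u)) ^+ 2)).
 by rewrite ler_sqr ?nnegrE ?hnorm_ge0//; [rewrite -mulrA|exact: mulr_ge0 c0 (ltW wu0)].
rewrite exprMn /cst; apply: ler_wpM2l; first exact: sqr_ge0.
rewrite expr2 ler_piMr//; have := len; lra.
Qed.

(** [m0 / 3 + (m0 + x) / 2 <= m0 + x / 2]: the form of the bound persists while the part unrelated
    to [m0] is halved. *)
Lemma error_bound_iter n : error_bound s0 s1 (m0 + 4 * M / 2 ^+ n).
Proof.
have M0 := ltW M_gt0; have c0 : 0 <= 4 * M by exact: mulr_ge0.
elim: n => [|n IH].
 by apply: error_bound_mono error_bound_start => //; rewrite expr0 divr1 lerDr.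
have q0 : 0 <= 4 * M / 2 ^+ n by rewrite divr_ge0// exprn_ge0.
apply: (error_bound_mono _ _ (error_bound_improve _ IH)); try by rewrite ?addr_ge0// divr_ge0// addr_ge0.
have -> : 4 * M / 2 ^+ n.+1 = 4 * M / 2 ^+ n / 2 by rewrite exprSr invfM !mulrA.
have := m00; lra.
Qed.

(** The iterated bounds tend to [q = m0], and [gap_growth] turns this into [2 * (m0 + m0)]. *)
Lemma gap_step t : s0 <= t <= s1 -> Ex P (fun o => hnorm (gp t o) ^+ 2) <= (4 * m0) ^+ 2.
Proof.
rewrite (_ : 4 * m0 = 2 * (m0 + m0)); last by ring.
apply: gap_growth => // u w su uw ws; have wu0 : 0 < w - u by rewrite subr_gt0.
rewrite -ler_pdivrMr//; apply: sqr_inf => // p' pp; rewrite ler_pdivrMr//.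
have c0 : 0 < 4 * M by rewrite pmulr_lgt0// M_gt0.
have d0 : 0 < (p' - m0) / (4 * M) by rewrite divr_gt0// subr_gt0.
have [n _ /(_ n (leqnn n))/= hn] := near_infty_natSinv_expn_lt (PosNum d0).
have h0 : 0 <= m0 + 4 * M / 2 ^+ n by rewrite addr_ge0// divr_ge0// ltW.
apply: (error_bound_mono h0 _ (error_bound_iter n)) => //.
move: hn; rewrite ltr_pdivlMr// div1r => /ltW hn; rewrite addrC -lerBrDr.
lra.
Qed.
End step.

(** The bound at the end of one subinterval is the starting bound of the next, and each subinterval
    multiplies the root mean square by 4. *)
Lemma gap_bound (l0 : R) K0 : 0 < l0 -> l0 <= 1 -> 2 * Csew * l0 `^ ep <= 1 / 6 -> K0%:R * l0 = T ->
 forall j t, (j <= K0)%N -> 0 <= t <= j%:R * l0 ->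
 Ex P (fun o => hnorm (gp t o) ^+ 2) <= (4 ^+ j * hnorm (x true - x false)) ^+ 2.
Proof.
move=> l00 l01 small KT; have T0 : 0 <= T by rewrite -KT mulr_ge0// ltW.
elim=> [|j IH] t jK /andP[t0 tj].
 have -> : t = 0 by lra.
 have z0 : 0 <= (0 : R) <= T by lra.
 rewrite expr0 mul1r -[leRHS](Ex_cst P); apply: Ex_ae_le; [exact: abd_gap|exact: abd_cst|].
 by apply: filterS (gap0 T0) => o ->.
have c0 : 0 <= 4 ^+ j * hnorm (x true - x false) by rewrite mulr_ge0 ?hnorm_ge0.
have s00 : 0 <= j%:R * l0 by rewrite mulr_ge0// ltW.
rewrite [4 ^+ j.+1]exprS -mulrA; have [tl|tl] := leP t (j%:R * l0).
 apply: le_trans (IH t (ltnW jK) _) _; first by rewrite t0.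
 by rewrite ler_sqr ?nnegrE ?(mulr_ge0 _ c0)// ler_peMl// ler1n.
have e1 : j.+1%:R * l0 - j%:R * l0 = l0 by lra.
apply: (@gap_step (j%:R * l0) (j.+1%:R * l0)) => //; rewrite ?e1//.
- by rewrite -KT ler_pM2r// ler_nat.
- by apply: IH; [exact: ltnW|rewrite s00/=].
- lra.
Qed.
End solution.

(** * The admissible exponents and the final estimate *)

Lemma exponents (R : realType) (alpha gamma sigma theta M : R) : 0 < alpha < 1 -> 0 <= gamma ->
 [/\ M < alpha <= 1 / 2, M - alpha / 2 < gamma < alpha / 2,
   2 / 3 * ((gamma + alpha) / alpha) < theta < 1 & 1 / 2 - alpha < sigma] \/
 [/\ 1 / 2 <= alpha < 1, M - alpha / 2 < gamma < 1 / 2 - alpha / 2,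
   (gamma + 2 * alpha < 3 / 2 -> 2 / 3 * ((gamma + 1 - alpha) / (1 - alpha)) < theta < 1),
   (3 / 2 <= gamma + 2 * alpha -> (4 * gamma + 2 * alpha - 1) / (2 * gamma + alpha) < theta < 1) &
   0 < sigma] ->
 exists k1 ep : R, [/\ 3 / 2 <= k1, 1 / 2 + gamma / beta alpha <= k1,
  1 / 2 + (gamma + alpha - 1 / 2) / beta alpha <= k1 & 0 < ep] /\
  [/\ k1 * (1 - theta) <= 1 / 2 - ep, k1 * (1 - theta) + (1 / 2 + gamma / beta alpha) <= 1 - ep & gamma < 1 / 2].
Proof.
move=> /andP[a0 a1] g0 hh.
(* The slack is [ep = 1 / 2 - gamma / beta - k1 * (1 - theta)], which bounds [a + k2] and a fortiori
   [a]. With [k1 = 3 / 2] its positivity reads [theta > 2 / 3 * (1 + gamma / beta)]. *)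
suff [k1 [k1a k1b k1c [key g1]]] : exists k1 : R, [/\ 3 / 2 <= k1, 1 / 2 + gamma / beta alpha <= k1,
  1 / 2 + (gamma + alpha - 1 / 2) / beta alpha <= k1 &
  k1 * (1 - theta) + gamma / beta alpha < 1 / 2 /\ gamma < 1 / 2].
 have b0 : 0 <= gamma / beta alpha by rewrite divr_ge0// ltW// beta_gt0 ?a0.
 exists k1, (1 / 2 - gamma / beta alpha - k1 * (1 - theta)); split; split => //; lra.
case: hh => [[/andP[_ a2] /andP[_ g1] /andP[t1 _] _]|[/andP[a2 _] /andP[_ g1] t1 t2 _]].
 have -> : beta alpha = alpha by rewrite /beta min_l//; lra.
 have h1 : gamma / alpha < 1 / 2 by rewrite ltr_pdivrMr//; lra.
 have h2 : (gamma + alpha) / alpha = gamma / alpha + 1 by field; rewrite gt_eqF.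
 have h3 : (gamma + alpha - 1 / 2) / alpha <= 1 by rewrite ler_pdivrMr//; lra.
 by exists (3 / 2); rewrite h2 in t1; split; [exact: lexx|lra|lra|split; lra].
have b0 : 0 < 1 - alpha by rewrite subr_gt0.
have -> : beta alpha = 1 - alpha by rewrite /beta min_r//; lra.
have h1 : gamma / (1 - alpha) < 1 / 2 by rewrite ltr_pdivrMr//; lra.
(* Here [beta = 1 - alpha], and the third lower bound on [k1] exceeds [3 / 2] exactly when
   [gamma + 2 * alpha > 3 / 2]: this is where the two ranges of [theta] part. *)
have [c|c] := ltP (gamma + 2 * alpha) (3 / 2).
 have /andP[t3 _] := t1 c.
 have h2 : (gamma + 1 - alpha) / (1 - alpha) = gamma / (1 - alpha) + 1 by field; rewrite gt_eqF.
 have h3 : (gamma + alpha - 1 / 2) / (1 - alpha) <= 1 by rewrite ler_pdivrMr//; lra.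
 by exists (3 / 2); rewrite h2 in t3; split; [exact: lexx|lra|lra|split; lra].
have /andP[t3 _] := t2 c; have d0 : 0 < 2 * gamma + alpha by lra.
(* This is the third lower bound itself. The equation [k1 * (1 - theta) = 1 / 2 - gamma / (1 -
   alpha)] characterizes the second threshold for [theta]. *)
pose k1 := (2 * gamma + alpha) / (2 * (1 - alpha)).
have k1E : k1 = 1 / 2 + (gamma + alpha - 1 / 2) / (1 - alpha) by rewrite /k1; field; rewrite gt_eqF.
have k10 : 0 < k1 by rewrite divr_gt0// mulr_gt0.
have h3 : 1 <= (gamma + alpha - 1 / 2) / (1 - alpha) by rewrite ler_pdivlMr//; lra.
have h4 : gamma / (1 - alpha) <= (gamma + alpha - 1 / 2) / (1 - alpha) by rewrite ler_pM2r ?invr_gt0//; lra.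
have h5 : k1 * (1 - theta) < 1 / 2 - gamma / (1 - alpha).
 have -> : 1 / 2 - gamma / (1 - alpha) = k1 * (1 - (4 * gamma + 2 * alpha - 1) / (2 * gamma + alpha)).
  by rewrite /k1; field; rewrite !gt_eqF.
 by rewrite ltr_pM2l//; lra.
by exists k1; split; [rewrite k1E; lra|rewrite k1E; lra|rewrite k1E; lra|split; lra].
Qed.

Lemma small_step (R : realType) (T ep c : R) : 0 < T -> 0 < ep -> 0 <= c ->
 exists l0 K0, [/\ 0 < l0, l0 <= 1, c * l0 `^ ep <= 1 / 6 & K0%:R * l0 = T].
Proof.
move=> T0 ep0 c0; have y0 : 0 < (6 * (c + 1))^-1 by rewrite invr_gt0 mulr_gt0// ltr_wpDl.
(* The largest admissible length; [c + 1] keeps the inverse meaningful for [c = 0]. The length [l0]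
   is [T] divided by an integer, so that the subintervals end exactly at [T]. *)
pose z := Num.min 1 ((6 * (c + 1))^-1 `^ ep^-1).
have z0 : 0 < z by rewrite lt_min ltr01 powR_gt0.
have K0 : 0 < (Num.truncn (T / z)).+1%:R :> R by rewrite ltr0n.
exists (T / (Num.truncn (T / z)).+1%:R), (Num.truncn (T / z)).+1.
have lz : T / (Num.truncn (T / z)).+1%:R <= z.
 by rewrite ler_pdivrMr// mulrC -ler_pdivrMr// ltW// truncnS_gt.
have l0 : 0 < T / (Num.truncn (T / z)).+1%:R by rewrite divr_gt0.
split=> //; first by apply: le_trans lz _; rewrite ge_min lexx.
 have p1 : (T / (Num.truncn (T / z)).+1%:R) `^ ep <= (6 * (c + 1))^-1.
  have -> : (6 * (c + 1))^-1 = ((6 * (c + 1))^-1 `^ ep^-1) `^ ep.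
   by rewrite -powRrM mulVf ?powRr1 ?(ltW y0)// gt_eqF.
  apply: ge0_ler_powR; rewrite ?nnegrE ?powR_ge0 ?(ltW ep0) ?(ltW l0)//.
  by apply: le_trans lz _; rewrite ge_min lexx orbT.
 apply: le_trans (ler_wpM2l c0 p1) _; rewrite ler_pdivrMr; last by rewrite mulr_gt0// ltr_wpDl.
 lra.
by rewrite mulrC divfK// gt_eqF.
Qed.

Theorem corollary4p11 (R : realType) (m : nat) (hm : (1 <= m <= 3)%N)
  (mu : nat -> R) (e : nat -> Usp R m) (he : bilaplacian_eigenbasis mu e)
  (alpha gamma sigma rho theta : R)
  (halpha : 0 < alpha < 1) (hgamma : 0 <= gamma) (hsigma : 0 <= sigma)
  (hrho : 0 < rho)
  (hrhomu : forall n, rho ^+ 2 != 4 * mu n `^ (1 - 2 * alpha))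
  (htheta : 0 < theta < 1)
  (C : Hsp R m -> Usp R m) (hC : C_b theta C)
  (hassum :
    [/\ m%:R / 8 < alpha <= 1 / 2,
        m%:R / 8 - alpha / 2 < gamma < alpha / 2,
        2 / 3 * ((gamma + alpha) / alpha) < theta < 1 &
        1 / 2 - alpha < sigma]
    \/
    [/\ 1 / 2 <= alpha < 1,
        m%:R / 8 - alpha / 2 < gamma < 1 / 2 - alpha / 2,
        (gamma + 2 * alpha < 3 / 2 ->
          2 / 3 * ((gamma + 1 - alpha) / (1 - alpha)) < theta < 1),
        (3 / 2 <= gamma + 2 * alpha ->
          (4 * gamma + 2 * alpha - 1) / (2 * gamma + alpha) < theta < 1) &
        0 < sigma])
  (hm3 : m = 3%N ->
    (\sum_(0 <= n <oo) (mu n `^ (- 2 * sigma - alpha))%:E *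
       cb_norm theta (fun h => dot (C h) (unitv e n) : R^o) ^+ 2 < +oo)%E)
  (S : R -> Hsp R m -> Hsp R m)
  (hS : generates (domA mu e rho alpha) (opA mu e rho alpha) S) :
  forall T : R, 0 < T -> exists CT : R, 0 < CT /\
  forall (x1 x2 : Hsp R m)
    (d : measure_display) (Omega : measurableType d) (P : probability Omega R)
    (F : R -> set (set Omega))
    (g : nat -> Usp R m) (b : nat -> R -> Omega -> R)
    (X1 X2 : R -> Omega -> Hsp R m),
  normal_filtration P T F ->
  cylindrical_wiener P T F g b ->
  mild_solution P S (opL mu e sigma \o opB mu e C) (opG mu e gamma)
    T F g b x1 X1 ->
  mild_solution P S (opL mu e sigma \o opB mu e C) (opG mu e gamma)
    T F g b x2 X2 ->
  (ereal_sup [set 'E_P[fun w => (hnorm (X1 t w - X2 t w) ^+ 2)%R] |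
              t in [set t : R | (0 <= t <= T)%R]]
   <= (CT * hnorm (x1 - x2) ^+ 2)%:E)%E.
Proof.
(* A positive dimension provides the first axis for Poincare's inequality, hence positive
   eigenvalues. *)
move=> T T0; have [n mE] : exists n, m = n.+1 by case/andP: hm; case: (m) => // n _ _; exists n.
subst m; have [hbi muS hob] := he.
have mu0 k : 0 < mu k by apply: (eigenvalue_gt0 (hbi k)); have [e0 _ _] := hob.
have [k1 [ep [[k1a k1b k1c ep0] [a_ep ak_ep g1]]]] := exponents halpha hgamma hassum.
have gamma0 : 0 <= gamma < 1 / 2 by rewrite hgamma.
have [KB [KB0 Bb Bh]] := opB_bounds hob mu0 muS htheta hC.
have [C1 C10 free] := free_steer hob mu0 muS hrho halpha gamma0 hS k1a k1b k1c.
have [C2 C20 steer] := drift_steer hob mu0 muS hrho halpha gamma0 hS.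
have k10 : 0 <= k1 by apply: le_trans k1a; rewrite divr_ge0.
pose c := Csew mu alpha gamma sigma theta KB k1 C1 C2 ep.
have c0 : 0 <= 2 * c by apply: mulr_ge0 => //; exact: Csew_ge0.
have [l0 [K0 [l00 l01 small KT]]] := small_step T0 ep0 c0.
(* Each of the [K0] subintervals contributes a factor [4 ^+ 2] to the mean square; [K0] depends on
   [T] and on constants fixed before the probability space. *)
exists ((4 ^+ K0) ^+ 2); split; first by rewrite !exprn_gt0.
move=> x1 x2 d Omega P F g b X1 X2 hF hW h1 h2.
pose x i := if i then x1 else x2; pose X i := if i then X1 else X2.
have hX i : mild_solution P S (opL mu e sigma \o opB mu e C) (opG mu e gamma) T F g b (x i) (X i) by case: i.
have [Z hZ] := noise_choice hob mu0 hrho hS hW hX.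
have nZ : noise_on mu e gamma S P T Z by exists F, g, b; split => // t /hZ[].
apply: ge_ereal_sup => _ [t tT <-].
have aX := abd_gap hob mu0 muS hrho halpha hsigma htheta hS KB0 Bb Bh hF hX hZ tT.
rewrite unlock -(EFin_Ex aX) lee_fin -exprMn.
apply: (gap_bound hob mu0 muS hrho halpha gamma0 hsigma htheta hS KB0 Bb Bh hF hW hX hZ C10 C20 k10 ep0 a_ep ak_ep
 (fun u r h => free _ _ _ _ _ u r h nZ) (fun u r l M h => steer _ _ _ _ _ u r l M h nZ) l00 l01 small KT (leqnn _)).
by rewrite KT.
Qed.
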